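(* Let $d\ge2$ and $k\ge1$ be integers and let $p\ge1$ be an integer dividing $k$. Then there exist automorphisms $G$ of $\mathbb{C}^d$ such that $G^p$ has the form $$G^p(z^1,\ldots,z^d)=(\lambda_1z^1,\ldots,\lambda_dz^d)\Bigl(1-\frac{(z^1\cdots z^d)^k}{kd}\Bigr)+O(\|z\|^l)$$ near the origin, where $l>2kd+1$ and $\lambda_1,\ldots,\lambda_d$ are of unit modulus, not roots of unity, and one-resonant via $\lambda_1\cdots\lambda_d=1$, and such that the attracting basins $\Omega_0,\ldots,\Omega_{k-1}$ of $G^p$ at the origin satisfy $$G(\Omega_h)=\Omega_{(h+k/p)\bmod k}\qquad\text{for } h=0,\ldots,k-1.$$ In particular, $G$ admits $k/p$ disjoint $p$-periodic cycles of non-recurrent, attracting Fatou components biholomorphic to $\mathbb{C}\times(\mathbb{C}^* )^{d-1}$, all attracted to the origin.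
   Context: $\mathbb{N}=\{0,1,2,\ldots\}$, $\mathbb{C}^*=\mathbb{C}\setminus\{0\}$; upper indices denote components; $e_j$ is the $j$-th unit vector. One-resonant via $\lambda_1\cdots\lambda_d=1$: for $m\in\mathbb{N}^d$ and $j\in\{1,\ldots,d\}$, $\lambda_1^{m_1}\cdots\lambda_d^{m_d}=\lambda_j$ if and only if $m=(q,\ldots,q)+e_j$ for some $q\in\mathbb{N}$. Basins: write $F=G^p$. For $\pi(z)=z^1\cdots z^d$, $R>0$, $\theta\in(0,\frac{\pi}{2k})$, $\beta\in(0,\frac1d)$ put $S_h(R,\theta)=\{u\in\mathbb{C}: |u^k-\frac1{2R}|<\frac1{2R},\ |\arg(u)-\frac{2\pi h}{k}|<\theta\}$ (arguments modulo $2\pi$), $W(\beta)=\{z\in\mathbb{C}^d: |z^j|<|\pi(z)|^\beta \text{ for } 1\le j\le d\}$, $B_h(R,\theta,\beta)=\{z\in W(\beta):\pi(z)\in S_h(R,\theta)\}$. Fix $\beta_0\in(0,1/d)$ with $\beta_0(l+d-1)>2k+1$, $\theta_0\in(0,\frac\pi{2k})$, and $R_0>0$ large enough that $B_h:=B_h(R_0,\theta_0,\beta_0)$ satisfies $F(B_h)\subseteq B_h$ and $F^n\to0$ uniformly on $B_h$ for all $h$ (such $R_0$ exists). Then $\Omega_h:=\bigcup_{n\in\mathbb{N}}F^{-n}(B_h)$. The Fatou set of an automorphism $G$ is the set of points having a neighbourhood on which $\{G^n\}_{n\in\mathbb{N}}$ is normal; its connected components are the Fatou components. A Fatou component $V$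 is $p$-periodic if $G^p(V)=V$ and $G^q(V)\ne V$ for $1\le q<p$; then $(V,G(V),\ldots,G^{p-1}(V))$ is a $p$-periodic cycle. $V$ is attracting to a point $P$ if the iterates converge to $P$ on $V$, and a periodic $V$ attracting to $P$ is non-recurrent if $P\in\partial V$. *)

(* Defs.v *)
From HB Require Import structures.
From mathcomp Require Import all_boot all_order all_algebra.
From mathcomp Require Import complex.
From mathcomp Require Import all_classical all_reals all_analysis.

Set Implicit Arguments.
Unset Strict Implicit.
Unset Printing Implicit Defensive.

Import Order.TTheory GRing.Theory Num.Theory.
Import numFieldNormedType.Exports.

Local Open Scope classical_set_scope.
Local Open Scope ring_scope.

(* The complex numbers R[i]; packing them as a numClosedFieldType gives access
   to the topology and normed module structures of MathComp-Analysis, which are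
   not inferred for R[i] itself. *)
Definition Cplx (R : realType) : numClosedFieldType := complex R.

Notation Cspace R d := 'rV[Cplx R]_d.

(* `|z| is an element of Cplx R; modulus z is the same number in R. *)
Definition modulus (R : realType) (z : Cplx R) : R :=
  ComplexField.Normc.normc z.

Definition ofR (R : realType) (x : R) : Cplx R := Complex x 0.

Definition cis (R : realType) (t : R) : Cplx R := Complex (cos t) (sin t).

Section Holomorphy.
Context {R : realType} {d : nat}.
Local Notation Cd := (Cspace R d).

(* [differentiable] is Frechet differentiability over the field Cplx R, i.e.
   complex differentiability. To be used for open U. *)
Definition holomorphic_on (U : set Cd) (f : Cd -> Cd) : Prop :=
  forall z, U z -> differentiable f z.

Definition automorphism (G : Cd -> Cd) : Prop :=
  holomorphic_on setT G /\
  exists H : Cd -> Cd, [/\ holomorphic_on setT H, cancel G H & cancel H G].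

Definition biholomorphic (U V : set Cd) : Prop :=
  [/\ open U, open V &
  exists f g : Cd -> Cd,
    [/\ holomorphic_on U f, holomorphic_on V g,
        (forall z, U z -> V (f z) /\ g (f z) = z) &
        (forall w, V w -> U (g w) /\ f (g w) = w)]].

(* C x (C \ {0})^(d-1) as an open subset of C^d: the first coordinate (of
   index 0) is free, the others are nonzero. *)
Definition C_times_Cstars : set Cd :=
  [set z : Cd | forall j : 'I_d, (0 < j)%N -> z 0 j != 0].

End Holomorphy.

Section Fatou.
Context {R : realType} {d : nat}.
Local Notation Cd := (Cspace R d).

Definition compactly_convergent (U : set Cd) (f : nat -> Cd -> Cd)
    (g : Cd -> Cd) : Prop :=
  forall K : set Cd, compact K -> K `<=` U -> {uniform K, f @ \oo --> g}.

Definition compactly_divergent (U : set Cd) (f : nat -> Cd -> Cd) : Prop :=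
  forall K L : set Cd, compact K -> K `<=` U -> compact L ->
  \forall n \near \oo, (f n @` K) `&` L = set0.

(* Normality in the sense of Montel, locally uniform divergence to infinity
   being allowed. *)
Definition normal_on (U : set Cd) (E : set (Cd -> Cd)) : Prop :=
  forall f : nat -> Cd -> Cd, (forall n, E (f n)) ->
  exists s : nat -> nat, {homo s : m n / (m < n)%N} /\
    ((exists g, compactly_convergent U (f \o s) g) \/
     compactly_divergent U (f \o s)).

Definition fatou_set (G : Cd -> Cd) : set Cd :=
  [set z : Cd | exists U : set Cd,
    [/\ open U, U z & normal_on U (range (fun n => iter n G))]].

Definition fatou_component (G : Cd -> Cd) (V : set Cd) : Prop :=
  exists2 z, fatou_set G z & V = connected_component (fatou_set G) z.

Definition periodic_set (G : Cd -> Cd) (p : nat) (V : set Cd) : Prop :=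
  iter p G @` V = V /\
  forall q, (1 <= q < p)%N -> iter q G @` V <> V.

Definition attracting (G : Cd -> Cd) (P : Cd) (V : set Cd) : Prop :=
  forall z, V z -> iter n G z @[n --> \oo] --> P.

Definition non_recurrent (P : Cd) (V : set Cd) : Prop :=
  (closure V `\` interior V) P.

End Fatou.

Section NormalForm.
Context {R : realType} {d : nat}.
Local Notation Cd := (Cspace R d).

Definition one_resonant (lambda : 'I_d -> Cplx R) : Prop :=
  forall (m : 'I_d -> nat) (j : 'I_d),
    \prod_i lambda i ^+ m i = lambda j <->
    exists q : nat, forall i, m i = (q + (i == j))%N.

Definition coord_prod (z : Cd) : Cplx R := \prod_j z 0 j.

(* The norm `|z| on row vectors is the maximum norm. *)
Definition has_normal_form (F : Cd -> Cd) (k l : nat)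
    (lambda : 'I_d -> Cplx R) : Prop :=
  forall z : Cd,
    F z = (1 - coord_prod z ^+ k / (k * d)%:R) *: (\row_j (lambda j * z 0 j))
          +O_(z \near (0 : Cd)) (`|z| ^+ l).

End NormalForm.

Section Basins.
Context {R : realType} {d : nat}.
Local Notation Cd := (Cspace R d).

(* |arg u - 2 pi h / k| < theta modulo 2 pi: some argument t of u is at distance
   less than theta from 2 pi h / k. The first condition excludes u = 0. *)
Definition S_region (k h : nat) (r theta : R) : set (Cplx R) :=
  [set u : Cplx R | modulus (u ^+ k - ofR (2 * r)^-1) < (2 * r)^-1 /\
    exists t : R, u = ofR (modulus u) * cis t /\
      `|t - 2 * pi * h%:R / k%:R| < theta].

Definition W_region (beta : R) : set Cd :=
  [set z : Cd | forall j, modulus (z 0 j) < modulus (coord_prod z) `^ beta].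

Definition B_region (k h : nat) (r theta beta : R) : set Cd :=
  [set z : Cd | W_region beta z /\ S_region k h r theta (coord_prod z)].

Definition admissible_exponents (k l : nat) (theta beta : R) : Prop :=
  [/\ 0 < theta < pi / (2 * k%:R),
      0 < beta < d%:R^-1 &
      2 * k%:R + 1 < beta * (l%:R + d%:R - 1)].

Definition admissible_radius (F : Cd -> Cd) (k : nat) (r theta beta : R) :
    Prop :=
  0 < r /\
  forall h, (h < k)%N ->
    F @` B_region k h r theta beta `<=` B_region k h r theta beta /\
    {uniform B_region k h r theta beta,
      (fun n => iter n F) @ \oo --> (fun=> 0 : Cd)}.

Definition basin (F : Cd -> Cd) (k h : nat) (r theta beta : R) : set Cd :=
  \bigcup_n (iter n F @^-1` B_region k h r theta beta).

End Basins.

Arguments admissible_exponents {R} d k l theta beta.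
Arguments C_times_Cstars : clear implicits.

(* Main.v *)
Require Import Defs.
From HB Require Import structures.
From mathcomp Require Import all_boot all_order all_algebra.
From mathcomp Require Import complex.
From mathcomp Require Import all_classical all_reals all_analysis.
From mathcomp Require Import ring lra zify.
Import Order.TTheory GRing.Theory Num.Theory.
Import numFieldNormedType.Exports.
Local Open Scope classical_set_scope.
Local Open Scope ring_scope.
Set Implicit Arguments.
Unset Strict Implicit.
Unset Printing Implicit Defensive.

(* Choose multipliers lambda_j = exp(i t_j) with sum t_j = 0 and no further
   resonance. With u = z_1 ... z_d, the normal form has a formal p-th root
   z |-> (mu_j z_j) a(u^k) where mu_1 ... mu_d = exp(2 pi i / p), and its jet of
   any order l is the jet of an automorphism G, because such jets are generated
   by shears and overshears.

   In W(beta) the product u obeys u' = u (1 - u^k / k + ...), so that v = u^-k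
   moves by v' = v + 1 + O(1/v); this gives the absorbing regions, and G permutes
   the basins since it turns u by the angle 2 pi / p.

   A point q of the Fatou set on the boundary of a basin would lie in a basin:
   the iterates are bounded near q by normality, and the three circles
   inequality turns the decay n^(-beta/k) inside the basin into a decay at a
   slightly worse power rate on a ball that crosses the boundary; points with
   |u| too small compared with |z| stay away from 0 for too long to decay at
   this rate, so all points of this ball eventually stay in W(beta').

   To straighten a basin, fix a reference orbit z_n in it and put
   f_n(w) = (k v_n (1 - u(w) / u_n), w_j / z_(n,j) (j > 0)), a coordinate with
   values in C x (C - {0})^(d-1). Read in the coordinates f_n and f_(n+1), the map F
   is the identity up to O(n^-2), hence f = lim f_n o F^n exists, and it is
   inverted by Picard iteration. *)

(** * Complex numbers and the maximum norm *)

(** Two precisions are at work. The absorbing regions, the action of G on the basins and the decay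
    argument use only that the error relative to each coordinate is O(x^2), where x = u^k; this is
    the inequality 2k + 1 <= beta (l + d - 1). The charts need O(x^3), because their coordinate 0
    multiplies errors by v = 1/x; hence the stronger 3k + 1 <= beta (l + d - 1), for which l and one
    particular beta are chosen at the end.

    The action of G is claimed for every admissible choice of parameters. Constant factors lost by
    applying G or a chart would destroy membership in W(beta); they are absorbed because an orbit of
    a basin enters W(beta') for every beta' < 1/d.

    That a basin is a whole Fatou component rests on two facts: it is relatively closed in the Fatou
    set, and it is connected. The latter is read off from the model C x (C - {0})^(d-1).

    Holomorphic functions are handled as uniform limits of polynomials. Restriction to complex lines
    reduces every Cauchy estimate to an average over roots of unity. *)

Notation Re := complex.Re.
Notation Im := complex.Im.

Arguments modulus : simpl never.

(* lra reifies every hypothesis, so it is run on a goal that carries only the relevant ones. *)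
Ltac lra_goal := repeat match goal with H : ?T |- _ =>
    match type of T with Prop => clear H end end; move=> *; lra.

Section ComplexModulus.
Variable R : realType.
Local Notation C := (Cplx R).
Implicit Types z w : C.

Lemma normC_modulus z : `|z| = ofR (modulus z). Proof. by []. Qed.

Lemma modulus_ge0 z : 0 <= modulus z.
Proof. by case: z => a b; rewrite /modulus /= sqrtr_ge0. Qed.
Hint Resolve modulus_ge0 : core.

Lemma modulus0 : modulus (0 : C) = 0.
Proof. exact: ComplexField.Normc.normc0. Qed.

Lemma modulus1 : modulus (1 : C) = 1.
Proof. exact: ComplexField.Normc.normc1. Qed.

Lemma modulusM z w : modulus (z * w) = modulus z * modulus w.
Proof. exact: ComplexField.Normc.normcM. Qed.

Lemma modulusV z : modulus z^-1 = (modulus z)^-1.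
Proof. exact: ComplexField.Normc.normcV. Qed.

Lemma modulusN z : modulus (- z) = modulus z.
Proof. exact: normcN. Qed.

Lemma modulusD z w : modulus (z + w) <= modulus z + modulus w.
Proof. exact: le_normcD. Qed.

Lemma modulusB z w : modulus (z - w) <= modulus z + modulus w.
Proof. by rewrite -(modulusN w) modulusD. Qed.

Lemma modulus_distC z w : modulus (z - w) = modulus (w - z).
Proof. by rewrite -modulusN opprB. Qed.

Lemma modulusX z n : modulus (z ^+ n) = modulus z ^+ n.
Proof.
by elim: n => [|n ih]; rewrite ?expr0 ?modulus1// !exprS modulusM ih.
Qed.

Lemma modulus_eq0 z : (modulus z == 0) = (z == 0).
Proof.
apply/eqP/eqP => [|->]; last exact: modulus0.
exact: ComplexField.Normc.eq0_normc.
Qed.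

Lemma modulus_gt0 z : (0 < modulus z) = (z != 0).
Proof. by rewrite lt_def modulus_eq0 modulus_ge0 andbT. Qed.

Lemma modulus_triangle a z w :
  modulus (z - w) <= modulus (z - a) + modulus (a - w).
Proof. by rewrite -[z - w](subrKA a) modulusD. Qed.

Lemma modulus_lower z w : modulus z - modulus w <= modulus (z + w).
Proof. by rewrite lerBlDr -[in X in X <= _](addrK w z) modulusB. Qed.

Lemma modulus_sum (I : Type) (r : seq I) (P : pred I) (F : I -> C) :
  modulus (\sum_(i <- r | P i) F i) <= \sum_(i <- r | P i) modulus (F i).
Proof.
elim/big_ind2 : _ => //; first by rewrite modulus0.
by move=> x y z w h1 h2; apply: le_trans (modulusD _ _) _; apply: lerD.
Qed.

Lemma modulus_prod (I : Type) (r : seq I) (P : pred I) (F : I -> C) :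
  modulus (\prod_(i <- r | P i) F i) = \prod_(i <- r | P i) modulus (F i).
Proof.
by elim/big_ind2 : _ => [|x y z w <- <-|//]; rewrite ?modulus1 ?modulusM.
Qed.

Lemma ofRM (x y : R) : ofR (x * y) = ofR x * ofR y.
Proof. exact: (rmorphM (real_complex R)). Qed.
Lemma ofRB (x y : R) : ofR (x - y) = ofR x - ofR y.
Proof. exact: (rmorphB (real_complex R)). Qed.
Lemma ofRX (x : R) n : ofR (x ^+ n) = ofR x ^+ n.
Proof. exact: (rmorphXn (real_complex R)). Qed.
Lemma ofRV (x : R) : ofR (x^-1) = (ofR x)^-1.
Proof. exact: (fmorphV (real_complex R)). Qed.
Lemma ofR_nat n : ofR (n%:R : R) = n%:R.
Proof. exact: (rmorph_nat (real_complex R)). Qed.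
Lemma ofR0 : ofR (0 : R) = 0. Proof. by []. Qed.
Lemma ofR_le (x y : R) : (ofR x <= ofR y) = (x <= y).
Proof. exact: lecR. Qed.
Lemma ofR_lt (x y : R) : (ofR x < ofR y) = (x < y).
Proof. exact: ltcR. Qed.

Lemma modulus_ofR (x : R) : modulus (ofR x) = `|x|.
Proof. by rewrite /modulus/= expr0n addr0 sqrtr_sqr. Qed.

Lemma modulus_ofR_ge0 (x : R) : 0 <= x -> modulus (ofR x) = x.
Proof. by move=> x0; rewrite modulus_ofR ger0_norm. Qed.

Lemma modulus_nat n : modulus (n%:R : C) = n%:R.
Proof. by rewrite -ofR_nat modulus_ofR_ge0. Qed.

Lemma sqr_modulus z : modulus z ^+ 2 = Re z ^+ 2 + Im z ^+ 2.
Proof.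
by case: z => a b; rewrite /modulus/= sqr_sqrtr// addr_ge0// sqr_ge0.
Qed.

Lemma Re_le_modulus z : `|Re z| <= modulus z.
Proof.
rewrite -(ler_pXn2r (ltn0Sn 1)) ?nnegrE// sqr_modulus real_normK ?num_real//.
by rewrite lerDl sqr_ge0.
Qed.

Lemma Im_le_modulus z : `|Im z| <= modulus z.
Proof.
rewrite -(ler_pXn2r (ltn0Sn 1)) ?nnegrE// sqr_modulus real_normK ?num_real//.
by rewrite lerDr sqr_ge0.
Qed.

Lemma modulus_le_ReIm z : modulus z <= `|Re z| + `|Im z|.
Proof.
rewrite -(ler_pXn2r (ltn0Sn 1)) ?nnegrE ?addr_ge0// sqr_modulus.
rewrite -(real_normK (num_real (Re z))) -(real_normK (num_real (Im z))).
by rewrite sqrrD lerD2r lerDl mulrn_wge0// mulr_ge0.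
Qed.

Lemma ReD z w : Re (z + w) = Re z + Re w.
Proof. by case: z w => a b []. Qed.
Lemma ImD z w : Im (z + w) = Im z + Im w.
Proof. by case: z w => a b []. Qed.
Lemma ReN z : Re (- z) = - Re z. Proof. by case: z. Qed.
Lemma ImN z : Im (- z) = - Im z. Proof. by case: z. Qed.
Lemma ReB z w : Re (z - w) = Re z - Re w.
Proof. by rewrite ReD ReN. Qed.
Lemma ImB z w : Im (z - w) = Im z - Im w.
Proof. by rewrite ImD ImN. Qed.
Lemma ReM z w : Re (z * w) = Re z * Re w - Im z * Im w.
Proof. by case: z w => a b []. Qed.
Lemma ImM z w : Im (z * w) = Re z * Im w + Im z * Re w.
Proof. by case: z w => a b [c d]; rewrite /=; ring. Qed.
Lemma Re_ofRM (a : R) z : Re (ofR a * z) = a * Re z.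
Proof. by rewrite ReM /= mul0r subr0. Qed.
Lemma Im_ofRM (a : R) z : Im (ofR a * z) = a * Im z.
Proof. by rewrite ImM /= mul0r addr0. Qed.
Lemma complex_ext z w : Re z = Re w -> Im z = Im w -> z = w.
Proof. by case: z w => a b [c d] /= -> ->. Qed.

Lemma Re_inv z : Re z^-1 = Re z / modulus z ^+ 2.
Proof.
have [->|z0] := eqVneq z 0; first by rewrite invr0 /= mul0r.
by case: z z0 => a b z0; rewrite sqr_modulus /=.
Qed.

(* Power series expansions of sine and cosine are avoided: the mean value
   theorem suffices for second-order bounds. *)
Lemma mean_value_bound (f g : R -> R) (K x : R) :
  (forall y : R, is_derive y 1 f (g y)) ->
  (forall y, `|y| <= `|x| -> `|g y| <= K) -> `|f x - f 0| <= K * `|x|.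
Proof.
move=> df gK.
have cf (a b : R) : {within `[a, b], continuous f}.
  apply: derivable_within_continuous => y _.
  by have := df y; case.
have [x0|x0] := leP 0 x.
  have [c cx ->] := @MVT_segment R f g 0 x x0 (fun y _ => df y) (cf _ _).
  rewrite subr0 normrM ler_wpM2r// gK//.
  move: cx; rewrite in_itv/= => /andP[c0 cx].
  by rewrite !ger0_norm.
have [c cx e] := @MVT_segment R f g x 0 (ltW x0) (fun y _ => df y) (cf _ _).
rewrite distrC e normrM sub0r normrN ler_wpM2r// gK//.
move: cx; rewrite in_itv/= => /andP[c0 cx].
by rewrite !ler0_norm ?lerN2// (ltW x0).
Qed.

Lemma norm_sin_le (x : R) : `|sin x| <= `|x|.
Proof.
rewrite -[sin x]subr0 -(@sin0 R) -[leRHS]mul1r.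
apply: (@mean_value_bound sin cos) => y.
by move=> _; rewrite cos_max.
Qed.

Lemma norm_cosB1_le (x : R) : `|cos x - 1| <= x ^+ 2.
Proof.
rewrite -(@cos0 R) -[x ^+ 2]real_normK ?num_real// expr2.
apply: (@mean_value_bound cos (fun y => - sin y)) => y.
by move=> xy; rewrite normrN (le_trans (norm_sin_le _)).
Qed.

Lemma norm_sinB_le (x : R) : `|sin x - x| <= `|x| ^+ 2 * `|x|.
Proof.
rewrite -[sin x - x]subr0 -[X in _ - X]subr0 -[X in _ - (X - _)](@sin0 R).
apply: (@mean_value_bound (fun y => sin y - y) (fun y => cos y - 1)) => y.
move=> xy; apply: (le_trans (norm_cosB1_le _)).
by rewrite -[y ^+ 2]real_normK ?num_real// lerXn2r ?nnegrE.
Qed.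

(** Only the tangent bound 1 + y <= expR y is used: y = x gives the lower estimate, and y = - x
    gives expR x <= 1 / (1 - x), hence the upper one. *)
Lemma norm_expRB_le (x : R) : `|x| <= 2^-1 -> `|expR x - 1 - x| <= 2 * x ^+ 2.
Proof.
rewrite ler_norml => /andP[x1 x2].
have h1 := expR_ge1Dx x; have h2 := expR_ge1Dx (- x).
have h3 : expR x * expR (- x) = 1 by rewrite -expRD subrr expR0.
have h4 := expR_gt0 x.
rewrite ger0_norm; last by lra.
suff : expR x <= 1 + x + 2 * x ^+ 2 by lra.
have h5 : expR x * (1 - x) <= 1 by rewrite -h3 ler_pM2l//; lra.
rewrite -(@ler_pM2r _ (1 - x)); last by lra.
apply: le_trans h5 _; nra.
Qed.

Definition cexp z : C := ofR (expR (Re z)) * cis (Im z).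

Lemma cisD (a b : R) : cis (a + b) = cis a * cis b.
Proof.
by apply: complex_ext; rewrite ?ReM ?ImM /= ?cosD// sinD addrC.
Qed.

Lemma cis0 : cis (0 : R) = 1 :> C.
Proof. by apply: complex_ext => /=; rewrite ?cos0 ?sin0. Qed.

Lemma modulus_cis (t : R) : modulus (cis t) = 1.
Proof. by rewrite /modulus/= cos2Dsin2 sqrtr1. Qed.

Lemma cis_nat (t : R) n : cis (n%:R * t) = cis t ^+ n.
Proof.
elim: n => [|n ih]; first by rewrite mul0r cis0.
by rewrite -addn1 natrD mulrDl mul1r cisD ih addn1 exprSr.
Qed.

Lemma cexpD z w : cexp (z + w) = cexp z * cexp w.
Proof. by rewrite /cexp ReD ImD expRD cisD ofRM mulrACA. Qed.

Lemma cexp0 : cexp 0 = 1.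
Proof. by rewrite /cexp /= expR0 cis0 mulr1. Qed.

Lemma modulus_cexp z : modulus (cexp z) = expR (Re z).
Proof. by rewrite modulusM modulus_cis mulr1 modulus_ofR_ge0// expR_ge0. Qed.

Lemma cexp_neq0 z : cexp z != 0.
Proof. by rewrite -modulus_gt0 modulus_cexp expR_gt0. Qed.

Lemma cexpN z : cexp (- z) = (cexp z)^-1.
Proof.
by apply: (mulIf (cexp_neq0 z)); rewrite -cexpD addNr cexp0 mulVf ?cexp_neq0.
Qed.

Lemma cexp_nat z n : cexp (n%:R * z) = cexp z ^+ n.
Proof.
elim: n => [|n ih]; first by rewrite mul0r cexp0.
by rewrite -addn1 natrD mulrDl mul1r cexpD ih addn1 exprSr.
Qed.

Lemma modulus_cexpB1B z : modulus z <= 2^-1 ->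
  modulus (cexp z - 1 - z) <= 8 * modulus z ^+ 2.
Proof.
set m := modulus z => m2.
have m0 : 0 <= m := modulus_ge0 z.
have a1 : `|Re z| <= m := Re_le_modulus z.
have b1 : `|Im z| <= m := Im_le_modulus z.
have a3 := @norm_expRB_le (Re z) (le_trans a1 m2).
have c3 := norm_cosB1_le (Im z).
have s1 := norm_sin_le (Im z).
have s3 := norm_sinB_le (Im z).
have eR : Re (cexp z - 1 - z) =
    (expR (Re z) - 1 - Re z) * cos (Im z) + (1 + Re z) * (cos (Im z) - 1).
  by rewrite !ReB /cexp Re_ofRM /=; ring.
have eI : Im (cexp z - 1 - z) =
    (expR (Re z) - 1 - Re z) * sin (Im z) + Re z * sin (Im z)
    + (sin (Im z) - Im z).
  by rewrite !ImB /cexp Im_ofRM /=; ring.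
have a2 : (Re z) ^+ 2 <= m ^+ 2.
  by rewrite -[X in X <= _]real_normK ?num_real// lerXn2r ?nnegrE.
have b2 : (Im z) ^+ 2 <= m ^+ 2.
  by rewrite -[X in X <= _]real_normK ?num_real// lerXn2r ?nnegrE.
have hE : `|expR (Re z) - 1 - Re z| <= 2 * m ^+ 2 by lra.
apply: (le_trans (modulus_le_ReIm _)).
have hR : `|Re (cexp z - 1 - z)| <= 2 * m ^+ 2 + (1 + m) * m ^+ 2.
  rewrite eR (le_trans (ler_normD _ _))// !normrM lerD//.
    by rewrite -[leRHS]mulr1 ler_pM// cos_max.
  apply: ler_pM => //; last by lra.
  by rewrite (le_trans (ler_normD _ _))// normr1 lerD2l.
have hI : `|Im (cexp z - 1 - z)| <= 2 * m ^+ 2 * m + m * m + m ^+ 2 * m.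
  rewrite eI (le_trans (ler_normD _ _))// lerD//.
      by rewrite (le_trans (ler_normD _ _))// !normrM lerD// ler_pM//; lra.
  by apply: (le_trans s3); rewrite ler_pM// lerXn2r ?nnegrE.
have m3 : m ^+ 2 * m <= m ^+ 2 * 2^-1 by rewrite ler_wpM2l// sqr_ge0.
have e1 : 2 * m ^+ 2 + (1 + m) * m ^+ 2 = 3 * m ^+ 2 + m ^+ 2 * m by ring.
have e2 : 2 * m ^+ 2 * m + m * m + m ^+ 2 * m = m ^+ 2 + 3 * (m ^+ 2 * m).
  by ring.
rewrite e1 in hR; rewrite e2 in hI.
set q := m ^+ 2 * m in m3 hI hR *; set r := m ^+ 2 in m3 hI hR *.
have r0 : 0 <= r by exact: sqr_ge0.
lra.
Qed.

Lemma modulus_cexpB1 z : modulus z <= 2^-1 ->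
  modulus (cexp z - 1) <= 5 * modulus z.
Proof.
move=> z2; have h := @modulus_cexpB1B z z2.
have := modulus_ge0 z => z0.
have : modulus (cexp z - 1) <= modulus (cexp z - 1 - z) + modulus z.
  by rewrite -[X in modulus X <= _](subrK z) modulusD.
nra.
Qed.

End ComplexModulus.
#[global] Hint Extern 0 (is_true (0 <= modulus _)) =>
  solve [apply: modulus_ge0] : core.

(** * The maximum norm with real values *)

Section VectorNorm.
Variables (R : realType) (d : nat).
Local Notation C := (Cplx R).
Local Notation Cd := 'rV[C]_d.
Implicit Types z w : Cd.

Definition vnorm z : R := \big[Num.max/0]_j modulus (z 0 j).

Lemma vnorm_ge0 z : 0 <= vnorm z.
Proof. exact: bigmax_ge_id. Qed.
#[local] Hint Extern 0 (is_true (0 <= vnorm _)) =>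
  solve [apply: vnorm_ge0] : core.

Lemma modulus_le_vnorm z j : modulus (z 0 j) <= vnorm z.
Proof. exact: (le_bigmax 0 (fun j => modulus (z 0 j))). Qed.

Lemma vnorm_le z a : 0 <= a -> (forall j, modulus (z 0 j) <= a) -> vnorm z <= a.
Proof. by move=> a0 h; apply: bigmax_le. Qed.

Lemma vnorm_lt z a : 0 < a -> (forall j, modulus (z 0 j) < a) -> vnorm z < a.
Proof. by move=> a0 h; apply: bigmax_lt. Qed.

Lemma vnormD z w : vnorm (z + w) <= vnorm z + vnorm w.
Proof.
apply: vnorm_le => [|j]; first by rewrite addr_ge0.
by rewrite mxE (le_trans (modulusD _ _))// lerD// modulus_le_vnorm.
Qed.

Lemma vnormN z : vnorm (- z) = vnorm z.
Proof. by apply: eq_bigr => j _; rewrite mxE modulusN. Qed.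

Lemma vnorm_distC z w : vnorm (z - w) = vnorm (w - z).
Proof. by rewrite -vnormN opprB. Qed.

Lemma vnorm_triangle a z w : vnorm (z - w) <= vnorm (z - a) + vnorm (a - w).
Proof. by rewrite -[z - w](subrKA a) vnormD. Qed.

Lemma vnorm_distD z w : vnorm z <= vnorm w + vnorm (z - w).
Proof. by rewrite -[in X in X <= _](subrKC w z) vnormD. Qed.

Lemma vnorm0 : vnorm 0 = 0.
Proof.
apply/le_anti; rewrite vnorm_ge0 andbT; apply: vnorm_le => // j.
by rewrite mxE modulus0.
Qed.

Lemma vnormZ c z : vnorm (c *: z) = modulus c * vnorm z.
Proof.
apply/le_anti/andP; split.
  apply: vnorm_le => [|j]; first by rewrite mulr_ge0 ?modulus_ge0.
  rewrite mxE modulusM; apply: ler_wpM2l; first exact: modulus_ge0.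
  exact: modulus_le_vnorm.
have [->|c0] := eqVneq c 0; first by rewrite modulus0 mul0r.
rewrite mulrC -ler_pdivlMr ?modulus_gt0// vnorm_le ?divr_ge0// => j.
rewrite ler_pdivlMr ?modulus_gt0// mulrC -modulusM.
have -> : c * z 0 j = (c *: z) 0 j by rewrite mxE.
exact: modulus_le_vnorm.
Qed.

Lemma vnorm_eq0 z : (vnorm z == 0) = (z == 0).
Proof.
apply/eqP/eqP => [h|->]; last exact: vnorm0.
apply/rowP => j; rewrite mxE; apply/eqP; rewrite -modulus_eq0.
by rewrite eq_le modulus_ge0 andbT -h modulus_le_vnorm.
Qed.

End VectorNorm.
#[global] Hint Extern 0 (is_true (0 <= vnorm _)) =>
  solve [apply: vnorm_ge0] : core.

(** * Topology of row vectors in terms of real radii *)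

Section Topology.
Variable R : realType.
Local Notation C := (Cplx R).

Lemma ofR_Re (x : C) : 0 <= x -> x = ofR (Re x).
Proof.
case: x => a b; rewrite lecE /= => /andP[/eqP b0 _].
by apply: complex_ext => //=; rewrite b0.
Qed.

Lemma normC_vnorm d (z : 'rV[C]_d) : `|z| = ofR (vnorm z).
Proof.
apply/le_anti/andP; split.
  have -> : `|z| = mx_norm z by [].
  have [->|/mx_norm_neq0[[i j] ->]] := eqVneq (mx_norm z) 0.
    by rewrite -ofR0 ofR_le vnorm_ge0.
  by rewrite (ord1 i) normC_modulus ofR_le modulus_le_vnorm.
have z0 : 0 <= `|z| by exact: normr_ge0.
rewrite (ofR_Re z0) ofR_le; apply: vnorm_le => [|j].
  by rewrite -ofR_le -ofR_Re.
rewrite -ofR_le -ofR_Re// -normC_modulus.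
have -> : `|z| = mx_norm z by [].
rewrite mx_normE.
by rewrite -[leLHS]nngE num_le; exact: (le_bigmax _ _ (0, j)).
Qed.

Lemma ofR_gt0P (e : C) : 0 < e -> exists2 r : R, 0 < r & e = ofR r.
Proof.
move=> e0; exists (Re e); last exact/ofR_Re/ltW.
by rewrite -ofR_lt ofR0 -ofR_Re// ltW.
Qed.

(** Translates neighbourhoods, whose radii are elements of [Cplx R], into conditions with real
    radii, the form in which estimates are made below. *)
Lemma nbhs_vnormP d (z : 'rV[C]_d) (A : set 'rV[C]_d) :
  nbhs z A <-> exists2 r : R, 0 < r & forall w, vnorm (w - z) < r -> A w.
Proof.
split => [/(@nbhs_ballP C)[e/= /ofR_gt0P[r r0 ->] zA]|[r r0 zA]].
  exists r => // w zw; apply: zA.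
  by rewrite mx_norm_ball /ball_ /= normC_vnorm ofR_lt vnorm_distC.
apply/(@nbhs_ballP C); exists (ofR r) => /=; first by rewrite -ofR0 ofR_lt.
move=> w; rewrite mx_norm_ball /ball_ /= normC_vnorm ofR_lt => zw.
by apply: zA; rewrite vnorm_distC.
Qed.

Lemma open_vnormP d (A : set 'rV[C]_d) :
  open A <-> forall z, A z -> exists2 r : R, 0 < r &
    forall w, vnorm (w - z) < r -> A w.
Proof.
rewrite openE; split => Ao z Az; first exact/nbhs_vnormP/Ao.
exact/nbhs_vnormP/Ao.
Qed.

Lemma cvg_vnormP d T (F : set_system T) (FF : Filter F) (f : T -> 'rV[C]_d)
    (l : 'rV[C]_d) :
  f @ F --> l <-> forall e : R, 0 < e -> \forall x \near F, vnorm (f x - l) < e.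
Proof.
split => [fl e e0|fl].
  have := fl [set y | vnorm (y - l) < e]; apply.
  by apply/nbhs_vnormP; exists e.
move=> A /nbhs_vnormP[r r0 rA].
have := fl _ r0; rewrite /nbhs /= => h.
by near=> x; apply: rA; near: x; exact: h.
Unshelve. all: by end_near. Qed.

Lemma cvgn_vnormP d (f : nat -> 'rV[C]_d) (l : 'rV[C]_d) :
  f n @[n --> \oo] --> l <->
  forall e : R, 0 < e -> exists N, forall n, (N <= n)%N -> vnorm (f n - l) < e.
Proof.
split => [/cvg_vnormP fl e /fl[N _ Nl]|fl]; first by exists N => n; exact: Nl.
by apply/cvg_vnormP => e /fl[N Nl]; exists N.
Qed.

Lemma continuous_vnormP d n (f : 'rV[C]_d -> 'rV[C]_n)
    (z : 'rV[C]_d) :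
  {for z, continuous f} <-> forall e : R, 0 < e -> exists2 r : R, 0 < r &
    forall w, vnorm (w - z) < r -> vnorm (f w - f z) < e.
Proof.
split => [/cvg_vnormP fc e /fc/nbhs_vnormP//|fc].
by apply/(@cvg_vnormP _ _ _ (nbhs_filter z)) => e /fc ?; apply/nbhs_vnormP.
Qed.

(** A linear part with quadratic remainder is what Cauchy estimates provide. Continuity of the
    linear part comes from the sum of the moduli of the entries of A, and uniqueness of the
    differential identifies it. *)
Lemma differentiable_quadratic d n (f : 'rV[C]_d -> 'rV[C]_n)
    (z : 'rV[C]_d)
    (A : 'M[C]_(d, n)) (K r : R) : 0 < r ->
  (forall h, vnorm h < r ->
    vnorm (f (z + h) - f z - h *m A) <= K * vnorm h ^+ 2) ->
  differentiable f z.
Proof.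
move=> r0 fA.
pose L : {linear 'rV[C]_d -> 'rV[C]_n} := mulmxr A.
pose a := \sum_i \sum_j modulus (A i j).
have a0 : 0 <= a by apply: sumr_ge0 => i _; apply: sumr_ge0.
have La h : vnorm (L h) <= a * vnorm h.
  apply: vnorm_le => [|j]; first by rewrite mulr_ge0.
  rewrite /L /= mxE (le_trans (modulus_sum _ _ _))// mulr_suml ler_sum// => i _.
  rewrite modulusM mulrC ler_pM ?modulus_le_vnorm//.
  by rewrite (bigD1 j)//= lerDl sumr_ge0.
have cL : continuous L.
  move=> x; apply/continuous_vnormP => e e0; exists (e / (a + 1)).
    by rewrite divr_gt0// ltr_wpDl.
  move=> w; rewrite ltr_pdivlMr ?ltr_wpDl// => xw.
  rewrite -linearB (le_lt_trans (La _))// (le_lt_trans _ xw)// mulrC.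
  by rewrite ler_wpM2l// lerDl.
have core (eps : C) : 0 < eps -> \forall x \near (0 : 'rV[C]_d),
    `|(f \o shift z - (cst (f z) + L)) x| <= eps * `|x|.
  move=> /ofR_gt0P[e e0 ->].
  apply/nbhs_vnormP; exists (Num.min r (e / (`|K| + 1))).
    by rewrite lt_min r0 divr_gt0// ltr_wpDl.
  move=> h; rewrite subr0 lt_min ltr_pdivlMr ?ltr_wpDl// => /andP[hr he].
  rewrite !normC_vnorm -ofRM ofR_le.
  have -> : (f \o shift z - (cst (f z) + L)) h = f (z + h) - f z - h *m A.
    by rewrite [z + h]addrC -addrA -opprD.
  apply: le_trans (fA _ hr) _; rewrite expr2 mulrA ler_wpM2r//.
  have := vnorm_ge0 h; have := ler_norm K; have := normr_ge0 K; nra.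
have dfL : 'd f z = L :> (_ -> _).
  by apply: (diff_unique cL); apply/eqaddoP; exact: core.
by apply/diff_locallyP; rewrite dfL; split => //; apply/eqaddoP; exact: core.
Qed.

Lemma uniform_vnormP d (D : set 'rV[C]_d) (f : nat -> 'rV[C]_d -> 'rV[C]_d)
    (g : 'rV[C]_d -> 'rV[C]_d) :
  {uniform D, f @ \oo --> g} <->
  forall e : R, 0 < e -> exists N, forall n, (N <= n)%N ->
    forall z, D z -> vnorm (f n z - g z) < e.
Proof.
split => [h e e0|h P /uniform_nbhs[E [+ EP]]].
  have /h[N _ Nh] : nbhs (g : {uniform` D -> 'rV[C]_d})
      [set k | forall z, D z -> vnorm (k z - g z) < e].
    apply/uniform_nbhs; exists [set xy | ball xy.1 (ofR e) xy.2].
    split.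
      by rewrite -(@entourage_ballE C); exists (ofR e) => //=; rewrite -ofR0 ofR_lt.
    move=> k /= kg z Dz; have := kg z Dz.
    by rewrite mx_norm_ball /ball_ /= normC_vnorm ofR_lt vnorm_distC.
  by exists N => n /Nh.
rewrite -(@entourage_ballE C) => -[_ /ofR_gt0P[e e0 ->] eE].
have [N Nh] := h e e0; exists N => // n /= /Nh {}Nh.
apply: EP => z Dz; apply: eE => /=.
by rewrite mx_norm_ball /ball_ /= normC_vnorm ofR_lt vnorm_distC Nh.
Qed.

Lemma eqaddO_vnormP d n (f g : 'rV[C]_d -> 'rV[C]_n) l :
  (forall z, f z = g z +O_(z \near (0 : 'rV[C]_d)) (`|z| ^+ l)) <->
  exists K r : R, [/\ 0 < K, 0 < r & forall z, vnorm z < r ->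
    vnorm (f z - g z) <= K * vnorm z ^+ l].
Proof.
split => [h|[K [r [K0 r0 h]]]].
  have /(@eqaddOP C _ _ C) := funext h.
  move=> [M [Mreal /(_ (ofR (`|Re M| + 1)))]].
  have -> : M < ofR (`|Re M| + 1).
    have -> : M = ofR (Re M) by rewrite -[LHS]RRe_real.
    by rewrite ofR_lt /= ltr_pwDr// ler_norm.
  move=> /(_ isT)/nbhs_vnormP[r r0 rh].
  exists (`|Re M| + 1), r; split => //.
  move=> z zr; have := rh z; rewrite subr0 => /(_ zr).
  by rewrite !normC_vnorm -ofRX normC_modulus modulus_ofR_ge0 ?exprn_ge0//
    -ofRM ofR_le.
have e : f = g +O_ (nbhs (0 : 'rV[C]_d)) (fun z => `|z| ^+ l).
  apply/eqaddOP; exists (ofR K); split; first by rewrite realE -ofR0 !ofR_le ltW.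
  move=> M KM; apply/nbhs_vnormP; exists r => // z; rewrite subr0 => zr.
  have Mr : M = ofR (Re M) by apply: ofR_Re; rewrite ltW// (lt_trans _ KM)// -ofR0 ofR_lt.
  rewrite !normC_vnorm -ofRX normC_modulus modulus_ofR_ge0 ?exprn_ge0//.
  rewrite Mr -ofRM ofR_le (le_trans (h _ zr))// ler_wpM2r ?exprn_ge0//.
  by rewrite -ofR_le -Mr ltW.
by move=> z; exact: (congr1 (fun k => k z) e).
Qed.

Lemma cauchy_modulus (u : nat -> C) :
  (forall e : R, 0 < e -> exists N, forall m n, (N <= m)%N -> (N <= n)%N ->
    modulus (u m - u n) < e) ->
  exists l, forall e : R, 0 < e -> exists N, forall n, (N <= n)%N ->
    modulus (u n - l) < e.
Proof.
move=> uc.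
have real_part (P : C -> R) : (forall z w, P (z - w) = P z - P w) ->
    (forall z, `|P z| <= modulus z) -> exists l : R, forall e : R, 0 < e ->
    exists N, forall n, (N <= n)%N -> `|P (u n) - l| < e.
  move=> PB Pm.
  have /cvg_ex[l /cvgrPdist_lt ul] : cvgn (P \o u).
    apply/cauchy_cvgP/cauchyP => e /uc[N Nh]; exists (P (u N)), N => // n /= Nn.
    by rewrite /ball /= -PB (le_lt_trans (Pm _))// Nh.
  by exists l => e /ul[N _ Nl]; exists N => n /Nl; rewrite distrC.
have [a ua] := real_part _ (@ReB R) (@Re_le_modulus R).
have [b ub] := real_part _ (@ImB R) (@Im_le_modulus R).
exists (Complex a b) => e e0.
have e2 : 0 < e / 2 by rewrite divr_gt0.
have [N Na] := ua _ e2; have [N' Nb] := ub _ e2.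
exists (maxn N N') => n; rewrite geq_max => /andP[/Na ha /Nb hb].
rewrite (le_lt_trans (modulus_le_ReIm _))// ReB ImB /=.
by rewrite [e]splitr ltrD.
Qed.

End Topology.

(** * Holomorphic functions as limits of polynomials *)

Section CauchyEstimates.
Variable R : realType.
Local Notation C := (Cplx R).
Implicit Types (q : {poly C}) (t : C).

(** The half-angle formula turns cos |x| = 1 into sin (|x| / 2) = 0, and the sine has no zero
    strictly between 0 and pi. *)
Lemma cis_eq1 (x : R) : `|x| < 2 * pi -> cis x = 1 -> x = 0.
Proof.
move=> x2pi [c1 _]; apply/eqP; apply: contraT => x0.
have : sin (`|x| / 2) ^+ 2 = 0.
  have c2 : cos `|x| = 1 by case: (ler0P x) => _; rewrite ?cosN.
  have := cosD (`|x| / 2) (`|x| / 2).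
  rewrite -splitr c2 -!expr2 => e.
  have := cos2Dsin2 (`|x| / 2); lra.
move/eqP; rewrite sqrf_eq0 => /eqP s0.
have := @sin_gt0_pi R (`|x| / 2); rewrite s0 ltxx; apply.
by rewrite divr_gt0 ?normr_gt0//= ltr_pdivrMr// mulrC.
Qed.

Lemma cis_2pi : cis (2 * pi) = 1 :> C.
Proof.
apply: complex_ext => /=.
  by rewrite mulrC mulr_natr cos2pi.
by rewrite mulrC mulr_natr sin2pi.
Qed.

Lemma prim_root_cis (N : nat) : (0 < N)%N ->
  N.-primitive_root (cis (2 * pi / N%:R) : C).
Proof.
move=> N0; apply/andP; split => //; apply/forallP => -[i iN]; apply/eqP => /=.
have N0R : 0 < N%:R :> R by rewrite ltr0n.
rewrite unity_rootE -cis_nat.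
move: iN; rewrite leq_eqVlt => /orP[/eqP iN|iN].
  rewrite iN eqxx [_ * (_ / _)]mulrC divfK; last by rewrite gt_eqF.
  by rewrite cis_2pi eqxx.
rewrite ltn_eqF//; apply/negbTE/eqP => /cis_eq1.
have i0 : 0 < i.+1%:R :> R by rewrite ltr0n.
have pi0 := @pi_gt0 R.
have h0 : 0 < i.+1%:R * (2 * pi / N%:R) :> R by apply: mulr_gt0 => //; apply: divr_gt0 => //; apply: mulr_gt0.
rewrite gtr0_norm//.
have -> : i.+1%:R * (2 * pi / N%:R) < 2 * pi :> R.
  by rewrite mulrCA -[ltRHS]mulr1 ltr_pM2l ?mulr_gt0// ltr_pdivrMr// mul1r ltr_nat.
by move=> /(_ isT) h; rewrite h ltxx in h0.
Qed.

Lemma sum_prim_root (N : nat) (w : C) (m : nat) :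
  N.-primitive_root w -> ~~ (N %| m)%N -> \sum_(s < N) (w ^+ m) ^+ s = 0.
Proof.
move=> pw Nm; have w1 : w ^+ m - 1 != 0.
  by rewrite subr_eq0 -(prim_order_dvd pw).
apply: (mulfI w1); rewrite mulr0 -subrX1 -exprM mulnC exprM.
by rewrite (prim_expr_order pw) expr1n subrr.
Qed.

(** Discrete form of Cauchy's integral formula: the factor with exponent N - i stands for the power
    - i of the sample point. *)
Lemma coef_average q (N i : nat) (w : C) : N.-primitive_root w ->
  (size q <= N)%N -> (i < N)%N ->
  \sum_(s < N) q.[w ^+ s] * (w ^+ s) ^+ (N - i) = N%:R * q`_i.
Proof.
move=> pw qN iN.
under eq_bigr => s _.
  rewrite (horner_coef_wide _ qN) mulr_suml.
  under eq_bigr => j _ do rewrite -mulrA -exprD -exprM mulnC exprM.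
  over.
rewrite exchange_big/= (bigD1 (Ordinal iN))//= [X in _ + X]big1 ?addr0.
  rewrite -mulr_sumr [X in _ * X](eq_bigr (fun=> 1)).
    by rewrite sumr_const card_ord mulrC.
  by move=> s _; rewrite subnKC ?(ltnW iN)// (prim_expr_order pw) expr1n.
move=> j ji; rewrite -mulr_sumr (sum_prim_root pw) ?mulr0//.
apply: contra ji; rewrite -val_eqE /=.
have jN := ltn_ord j; move=> /dvdnP[c e].
by apply/eqP; case: c e => [|[|c]]; lia.
Qed.

(** This is [coef_average] for the rescaled polynomial q(r X), with more sample points than the
    degree of q and than i. *)
Lemma cauchy_coef q (r M : R) i : 0 < r ->
  (forall t, modulus t <= r -> modulus q.[t] <= M) ->
  modulus q`_i * r ^+ i <= M.
Proof.
move=> r0 qM; pose N := (maxn (size q) i).+1.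
have N0 : (0 < N)%N by [].
have pw := prim_root_cis N0; set w := cis _ in pw.
pose p := q \Po (ofR r *: 'X).
have pE t : p.[t] = q.[ofR r * t].
  by rewrite horner_comp hornerZ hornerX.
have sp : (size p <= N)%N.
  rewrite (leq_trans (size_comp_poly_leq _ _))// size_scale; last first.
    by rewrite -modulus_eq0 modulus_ofR_ge0 ?ltW// gt_eqF.
  by rewrite size_polyX muln1 /N ltnS leq_max; apply/orP; left; lia.
have iN : (i < N)%N by rewrite ltnS leq_maxr.
have pi' : p`_i = q`_i * ofR r ^+ i.
  have -> : p = \poly_(j < size q) (q`_j * ofR r ^+ j).
    rewrite /p comp_polyE poly_def; apply: eq_bigr => j _.
    by rewrite exprZn scalerA.
  by rewrite coef_poly; case: ltnP => // /(nth_default 0) ->; rewrite mul0r.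
have := coef_average pw sp iN; rewrite pi' => e.
have : modulus (N%:R * (q`_i * ofR r ^+ i)) <= N%:R * M.
  rewrite -e (le_trans (modulus_sum _ _ _))//.
  have -> : N%:R * M = \sum_(s < N) M.
    by rewrite sumr_const card_ord mulr_natl.
  apply: ler_sum => s _.
  rewrite modulusM !modulusX /w modulus_cis !expr1n mulr1 pE.
  by apply: qM; rewrite modulusM modulusX modulus_cis expr1n mulr1 modulus_ofR_ge0// ltW.
rewrite !modulusM modulusX modulus_nat modulus_ofR_ge0; last exact: ltW.
by rewrite ler_pM2l ?ltr0n.
Qed.

Lemma geometric_tail_le (x : R) (m n : nat) : 0 <= x -> x < 1 ->
  \sum_(m <= i < n) x ^+ i <= x ^+ m / (1 - x).
Proof.
move=> x0 x1; have x2 : 0 < 1 - x by rewrite subr_gt0.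
rewrite ler_pdivlMr//.
have [nm|mn] := leqP n m; first by rewrite big_geq// mul0r exprn_ge0.
have -> : (\sum_(m <= i < n) x ^+ i) * (1 - x) = x ^+ m - x ^+ n.
  rewrite -[RHS]opprB -(telescope_sumr _ (ltnW mn)) -sumrN mulr_suml.
  by apply: eq_bigr => i _; rewrite opprB exprSr mulrBr mulr1.
by rewrite gerBl exprn_ge0.
Qed.

(** Evaluation at 1 is the case of interest: a function of several variables is restricted to the
    line t |-> z + t h and wanted at z + h. *)
Lemma poly_tail_le q (K x : R) (m : nat) : 0 <= x -> x < 1 ->
  (forall i, modulus q`_i <= K * x ^+ i) ->
  modulus (q.[1] - \sum_(i < m) q`_i) <= K * (x ^+ m / (1 - x)).
Proof.
move=> x0 x1 qx.
have K0 : 0 <= K by have := qx 0; rewrite expr0 mulr1; exact: le_trans.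
pose n := maxn m (size q).
have -> : q.[1] = \sum_(0 <= i < n) q`_i.
  rewrite (horner_coef_wide _ (leq_maxr m (size q))) big_mkord.
  by apply: eq_bigr => i _; rewrite expr1n mulr1.
rewrite (big_cat_nat (leq0n m) (leq_maxl m (size q)))/= big_mkord addrAC subrr add0r.
rewrite (le_trans (modulus_sum _ _ _))//.
apply: (@le_trans _ _ (\sum_(m <= i < n) K * x ^+ i)).
  by apply: ler_sum.
by rewrite -mulr_sumr ler_wpM2l// geometric_tail_le.
Qed.

End CauchyEstimates.

(** * Polynomial functions of several variables *)

Section PolynomialFunctions.
Variables (R : realType) (n : nat).
Local Notation C := (Cplx R).
Local Notation Cn := 'rV[C]_n.
Implicit Types (f g : Cn -> C) (z w h v : Cn) (A : set Cn).

(** Polynomials enter only as functions: through their restrictions to lines, their bounds and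
    Lipschitz constants on balls, and their stability under composition, all of which follow by
    induction on this predicate. *)
Inductive polyfun : (Cn -> C) -> Prop :=
| polyfun_cst c : polyfun (fun=> c)
| polyfun_coord j : polyfun (fun z => z 0 j)
| polyfun_add f g : polyfun f -> polyfun g -> polyfun (fun z => f z + g z)
| polyfun_mul f g : polyfun f -> polyfun g -> polyfun (fun z => f z * g z).

Lemma polyfun_horner (q : {poly C}) f : polyfun f -> polyfun (fun z => q.[f z]).
Proof.
move=> pf; elim/poly_ind: q => [|q c ih].
  by under eq_fun do rewrite horner0; exact: polyfun_cst.
under eq_fun do rewrite hornerMXaddC.
by apply: polyfun_add; [exact: polyfun_mul|exact: polyfun_cst].
Qed.

Lemma polyfun_line f : polyfun f -> forall z v,
  exists q : {poly C}, forall t, f (z + t *: v) = q.[t].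
Proof.
elim=> [c|j|{}f g _ ihf _ ihg|{}f g _ ihf _ ihg] z v.
- by exists c%:P => t; rewrite hornerC.
- exists ((z 0 j)%:P + v 0 j *: 'X) => t.
  by rewrite hornerD hornerC hornerZ hornerX !mxE mulrC.
- have [p fp] := ihf z v; have [q gq] := ihg z v.
  by exists (p + q) => t; rewrite hornerD fp gq.
- have [p fp] := ihf z v; have [q gq] := ihg z v.
  by exists (p * q) => t; rewrite hornerM fp gq.
Qed.

(** The point is that a is chosen before v: along all lines through z the coefficient of degree one
    is the same linear form in the direction, the future derivative. *)
Lemma polyfun_gradient f : polyfun f -> forall z, exists a : 'I_n -> C, forall v,
  exists q : {poly C}, [/\ forall t, f (z + t *: v) = q.[t],
    q`_0 = f z & q`_1 = \sum_j a j * v 0 j].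
Proof.
elim=> [c|j|{}f g _ ihf _ ihg|{}f g _ ihf _ ihg] z.
- exists (fun=> 0) => v; exists c%:P; split => [t||]; rewrite ?hornerC ?coefC//.
  by rewrite big1// => j _; rewrite mul0r.
- exists (fun i => (i == j)%:R) => v; exists ((z 0 j)%:P + v 0 j *: 'X).
  split => [t||]; rewrite ?hornerD ?hornerC ?hornerZ ?hornerX ?mxE 1?mulrC//.
    by rewrite coefD coefC coefZ coefX /= mulr0 addr0.
  rewrite coefD coefC coefZ coefX /= mulr1 add0r (bigD1 j)//= eqxx mul1r.
  by rewrite big1 ?addr0// => i /negbTE ->; rewrite mul0r.
- have [a ha] := ihf z; have [b hb] := ihg z.
  exists (fun j => a j + b j) => v.
  have [p [fp p0 p1]] := ha v; have [q [gq q0 q1]] := hb v.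
  exists (p + q); split => [t||]; rewrite ?hornerD ?coefD ?fp ?gq ?p0 ?q0//.
  by rewrite p1 q1 -big_split; apply: eq_bigr => j _; rewrite mulrDl.
- have [a ha] := ihf z; have [b hb] := ihg z.
  exists (fun j => f z * b j + a j * g z) => v.
  have [p [fp p0 p1]] := ha v; have [q [gq q0 q1]] := hb v.
  exists (p * q); split => [t||]; rewrite ?hornerM ?fp ?gq//.
    by rewrite coefM big_ord1 subn0 p0 q0.
  rewrite coefM 2!big_ord_recl big_ord0 addr0 /= !subSS !subn0 p0 q0 p1 q1.
  rewrite mulr_sumr mulr_suml -big_split; apply: eq_bigr => j _.
  by rewrite /=; ring.
Qed.

Lemma polyfun_bound f (B : R) : polyfun f -> 0 <= B ->
  exists2 K : R, 0 <= K & forall z, vnorm z <= B -> modulus (f z) <= K.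
Proof.
move=> pf B0; elim: pf => [c|j|{}f g _ [K K0 fK] _ [L L0 gL]|{}f g _ [K K0 fK] _ [L L0 gL]].
- by exists (modulus c).
- by exists B => // z; apply: le_trans; exact: modulus_le_vnorm.
- exists (K + L) => [|z zB]; first by rewrite addr_ge0.
  by rewrite (le_trans (modulusD _ _))// lerD ?fK ?gL.
- exists (K * L) => [|z zB]; first by rewrite mulr_ge0.
  by rewrite modulusM ler_pM ?fK ?gL.
Qed.

Lemma polyfun_lipschitz f (B : R) : polyfun f -> 0 <= B ->
  exists2 K : R, 0 <= K & forall z w, vnorm z <= B -> vnorm w <= B ->
    modulus (f z - f w) <= K * vnorm (z - w).
Proof.
move=> pf B0; elim: pf => [c|j|{}f g _ [K K0 fK] _ [L L0 gL]|{}f g pf [K K0 fK] pg [L L0 gL]].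
- by exists 0 => // z w _ _; rewrite subrr modulus0 mul0r.
- exists 1 => // z w _ _; rewrite mul1r.
  by have := modulus_le_vnorm (z - w) j; rewrite !mxE.
- exists (K + L) => [|z w zB wB]; first by rewrite addr_ge0.
  by rewrite opprD addrACA mulrDl (le_trans (modulusD _ _))// lerD ?fK ?gL.
- have [S S0 fS] := polyfun_bound pf B0; have [T T0 gT] := polyfun_bound pg B0.
  exists (K * T + S * L) => [|z w zB wB]; first by rewrite addr_ge0 ?mulr_ge0.
  have -> : f z * g z - f w * g w = (f z - f w) * g z + f w * (g z - g w) by ring.
  rewrite (le_trans (modulusD _ _))// !modulusM mulrDl lerD//.
    by rewrite mulrAC ler_pM ?fK ?gT.
  by rewrite -mulrA ler_pM ?gL ?fS.
Qed.

(** On the line through z in the direction h, the disc of radius r / |h| is mapped into the ball of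
    radius r about z. *)
Lemma polyfun_coef f z h (q : {poly C}) (r M : R) : 0 < r ->
  (forall t, f (z + t *: h) = q.[t]) ->
  (forall w, vnorm (w - z) <= r -> modulus (f w) <= M) ->
  0 < vnorm h -> forall i, modulus q`_i <= M * (vnorm h / r) ^+ i.
Proof.
move=> r0 fq fM h1 i.
have qM t : modulus t <= r / vnorm h -> modulus q.[t] <= M.
  move=> tr; rewrite -fq fM// addrC addKr vnormZ.
  by rewrite -ler_pdivlMr.
have := cauchy_coef i (divr_gt0 r0 h1) qM.
rewrite -[vnorm h / r]invrK invf_div exprVn -ler_pdivlMr// exprn_gt0//.
by rewrite divr_gt0.
Qed.

Lemma polyfun_cauchy1 f z h (r M : R) : polyfun f -> 0 < r ->
  (forall w, vnorm (w - z) <= r -> modulus (f w) <= M) ->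
  vnorm h <= r / 2 -> modulus (f (z + h) - f z) <= 2 * M / r * vnorm h.
Proof.
move=> pf r0 fM hr.
have [->|h0] := eqVneq h 0; first by rewrite addr0 subrr modulus0 vnorm0 mulr0.
have h1 : 0 < vnorm h by rewrite lt_def vnorm_eq0 h0 vnorm_ge0.
have [q fq] := polyfun_line pf z h.
have M0 : 0 <= M.
  by apply: le_trans (modulus_ge0 _) (fM z _); rewrite subrr vnorm0 ltW.
have x2 : vnorm h / r <= 2^-1 by rewrite ler_pdivrMr// mulrC.
have x0 : 0 <= vnorm h / r by rewrite divr_ge0 ?ltW.
have := poly_tail_le 1 x0 (le_lt_trans x2 _) (polyfun_coef r0 fq fM h1).
have -> : q.[1] = f (z + h) by rewrite -fq scale1r.
rewrite big_ord1; have -> : q`_0 = f z.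
  by rewrite -horner_coef0 -fq scale0r addr0.
move=> /(_ _)/le_trans -> //; first by lra.
rewrite expr1 mulrA ler_pdivrMr; last by lra.
set x := vnorm h / r in x0 x2 *.
have -> : 2 * M / r * vnorm h = 2 * (M * x) by rewrite /x; ring.
have : 0 <= M * x by rewrite mulr_ge0.
nra.
Qed.

Lemma polyfun_cauchy2 f z h (q : {poly C}) (r M : R) : polyfun f -> 0 < r ->
  (forall t, f (z + t *: h) = q.[t]) ->
  (forall w, vnorm (w - z) <= r -> modulus (f w) <= M) ->
  0 < vnorm h -> vnorm h <= r / 2 ->
  modulus (f (z + h) - f z - q`_1) <= 2 * M / r ^+ 2 * vnorm h ^+ 2.
Proof.
move=> pf r0 fq fM h1 hr.
have M0 : 0 <= M.
  by apply: le_trans (modulus_ge0 _) (fM z _); rewrite subrr vnorm0 ltW.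
have x2 : vnorm h / r <= 2^-1 by rewrite ler_pdivrMr// mulrC.
have x0 : 0 <= vnorm h / r by rewrite divr_ge0 ?ltW.
have := poly_tail_le 2 x0 (le_lt_trans x2 _) (polyfun_coef r0 fq fM h1).
have -> : q.[1] = f (z + h) by rewrite -fq scale1r.
rewrite big_ord_recl big_ord1 /= opprD addrA; have -> : q`_0 = f z.
  by rewrite -horner_coef0 -fq scale0r addr0.
move=> /(_ _)/le_trans -> //; first by lra.
rewrite mulrA ler_pdivrMr; last by lra.
set x := vnorm h / r in x0 x2 *.
have -> : 2 * M / r ^+ 2 * vnorm h ^+ 2 = 2 * (M * x ^+ 2).
  by rewrite /x exprMn exprVn; ring.
have : 0 <= M * x ^+ 2 by rewrite mulr_ge0 ?exprn_ge0.
nra.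
Qed.

End PolynomialFunctions.

(** * Uniform limits of polynomials *)

Section Approximation.
Variable R : realType.
Local Notation C := (Cplx R).

Definition vball n (c : 'rV[C]_n) (r : R) : set 'rV[C]_n :=
  [set z | vnorm (z - c) <= r].

Definition vbounded n (A : set 'rV[C]_n) : Prop :=
  exists2 B : R, 0 <= B & forall z, A z -> vnorm z <= B.

Lemma vbounded_ball n (c : 'rV[C]_n) r : vbounded (vball c r).
Proof.
exists (vnorm c + `|r|) => [|z zr]; first by rewrite addr_ge0.
by rewrite (le_trans (vnorm_distD z c))// lerD2l (le_trans zr)// ler_norm.
Qed.

(* On balls, uniform limits of polynomials are exactly the functions that are
   holomorphic up to the boundary; taking this as the definition of
   holomorphy makes it stable under uniform limits for free. *)
Definition approx n (A : set 'rV[C]_n) (f : 'rV[C]_n -> C) : Prop :=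
  forall e : R, 0 < e -> exists2 P, polyfun P &
    forall z, A z -> modulus (f z - P z) <= e.

Section Stability.
Variables (n : nat) (A : set 'rV[C]_n).
Implicit Types f g : 'rV[C]_n -> C.

Lemma approx_polyfun f : polyfun f -> approx A f.
Proof. by move=> pf e e0; exists f => // z _; rewrite subrr modulus0 ltW. Qed.

Lemma approx_cst c : approx A (fun=> c).
Proof. exact/approx_polyfun/polyfun_cst. Qed.

Lemma approx_coord j : approx A (fun z => z 0 j).
Proof. exact/approx_polyfun/polyfun_coord. Qed.

Lemma approx_ext f g : (forall z, A z -> f z = g z) -> approx A f -> approx A g.
Proof.
by move=> fg af e /af[P pP fP]; exists P => // z Az; rewrite -fg// fP.
Qed.

Lemma approx_sub B f : A `<=` B -> approx B f -> approx A f.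
Proof. by move=> AB af e /af[P pP fP]; exists P => // z /AB/fP. Qed.

Lemma approx_lim f : (forall e : R, 0 < e -> exists2 g, approx A g &
  forall z, A z -> modulus (f z - g z) <= e) -> approx A f.
Proof.
move=> af e e0; have e2 : 0 < e / 2 by rewrite divr_gt0.
have [g /(_ _ e2)[P pP gP] fg] := af _ e2; exists P => // z Az.
rewrite (le_trans (modulus_triangle (g z) _ _))// [e]splitr lerD ?fg ?gP//.
Qed.

Lemma approxD f g : approx A f -> approx A g -> approx A (fun z => f z + g z).
Proof.
move=> af ag e e0; have e2 : 0 < e / 2 by rewrite divr_gt0.
have [P pP fP] := af _ e2; have [Q pQ gQ] := ag _ e2.
exists (fun z => P z + Q z) => [|z Az]; first exact: polyfun_add.
by rewrite opprD addrACA (le_trans (modulusD _ _))// [e]splitr lerD ?fP ?gQ.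
Qed.

Hypothesis bA : vbounded A.

Lemma approx_bound f : approx A f ->
  exists2 K : R, 0 <= K & forall z, A z -> modulus (f z) <= K.
Proof.
have [B B0 AB] := bA => /(_ 1 ltr01)[P pP fP].
have [K K0 PK] := polyfun_bound pP B0.
exists (1 + K) => [|z Az]; first by rewrite addr_ge0.
by rewrite -[f z](subrK (P z)) (le_trans (modulusD _ _))// lerD ?fP ?PK ?AB.
Qed.

Lemma approxM f g : approx A f -> approx A g -> approx A (fun z => f z * g z).
Proof.
move=> af ag e e0.
have [K K0 fK] := approx_bound af; have [L L0 gL] := approx_bound ag.
have d0 : 0 < Num.min 1 (e / (K + L + 1)).
  by rewrite lt_min ltr01 divr_gt0// ltr_wpDl// addr_ge0.
set d := Num.min _ _ in d0.
have d1 : d <= 1 by rewrite ge_min lexx.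
have d2 : d * (K + L + 1) <= e.
  by rewrite -ler_pdivlMr ?ge_min ?lexx ?orbT// ltr_wpDl// addr_ge0.
have [P pP fP] := af _ d0; have [Q pQ gQ] := ag _ d0.
exists (fun z => P z * Q z) => [|z Az]; first exact: polyfun_mul.
have -> : f z * g z - P z * Q z =
    (f z - P z) * g z + f z * (g z - Q z) - (f z - P z) * (g z - Q z) by ring.
rewrite (le_trans (modulusB _ _))// (le_trans (lerD (modulusD _ _) (lexx _)))//.
rewrite !modulusM.
have h1 := fP z Az; have h2 := gQ z Az; have h3 := fK z Az; have h4 := gL z Az.
apply: le_trans d2.
have h5 : modulus (f z - P z) * modulus (g z) <= d * L by rewrite ler_pM.
have h6 : modulus (f z) * modulus (g z - Q z) <= d * K by rewrite mulrC ler_pM.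
have h7 : modulus (f z - P z) * modulus (g z - Q z) <= d * 1.
  by rewrite ler_pM// (le_trans h2).
nra.
Qed.

Lemma approxN f : approx A f -> approx A (fun z => - f z).
Proof.
move=> af; apply: approx_ext (approxM (approx_cst (-1)) af) => z _.
by rewrite mulN1r.
Qed.

Lemma approxB f g : approx A f -> approx A g -> approx A (fun z => f z - g z).
Proof. by move=> af ag; apply: approxD => //; exact: approxN. Qed.

Lemma approxX f k : approx A f -> approx A (fun z => f z ^+ k).
Proof.
move=> af; elim: k => [|k ih]; first exact: approx_cst.
by apply: approx_ext (approxM af ih) => z _; rewrite exprS.
Qed.

Lemma approx_sum (I : Type) (r : seq I) (P : pred I) (F : I -> 'rV[C]_n -> C) :
  (forall i, P i -> approx A (F i)) ->
  approx A (fun z => \sum_(i <- r | P i) F i z).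
Proof.
move=> aF; elim: r => [|i r ih].
  by under eq_fun do rewrite big_nil; exact: approx_cst.
under eq_fun do rewrite big_cons.
by case: (boolP (P i)) => // Pi; apply: approxD => //; exact: aF.
Qed.

Lemma approx_prod (I : Type) (r : seq I) (P : pred I) (F : I -> 'rV[C]_n -> C) :
  (forall i, P i -> approx A (F i)) ->
  approx A (fun z => \prod_(i <- r | P i) F i z).
Proof.
move=> aF; elim: r => [|i r ih].
  by under eq_fun do rewrite big_nil; exact: approx_cst.
under eq_fun do rewrite big_cons.
by case: (boolP (P i)) => // Pi; apply: approxM => //; exact: aF.
Qed.

End Stability.

Lemma polyfun_comp m n (P : 'rV[C]_m -> C) (G : 'I_m -> 'rV[C]_n -> C) :
  polyfun P -> (forall j, polyfun (G j)) ->
  polyfun (fun z => P (\row_j G j z)).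
Proof.
move=> pP pG; elim: pP => [c|j|f g _ pf _ pg|f g _ pf _ pg].
- exact: polyfun_cst.
- by under eq_fun do rewrite mxE; exact: pG.
- exact: polyfun_add.
- exact: polyfun_mul.
Qed.

(** The margin eta is there because the inner map g is itself replaced by polynomials, whose values
    must still lie in the set B on which f is approximated. *)
Lemma approx_comp m n (A : set 'rV[C]_n) (B : set 'rV[C]_m) (f : 'rV[C]_m -> C)
    (g : 'rV[C]_n -> 'rV[C]_m) (eta : R) :
  vbounded B -> approx B f -> (forall j, approx A (fun z => g z 0 j)) ->
  0 < eta -> (forall z y, A z -> vnorm (y - g z) <= eta -> B y) ->
  approx A (f \o g).
Proof.
move=> [K K0 BK] af ag eta0 AB e e0.
have e2 : 0 < e / 2 by rewrite divr_gt0.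
have [P pP fP] := af _ e2.
have [L L0 PL] := polyfun_lipschitz pP K0.
have L1 : 0 < L + 1 by rewrite ltr_wpDl.
pose d := Num.min eta (e / 2 / (L + 1)).
have d0 : 0 < d by rewrite lt_min eta0 divr_gt0.
have [G pG gG] : exists2 G : 'I_m -> 'rV[C]_n -> C, (forall j, polyfun (G j)) &
    forall j z, A z -> modulus (g z 0 j - G j z) <= d.
  have /choice[G hG] : forall j, exists G, polyfun G /\
      forall z, A z -> modulus (g z 0 j - G z) <= d.
    by move=> j; have [G pG gG] := ag j _ d0; exists G.
  by exists G => j; case: (hG j).
exists (fun z => P (\row_j G j z)) => [|z Az]; first exact: polyfun_comp.
have dz : vnorm (\row_j G j z - g z) <= d.
  rewrite vnorm_distC; apply: vnorm_le => [|j]; first exact: ltW.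
  by rewrite !mxE gG.
have B1 : B (g z) by apply: (AB z) => //; rewrite subrr vnorm0 ltW.
have B2 : B (\row_j G j z) by apply: (AB z) => //; rewrite (le_trans dz)// ge_min lexx.
rewrite (le_trans (modulus_triangle (P (g z)) _ _))// [e]splitr lerD ?fP//.
rewrite (le_trans (PL _ _ (BK _ B1) (BK _ B2)))// vnorm_distC.
rewrite (le_trans (ler_wpM2l L0 dz))// (@le_trans _ _ ((L + 1) * d))//.
  by rewrite ler_wpM2r ?lerDl// ltW.
by rewrite mulrC -ler_pdivlMr// ge_min lexx orbT.
Qed.

Definition approx1 (r : R) (h : C -> C) : Prop :=
  forall e : R, 0 < e -> exists q : {poly C},
    forall t, modulus t <= r -> modulus (h t - q.[t]) <= e.

Lemma approx_comp1 n (A : set 'rV[C]_n) (h : C -> C) (g : 'rV[C]_n -> C)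
    (r r' : R) : approx1 r h -> approx A g -> r' < r ->
  (forall z, A z -> modulus (g z) <= r') -> approx A (fun z => h (g z)).
Proof.
move=> ah ag r'r gr'.
pose B : set 'rV[C]_1 := [set y | vnorm y <= r].
have -> : (fun z => h (g z)) = (fun y : 'rV[C]_1 => h (y 0 0)) \o
    (fun z => \row_(j < 1) g z) by apply/funext => z; rewrite /= mxE.
apply: (@approx_comp 1 n A B _ _ (r - r')).
- by exists `|r| => // z /le_trans -> //; exact: ler_norm.
- move=> e /ah[q hq]; exists (fun y => q.[y 0 0]).
    exact/polyfun_horner/polyfun_coord.
  by move=> y By; rewrite hq// (le_trans (modulus_le_vnorm _ _)).
- by move=> j; under eq_fun do rewrite mxE.
- by rewrite subr_gt0.
- move=> z y Az yz; rewrite /B /= (le_trans (vnorm_distD y (\row_j g z)))//.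
  rewrite -[r](subrKC r') lerD//.
  apply: vnorm_le => [|j]; first exact: le_trans (gr' _ Az).
  by rewrite mxE gr'.
Qed.

Lemma approx1_inv (r : R) : 0 <= r -> r < 1 -> approx1 r (fun t => (1 + t)^-1).
Proof.
move=> r0 r1 e e0.
have : \forall n \near \oo, r ^+ n / (1 - r) <= e.
  have /cvgrPdist_le/(_ (e * (1 - r))) : r ^+ n @[n --> \oo] --> 0.
    by apply: cvg_expr; rewrite ger0_norm.
  rewrite mulr_gt0 ?subr_gt0// => /(_ isT); apply: filterS => n.
  by rewrite sub0r normrN ger0_norm ?exprn_ge0// ler_pdivrMr ?subr_gt0.
case=> n _ /(_ n (leqnn n)) rn.
exists (\sum_(i < n) (- 'X) ^+ i) => t tr.
have t1 : 1 + t != 0.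
  rewrite -modulus_gt0 (lt_le_trans _ (modulus_lower _ _))// modulus1 subr_gt0.
  exact: le_lt_trans r1.
have -> : (1 + t)^-1 - (\sum_(i < n) (- 'X) ^+ i).[t] = (- t) ^+ n / (1 + t).
  apply: (mulIf t1); rewrite mulrBl mulVf// divfK//.
  rewrite horner_sum; under eq_bigr do rewrite horner_exp hornerN hornerX.
  have := subrX1 (- t) n => e1.
  have -> : (\sum_(i < n) (- t) ^+ i) * (1 + t) = - ((- t) ^+ n - 1).
    by rewrite e1; ring.
  by ring.
rewrite modulusM modulusX modulusN modulusV; apply: le_trans rn.
apply: ler_pM => //.
- by rewrite exprn_ge0.
- by rewrite invr_ge0.
- by rewrite lerXn2r ?nnegrE.
- rewrite lef_pV2 ?posrE ?subr_gt0//; last by rewrite modulus_gt0.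
  by rewrite (le_trans _ (modulus_lower _ _))// modulus1 lerB.
Qed.

Lemma modulus_expr_dist (x y : C) (K : R) N :
  modulus x <= K -> modulus y <= K ->
  modulus (x ^+ N - y ^+ N) <= N%:R * modulus (x - y) * K ^+ N.-1.
Proof.
move=> xK yK; have K0 : 0 <= K by exact: le_trans xK.
case: N => [|N] /=.
  have -> : x ^+ 0 - y ^+ 0 = 0 :> C by rewrite !expr0 subrr.
  by rewrite modulus0 !mul0r.
rewrite subrXX modulusM -mulrA mulrCA ler_wpM2l//.
rewrite (le_trans (modulus_sum _ _ _))//.
have -> : N.+1%:R * K ^+ N = \sum_(i < N.+1) K ^+ N.
  by rewrite sumr_const card_ord mulr_natl.
apply: ler_sum => i _; rewrite modulusM !modulusX /=.
have -> : K ^+ N = K ^+ (N - i) * K ^+ i by rewrite -exprD subnK// -ltnS.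
by apply: ler_pM; rewrite ?exprn_ge0// lerXn2r ?nnegrE.
Qed.

(** The approximants are (1 + t/N)^N, compared with cexp (t/N)^N; thus the second order bound on
    cexp near 0 suffices. *)
Lemma approx1_cexp (r : R) : 0 <= r -> approx1 r (@cexp R).
Proof.
move=> r0 e e0.
pose K := 8 * r ^+ 2 * expR r.
have K0 : 0 <= K by rewrite !mulr_ge0 ?exprn_ge0 ?expR_ge0.
(* The summand 2 r ensures r / N <= 1/2, the range of the bound on cexp; the summand K / e makes the
   error K / N at most e. *)
pose N := (Num.trunc (2 * r + K / e + 1)).+1.
have NR : 2 * r + K / e + 1 < N%:R by rewrite truncnS_gt.
have N0 : 0 < N%:R :> R by rewrite ltr0n.
exists ((1 + N%:R^-1 *: 'X) ^+ N) => t tr.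
rewrite horner_exp hornerD hornerC hornerZ hornerX.
have -> : cexp t = cexp (t / N%:R) ^+ N.
  by rewrite -cexp_nat mulrC divfK// pnatr_eq0.
have mt : modulus (t / N%:R) <= r / N%:R.
  by rewrite modulusM modulusV modulus_nat ler_pM2r ?invr_gt0.
have Ke0 : 0 <= K / e by rewrite divr_ge0// ltW.
have rN : r / N%:R <= 2^-1 by rewrite ler_pdivrMr// mulrC ler_pdivlMr//; lra.
have h1 : modulus (cexp (t / N%:R)) <= expR (r / N%:R).
  rewrite modulus_cexp ler_expR (le_trans _ mt)//.
  by rewrite (le_trans (ler_norm _))// Re_le_modulus.
have h2 : modulus (1 + N%:R^-1 * t) <= expR (r / N%:R).
  rewrite (le_trans (modulusD _ _))// modulus1 (le_trans _ (expR_ge1Dx _))//.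
  by rewrite lerD2l mulrC.
apply: (le_trans (modulus_expr_dist N h1 h2)).
have h3 : modulus (cexp (t / N%:R) - (1 + N%:R^-1 * t)) <= 8 * (r / N%:R) ^+ 2.
  rewrite opprD addrA [_^-1 * t]mulrC.
  rewrite (le_trans (modulus_cexpB1B (le_trans mt rN)))// ler_pM2l//.
  by rewrite lerXn2r ?nnegrE ?divr_ge0.
have h4 : expR (r / N%:R) ^+ N.-1 <= expR r.
  rewrite -expRM_natl ler_expR /= mulrA ler_pdivrMr// mulrC ler_wpM2l//.
  by rewrite ler_nat.
apply: (@le_trans _ _ (N%:R * (8 * (r / N%:R) ^+ 2) * expR r)).
  by rewrite ler_pM ?exprn_ge0 ?expR_ge0 ?mulr_ge0// ler_wpM2l.
have -> : N%:R * (8 * (r / N%:R) ^+ 2) * expR r = K / N%:R.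
  by rewrite /K exprMn exprVn; field; rewrite gt_eqF.
rewrite ler_pdivrMr// mulrC -ler_pdivrMr//; lra.
Qed.

Section CauchyApprox.
Variables (n : nat) (f : 'rV[C]_n -> C) (z : 'rV[C]_n) (r M : R).
Hypotheses (r0 : 0 < r) (af : approx (vball z r) f).
Hypothesis fM : forall w, vball z r w -> modulus (f w) <= M.

Lemma approx_lipschitz h : vnorm h <= r / 2 ->
  modulus (f (z + h) - f z) <= 2 * M / r * vnorm h.
Proof.
move=> hr; apply/ler_addgt0Pr => e e0.
have zz : vball z r z by rewrite /vball /= subrr vnorm0 ltW.
have zh : vball z r (z + h).
  by rewrite /vball /= addrC addKr (le_trans hr)// ler_pdivrMr// ler_peMr ?ltW//; lra.
pose d := e / 3.
have d0 : 0 < d by rewrite divr_gt0.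
have [P pP fP] := af d0.
have PM w : vnorm (w - z) <= r -> modulus (P w) <= M + d.
  move=> wz; rewrite -[P w](subrK (f w)) addrC (le_trans (modulusD _ _))//.
  by rewrite lerD ?fM// modulus_distC fP.
have := polyfun_cauchy1 pP r0 PM hr.
have h1 := fP _ zz; have h2 := fP _ zh.
have -> : f (z + h) - f z =
    (f (z + h) - P (z + h)) + (P (z + h) - P z) - (f z - P z) by ring.
have h3 := modulusB (f (z + h) - P (z + h) + (P (z + h) - P z)) (f z - P z).
have h4 := modulusD (f (z + h) - P (z + h)) (P (z + h) - P z).
have h5 : 2 * (M + d) / r * vnorm h <= 2 * M / r * vnorm h + d.
  have -> : 2 * (M + d) / r * vnorm h =
    2 * M / r * vnorm h + d * (2 * (vnorm h / r)) by ring.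
  rewrite lerD2l; apply: ler_piMr; first exact: ltW.
  rewrite mulrA ler_pdivrMr// mul1r mulrC.
  by rewrite -ler_pdivlMr.
have h6 : e = d + d + d by rewrite /d; lra.
by move=> h7; lra.
Qed.

(** Cauchy's estimate applied to differences of approximating polynomials shows that their gradients
    converge. The quadratic remainder has a bound independent of the approximation and passes to the
    limit. *)
Lemma approx_derivative : exists (a : 'I_n -> C) (K : R), forall h,
  vnorm h <= r / 2 ->
  modulus (f (z + h) - f z - \sum_j a j * h 0 j) <= K * vnorm h ^+ 2.
Proof.
have /choice[P hP] : forall N : nat, exists P, polyfun P /\
    forall w, vball z r w -> modulus (f w - P w) <= N.+1%:R^-1.
  by move=> N; have [|P pP fP] := @af N.+1%:R^-1; [by []|exists P].
have /choice[a ha] : forall N, exists a : 'I_n -> C, forall v,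
    exists q : {poly C}, [/\ forall t, P N (z + t *: v) = q.[t],
    q`_0 = P N z & q`_1 = \sum_j a j * v 0 j].
  by move=> N; have [pP _] := hP N; exact: polyfun_gradient.
have inv_small (e : R) : 0 < e -> exists N, forall m, (N <= m)%N -> m.+1%:R^-1 < e.
  move=> e0; exists (Num.trunc e^-1) => m Nm.
  rewrite invf_plt ?posrE//; apply: lt_le_trans (truncnS_gt _) _.
  by rewrite ler_nat ltnS.
have acauchy j : exists l, forall e : R, 0 < e -> exists N, forall m,
    (N <= m)%N -> modulus (a m j - l) < e.
  apply: cauchy_modulus => e e0.
  have e1 : 0 < e * r / 2 by rewrite !(mulr_gt0, divr_gt0).
  have [N hN] := inv_small _ e1.
  exists N => m k Nm Nk.
  pose v : 'rV[C]_n := \row_i (i == j)%:R.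
  have v1 : vnorm v = 1.
    apply/le_anti; rewrite vnorm_le//=; last first.
      by move=> i; rewrite mxE; case: eqP => _; rewrite ?modulus1 ?modulus0.
    by rewrite (le_trans _ (modulus_le_vnorm v j))// mxE eqxx modulus1.
  have av i : \sum_j0 a i j0 * v 0 j0 = a i j.
    rewrite (bigD1 j)//= mxE eqxx mulr1 big1 ?addr0// => j0 /negbTE j0j.
    by rewrite mxE j0j mulr0.
  have [q [Pq _ q1]] := ha m v; have [p [Pp _ p1]] := ha k v.
  rewrite av in q1; rewrite av in p1.
  have [pm fm] := hP m; have [pk fk] := hP k.
  have qp t : P m (z + t *: v) - P k (z + t *: v) = (q - p).[t].
    by rewrite hornerD hornerN Pq Pp.
  have PM w : vnorm (w - z) <= r ->
      modulus (P m w - P k w) <= m.+1%:R^-1 + k.+1%:R^-1.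
    move=> wz; rewrite (le_trans (modulus_triangle (f w) _ _))//.
    by rewrite lerD ?fk// modulus_distC fm.
  have := @polyfun_coef _ _ (fun w => P m w - P k w) z v (q - p) r _ r0 qp PM.
  rewrite v1 => /(_ ltr01 1%N); rewrite coefB q1 p1 expr1 => /le_lt_trans -> //.
  have h1 := hN m Nm; have h2 := hN k Nk.
  by rewrite mul1r ltr_pdivrMr// (lt_le_trans (ltrD h1 h2))//; lra.
have /choice[b hb] := acauchy.
exists b, (2 * (M + 1) / r ^+ 2) => h hr.
have [->|h0] := eqVneq h 0.
  rewrite addr0 subrr sub0r modulusN big1 ?modulus0 ?vnorm0 ?expr0n ?mulr0//.
  by move=> j _; rewrite mxE mulr0.
have h1 : 0 < vnorm h by rewrite lt_def vnorm_eq0 h0 vnorm_ge0.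
have zz : vball z r z by rewrite /vball /= subrr vnorm0 ltW.
have zh : vball z r (z + h).
  by rewrite /vball /= addrC addKr (le_trans hr)// ler_pdivrMr// ler_peMr ?ltW//; lra.
apply/ler_addgt0Pr => e e0.
pose d := e / (2 + n%:R * vnorm h).
have D0 : 0 < 2 + n%:R * vnorm h by rewrite ltr_pwDl// mulr_ge0.
have d0 : 0 < d by rewrite divr_gt0.
have [N hN] := inv_small _ d0.
have /choice[Nj hNj] : forall j, exists N, forall m, (N <= m)%N ->
    modulus (a m j - b j) < d by move=> j; exact: hb.
pose m := maxn N (\max_j Nj j).
have mN : m.+1%:R^-1 < d by rewrite hN// leq_maxl.
have mj j : modulus (a m j - b j) < d.
  by apply: hNj; rewrite (leq_trans _ (leq_maxr _ _))// leq_bigmax.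
have [pP fP] := hP m; have [q [Pq _ q1]] := ha m h.
have PM w : vnorm (w - z) <= r -> modulus (P m w) <= M + 1.
  move=> wz; rewrite -[P m w](subrK (f w)) addrC (le_trans (modulusD _ _))//.
  rewrite lerD ?fM// modulus_distC (le_trans (fP _ wz))//.
  by rewrite invf_le1// ler1n.
have := polyfun_cauchy2 pP r0 Pq PM h1 hr; rewrite q1.
set S := (X in _ <= X) => hS.
have -> : f (z + h) - f z - \sum_j b j * h 0 j =
    (f (z + h) - P m (z + h)) - (f z - P m z) +
    ((P m (z + h) - P m z - \sum_j a m j * h 0 j) +
    \sum_j (a m j - b j) * h 0 j).
  have -> : \sum_j (a m j - b j) * h 0 j =
      \sum_j a m j * h 0 j - \sum_j b j * h 0 j.
    by rewrite -sumrB; apply: eq_bigr => j _; rewrite mulrBl.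
  by ring.
have g1 := fP _ zz; have g2 := fP _ zh.
have g3 : modulus (\sum_j (a m j - b j) * h 0 j) <= n%:R * (d * vnorm h).
  rewrite (le_trans (modulus_sum _ _ _))//.
  have -> : n%:R * (d * vnorm h) = \sum_(j < n) d * vnorm h.
    by rewrite sumr_const card_ord mulr_natl.
  by apply: ler_sum => j _; rewrite modulusM ler_pM ?modulus_le_vnorm// ltW.
rewrite (le_trans (modulusD _ _))//.
have g4 := modulusB (f (z + h) - P m (z + h)) (f z - P m z).
have g5 := modulusD (P m (z + h) - P m z - \sum_j a m j * h 0 j)
  (\sum_j (a m j - b j) * h 0 j).
have g6 : e = 2 * d + n%:R * (d * vnorm h).
  have -> : 2 * d + n%:R * (d * vnorm h) = d * (2 + n%:R * vnorm h) by ring.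
  by rewrite /d divfK// gt_eqF.
rewrite -/S; have {}g1 := le_lt_trans g1 mN; have {}g2 := le_lt_trans g2 mN.
by lra.
Qed.

End CauchyApprox.

Definition analytic n m (f : 'rV[C]_n -> 'rV[C]_m) (z : 'rV[C]_n) : Prop :=
  exists2 r : R, 0 < r & forall j, approx (vball z r) (fun w => f w 0 j).

Lemma analytic_differentiable n m (f : 'rV[C]_n -> 'rV[C]_m) z :
  analytic f z -> differentiable f z.
Proof.
move=> [r r0 af].
have /choice[a ha] : forall j, exists a : ('I_n -> C) * R, forall h,
    vnorm h <= r / 2 -> modulus (f (z + h) 0 j - f z 0 j
      - \sum_i a.1 i * h 0 i) <= a.2 * vnorm h ^+ 2.
  move=> j; have [M M0 fM] := approx_bound (vbounded_ball z r) (af j).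
  by have [a [K aK]] := approx_derivative r0 (af j) fM; exists (a, K).
apply: (@differentiable_quadratic _ _ _ _ _ (\matrix_(i, j) (a j).1 i)
  (\sum_j `|(a j).2|) (r / 2)); first by rewrite divr_gt0.
move=> h /ltW hr; apply: vnorm_le => [|j].
  by rewrite mulr_ge0 ?exprn_ge0// sumr_ge0.
have -> : (f (z + h) - f z - h *m \matrix_(i, j) (a j).1 i) 0 j =
    f (z + h) 0 j - f z 0 j - \sum_i (a j).1 i * h 0 i.
  rewrite !mxE; congr (_ - _); apply: eq_bigr => i _.
  by rewrite mxE mulrC.
rewrite (le_trans (ha j h hr))// ler_wpM2r ?exprn_ge0//.
by rewrite (le_trans (ler_norm _))// (bigD1 j)//= lerDl sumr_ge0.
Qed.

Lemma analytic_continuous n m (f : 'rV[C]_n -> 'rV[C]_m) z :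
  analytic f z -> {for z, continuous f}.
Proof. by move/analytic_differentiable/differentiable_continuous. Qed.

Lemma analytic_ext n m (f g : 'rV[C]_n -> 'rV[C]_m) z (r : R) : 0 < r ->
  (forall w, vball z r w -> f w = g w) -> analytic f z -> analytic g z.
Proof.
move=> r0 fg [s s0 af]; exists (Num.min r s) => [|j].
  by rewrite lt_min r0.
have sub1 : vball z (Num.min r s) `<=` vball z s.
  by move=> w /le_trans; apply; rewrite ge_min lexx orbT.
apply: (@approx_ext _ _ (fun w => f w 0 j)); last exact: approx_sub (af j).
by move=> w wz; rewrite fg// /vball /= (le_trans wz)// ge_min lexx.
Qed.

Lemma analytic_comp n m k (f : 'rV[C]_m -> 'rV[C]_k) (g : 'rV[C]_n -> 'rV[C]_m)
    z : analytic g z -> analytic f (g z) -> analytic (f \o g) z.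
Proof.
move=> ag [s s0 af].
have s2 : 0 < s / 2 by rewrite divr_gt0.
have /continuous_vnormP/(_ _ s2)[t t0 gt] := analytic_continuous ag.
have [r r0 {}ag] := ag.
exists (Num.min r (t / 2)) => [|j]; first by rewrite lt_min r0 divr_gt0.
apply: (@approx_comp _ _ _ (vball (g z) s) (fun y => f y 0 j) g (s / 2)) => //.
- exact: vbounded_ball.
- move=> i; apply: approx_sub (ag i) => w /le_trans; apply.
  by rewrite ge_min lexx.
- move=> w y wz yw; rewrite /vball /= [s]splitr.
  rewrite (le_trans (vnorm_triangle (g w) _ _))// lerD// ltW// gt//.
  rewrite (le_lt_trans wz)// gt_min; apply/orP; right.
  by rewrite ltr_pdivrMr// ltr_pMr//; lra.
Qed.

End Approximation.

(** * Jets of automorphisms *)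

Section Jets.
Variables (R : realType) (d : nat).
Local Notation C := (Cplx R).
Local Notation Cd := 'rV[C]_d.
Implicit Types (f g h : Cd -> C) (z w v r : Cd) (F G Phi Q T : Cd -> Cd).

Definition bigO (l : nat) f : Prop := exists K r : R, [/\ 0 <= K, 0 < r &
  forall z, vnorm z < r -> modulus (f z) <= K * vnorm z ^+ l].

Lemma bigO_ext l f g : f =1 g -> bigO l f -> bigO l g.
Proof. by move=> /funext ->. Qed.

Lemma bigO_add l f g : bigO l f -> bigO l g -> bigO l (fun z => f z + g z).
Proof.
move=> [K [r [K0 r0 fK]]] [L [s [L0 s0 gL]]].
exists (K + L), (Num.min r s); split => [||z]; first exact: addr_ge0.
  by rewrite lt_min r0.
rewrite lt_min => /andP[zr zs].
by rewrite (le_trans (modulusD _ _))// mulrDl lerD ?fK ?gL.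
Qed.

Lemma bigO_mul l m f g : bigO l f -> bigO m g -> bigO (l + m) (fun z => f z * g z).
Proof.
move=> [K [r [K0 r0 fK]]] [L [s [L0 s0 gL]]].
exists (K * L), (Num.min r s); split => [||z]; first exact: mulr_ge0.
  by rewrite lt_min r0.
rewrite lt_min => /andP[zr zs].
by rewrite modulusM exprD mulrACA ler_pM ?fK ?gL.
Qed.

Lemma bigO_cst c : bigO 0 (fun=> c).
Proof. by exists (modulus c), 1; split => // z _; rewrite expr0 mulr1. Qed.

Lemma bigO_scale l c f : bigO l f -> bigO l (fun z => c * f z).
Proof. exact: (bigO_mul (bigO_cst c)). Qed.

Lemma bigO_opp l f : bigO l f -> bigO l (fun z => - f z).
Proof. by move/(bigO_scale (-1)); apply: bigO_ext => z; rewrite mulN1r. Qed.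

Lemma bigO_sub l f g : bigO l f -> bigO l g -> bigO l (fun z => f z - g z).
Proof. by move=> lf /bigO_opp; exact: bigO_add. Qed.

Lemma bigO0 l : bigO l (fun=> 0).
Proof. by exists 0, 1; split => // z _; rewrite modulus0 mul0r. Qed.

Lemma bigO_sum l (I : Type) (s : seq I) (P : pred I) (f : I -> Cd -> C) :
  (forall i, P i -> bigO l (f i)) -> bigO l (fun z => \sum_(i <- s | P i) f i z).
Proof.
move=> lf; elim: s => [|i s ih].
  by under eq_fun do rewrite big_nil; exact: bigO0.
under eq_fun do rewrite big_cons.
by case: (boolP (P i)) => // /lf h; exact: bigO_add.
Qed.

Lemma bigO_exp l f n : bigO l f -> bigO (l * n) (fun z => f z ^+ n).
Proof.
move=> lf; elim: n => [|n ih]; first by rewrite muln0; exact: bigO_cst.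
by rewrite mulnS; apply: bigO_ext (bigO_mul lf ih) => z; rewrite exprS.
Qed.

Lemma bigO_le l m f : (m <= l)%N -> bigO l f -> bigO m f.
Proof.
move=> ml [K [r [K0 r0 fK]]]; exists K, (Num.min r 1); split => // [|z].
  by rewrite lt_min r0 ltr01.
rewrite lt_min => /andP[zr z1]; apply: le_trans (fK z zr) _.
rewrite ler_wpM2l// -(subnK ml) exprD ler_piMl ?exprn_ge0//.
by rewrite exprn_ile1// ltW.
Qed.

Definition linform (a : Cd) z : C := \sum_j a 0 j * z 0 j.

Lemma linformD a z w : linform a (z + w) = linform a z + linform a w.
Proof.
by rewrite -big_split; apply: eq_bigr => j _; rewrite mxE mulrDr.
Qed.

Lemma linformZ a c z : linform a (c *: z) = c * linform a z.
Proof. by rewrite mulr_sumr; apply: eq_bigr => j _; rewrite mxE mulrCA. Qed.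

Lemma linformDl a b z : linform (a + b) z = linform a z + linform b z.
Proof.
by rewrite -big_split; apply: eq_bigr => j _; rewrite mxE mulrDl.
Qed.

Lemma linformZl c a z : linform (c *: a) z = c * linform a z.
Proof. by rewrite mulr_sumr; apply: eq_bigr => j _; rewrite mxE mulrA. Qed.

Lemma linform_delta j z : linform (delta_mx 0 j) z = z 0 j.
Proof.
rewrite /linform (bigD1 j)//= mxE !eqxx mul1r big1 ?addr0// => i /negbTE ij.
by rewrite mxE ij andbF mul0r.
Qed.

Definition linnorm (a : Cd) : R := \sum_j modulus (a 0 j).

Lemma linnorm_ge0 (a : Cd) : 0 <= linnorm a. Proof. exact: sumr_ge0. Qed.

Lemma linform_le a z : modulus (linform a z) <= linnorm a * vnorm z.
Proof.
rewrite (le_trans (modulus_sum _ _ _))// mulr_suml ler_sum// => j _.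
by rewrite modulusM ler_wpM2l// modulus_le_vnorm.
Qed.

Lemma bigO_linform a : bigO 1 (linform a).
Proof.
exists (linnorm a), 1; split => //; first exact: linnorm_ge0.
by move=> z _; rewrite expr1 linform_le.
Qed.

(* Homogeneous polynomials, presented as sums of powers of linear forms. *)
Inductive homog (m : nat) : (Cd -> C) -> Prop :=
| homog0 : homog m (fun=> 0)
| homog_addpow c a h : homog m h -> homog m (fun z => c * linform a z ^+ m + h z).

Lemma homog_pow m c a : homog m (fun z => c * linform a z ^+ m).
Proof.
by have := homog_addpow c a (homog0 m); under eq_fun do rewrite addr0.
Qed.

Lemma homogD m f g : homog m f -> homog m g -> homog m (fun z => f z + g z).
Proof.
move=> + hg; elim=> [|c a h _ ih]; first by under eq_fun do rewrite add0r.
by under eq_fun do rewrite -addrA; exact: homog_addpow.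
Qed.

Lemma homogZ m c f : homog m f -> homog m (fun z => c * f z).
Proof.
elim=> [|b a h _ ih]; first by under eq_fun do rewrite mulr0; exact: homog0.
by under eq_fun do rewrite mulrDr mulrA; exact: homog_addpow.
Qed.

Lemma homog_sum m (I : Type) (s : seq I) (f : I -> Cd -> C) :
  (forall i, homog m (f i)) -> homog m (fun z => \sum_(i <- s) f i z).
Proof.
move=> hf; elim: s => [|i s ih].
  by under eq_fun do rewrite big_nil; exact: homog0.
by under eq_fun do rewrite big_cons; exact: homogD.
Qed.

(* Polarization: averaging (x + wy)^N against powers of w over the roots of
   unity w of large order isolates a single monomial in x and y. *)
Lemma homog_pow_mul m k a b :
  homog (m + k) (fun z => linform a z ^+ m * linform b z ^+ k).
Proof.
set N := (m + k)%N.
have N0 : (0 < N.+1)%N by [].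
have pw := prim_root_cis R N0; set w := cis _ in pw.
have kN : (k < N.+1)%N by rewrite ltnS leq_addl.
have binN0 : 'C(N, k)%:R != 0 :> C.
  by rewrite pnatr_eq0 -lt0n bin_gt0 leq_addl.
have NN0 : N.+1%:R != 0 :> C by rewrite pnatr_eq0.
have -> : (fun z => linform a z ^+ m * linform b z ^+ k) = (fun z =>
    \sum_(s < N.+1) (w ^+ s) ^+ (N.+1 - k) / (N.+1%:R * 'C(N, k)%:R) *
    linform (a + (w ^+ s) *: b) z ^+ N).
  apply/funext => z; pose q : {poly C} :=
    \poly_(i < N.+1) (linform a z ^+ (N - i) * linform b z ^+ i *+ 'C(N, i)).
  have qE t : q.[t] = (linform a z + t * linform b z) ^+ N.
    rewrite exprDn horner_poly; apply: eq_bigr => i _.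
    by rewrite exprMn mulrnAl mulrAC mulrA.
  have := @coef_average _ q N.+1 k w pw (size_poly _ _) kN.
  rewrite coef_poly kN addnK => /(congr1 (fun x => x / (N.+1%:R * 'C(N, k)%:R))).
  have -> : N.+1%:R * (linform a z ^+ m * linform b z ^+ k *+ 'C(N, k)) /
      (N.+1%:R * 'C(N, k)%:R) = linform a z ^+ m * linform b z ^+ k.
    rewrite -[X in N.+1%:R * X]mulr_natr; field.
    by rewrite binN0 nat1r NN0.
  rewrite -/w => <-; rewrite mulr_suml; apply: eq_bigr => s _.
  by rewrite qE linformDl linformZl [RHS]mulrC mulrA.
by apply: homog_sum => s; exact: homog_pow.
Qed.

Lemma homogM m k f g : homog m f -> homog k g -> homog (m + k) (fun z => f z * g z).
Proof.
move=> hf hg; elim: hf => [|c a h _ ih].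
  by under eq_fun do rewrite mul0r; exact: homog0.
under eq_fun do rewrite mulrDl.
apply: homogD => //; elim: hg => [|e b h' _ ih'].
  by under eq_fun do rewrite mulr0; exact: homog0.
under eq_fun do rewrite mulrDr mulrACA.
by apply: homogD => //; exact/homogZ/homog_pow_mul.
Qed.

Lemma homog_scale m f : homog m f -> forall t z, f (t *: z) = t ^+ m * f z.
Proof.
elim=> [|c a h _ ih] t z; first by rewrite mulr0.
by rewrite ih linformZ exprMn; ring.
Qed.

Lemma homog_bigO m f : homog m f -> bigO m f.
Proof.
elim=> [|c a h _ ih]; first exact: bigO0.
apply: bigO_add => //; apply: bigO_scale.
by have := bigO_exp m (bigO_linform a); rewrite mul1n.
Qed.

(** Factor a^m - b^m for each power of a linear form: the difference contributes order l + 1 and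
    each of the m - 1 remaining factors order 1. *)
Lemma homog_shift m h (f g : 'I_d -> Cd -> C) l : (0 < m)%N -> homog m h ->
  (forall j, bigO 1 (f j)) -> (forall j, bigO 1 (g j)) ->
  (forall j, bigO l.+1 (fun z => f j z - g j z)) ->
  bigO (l + m) (fun z => h (\row_j f j z) - h (\row_j g j z)).
Proof.
move=> m0 hh Of Og Ofg; elim: hh => [|c a {}h _ ih].
  by under eq_fun do rewrite subrr; exact: bigO0.
have lfO (s : 'I_d -> Cd -> C) k : (forall j, bigO k (s j)) ->
    bigO k (fun z => linform a (\row_j s j z)).
  move=> Os; apply: bigO_sum => j _.
  by under eq_fun do rewrite mxE; exact: bigO_scale.
apply: (@bigO_ext _ (fun z => c * (linform a (\row_j f j z) ^+ m -
    linform a (\row_j g j z) ^+ m) +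
    (h (\row_j f j z) - h (\row_j g j z)))) => [z|]; first by ring.
apply: bigO_add => //; apply: bigO_scale.
under eq_fun do rewrite subrXX.
have -> : (l + m = l.+1 + m.-1)%N by lia.
apply: bigO_mul.
  apply: (@bigO_ext _ (fun z => linform a (\row_j (f j z - g j z)))) => [z|].
    rewrite -sumrB; apply: eq_bigr => j _.
    by rewrite !mxE mulrBr.
  exact: lfO.
apply: bigO_sum => i _.
have im : (i <= m.-1)%N by have := ltn_ord i; lia.
have := bigO_mul (bigO_exp (m.-1 - i) (lfO _ _ Of)) (bigO_exp i (lfO _ _ Og)).
by rewrite !mul1n subnK.
Qed.

(** A Taylor polynomial is asked for at each order separately, so no compatibility between the
    orders has to be carried along. *)
Definition jet f : Prop := forall l, exists h : nat -> Cd -> C,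
  (forall m, homog m (h m)) /\ bigO l (fun z => f z - \sum_(m < l) h m z).

Lemma jet_ext f g : f =1 g -> jet f -> jet g.
Proof. by move=> /funext ->. Qed.

Lemma jet_homog m f : homog m f -> jet f.
Proof.
move=> hf l; exists (fun i z => if i == m then f z else 0); split => [i|].
  case: eqP => [->|_]; [exact: hf|exact: homog0].
have [ml|lm] := ltnP m l.
  apply: (@bigO_ext _ (fun=> 0)) => [z|]; last exact: bigO0.
  rewrite (bigD1 (Ordinal ml))//= eqxx big1 ?addr0 ?subrr// => i.
  by rewrite -val_eqE /= => /negbTE ->.
apply: (@bigO_ext _ f) => [z|]; last exact: bigO_le lm (homog_bigO hf).
rewrite big1 ?subr0// => i _; case: eqP => // e.
by have := ltn_ord i; rewrite e ltnNge lm.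
Qed.

Lemma jet_cst c : jet (fun=> c).
Proof.
apply: (@jet_homog 0); have := homog_pow 0 c 0.
by under eq_fun do rewrite expr0 mulr1.
Qed.

Lemma jet_linform a : jet (linform a).
Proof.
apply: (@jet_homog 1); have := homog_pow 1 1 a.
by under eq_fun do rewrite expr1 mul1r.
Qed.

Lemma jet_coord j : jet (fun z => z 0 j).
Proof. by under eq_fun do rewrite -linform_delta; exact: jet_linform. Qed.

Lemma jet_bigO0 f : jet f -> bigO 0 f.
Proof.
move=> /(_ 0)[h [_ Of]]; apply: bigO_ext Of => z.
by rewrite big_ord0 subr0.
Qed.

Lemma jetD f g : jet f -> jet g -> jet (fun z => f z + g z).
Proof.
move=> jf jg l; have [p [hp Op]] := jf l; have [q [hq Oq]] := jg l.
exists (fun m z => p m z + q m z); split => [m|]; first exact: homogD.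
apply: bigO_ext (bigO_add Op Oq) => z.
by rewrite big_split /=; ring.
Qed.

Lemma jet_lim f : (forall l, exists2 g, jet g & bigO l (fun z => f z - g z)) ->
  jet f.
Proof.
move=> fl l; have [g /(_ l)[h [hh Og]] Of] := fl l; exists h; split => //.
by apply: bigO_ext (bigO_add Of Og) => z; ring.
Qed.

Lemma jet_sum (I : Type) (s : seq I) (f : I -> Cd -> C) :
  (forall i, jet (f i)) -> jet (fun z => \sum_(i <- s) f i z).
Proof.
move=> jf; elim: s => [|i s ih].
  by under eq_fun do rewrite big_nil; exact: jet_cst.
by under eq_fun do rewrite big_cons; exact: jetD.
Qed.

Lemma jetM f g : jet f -> jet g -> jet (fun z => f z * g z).
Proof.
move=> jf jg; apply: jet_lim => l.
have [p [hp Op]] := jf l; have [q [hq Oq]] := jg l.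
exists (fun z => (\sum_(i < l) p i z) * (\sum_(j < l) q j z)).
  under eq_fun do rewrite big_distrlr /=.
  apply: jet_sum => i; apply: jet_sum => j.
  exact: jet_homog (homogM (hp i) (hq j)).
have O0 : bigO 0 (fun z => \sum_(i < l) p i z).
  by apply: bigO_sum => i _; exact: bigO_le (homog_bigO (hp i)).
have O1 := bigO_mul Op (jet_bigO0 jg); rewrite addn0 in O1.
have O2 := bigO_mul O0 Oq; rewrite add0n in O2.
by apply: bigO_ext (bigO_add O1 O2) => z; ring.
Qed.

Lemma jet_opp f : jet f -> jet (fun z => - f z).
Proof.
by move=> /(jetM (jet_cst (-1))); apply: jet_ext => z; rewrite mulN1r.
Qed.

Lemma jetX f n : jet f -> jet (fun z => f z ^+ n).
Proof.
move=> jf; elim: n => [|n ih]; first exact: jet_cst.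
by apply: jet_ext (jetM jf ih) => z; rewrite exprS.
Qed.

Lemma jet_prod (I : Type) (s : seq I) (f : I -> Cd -> C) :
  (forall i, jet (f i)) -> jet (fun z => \prod_(i <- s) f i z).
Proof.
move=> jf; elim: s => [|i s ih].
  by under eq_fun do rewrite big_nil; exact: jet_cst.
by under eq_fun do rewrite big_cons; exact: jetM.
Qed.

Lemma jet_horner (q : {poly C}) f : jet f -> jet (fun z => q.[f z]).
Proof.
move=> jf; elim/poly_ind: q => [|q c ih].
  by under eq_fun do rewrite horner0; exact: jet_cst.
under eq_fun do rewrite hornerMXaddC.
by apply: jetD; [exact: jetM|exact: jet_cst].
Qed.

Lemma bigO_comp l f (Phi : Cd -> Cd) : bigO l f ->
  (forall j, bigO 1 (fun z => Phi z 0 j)) -> bigO l (f \o Phi).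
Proof.
move=> [K [r [K0 r0 fK]]] OPhi.
have [L [s [L0 s0 PhiL]]] : exists L s : R, [/\ 0 <= L, 0 < s &
    forall z, vnorm z < s -> vnorm (Phi z) <= L * vnorm z].
  have /choice[p hp] : forall j, exists p : R * R, [/\ 0 <= p.1, 0 < p.2 &
      forall z, vnorm z < p.2 -> modulus (Phi z 0 j) <= p.1 * vnorm z ^+ 1].
    by move=> j; have [L [s h]] := OPhi j; exists (L, s).
  have L0 : 0 <= \sum_j (p j).1 by apply: sumr_ge0 => j _; case: (hp j).
  exists (\sum_j (p j).1), (\big[Num.min/1]_j (p j).2); split => //.
    by apply/bigmin_gtP; split => // j _; case: (hp j).
  move=> z /bigmin_gtP[_ zp]; apply: vnorm_le => [|j]; first exact: mulr_ge0.
  have [_ _ /(_ z (zp j isT))] := hp j; rewrite expr1 => /le_trans; apply.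
  rewrite ler_wpM2r// (bigD1 j)//= lerDl sumr_ge0// => i _.
  by case: (hp i).
have L1 : 0 < L + 1 by rewrite ltr_wpDl.
exists (K * L ^+ l), (Num.min s (r / (L + 1))); split => [||z].
- by rewrite mulr_ge0 ?exprn_ge0.
- by rewrite lt_min s0 divr_gt0.
rewrite lt_min => /andP[zs]; rewrite ltr_pdivlMr// => zr.
have Pz := PhiL z zs.
apply: (le_trans (fK _ _)); last first.
  by rewrite -mulrA -exprMn ler_wpM2l// lerXn2r ?nnegrE ?mulr_ge0.
by apply: le_lt_trans zr; rewrite (le_trans Pz)// mulrC ler_wpM2l// lerDl.
Qed.

Lemma jet_comp f (Phi : Cd -> Cd) : jet f -> (forall j, jet (fun z => Phi z 0 j)) ->
  (forall j, bigO 1 (fun z => Phi z 0 j)) -> jet (f \o Phi).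
Proof.
move=> jf jPhi OPhi; apply: jet_lim => l; have [h [hh Of]] := jf l.
exists (fun z => \sum_(i < l) h i (Phi z)).
  apply: jet_sum => i; elim: (hh i) => [|c a g _ ih]; first exact: jet_cst.
  apply: jetD => //; apply: jetM; first exact: jet_cst.
  apply: jetX; apply: jet_sum => j; apply: jetM => //; exact: jet_cst.
exact: (bigO_comp Of OPhi).
Qed.

(** A polynomial with terms of degree below l only, which is O(|z|^l), vanishes: along the line
    through z, Cauchy's estimate on discs of radius s bounds each of its coefficients by a multiple
    of s. *)
Lemma jet_lowest l f : jet f -> bigO l f ->
  exists2 h, homog l h & bigO l.+1 (fun z => f z - h z).
Proof.
move=> /(_ l.+1)[h [hh Of]] Ofl; exists (h l) => //.
suff low0 z : \sum_(i < l) h i z = 0.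
  by apply: bigO_ext Of => z; rewrite big_ord_recr /= low0 add0r.
have OS : bigO l (fun z => \sum_(i < l) h i z).
  have O1 := bigO_add (bigO_le (leqnSn l) Of) (homog_bigO (hh l)).
  apply: bigO_ext (bigO_sub Ofl O1) => w; rewrite big_ord_recr /=; ring.
have {OS}[K [r [K0 r0 hK]]] := OS.
apply: big1 => i _; apply/eqP; rewrite -modulus_eq0; apply/eqP/le_anti.
rewrite modulus_ge0 andbT.
have z1 : 0 < vnorm z + 1 by rewrite ltr_wpDl.
pose q : {poly C} := \poly_(j < l) h j z.
have qE t : q.[t] = \sum_(j < l) h j (t *: z).
  rewrite horner_poly; apply: eq_bigr => j _.
  by rewrite (homog_scale (hh j)) mulrC.
have qi : q`_i = h i z by rewrite coef_poly ltn_ord.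
pose L := K * (vnorm z + 1) ^+ l.
have L0 : 0 <= L by rewrite mulr_ge0 ?exprn_ge0// ltW.
have bound (s : R) : 0 < s -> s < 1 -> s < r / (vnorm z + 1) ->
    modulus (h i z) <= L * s.
  move=> s0 s1; rewrite ltr_pdivlMr// => sr.
  have sz t : modulus t <= s -> modulus q.[t] <= L * s ^+ l.
    move=> ts; rewrite qE; have tz : vnorm (t *: z) <= s * (vnorm z + 1).
      by rewrite vnormZ ler_pM// lerDl.
    apply: (le_trans (hK _ _)); first exact: le_lt_trans sr.
    rewrite /L -mulrA -exprMn ler_wpM2l// lerXn2r ?nnegrE//.
      by rewrite mulr_ge0 ?ltW.
    by rewrite mulrC.
  have := cauchy_coef i s0 sz.
  have -> : s ^+ l = s ^+ (l - i) * s ^+ i by rewrite -exprD subnK// ltnW.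
  rewrite qi mulrA ler_pM2r ?exprn_gt0//.
  move=> /le_trans; apply; rewrite ler_wpM2l//.
  have := ltn_ord i; rewrite -subn_gt0; case: (l - i)%N => // n _.
  rewrite exprS; apply: ler_piMr; first exact: ltW.
  by apply: exprn_ile1; exact: ltW.
apply/ler_addgt0Pr => e e0; rewrite add0r.
have L1 : 0 < L + 1 by rewrite ltr_wpDl.
pose s := Num.min (2^-1) (Num.min (r / (vnorm z + 1) / 2) (e / (L + 1))).
have s0 : 0 < s by rewrite !lt_min invr_gt0 ltr0n !divr_gt0.
have rz : 0 < r / (vnorm z + 1) by rewrite divr_gt0.
apply: (le_trans (bound s s0 _ _)).
- by rewrite /s gt_min invf_lt1// ltr1n.
- by rewrite /s !gt_min; apply/orP; right; apply/orP; left; lra.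
- have : s <= e / (L + 1) by rewrite /s !ge_min lexx !orbT.
  rewrite ler_pdivlMr// => /(le_trans _); apply.
  by rewrite mulrC ler_wpM2l ?lerDl// ltW.
Qed.

End Jets.

(** * Entire maps and their automorphisms *)

Section Automorphisms.
Variable R : realType.
Local Notation C := (Cplx R).

Definition entire n (f : 'rV[C]_n -> C) : Prop :=
  forall B : R, approx (vball 0 B) f.

Lemma entire_approx n (f : 'rV[C]_n -> C) A : entire f -> vbounded A -> approx A f.
Proof.
move=> ef [B B0 AB]; apply: approx_sub (ef B) => z /AB.
by rewrite /vball /= subr0.
Qed.

Lemma entire_polyfun n (f : 'rV[C]_n -> C) : polyfun f -> entire f.
Proof. by move=> pf B; exact: approx_polyfun. Qed.

Lemma entire_cst n c : entire (fun _ : 'rV[C]_n => c).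
Proof. exact/entire_polyfun/polyfun_cst. Qed.

Lemma entire_coord n j : entire (fun z : 'rV[C]_n => z 0 j).
Proof. exact/entire_polyfun/polyfun_coord. Qed.

Lemma entireD n (f g : 'rV[C]_n -> C) :
  entire f -> entire g -> entire (fun z => f z + g z).
Proof. by move=> ef eg B; exact: approxD. Qed.

Lemma entireM n (f g : 'rV[C]_n -> C) :
  entire f -> entire g -> entire (fun z => f z * g z).
Proof. by move=> ef eg B; apply: approxM => //; exact: vbounded_ball. Qed.

Lemma entireX n (f : 'rV[C]_n -> C) k : entire f -> entire (fun z => f z ^+ k).
Proof. by move=> ef B; apply: approxX => //; exact: vbounded_ball. Qed.

Lemma entire_sum n (I : Type) (r : seq I) (F : I -> 'rV[C]_n -> C) :
  (forall i, entire (F i)) -> entire (fun z => \sum_(i <- r) F i z).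
Proof. by move=> eF B; apply: approx_sum => // i _; exact: eF. Qed.

Lemma entire_prod n (I : Type) (r : seq I) (F : I -> 'rV[C]_n -> C) :
  (forall i, entire (F i)) -> entire (fun z => \prod_(i <- r) F i z).
Proof.
by move=> eF B; apply: approx_prod => [|i _]; [exact: vbounded_ball|exact: eF].
Qed.

Lemma entire_linform n (a : 'rV[C]_n) : entire (linform a).
Proof.
apply: entire_sum => j; apply: entireM; first exact: entire_cst.
exact: entire_coord.
Qed.

Lemma entire_cexp n (f : 'rV[C]_n -> C) : entire f -> entire (fun z => cexp (f z)).
Proof.
move=> ef B; have [K K0 fK] := approx_bound (vbounded_ball 0 B) (ef B).
apply: (@approx_comp1 _ _ _ _ _ (K + 1) K) => //.
- by apply: approx1_cexp; rewrite addr_ge0.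
- by rewrite ltrDl.
Qed.

Definition entire_map n m (f : 'rV[C]_n -> 'rV[C]_m) : Prop :=
  forall j, entire (fun z => f z 0 j).

Lemma entire_comp n m (f : 'rV[C]_m -> C) (g : 'rV[C]_n -> 'rV[C]_m) :
  entire f -> entire_map g -> entire (f \o g).
Proof.
move=> ef eg B.
have /choice[K hK] : forall j, exists K : R, 0 <= K /\
    forall z, vball 0 B z -> modulus (g z 0 j) <= K.
  by move=> j; have [K K0 gK] := approx_bound (vbounded_ball 0 B) (eg j B); exists K.
pose L := \sum_j K j.
have L0 : 0 <= L by apply: sumr_ge0 => j _; case: (hK j).
apply: (@approx_comp _ _ _ _ (vball 0 (L + 1)) f g 1) => //.
- exact: vbounded_ball.
- by move=> j; exact: eg.
- move=> z y Bz yz; rewrite /vball /= subr0 (le_trans (vnorm_distD y (g z)))//.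
  rewrite lerD//; apply: vnorm_le => // j.
  have [_ /(_ z Bz) /le_trans] := hK j; apply.
  rewrite /L (bigD1 j)//= lerDl sumr_ge0// => i _; by case: (hK i).
Qed.

Lemma entire_map_comp n m k (f : 'rV[C]_m -> 'rV[C]_k) (g : 'rV[C]_n -> 'rV[C]_m) :
  entire_map f -> entire_map g -> entire_map (f \o g).
Proof. by move=> ef eg j; exact: (entire_comp (ef j) eg). Qed.

Lemma entire_map_id n : entire_map (@id 'rV[C]_n).
Proof. by move=> j; exact: entire_coord. Qed.

Lemma entire_map_iter n (f : 'rV[C]_n -> 'rV[C]_n) k :
  entire_map f -> entire_map (iter k f).
Proof.
move=> ef; elim: k => [|k ih]; first exact: entire_map_id.
exact: (entire_map_comp ef ih).
Qed.

Lemma entire_analytic n m (f : 'rV[C]_n -> 'rV[C]_m) z :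
  entire_map f -> analytic f z.
Proof.
by move=> ef; exists 1 => // j; apply: entire_approx => //; exact: vbounded_ball.
Qed.

Definition entire_auto n (G : 'rV[C]_n -> 'rV[C]_n) : Prop :=
  exists H, [/\ entire_map G, entire_map H, cancel G H & cancel H G].

Lemma entire_auto_automorphism n (G : 'rV[C]_n -> 'rV[C]_n) :
  entire_auto G -> automorphism G.
Proof.
move=> [H [eG eH GH HG]]; split => [z _|].
  exact/analytic_differentiable/entire_analytic.
exists H; split => // z _; exact/analytic_differentiable/entire_analytic.
Qed.

Lemma entire_auto_id n : entire_auto (@id 'rV[C]_n).
Proof. by exists id; split => //; exact: entire_map_id. Qed.

Lemma entire_auto_comp n (F G : 'rV[C]_n -> 'rV[C]_n) :
  entire_auto F -> entire_auto G -> entire_auto (F \o G).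
Proof.
move=> [F' [eF eF' FF' F'F]] [G' [eG eG' GG' G'G]].
exists (G' \o F'); split; [exact: entire_map_comp|exact: entire_map_comp| |].
  by move=> z /=; rewrite FF' GG'.
by move=> z /=; rewrite G'G F'F.
Qed.

End Automorphisms.

(** * Taylor expansion of the exponential *)

Section ExpJet.
Variables (R : realType) (d : nat).
Local Notation C := (Cplx R).

(** The coefficients of the approximating polynomials converge by Cauchy's estimate, and their tails
    are bounded uniformly in the approximation, so that the bound survives the limit. *)
Lemma approx1_taylor (h : C -> C) (r : R) : 0 < r -> approx1 r h ->
  forall l, exists (c : nat -> C) (K : R), 0 <= K /\
    forall t, modulus t <= r / 2 ->
      modulus (h t - \sum_(i < l) c i * t ^+ i) <= K * modulus t ^+ l.
Proof.
move=> r0 ah l.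
have /choice[q hq] : forall N : nat, exists q : {poly C},
    forall t, modulus t <= r -> modulus (h t - q.[t]) <= N.+1%:R^-1.
  by move=> N; apply: ah.
have inv_small (e : R) : 0 < e -> exists N, forall m, (N <= m)%N -> m.+1%:R^-1 < e.
  move=> e0; exists (Num.trunc e^-1) => m Nm.
  rewrite invf_plt ?posrE//; apply: lt_le_trans (truncnS_gt _) _.
  by rewrite ler_nat ltnS.
have /choice[c hc] : forall i : nat, exists l, forall e : R, 0 < e ->
    exists N, forall m, (N <= m)%N -> modulus ((q m)`_i - l) < e.
  move=> i; apply: cauchy_modulus => e e0.
  have e1 : 0 < e * r ^+ i / 2 by rewrite !(mulr_gt0, divr_gt0) ?exprn_gt0.
  have [N hN] := inv_small _ e1; exists N => m k Nm Nk.
  have qmk t : modulus t <= r -> modulus (q m - q k).[t] <= m.+1%:R^-1 + k.+1%:R^-1.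
    move=> tr; rewrite hornerD hornerN.
    rewrite (le_trans (modulus_triangle (h t) _ _))// lerD ?hq//.
    by rewrite modulus_distC hq.
  have := cauchy_coef i r0 qmk.
  rewrite coefB -ler_pdivlMr ?exprn_gt0// => /le_lt_trans; apply.
  rewrite ltr_pdivrMr ?exprn_gt0// (lt_le_trans (ltrD (hN _ Nm) (hN _ Nk)))//.
  by lra.
have [M hM] : exists M : R, forall N t, modulus t <= r -> modulus (q N).[t] <= M.
  have [M M0 q0M] : exists2 M : R, 0 <= M &
      forall t, modulus t <= r -> modulus (q 0%N).[t] <= M.
    exists (\sum_(i < size (q 0%N)) modulus (q 0%N)`_i * r ^+ i).
      by apply: sumr_ge0 => i _; rewrite mulr_ge0 ?exprn_ge0// ltW.
    move=> t tr; rewrite horner_coef (le_trans (modulus_sum _ _ _))//.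
    apply: ler_sum => i _; rewrite modulusM modulusX ler_wpM2l//.
    by rewrite lerXn2r ?nnegrE// ltW.
  exists (M + 2) => N t tr; rewrite -[(q N).[t]](subrK (q 0%N).[t]).
  rewrite (le_trans (modulusD _ _))// addrC lerD ?q0M//.
  rewrite (le_trans (modulus_triangle (h t) _ _))//.
  have -> : 2 = 1 + 1 :> R by lra.
  have h0 := hq 0%N t tr; rewrite invr1 in h0; rewrite lerD//.
  by rewrite modulus_distC (le_trans (hq _ _ tr))// invf_le1// ler1n.
have M0 : 0 <= M.
  by apply: le_trans (hM 0%N 0 _); rewrite ?modulus0// ltW.
exists c, (M * 2 / r ^+ l); split.
  by rewrite divr_ge0 ?mulr_ge0 ?exprn_ge0// ltW.
move=> t tr; apply/ler_addgt0Pr => e e0.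
pose D := 2 + \sum_(i < l) modulus t ^+ i.
have D0 : 0 < D by rewrite ltr_pwDl// sumr_ge0// => i _; rewrite exprn_ge0.
have d0 : 0 < e / D by rewrite divr_gt0.
have [N0 hN0] := inv_small _ d0.
have /choice[Ni hNi] : forall i : nat, exists N, forall m, (N <= m)%N ->
    modulus ((q m)`_i - c i) < e / D by move=> i; exact: hc.
pose m := maxn N0 (\max_(i < l) Ni i).
have mN : m.+1%:R^-1 < e / D by rewrite hN0// leq_maxl.
have mi (i : 'I_l) : modulus ((q m)`_i - c i) < e / D.
  apply: hNi; rewrite (leq_trans _ (leq_maxr _ _))//.
  by rewrite (bigD1 i)//= leq_maxl.
have tr' : modulus t <= r by rewrite (le_trans tr)//; lra.
have x0 : 0 <= modulus t / r by rewrite divr_ge0// ltW.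
have x2 : modulus t / r <= 2^-1 by rewrite ler_pdivrMr// mulrC.
have qc i : modulus (q m \Po (t *: 'X))`_i <= M * (modulus t / r) ^+ i.
  have -> : (q m \Po (t *: 'X))`_i = (q m)`_i * t ^+ i.
    have -> : q m \Po (t *: 'X) = \poly_(j < size (q m)) ((q m)`_j * t ^+ j).
      rewrite comp_polyE poly_def; apply: eq_bigr => j _.
      by rewrite exprZn scalerA.
    by rewrite coef_poly; case: ltnP => // /(nth_default 0) ->; rewrite mul0r.
  rewrite modulusM modulusX expr_div_n mulrA ler_pdivlMr ?exprn_gt0//.
  rewrite mulrAC ler_wpM2r ?exprn_ge0//.
  by apply: cauchy_coef => // s; exact: hM.
have := poly_tail_le l x0 (le_lt_trans x2 _) qc.
have -> : (q m \Po (t *: 'X)).[1] = (q m).[t].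
  by rewrite horner_comp hornerZ hornerX mulr1.
have -> : \sum_(i < l) (q m \Po (t *: 'X))`_i = \sum_(i < l) (q m)`_i * t ^+ i.
  apply: eq_bigr => i _.
  have -> : q m \Po (t *: 'X) = \poly_(j < size (q m)) ((q m)`_j * t ^+ j).
    rewrite comp_polyE poly_def; apply: eq_bigr => j _.
    by rewrite exprZn scalerA.
  by rewrite coef_poly; case: ltnP => // /(nth_default 0) ->; rewrite mul0r.
move=> /(_ _) h1; have {}h1 := h1 ltac:(lra).
have h2 : M * ((modulus t / r) ^+ l / (1 - modulus t / r)) <=
    M * 2 / r ^+ l * modulus t ^+ l.
  have -> : M * 2 / r ^+ l * modulus t ^+ l = M * ((modulus t / r) ^+ l * 2).
    by rewrite expr_div_n; ring.
  rewrite ler_wpM2l// ler_wpM2l ?exprn_ge0//.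
  by rewrite -[leRHS]invrK lef_pV2 ?posrE; lra.
have h3 : modulus (\sum_(i < l) (q m)`_i * t ^+ i - \sum_(i < l) c i * t ^+ i)
    <= \sum_(i < l) e / D * modulus t ^+ i.
  rewrite -sumrB (le_trans (modulus_sum _ _ _))// ler_sum// => i _.
  by rewrite -mulrBl modulusM modulusX ler_wpM2r ?exprn_ge0// ltW.
have h4 : \sum_(i < l) e / D * modulus t ^+ i + 2 * (e / D) = e.
  have -> : \sum_(i < l) e / D * modulus t ^+ i + 2 * (e / D) = e / D * D.
    by rewrite -mulr_sumr /D mulrDr addrC [2 * _]mulrC.
  by rewrite divfK// gt_eqF.
have h5 := le_lt_trans (hq m t tr') mN.
have -> : h t - \sum_(i < l) c i * t ^+ i = (h t - (q m).[t]) +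
    (((q m).[t] - \sum_(i < l) (q m)`_i * t ^+ i) +
    (\sum_(i < l) (q m)`_i * t ^+ i - \sum_(i < l) c i * t ^+ i)) by ring.
have h6 := modulusD (h t - (q m).[t]) (((q m).[t] - \sum_(i < l) (q m)`_i * t ^+ i) +
    (\sum_(i < l) (q m)`_i * t ^+ i - \sum_(i < l) c i * t ^+ i)).
have h7 := modulusD ((q m).[t] - \sum_(i < l) (q m)`_i * t ^+ i)
    (\sum_(i < l) (q m)`_i * t ^+ i - \sum_(i < l) c i * t ^+ i).
have h8 : 0 < e / D by [].
lra.
Qed.

Lemma jet_cexp (f : 'rV[C]_d -> C) : jet f -> bigO 1 f -> jet (fun z => cexp (f z)).
Proof.
move=> jf Of; apply: jet_lim => l.
have [c [K [K0 hK]]] := @approx1_taylor (@cexp R) 1 ltr01 (approx1_cexp ler01) l.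
exists (fun z => \sum_(i < l) c i * f z ^+ i).
  apply: jet_sum => i; apply: jetM; first exact: jet_cst.
  exact: jetX.
have [L [s [L0 s0 fL]]] := Of.
have L1 : 0 < L + 1 by rewrite ltr_wpDl.
exists (K * L ^+ l), (Num.min s (2^-1 / (L + 1))); split.
- by rewrite mulr_ge0 ?exprn_ge0.
- by rewrite lt_min s0 divr_gt0.
move=> z; rewrite lt_min ltr_pdivlMr// => /andP[zs z2].
have fz := fL z zs; rewrite expr1 in fz.
apply: (le_trans (hK _ _)).
  rewrite mul1r (le_trans fz)// (le_trans _ (ltW z2))// mulrC ler_wpM2l//.
  by rewrite lerDl.
by rewrite -mulrA -exprMn ler_wpM2l// lerXn2r ?nnegrE ?mulr_ge0.
Qed.

End ExpJet.

(** * Prescribing the jet of an automorphism *)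

Section JetInterpolation.
Variables (R : realType) (d : nat).
Local Notation C := (Cplx R).
Local Notation Cd := 'rV[C]_d.
Implicit Types (F G Phi Q T P : Cd -> Cd) (a b v r z : Cd).

(** The last field expresses that the origin is fixed, in the form in which it is used to compose
    expansions. *)
Record jet_auto (Q : Cd -> Cd) : Prop := JetAuto {
  jet_auto_entire : entire_auto Q;
  jet_auto_jet : forall j, jet (fun z => Q z 0 j);
  jet_auto_bigO1 : forall j, bigO 1 (fun z => Q z 0 j) }.

Lemma bigO_coord j : bigO 1 (fun z : Cd => z 0 j).
Proof. by under eq_fun do rewrite -linform_delta; exact: bigO_linform. Qed.

Lemma jet_auto_id : jet_auto id.
Proof.
split; [exact: entire_auto_id|exact: jet_coord|exact: bigO_coord].
Qed.

Lemma jet_auto_comp F G : jet_auto F -> jet_auto G -> jet_auto (F \o G).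
Proof.
move=> [eF jF OF] [eG jG OG]; split; first exact: entire_auto_comp.
- by move=> j; exact: (jet_comp (jF j) jG OG).
- by move=> j; exact: (bigO_comp (OF j) OG).
Qed.

Definition realizes (m : nat) (P : Cd -> Cd) : Prop := exists2 Phi,
  jet_auto Phi & forall j, bigO m.+1 (fun z => Phi z 0 j - z 0 j - P z 0 j).

Definition homog_map m (P : Cd -> Cd) := forall j, homog m (fun z => P z 0 j).

Lemma row_coordK (z : Cd) : \row_j z 0 j = z.
Proof. by apply/rowP => j; rewrite mxE. Qed.

Lemma bigO_id_add_homog m P Phi : (1 < m)%N -> homog_map m P ->
  (forall j, bigO m.+1 (fun z => Phi z 0 j - z 0 j - P z 0 j)) ->
  forall j, bigO m (fun z => Phi z 0 j - z 0 j).
Proof.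
move=> m1 hP OPhi j.
apply: bigO_ext (bigO_add (bigO_le (leqnSn m) (OPhi j)) (homog_bigO (hP j))).
by move=> z; ring.
Qed.

Lemma homog_map_perturb m l P Phi : (0 < m)%N -> (1 < l)%N -> homog_map m P ->
  (forall j, bigO l (fun z => Phi z 0 j - z 0 j)) ->
  forall j, bigO (m + l).-1 (fun z => P (Phi z) 0 j - P z 0 j).
Proof.
move=> m0 l1 hP OPhi j.
have l0 : (0 < l)%N by exact: ltnW.
have -> : ((m + l).-1 = l.-1 + m)%N by lia.
have O1 i : bigO 1 (fun z : Cd => Phi z 0 i).
  apply: bigO_ext (bigO_add (bigO_le l0 (OPhi i)) (bigO_coord i)) => z.
  by ring.
have := @homog_shift _ _ m _ (fun i z => Phi z 0 i) (fun i z => z 0 i) l.-1 m0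
  (hP j) O1 bigO_coord.
rewrite prednK// => /(_ OPhi); apply: bigO_ext => z.
by rewrite !row_coordK.
Qed.

(** Composition adds the leading terms: replacing z by G z in P changes it at order 2m - 1, which is
    at least m + 1 as m >= 2. *)
Lemma realizesD m P P' : (1 < m)%N -> homog_map m P -> homog_map m P' ->
  realizes m P -> realizes m P' -> realizes m (fun z => P z + P' z).
Proof.
move=> m1 hP hP' [F jF OF] [G jG OG].
exists (F \o G) => [|j]; first exact: jet_auto_comp.
have OG1 := bigO_id_add_homog m1 hP' OG.
have OPG : bigO m.+1 (fun z => P (G z) 0 j - P z 0 j).
  apply: bigO_le (homog_map_perturb (ltnW m1) m1 hP OG1 j); lia.
have OFG := bigO_comp (OF j) (jet_auto_bigO1 jG).
apply: bigO_ext (bigO_add (bigO_add OFG (OG j)) OPG) => z.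
by rewrite /= mxE; ring.
Qed.

Lemma homog_mapZ m (c : C) v a : homog_map m (fun z => (c * linform a z ^+ m) *: v).
Proof.
move=> j; under eq_fun do rewrite mxE mulrC mulrA.
exact: homog_pow.
Qed.

Lemma realizes0 m : realizes m (fun=> 0).
Proof.
exists id => [|j]; first exact: jet_auto_id.
by apply: bigO_ext (bigO0 _ _ _) => z; rewrite mxE; ring.
Qed.

(** The form a is constant along v, so changing the sign of c inverts the shear exactly. *)
Lemma realizes_shear m (c : C) a v : (0 < m)%N -> linform a v = 0 ->
  realizes m (fun z => (c * linform a z ^+ m) *: v).
Proof.
move=> m0 av.
pose S (c : C) z := z + (c * linform a z ^+ m) *: v.
have eS e : entire_map (S e).
  move=> j; under eq_fun do rewrite !mxE.
  apply: entireD; first exact: entire_coord.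
  apply: entireM; last exact: entire_cst.
  apply: entireM; first exact: entire_cst.
  exact/entireX/entire_linform.
have aS e z : linform a (S e z) = linform a z.
  by rewrite linformD linformZ av mulr0 addr0.
have SK e : cancel (S e) (S (- e)).
  move=> z; rewrite {1}/S aS /S -addrA -scalerDl.
  by rewrite mulNr subrr scale0r addr0.
exists (S c); last first.
  move=> j; apply: bigO_ext (bigO0 _ _ _) => z; rewrite !mxE; ring.
split.
- exists (S (- c)); split => //.
  by have := SK (- c); rewrite opprK.
- move=> j; under eq_fun do rewrite !mxE.
  apply: jetD; first exact: jet_coord.
  apply: jetM; last exact: jet_cst.
  apply: jetM; first exact: jet_cst.
  exact/jetX/jet_linform.
- move=> j; under eq_fun do rewrite !mxE.
  apply: bigO_add; first exact: bigO_coord.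
  under eq_fun do rewrite mulrAC.
  apply: bigO_scale; have := bigO_exp m (bigO_linform a).
  by apply: bigO_le; rewrite mul1n.
Qed.

Lemma bigO_cexp_aux l (f : Cd -> C) : (0 < l)%N -> bigO l f ->
  exists K r : R, [/\ 0 <= K, 0 < r & forall z, vnorm z < r ->
    modulus (f z) <= K * vnorm z ^+ l /\ modulus (f z) <= 2^-1].
Proof.
move=> l0 [K [r [K0 r0 hK]]].
exists K, (Num.min r (Num.min 1 (2^-1 / (K + 1)))).
split => // [|z]; first by rewrite !lt_min r0 ltr01 divr_gt0// ltr_wpDl.
rewrite !lt_min ltr_pdivlMr ?ltr_wpDl// => /and3P[zr z1 z2].
have h := hK z zr; split => //.
have zm : vnorm z ^+ l <= vnorm z.
  case: (l) l0 => // n _; rewrite exprS ler_piMr// exprn_ile1//.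
  exact: ltW.
rewrite (le_trans h)// (le_trans _ (ltW z2))// mulrC ler_pM// ?exprn_ge0//.
by rewrite lerDl.
Qed.

Lemma bigO_cexpB1 l (f : Cd -> C) : (0 < l)%N -> bigO l f ->
  bigO l (fun z => cexp (f z) - 1).
Proof.
move=> l0 /(bigO_cexp_aux l0)[K [r [K0 r0 hK]]].
exists (5 * K), r; split => // [|z /hK[h1 h2]]; first exact: mulr_ge0.
by rewrite (le_trans (modulus_cexpB1 h2))// -mulrA ler_pM2l.
Qed.

Lemma bigO_cexpB1B l (f : Cd -> C) : (0 < l)%N -> bigO l f ->
  bigO (l + l) (fun z => cexp (f z) - 1 - f z).
Proof.
move=> l0 /(bigO_cexp_aux l0)[K [r [K0 r0 hK]]].
exists (8 * K ^+ 2), r; split => // [|z /hK[h1 h2]].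
  by rewrite mulr_ge0 ?exprn_ge0.
rewrite (le_trans (modulus_cexpB1B h2))// -mulrA ler_pM2l// addnn -mul2n mulnC.
by rewrite exprM -exprMn lerXn2r ?nnegrE ?mulr_ge0 ?exprn_ge0.
Qed.

(** The map S c keeps the form a and multiplies b by exp(c a^(m-1)), hence S (- c) is its inverse.
    Its nonlinear part begins with the given field, the error being of order 2(m - 1) + 1 >= m +
    1. *)
Lemma realizes_overshear m (c : C) a b v : (1 < m)%N ->
  linform a v = 0 -> linform b v = 1 ->
  realizes m (fun z => (c * (linform a z ^+ m.-1 * linform b z)) *: v).
Proof.
move=> m1 av bv.
pose E (c : C) z := cexp (c * linform a z ^+ m.-1).
pose S (c : C) z := z + ((E c z - 1) * linform b z) *: v.
have m0 : (0 < m.-1)%N by lia.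
have Oe e : bigO m.-1 (fun z => e * linform a z ^+ m.-1).
  by apply: bigO_scale; have := bigO_exp m.-1 (bigO_linform a); rewrite mul1n.
have eE e : entire (E e).
  apply: entire_cexp; apply: entireM; first exact: entire_cst.
  exact/entireX/entire_linform.
have jE e : jet (E e).
  apply: jet_cexp; last exact: bigO_le (Oe e).
  apply: jetM; first exact: jet_cst.
  exact/jetX/jet_linform.
have eS e : entire_map (S e).
  move=> j; under eq_fun do rewrite !mxE.
  apply: entireD; first exact: entire_coord.
  apply: entireM; last exact: entire_cst.
  apply: entireM; last exact: entire_linform.
  by apply: entireD => //; exact: entire_cst.
have aS e z : linform a (S e z) = linform a z.
  by rewrite linformD linformZ av mulr0 addr0.
have bS e z : linform b (S e z) = E e z * linform b z.
  by rewrite linformD linformZ bv; ring.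
have SK e : cancel (S e) (S (- e)).
  move=> z; rewrite {1}/S bS {1}/S -addrA -scalerDl.
  have -> : E (- e) (S e z) = (E e z)^-1 by rewrite /E aS mulNr cexpN.
  have -> : (E e z - 1) * linform b z + ((E e z)^-1 - 1) * (E e z * linform b z) = 0.
    by field; exact: cexp_neq0.
  by rewrite scale0r addr0.
have OE1 : bigO m.-1 (fun z => E c z - 1) := bigO_cexpB1 m0 (Oe c).
have OE2 := bigO_cexpB1B m0 (Oe c).
exists (S c); last first.
  move=> j; apply: bigO_ext (bigO_le _ (bigO_scale (v 0 j)
    (bigO_mul OE2 (bigO_linform b)))) => [z|]; last by lia.
  by rewrite !mxE /E; ring.
split.
- exists (S (- c)); split => //.
  by have := SK (- c); rewrite opprK.
- move=> j; under eq_fun do rewrite !mxE.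
  apply: jetD; first exact: jet_coord.
  apply: jetM; last exact: jet_cst.
  apply: jetM; last exact: jet_linform.
  by apply: jetD => //; exact: jet_cst.
- move=> j; under eq_fun do rewrite !mxE mulrC.
  apply: bigO_add; first exact: bigO_coord.
  apply: bigO_scale; apply: bigO_le (bigO_mul OE1 (bigO_linform b)); lia.
Qed.

Lemma homog_map_sum m (I : Type) (s : seq I) (P : I -> Cd -> Cd) :
  (forall i, homog_map m (P i)) -> homog_map m (fun z => \sum_(i <- s) P i z).
Proof.
move=> hP j; under eq_fun do rewrite summxE.
by apply: homog_sum => i; exact: hP.
Qed.

Lemma realizes_sum m (I : Type) (s : seq I) (P : I -> Cd -> Cd) : (1 < m)%N ->
  (forall i, homog_map m (P i)) -> (forall i, realizes m (P i)) ->
  realizes m (fun z => \sum_(i <- s) P i z).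
Proof.
move=> m1 hP rP; elim: s => [|i s ih].
  by under eq_fun do rewrite big_nil; exact: realizes0.
under eq_fun do rewrite big_cons.
by apply: realizesD => //; exact: homog_map_sum.
Qed.

Hypothesis d2 : (1 < d)%N.

(** This is where d >= 2 enters: every linear form has a nonzero direction along which shears can be
    performed. *)
Lemma linform_kernel_vector a : exists2 v, linform a v = 0 & v != 0.
Proof.
have d0 : (0 < d)%N by exact: ltnW.
pose i0 := Ordinal d0; pose i1 := Ordinal d2.
have lfd j : linform a (delta_mx 0 j) = a 0 j.
  rewrite /linform (bigD1 j)//= mxE !eqxx mulr1 big1 ?addr0// => i /negbTE ij.
  by rewrite mxE ij andbF mulr0.
have [a0|a0] := eqVneq (a 0 i0) 0.
  exists (delta_mx 0 i0); first by rewrite lfd.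
  by apply/eqP => /rowP/(_ i0)/eqP; rewrite !mxE !eqxx oner_eq0.
exists (delta_mx 0 i1 - (a 0 i1 / a 0 i0) *: delta_mx 0 i0).
  by rewrite -scaleNr linformD linformZ !lfd mulNr divfK// subrr.
apply/eqP => /rowP/(_ i1)/eqP; rewrite !mxE !eqxx.
have -> : (i1 == i0) = false by [].
by rewrite mulr0 subr0 oner_eq0.
Qed.

(* Modulo shears, the field x^m r, where the linear form x does not vanish on
   r, is a multiple of an overshear: extracting the coefficient of s in
   (x + s y)^m (x(r) v - s r) exhibits their difference as a combination of
   shears in the directions x(r) v - s r. *)
Lemma realizes_power m (c : C) a r : (1 < m)%N ->
  realizes m (fun z => (c * linform a z ^+ m) *: r).
Proof.
move=> m1; have [ar|ar] := eqVneq (linform a r) 0.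
  by apply: realizes_shear => //; exact: ltnW.
set al := linform a r in ar.
have [v av v0] := linform_kernel_vector a.
have [b bv br] : exists2 b, linform b v = 1 & linform b r = 0.
  have [j vj] : exists j, v 0 j != 0.
    apply/existsP; apply: contraNT v0 => /existsPn v0; apply/eqP/rowP => j.
    by rewrite mxE; apply/eqP/negPn/v0.
  pose b0 : Cd := (v 0 j)^-1 *: delta_mx 0 j.
  have b0E z : linform b0 z = z 0 j / v 0 j.
    by rewrite linformZl linform_delta mulrC.
  exists (b0 - (linform b0 r / al) *: a).
    by rewrite -scaleNr linformDl b0E linformZl av mulr0 addr0 divff.
  by rewrite -scaleNr linformDl b0E linformZl mulNr -/al divfK// subrr.
have N0 : (0 < m.+2)%N by [].
have pw := prim_root_cis R N0; set w := cis _ in pw.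
have NN0 : m.+2%:R != 0 :> C by rewrite pnatr_eq0.
pose ct (t : 'I_m.+2) : C := - (c / m.+2%:R * (w ^+ t) ^+ m.+1).
have -> : (fun z => (c * linform a z ^+ m) *: r) = (fun z =>
    (c * m%:R * al * (linform a z ^+ m.-1 * linform b z)) *: v +
    \sum_(t < m.+2) (ct t * linform (a + w ^+ t *: b) z ^+ m) *:
      (al *: v - w ^+ t *: r)).
  apply/funext => z; apply/rowP => j; rewrite mxE [RHS]mxE summxE mxE.
  set x := linform a z; set y := linform b z.
  pose q : {poly C} := \poly_(i < m.+1) (x ^+ (m - i) * y ^+ i *+ 'C(m, i)) *
    ((al * v 0 j)%:P - r 0 j *: 'X).
  have qE t : q.[t] = (x + t * y) ^+ m * (al * v 0 j - t * r 0 j).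
    rewrite hornerM hornerD hornerC hornerN hornerZ hornerX [r 0 j * t]mulrC.
    congr (_ * _); rewrite exprDn horner_poly; apply: eq_bigr => i _.
    by rewrite exprMn mulrnAl mulrAC mulrA.
  have sq : (size q <= m.+2)%N.
    rewrite (leq_trans (size_polyMleq _ _))//.
    have s1 : (size (\poly_(i < m.+1) (x ^+ (m - i) * y ^+ i *+ 'C(m, i))) <=
        m.+1)%N by exact: size_poly.
    have s2 : (size ((al * v 0 j)%:P - r 0 j *: 'X)%R <= 2)%N.
      rewrite (leq_trans (size_polyD _ _))// geq_max.
      rewrite (leq_trans (size_polyC_leq1 _))//= size_polyN.
      by rewrite (leq_trans (size_scale_leq _ _))// size_polyX.
    by lia.
  have q1 : q`_1 = x ^+ m * - r 0 j + x ^+ m.-1 * y * m%:R * (al * v 0 j).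
    rewrite coefM big_ord_recl big_ord1 !coefD !coefC !coefN !coefZ !coefX.
    rewrite !coef_poly /= ltnS (ltnW m1) bin0 bin1 subn0 subn1 expr0 expr1.
    by rewrite mulr1n mulr1 add0r mulr0 subr0 mulr1 mulr_natr.
  have := @coef_average _ q m.+2 1 w pw sq isT; rewrite q1 subn1 => e.
  have {}e : c * x ^+ m * r 0 j = c * m%:R * al * (x ^+ m.-1 * y) * v 0 j -
      c / m.+2%:R * \sum_(s < m.+2) q.[w ^+ s] * (w ^+ s) ^+ m.+1.
    rewrite e (mulrA (c / _)) divfK//; ring.
  rewrite e; congr (_ + _); rewrite mulr_sumr -sumrN; apply: eq_bigr => t _.
  by rewrite !mxE qE linformDl linformZl /ct -/x -/y; ring.
have hom1 : homog_map m (fun z =>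
    (c * m%:R * al * (linform a z ^+ m.-1 * linform b z)) *: v).
  move=> j; under eq_fun do rewrite mxE mulrC.
  apply: homogZ; apply: homogZ.
  have := homogM (homog_pow m.-1 1 a) (homog_pow 1 1 b).
  rewrite addn1 prednK; last exact: ltnW.
  by under eq_fun do rewrite !mul1r expr1.
apply: realizesD => //.
- by apply: homog_map_sum => t; exact: homog_mapZ.
- exact: realizes_overshear.
- apply: realizes_sum => // t; first exact: homog_mapZ.
  apply: realizes_shear; first exact: ltnW.
  rewrite -scaleNr !(linformD, linformZ) !linformDl !linformZl av bv br -/al.
  by ring.
Qed.

Lemma realizes_homog m P : (1 < m)%N -> homog_map m P -> realizes m P.
Proof.
move=> m1 hP.
have hdelta j f : homog m f -> homog_map m (fun z => f z *: delta_mx 0 j).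
  by move=> hf i; under eq_fun do rewrite mxE mulrC; exact: homogZ.
have rdelta j f : homog m f -> realizes m (fun z => f z *: delta_mx 0 j).
  elim=> [|c a h hh ih].
    by under eq_fun do rewrite scale0r; exact: realizes0.
  under eq_fun do rewrite scalerDl.
  by apply: realizesD => //; [exact: homog_mapZ|exact: hdelta|exact: realizes_power].
have -> : P = (fun z => \sum_j P z 0 j *: delta_mx 0 j).
  by apply/funext => z; exact: row_sum_delta.
by apply: realizes_sum => // j; [exact: hdelta|exact: rdelta].
Qed.

(** If Q matches T below order l, the lowest part of T - Q is a homogeneous field; realizing it by
    some Phi and passing to Phi \o Q gains one order. *)
Theorem jet_interpolation T l : (1 < l)%N ->
  (forall j, jet (fun z => T z 0 j)) ->
  (forall j, bigO 2 (fun z => T z 0 j - z 0 j)) ->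
  exists2 Q, jet_auto Q & forall j, bigO l (fun z => Q z 0 j - T z 0 j).
Proof.
(* The induction starts at order 2, where T agrees with the identity. *)
case: l => [//|[//|l]] _ jT OT; elim: l => [|l [Q jQ OQ]].
  exists id => [|j]; first exact: jet_auto_id.
  by apply: bigO_ext (bigO_opp (OT j)) => z; ring.
have /choice[h hh] : forall j, exists h : Cd -> C, homog l.+2 h /\
    bigO l.+3 (fun z => T z 0 j - Q z 0 j - h z).
  move=> j; have [||h hh Oh] := @jet_lowest _ _ l.+2 (fun z => T z 0 j - Q z 0 j).
  - by apply: jetD => //; apply: jet_opp; exact: jet_auto_jet.
  - by apply: bigO_ext (bigO_opp (OQ j)) => z; ring.
  - by exists h.
have hP : homog_map l.+2 (fun z => \row_j h j z).
  by move=> j; under eq_fun do rewrite mxE; case: (hh j).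
have [Phi jPhi OPhi] := @realizes_homog l.+2 _ isT hP.
exists (Phi \o Q) => [|j]; first exact: jet_auto_comp.
have OQ2 i : bigO 2 (fun z => Q z 0 i - z 0 i).
  by apply: bigO_ext (bigO_add (bigO_le _ (OQ i)) (OT i)) => // z; ring.
have O1 := bigO_comp (OPhi j) (jet_auto_bigO1 jQ).
have O2 := @homog_map_perturb l.+2 2 _ _ isT isT hP OQ2 j.
have O3 : bigO l.+3 (fun z => T z 0 j - Q z 0 j - h j z) by case: (hh j).
rewrite addn2 /= in O2.
apply: bigO_ext (bigO_sub (bigO_add O1 O2) O3) => z.
by rewrite /= !mxE; ring.
Qed.

End JetInterpolation.

(** * The root automorphism *)

Section FormalRoot.
Variable F : fieldType.
Implicit Types p q r a : {poly F}.

Definition eqX M p q := 'X^M %| (p - q).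

Lemma eqX_refl M p : eqX M p p.
Proof. by rewrite /eqX subrr dvdp0. Qed.

Lemma eqX_trans M q p r : eqX M p q -> eqX M q r -> eqX M p r.
Proof. by rewrite /eqX => h1 h2; rewrite -[p](subrK q) -addrA dvdp_addr. Qed.

Lemma eqX_le M M' p q : (M' <= M)%N -> eqX M p q -> eqX M' p q.
Proof. by move=> MM; apply: dvdp_trans; rewrite dvdp_exp2l. Qed.

Lemma eqXD M p p' q q' : eqX M p p' -> eqX M q q' -> eqX M (p + q) (p' + q').
Proof. by rewrite /eqX => h1 h2; rewrite opprD addrACA dvdp_addr. Qed.

Lemma eqXM M p p' q q' : eqX M p p' -> eqX M q q' -> eqX M (p * q) (p' * q').
Proof.
rewrite /eqX => h1 h2.
have -> : p * q - p' * q' = (p - p') * q + p' * (q - q') by ring.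
by rewrite dvdp_addr; [exact: dvdp_mull|exact: dvdp_mulr].
Qed.

Lemma eqX_exp M p p' n : eqX M p p' -> eqX M (p ^+ n) (p' ^+ n).
Proof.
move=> h; elim: n => [|n ih]; first exact: eqX_refl.
by rewrite !exprS; exact: eqXM.
Qed.

Lemma eqX_comp M a p p' : eqX M p p' -> eqX M (a \Po p) (a \Po p').
Proof.
move=> h; elim/poly_ind: a => [|a c ih]; first by rewrite !comp_poly0; exact: eqX_refl.
rewrite !comp_poly_MXaddC; apply: eqXD; last exact: eqX_refl.
exact: eqXM.
Qed.

Lemma eqX_mulXn M n p q : eqX M p q -> eqX (n + M) ('X^n * p) ('X^n * q).
Proof. by rewrite /eqX -mulrBr exprD => h; rewrite dvdp_mul. Qed.

Lemma eqX1_coef0 p c : p`_0 = c -> eqX 1 p c%:P.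
Proof.
move=> <-; rewrite /eqX expr1 -['X]subr0 -polyC0 dvdp_XsubCl /root.
by rewrite hornerD hornerN hornerC horner_coef0 subrr.
Qed.

(* If z is multiplied by a(x), where x = u^k and u is the product of the d
   coordinates, then x is mapped to x a(x)^(kd); the i-th iterate multiplies z
   by [multiplier a (k * d) i]. *)
Fixpoint multiplier a (N i : nat) : {poly F} :=
  if i is i'.+1 then
    multiplier a N i' * (a \Po ('X * multiplier a N i' ^+ N))
  else 1.

Lemma coef0_comp a p : p`_0 = 0 -> (a \Po p)`_0 = a`_0.
Proof. by rewrite -!horner_coef0 horner_comp => ->. Qed.

Lemma coef0_multiplier a N i : a`_0 = 1 -> (multiplier a N i)`_0 = 1.
Proof.
move=> a0; elim: i => [|i ih] /=; first by rewrite coefC.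
by rewrite coef0M ih coef0_comp ?a0 ?mulr1// coefXM.
Qed.

(** Each of the i factors contributes b X^M, because all multipliers are 1 at 0. The induced change
    in the argument of a is one order higher, thanks to the factor X. *)
Lemma multiplier_perturb a b M N i : (0 < M)%N -> a`_0 = 1 ->
  eqX M.+1 (multiplier (a + b *: 'X^M) N i)
    (multiplier a N i + (i%:R * b) *: 'X^M).
Proof.
move=> M0 a0; pose a' := a + b *: 'X^M.
have a'0 : a'`_0 = 1.
  by rewrite coefD coefZ coefXn a0 eq_sym -leqn0 leqNgt M0 mulr0 addr0.
elim: i => [|i ih] /=.
  by rewrite mul0r scale0r addr0; exact: eqX_refl.
set A := multiplier a N i in ih *; rewrite -/a' in ih *.
set A' := multiplier a' N i in ih *.
have A0 : A`_0 = 1 by exact: coef0_multiplier.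
have A'0 : A'`_0 = 1 by exact: coef0_multiplier.
have AA' : eqX M A' A.
  apply: eqX_trans (eqX_le (leqnSn M) ih) _.
  by rewrite /eqX addrC addKr -mul_polyC dvdp_mull.
set P := 'X * A ^+ N; set P' := 'X * A' ^+ N.
have PP' : eqX M.+1 P' P.
  have := eqX_mulXn 1 (eqX_exp N AA'); by rewrite expr1 add1n.
have one p : p`_0 = 1 -> eqX M.+1 (b *: ('X^M * p)) (b *: 'X^M).
  move=> /eqX1_coef0/(eqX_mulXn M); rewrite addn1 mulr1.
  by rewrite /eqX -scalerBr => h; rewrite -mul_polyC dvdp_mull.
have e1 : eqX M.+1 (a' \Po P') (a \Po P + b *: 'X^M).
  rewrite /a' comp_polyD comp_polyZ comp_Xn_poly; apply: eqXD.
    exact: eqX_comp.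
  rewrite /P' exprMn -exprM; apply: one.
  by rewrite -horner_coef0 horner_exp horner_coef0 A'0 expr1n.
apply: (eqX_trans (eqXM ih e1)).
have -> : (A + (i%:R * b) *: 'X^M) * (a \Po P + b *: 'X^M) = A * (a \Po P) +
   (b *: ('X^M * A) + i%:R *: (b *: ('X^M * (a \Po P + b *: 'X^M)))).
  rewrite -!mul_polyC; rewrite polyCM; ring.
apply: eqXD; first exact: eqX_refl.
have -> : (i.+1%:R * b) *: 'X^M = b *: 'X^M + i%:R *: (b *: 'X^M) :> {poly F}.
  by rewrite scalerA -scalerDl -natr1 mulrDl mul1r addrC.
apply: eqXD; first exact: one.
rewrite /eqX -scalerBr -[X in _ %| X]mul_polyC; apply: dvdp_mull; apply: one.
rewrite coefD coefZ coefXn eq_sym -leqn0 leqNgt M0 mulr0 addr0.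
by rewrite coef0_comp ?a0// coefXM.
Qed.

(** Coefficients of a are found one at a time. By [multiplier_perturb] a new term b X^M moves the
    p-th multiplier by p b X^M, so any discrepancy can be removed when p is invertible. *)
Lemma formal_root (N p M : nat) (c : F) : p%:R != 0 :> F -> exists2 a : {poly F},
  a`_0 = 1 & eqX M.+1 (multiplier a N p) (1 + c *: 'X).
Proof.
move=> p0; elim: M => [|M [a a0 ha]].
  exists 1; first by rewrite coefC.
  apply: (@eqX_trans _ 1).
    by apply: (@eqX1_coef0 _ 1); apply: coef0_multiplier; rewrite coefC.
  by rewrite /eqX opprD addNKr -scaleNr expr1 -mul_polyC dvdp_mull.
have /dvdpP[r er] := ha.
pose b := - r`_0 / p%:R.
exists (a + b *: 'X^(M.+1)).
  by rewrite coefD coefZ coefXn mulr0 addr0.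
apply: (eqX_trans (multiplier_perturb b N p _ a0)) => //.
have -> : multiplier a N p + (p%:R * b) *: 'X^(M.+1) =
    1 + c *: 'X + 'X^(M.+1) * (r - (r`_0)%:P).
  rewrite -[multiplier a N p](subrK (1 + c *: 'X)) er /b mulrCA divff// mulr1.
  by rewrite scaleNr -!mul_polyC; ring.
rewrite -[X in eqX _ _ X]addr0 -[X in eqX _ _ (_ + X)](mulr0 'X^(M.+1)).
apply: eqXD; first exact: eqX_refl.
rewrite -addn1; apply: eqX_mulXn.
have := eqXD (eqX1_coef0 (erefl r`_0)) (eqX_refl 1 (- (r`_0)%:P)).
by rewrite subrr.
Qed.

End FormalRoot.

(** * Multipliers with a single resonance *)

Section Frequencies.
Variable R : realType.
Local Notation C := (Cplx R).

Lemma finite_roots (p : {poly R}) : p != 0 -> finite_set [set x | root p x].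
Proof.
have [n] := ubnP (size p); elim: n p => // n ih p; rewrite ltnS => pn p0.
have [[x px]|nr] := pselect (exists x, root p x); last first.
  apply: (@sub_finite_set _ _ set0) => // x px.
  by apply: nr; exists x.
have /factor_theorem[q pq] := px.
have q0 : q != 0 by apply: contraNN p0 => /eqP q0; rewrite pq q0 mul0r.
apply: (@sub_finite_set _ _ ([set x] `|` [set y | root q y])).
  move=> y; rewrite /= pq rootM root_XsubC => /orP[qy|/eqP ->]; [by right|by left].
rewrite finite_setU; split; first exact: finite_set1.
apply: ih => //; move: pn; rewrite pq size_Mmonic ?monicXsubC// size_XsubC.
by rewrite addn2.
Qed.

(** The algebraic numbers are countable, hence of measure zero, while [0, 1] has measure one. *)
Lemma exists_transcendental : exists x : R, forall q : {poly int},
  (map_poly intr q).[x] = 0 -> q = 0.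
Proof.
pose A : set R := \bigcup_(q in [set q : {poly int} | q != 0])
  [set x | root (map_poly intr q) x].
suff [x Ax] : exists x, ~ A x.
  exists x => q qx; apply/eqP; apply: contrapT => q0; apply: Ax.
  by exists q => /=; [exact/negP|exact/eqP].
have cA : countable A.
  apply: bigcup_countable => [|q /= q0]; first exact: countableP.
  apply: finite_set_countable.
  by apply: finite_roots; rewrite map_poly_eq0_id0// intr_eq0 lead_coef_eq0.
apply/existsNP => allA.
have c01 : countable `[0 : R, 1]%classic.
  by apply: sub_countable cA; exact/subset_card_le.
have := countable_lebesgue_measure0 c01.
rewrite lebesgue_measure_itv /= lte01 oppr0 adde0 => /eqP.
by rewrite onee_eq0.
Qed.

Lemma cisN (t : R) : cis (- t) = (cis t)^-1 :> C.
Proof.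
have c0 : cis t != 0 :> C by rewrite -modulus_gt0 modulus_cis.
by apply: (mulIf c0); rewrite mulVf// -cisD addNr cis0.
Qed.

Lemma cis_int (m : int) : cis (2 * pi * m%:~R) = 1 :> C.
Proof.
case: m => m; first by rewrite -pmulrn mulrC cis_nat cis_2pi expr1n.
by rewrite NegzE mulrNz mulrN cisN -pmulrn mulrC cis_nat cis_2pi expr1n invr1.
Qed.

Lemma cis_eq_cis (a b : R) : cis a = cis b -> exists n : int, a - b = 2 * pi * n%:~R.
Proof.
move=> ab; pose n := Num.floor ((a - b) / (2 * pi)).
have pi2 : 0 < 2 * pi :> R by rewrite mulr_gt0// pi_gt0.
exists n; apply/eqP; rewrite -subr_eq0; apply/eqP/cis_eq1.
  have /andP[n1 n2] := floor_itv ((a - b) / (2 * pi)).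
  rewrite ler_pdivlMr// in n1; rewrite ltr_pdivrMr// intrD in n2.
  rewrite -/n in n1 n2; rewrite ger0_norm ?subr_ge0 1?mulrC//.
  by rewrite ltrBlDr (lt_le_trans n2)// mulrDl mul1r addrC.
have cb : cis b != 0 :> C by rewrite -modulus_gt0 modulus_cis.
by rewrite !cisD !cisN ab mulfV// cis_int invr1 mulr1.
Qed.

Lemma cis_sum (I : Type) (s : seq I) (P : pred I) (f : I -> R) :
  cis (\sum_(i <- s | P i) f i) = \prod_(i <- s | P i) cis (f i) :> C.
Proof.
elim/big_ind2 : _ => //; first exact: cis0.
by move=> x y z w <- <-; rewrite cisD.
Qed.

(** For a transcendental x take the angles 2 pi x, ..., 2 pi x^(d-1) and minus their sum. A
    resonance becomes an integer polynomial relation in x, with constant term given by the number n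
    of turns; its coefficients vanish, which makes all the differences m i - (i == j) equal. *)
Lemma exists_frequencies (d : nat) : (1 < d)%N ->
  exists t : 'I_d -> R, \sum_j t j = 0 /\ one_resonant (fun j => cis (t j) : C).
Proof.
case: d => [//|d]; rewrite ltnS => d0; have [x xT] := exists_transcendental.
pose f (j : 'I_d.+1) : R := 2 * pi * (if j == ord_max then
  - \sum_(i < d) x ^+ i.+1 else x ^+ j.+1).
have f0 : \sum_j f j = 0.
  rewrite -mulr_sumr big_ord_recr /= eqxx.
  rewrite (eq_bigr (fun i : 'I_d => x ^+ i.+1)) ?subrr ?mulr0// => i _.
  by rewrite -val_eqE /= ltn_eqF.
exists f; split => // m j.
have -> : \prod_i (cis (f i) : C) ^+ m i = cis (\sum_i (m i)%:R * f i).
  by rewrite cis_sum; apply: eq_bigr => i _; rewrite cis_nat.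
split => [/cis_eq_cis[n en]|[q mq]]; last first.
  congr (cis _); under eq_bigr => i _ do rewrite mq natrD mulrDl.
  rewrite big_split /= -mulr_sumr f0 mulr0 add0r (bigD1 j)//= eqxx mul1r.
  by rewrite big1 ?addr0// => i /negbTE ->; rewrite mul0r.
pose c i : int := (m i)%:Z - (i == j)%:Z.
pose w := widen_ord (leqnSn d).
pose q : {poly int} :=
  \sum_(i < d) (c (w i) - c ord_max) *: 'X^(i.+1) - n%:P.
have pi2 : 2 * pi != 0 :> R by rewrite mulf_neq0// gt_eqF// pi_gt0.
have fw i : f (w i) = 2 * pi * x ^+ i.+1.
  by rewrite /f -val_eqE /= ltn_eqF.
have fm : f ord_max = - (2 * pi * \sum_(i < d) x ^+ i.+1).
  by rewrite /f eqxx mulrN.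
have q0 : q = 0.
  apply: xT; rewrite /q rmorphB /= map_polyC /= hornerD hornerN hornerC.
  rewrite rmorph_sum /= horner_sum.
  apply: (mulfI pi2); rewrite mulr0 mulrBr -en.
  have -> : \sum_i (m i)%:R * f i - f j = \sum_i (c i)%:~R * f i.
    rewrite [X in _ - X](_ : _ = \sum_i (i == j)%:R * f i); last first.
      rewrite (bigD1 j)//= eqxx mul1r big1 ?addr0// => i /negbTE ->.
      by rewrite mul0r.
    rewrite -sumrB; apply: eq_bigr => i _.
    by rewrite /c intrD mulrNz -!pmulrn mulrDl mulNr.
  rewrite big_ord_recr /= -/w fm; apply/eqP; rewrite subr_eq0; apply/eqP.
  rewrite mulr_sumr mulrN mulrCA mulr_sumr mulr_sumr -sumrB.
  apply: eq_bigr => i _; rewrite fw map_polyZ /= map_polyXn hornerZ hornerXn.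
  by rewrite intrD mulrNz; ring.
have cc i : c i = c ord_max.
  case: (unliftP ord_max i) => [i'|] ->//.
  have : q`_(i'.+1) = 0 by rewrite q0 coef0.
  rewrite /q coefB coefC /= subr0 coef_sum (bigD1 i')//= coefZ coefXn eqxx mulr1.
  rewrite big1 ?addr0 => [/eqP|k /negbTE ki]; last first.
    by rewrite coefZ coefXn eqSS eq_sym val_eqE ki mulr0.
  rewrite subr_eq0 => /eqP <-; congr c; apply/val_inj => /=.
  by rewrite /bump leqNgt ltn_ord add0n.
(* At an index other than j the common difference is m i0 itself, so it is a natural number. *)
have [i0 i0j] : exists i0 : 'I_d.+1, i0 != j.
  have [j0|j0] := eqVneq j ord0; last by exists ord0; rewrite eq_sym.
  by exists ord_max; rewrite j0 -val_eqE /= -lt0n.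
exists (m i0) => i; have := cc i; rewrite -(cc i0) /c (negbTE i0j) subr0.
move=> /eqP; rewrite subr_eq => /eqP e; apply/eqP.
by rewrite -eqz_nat e PoszD.
Qed.

End Frequencies.

(** * The automorphism G and the expansions of its iterates *)

Section RootAutomorphism.
Variables (R : realType) (d : nat).
Local Notation C := (Cplx R).
Local Notation Cd := 'rV[C]_d.
Implicit Types (f g : Cd -> C) (z : Cd).

Definition eqO l f g := bigO l (fun z => f z - g z).

Lemma eqO_trans l g f h : eqO l f g -> eqO l g h -> eqO l f h.
Proof. by move=> h1 h2; apply: bigO_ext (bigO_add h1 h2) => z; ring. Qed.

Lemma eqO_eq l f g : f =1 g -> eqO l f g.
Proof. by move=> fg; apply: bigO_ext (bigO0 _ _ l) => z; rewrite fg subrr. Qed.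

Lemma eqO_bigO0 l f g : eqO l f g -> bigO 0 g -> bigO 0 f.
Proof.
move=> h1 h2; apply: bigO_ext (bigO_add (bigO_le (leq0n l) h1) h2) => z; ring.
Qed.

Lemma eqOD l f f' g g' : eqO l f f' -> eqO l g g' ->
  eqO l (fun z => f z + g z) (fun z => f' z + g' z).
Proof. by move=> h1 h2; apply: bigO_ext (bigO_add h1 h2) => z; ring. Qed.

Lemma eqOM l f f' g g' : bigO 0 f' -> bigO 0 g' -> eqO l f f' -> eqO l g g' ->
  eqO l (fun z => f z * g z) (fun z => f' z * g' z).
Proof.
move=> Of' Og' h1 h2; have Og := eqO_bigO0 h2 Og'.
have h3 := bigO_mul h1 Og; have h4 := bigO_mul Of' h2.
rewrite addn0 in h3; rewrite add0n in h4.
by apply: bigO_ext (bigO_add h3 h4) => z; ring.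
Qed.

Lemma bigO0_mul f g : bigO 0 f -> bigO 0 g -> bigO 0 (fun z => f z * g z).
Proof. exact: bigO_mul. Qed.

Lemma bigO0_exp f n : bigO 0 f -> bigO 0 (fun z => f z ^+ n).
Proof. by move=> /(bigO_exp n); rewrite mul0n. Qed.

Lemma bigO0_prod (I : Type) (s : seq I) (f : I -> Cd -> C) :
  (forall i, bigO 0 (f i)) -> bigO 0 (fun z => \prod_(i <- s) f i z).
Proof.
move=> Of; elim: s => [|i s ih].
  by under eq_fun do rewrite big_nil; exact: bigO_cst.
by under eq_fun do rewrite big_cons; exact: bigO0_mul.
Qed.

Lemma eqO_exp l f f' n : bigO 0 f' -> eqO l f f' ->
  eqO l (fun z => f z ^+ n) (fun z => f' z ^+ n).
Proof.
move=> Of' h; elim: n => [|n ih]; first exact: eqO_eq.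
have := eqOM Of' (bigO0_exp n Of') h ih.
by apply: bigO_ext => z; rewrite !exprS.
Qed.

Lemma eqO_prod l (I : Type) (s : seq I) (f f' : I -> Cd -> C) :
  (forall i, bigO 0 (f' i)) -> (forall i, eqO l (f i) (f' i)) ->
  eqO l (fun z => \prod_(i <- s) f i z) (fun z => \prod_(i <- s) f' i z).
Proof.
move=> Of' h; elim: s => [|i s ih].
  by apply: eqO_eq => z; rewrite !big_nil.
have := eqOM (Of' i) (bigO0_prod s Of') (h i) ih.
by apply: bigO_ext => z; rewrite !big_cons.
Qed.

Lemma eqO_horner l (q : {poly C}) f f' : bigO 0 f' -> eqO l f f' ->
  eqO l (fun z => q.[f z]) (fun z => q.[f' z]).
Proof.
move=> Of' h; have Oq (r : {poly C}) : bigO 0 (fun z => r.[f' z]).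
  elim/poly_ind: r => [|r c ih].
    by apply: bigO_ext (bigO0 _ _ _) => z; rewrite horner0.
  apply: bigO_ext (bigO_add (bigO0_mul ih Of') (bigO_cst d c)) => z.
  by rewrite hornerMXaddC.
elim/poly_ind: q => [|q c ih]; first by apply: eqO_eq => z; rewrite !horner0.
have := eqOD (eqOM (Oq q) Of' ih h) (@eqO_eq l (fun=> c) _ (fun=> erefl)).
by apply: bigO_ext => z; rewrite !hornerMXaddC.
Qed.

Lemma modulus_coord_prod_le z : modulus (coord_prod z) <= vnorm z ^+ d.
Proof.
rewrite modulus_prod.
have -> : vnorm z ^+ d = \prod_(j < d) vnorm z by rewrite prodr_const card_ord.
by apply: ler_prod => j _; rewrite modulus_ge0 modulus_le_vnorm.
Qed.

Lemma bigO_coord_prod : bigO d (@coord_prod R d).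
Proof. by exists 1, 1; split => // z _; rewrite mul1r modulus_coord_prod_le. Qed.

Lemma jet_coord_prod : jet (@coord_prod R d).
Proof. by apply: jet_prod => j; exact: jet_coord. Qed.

Lemma bigO0_coord j : bigO 0 (fun z : Cd => z 0 j).
Proof. exact: (bigO_le (leq0n 1) (bigO_coord R j)). Qed.

Definition diagonal_map (mu : 'I_d -> C) (z : Cd) : Cd := \row_j (mu j * z 0 j).

Lemma jet_auto_diagonal mu : (forall j, mu j != 0) -> jet_auto (diagonal_map mu).
Proof.
move=> mu0.
have eD nu : entire_map (diagonal_map nu).
  move=> j; under eq_fun do rewrite mxE.
  by apply: entireM; [exact: entire_cst|exact: entire_coord].
split.
- exists (diagonal_map (fun j => (mu j)^-1)); split => // z; apply/rowP => j.
    by rewrite !mxE mulKf.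
  by rewrite !mxE mulVKf.
- move=> j; under eq_fun do rewrite mxE.
  by apply: jetM; [exact: jet_cst|exact: jet_coord].
- by move=> j; under eq_fun do rewrite mxE; exact/bigO_scale/(bigO_coord R j).
Qed.

(** Since the product of the mu j is a k-th root of unity, G acts on x = u^k by x |-> x a(x)^(d k)
    up to the remainder, without rotation; the multipliers therefore remain polynomials in u^k. *)
Lemma iterate_expansion (G : Cd -> Cd) (a : {poly C}) (mu : 'I_d -> C) k l :
  jet_auto G -> a`_0 = 1 -> (\prod_j mu j) ^+ k = 1 ->
  (forall j, eqO l (fun z => G z 0 j)
    (fun z => mu j * z 0 j * a.[coord_prod z ^+ k])) ->
  forall i j, eqO l (fun z => iter i G z 0 j) (fun z =>
    mu j ^+ i * z 0 j * (multiplier a (d * k) i).[coord_prod z ^+ k]).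
Proof.
move=> jG a0 muk OG; elim=> [|i ih] j.
  by apply: eqO_eq => z; rewrite expr0 mul1r hornerC mulr1.
have jGi : jet_auto (iter i G).
  elim: (i) => [|i' ih']; first exact: jet_auto_id.
  exact: (jet_auto_comp jG ih').
set W := iter i G in ih jGi *; set A := multiplier a (d * k) i in ih *.
have OA (q : {poly C}) : bigO 0 (fun z : Cd => q.[coord_prod z ^+ k]).
  by apply: jet_bigO0; apply: jet_horner; apply: jetX; exact: jet_coord_prod.
have OS j' : bigO 0 (fun z : Cd => mu j' ^+ i * z 0 j' * A.[coord_prod z ^+ k]).
  apply: bigO0_mul; last exact: OA.
  exact: (bigO0_mul (bigO_cst d _) (bigO0_coord j')).
have Ou : eqO l (fun z => coord_prod (W z) ^+ k)
    (fun z => ('X * A ^+ (d * k)).[coord_prod z ^+ k]).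
  apply: (eqO_trans (eqO_exp k _ (eqO_prod (index_enum 'I_d) OS ih))).
    exact: bigO0_prod.
  apply: eqO_eq => z; rewrite hornerM hornerX horner_exp.
  rewrite 2!big_split /= prodr_const card_ord prodrXl exprMn exprMn -!exprM.
  by rewrite [(i * k)%N]mulnC exprM muk expr1n mul1r.
have h1 := bigO_comp (OG j) (jet_auto_bigO1 jGi).
apply: (@eqO_trans _ (fun z => mu j * W z 0 j * a.[coord_prod (W z) ^+ k])).
  exact: h1.
apply: (@eqO_trans _ (fun z => mu j * (mu j ^+ i * z 0 j * A.[coord_prod z ^+ k])
    * a.[('X * A ^+ (d * k)).[coord_prod z ^+ k]])).
  apply: eqOM.
  - exact: (bigO0_mul (bigO_cst d _) (OS j)).
  - under eq_fun do rewrite -horner_comp; exact: OA.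
  - apply: eqOM => //; first exact: bigO_cst.
    exact: eqO_eq.
  - by apply: eqO_horner => //; exact: OA.
apply: eqO_eq => z; rewrite /= -/A [X in _ = _ * X]hornerM horner_comp exprS; ring.
Qed.

Theorem exists_root_automorphism (k p l : nat) : (1 < d)%N -> (0 < k)%N ->
  (0 < p)%N -> (p %| k)%N -> (1 < l)%N ->
  exists (G : Cd -> Cd) (a : {poly C}) (mu : 'I_d -> C) (t : 'I_d -> R),
  [/\ jet_auto G, a`_0 = 1,
    [/\ forall j, modulus (mu j) = 1, forall j, mu j ^+ p = cis (t j),
        \prod_j mu j = cis (2 * pi / p%:R), \sum_j t j = 0 &
        one_resonant (fun j => cis (t j) : C)],
    forall j, eqO l (fun z => G z 0 j)
      (fun z => mu j * z 0 j * a.[coord_prod z ^+ k]) &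
    forall j, eqO l (fun z => iter p G z 0 j)
      (fun z => cis (t j) * z 0 j * (1 - coord_prod z ^+ k / (k * d)%:R))].
Proof.
move=> d1 k0 p0 pk l1.
have [t [t0 tr]] := exists_frequencies R d1.
have p0R : p%:R != 0 :> R by rewrite pnatr_eq0 -lt0n.
have p0C : p%:R != 0 :> C by rewrite pnatr_eq0 -lt0n.
(* The prescribed p-th multiplier is 1 - x / (k d), the factor in the normal form. *)
have [a a0 ha] := @formal_root C (d * k) p l (- (k * d)%:R^-1) p0C.
pose T (z : Cd) : Cd := \row_j (z 0 j * a.[coord_prod z ^+ k]).
have [Q jQ OQ] : exists2 Q, jet_auto Q &
    forall j, bigO l (fun z => Q z 0 j - T z 0 j).
  apply: jet_interpolation => //.
    move=> j; under eq_fun do rewrite mxE; apply: jetM; first exact: jet_coord.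
    by apply: jet_horner; apply: jetX; exact: jet_coord_prod.
  move=> j.
  have Oa : bigO 1 (fun z : Cd => a.[coord_prod z ^+ k] - 1).
    have /dvdpP[b ab] := eqX1_coef0 a0.
    have := bigO_mul (jet_bigO0 (jet_horner b (jetX k jet_coord_prod)))
      (bigO_exp k bigO_coord_prod).
    rewrite add0n => h; apply: bigO_ext (bigO_le _ h) => [z|].
      have := congr1 (fun q : {poly C} => q.[coord_prod z ^+ k]) ab.
      by rewrite hornerD hornerN hornerC hornerM expr1 hornerX.
    by rewrite muln_gt0 k0 andbT ltnW.
  apply: bigO_ext (bigO_mul (bigO_coord R j) Oa) => z.
  by rewrite mxE mulrBr mulr1.
pose j0 : 'I_d := Ordinal (ltnW d1).
(* A p-th root of exp(i t_j) in each coordinate. The additional angle 2 pi / p is put into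
   coordinate 0 only: it is invisible in the p-th powers but becomes the argument of the product. *)
pose mu j : C := cis (t j / p%:R + (j == j0)%:R * (2 * pi / p%:R)).
have mu1 j : modulus (mu j) = 1 by exact: modulus_cis.
have mu0 j : mu j != 0 by rewrite -modulus_gt0 mu1.
have mup j : mu j ^+ p = cis (t j).
  rewrite -cis_nat mulrDr mulrC divfK// mulrCA mulrC; case: eqP => _.
    by rewrite mulr1 [p%:R * _]mulrC divfK// cisD cis_2pi mulr1.
  by rewrite mulr0 addr0.
have prodmu : \prod_j mu j = cis (2 * pi / p%:R).
  rewrite -cis_sum big_split /= -mulr_suml t0 mul0r add0r (bigD1 j0)//= ?eqxx mul1r.
  by rewrite big1 ?addr0// => j /negbTE ->; rewrite mul0r.
have muk : (\prod_j mu j) ^+ k = 1.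
  have [q ->] := dvdnP pk.
  rewrite prodmu mulnC exprM -[X in X ^+ q]cis_nat mulrC divfK//.
  by rewrite cis_2pi expr1n.
have jG : jet_auto (diagonal_map mu \o Q).
  exact: jet_auto_comp (jet_auto_diagonal mu0) jQ.
have OG j : eqO l (fun z => (diagonal_map mu \o Q) z 0 j)
    (fun z => mu j * z 0 j * a.[coord_prod z ^+ k]).
  apply: bigO_ext (bigO_scale (mu j) (OQ j)) => z.
  by rewrite /= !mxE; ring.
exists (diagonal_map mu \o Q), a, mu, t; split => // j.
apply: (eqO_trans (iterate_expansion jG a0 muk OG p j)).
have /dvdpP[r er] := ha.
have Or := bigO_mul (bigO_coord R j) (bigO_mul (jet_bigO0 (jet_horner r
  (jetX k jet_coord_prod))) (bigO_exp l.+1 (bigO_exp k bigO_coord_prod))).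
apply: bigO_ext (bigO_le _ (bigO_scale (cis (t j)) Or)) => [z|].
  have := congr1 (fun q : {poly C} => q.[coord_prod z ^+ k]) er.
  rewrite hornerD hornerN hornerD hornerC hornerZ hornerX hornerM hornerXn.
  move/eqP; rewrite subr_eq => /eqP ->; rewrite mup; ring.
rewrite add0n add1n; apply: ltnW; rewrite ltnS.
by rewrite (leq_trans (leqnSn l))// leq_pmull// muln_gt0 k0 andbT ltnW.
Qed.

End RootAutomorphism.

(** * Local dynamics and basins *)

Section Wedge.
Variables (R : realType) (d : nat).
Local Notation C := (Cplx R).
Local Notation Cd := 'rV[C]_d.
Implicit Types (z : Cd) (beta : R).

Local Notation au z := (modulus (coord_prod z)).

Lemma W_coord_prod_gt0 beta z : (0 < d)%N -> 0 < beta -> W_region beta z ->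
  0 < au z.
Proof.
move=> d0 b0 /(_ (Ordinal d0)) Wz; rewrite lt_def modulus_ge0 andbT.
apply: contraTneq Wz => ->; rewrite powR0 ?gt_eqF//.
by rewrite -leNgt.
Qed.

Lemma coord_neq0 z j : 0 < au z -> z 0 j != 0.
Proof.
rewrite modulus_gt0 /coord_prod => /prodf_neq0/(_ j isT); exact.
Qed.

Lemma W_vnorm_le beta z : W_region beta z -> vnorm z <= au z `^ beta.
Proof. by move=> Wz; apply: vnorm_le => [|j]; [exact: powR_ge0|exact/ltW/Wz]. Qed.

(** The other d - 1 coordinates are each below |u|^beta. The resulting lower bound on |z_j| is what
    converts absolute errors into relative ones. *)
Lemma W_coord_ge beta z j : (0 < d)%N -> 0 < beta -> W_region beta z ->
  au z <= modulus (z 0 j) * au z `^ (beta * (d%:R - 1)).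
Proof.
move=> d0 b0 Wz; have u0 := W_coord_prod_gt0 d0 b0 Wz.
rewrite {1}/coord_prod (bigD1 j)//= modulusM ler_wpM2l// modulus_prod.
have -> : au z `^ (beta * (d%:R - 1)) = \prod_(i < d | i != j) au z `^ beta.
  rewrite prodr_const cardC1 card_ord powRrM -powR_mulrn ?powR_ge0//.
  by rewrite -[in RHS]subn1 natrB.
by apply: ler_prod => i _; rewrite modulus_ge0 ltW// Wz.
Qed.

Lemma powR_lt_threshold (e s : R) : 0 < e -> 0 < s -> exists2 r : R, 0 < r <= 1 &
  forall a, 0 <= a -> a < r -> a `^ s < e.
Proof.
move=> e0 s0; exists (Num.min 1 (e `^ s^-1)).
  by rewrite lt_min ltr01 powR_gt0//= ge_min lexx.
move=> a a0; rewrite lt_min => /andP[_ ae].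
have -> : e = (e `^ s^-1) `^ s by rewrite -powRrM mulVf ?gt_eqF// powRr1 ?ltW.
by rewrite gt0_ltr_powR ?nnegrE// ltW// powR_gt0.
Qed.

(** In W(beta) one has |z|^l <= |u|^(beta l) and |z_j| >= |u|^(1 - beta (d - 1)), so an error
    O(|z|^l) divided by z_j is O(|u|^(beta (l + d - 1) - 1)). The hypothesis on e says exactly that
    this exponent is at least k e. *)
Lemma factor_bound (G : Cd -> Cd) (mu : 'I_d -> C) (a : {poly C}) (k l e : nat)
    beta : (0 < d)%N -> 0 < beta -> (forall j, modulus (mu j) = 1) ->
  (forall j, eqO l (fun z => G z 0 j) (fun z => mu j * z 0 j * a.[coord_prod z ^+ k])) ->
  e%:R * k%:R + 1 <= beta * (l%:R + d%:R - 1) ->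
  exists K r : R, [/\ 0 < K, 0 < r <= 1 & forall z, W_region beta z -> au z < r ->
    forall j, modulus (G z 0 j / (mu j * z 0 j) - a.[coord_prod z ^+ k])
      <= K * modulus (coord_prod z ^+ k) ^+ e].
Proof.
move=> d0 b0 mu1 OG ebeta.
have /choice[p hp] : forall j, exists p : R * R, [/\ 0 <= p.1, 0 < p.2 &
    forall z, vnorm z < p.2 -> modulus (G z 0 j - mu j * z 0 j *
      a.[coord_prod z ^+ k]) <= p.1 * vnorm z ^+ l].
  by move=> j; have [K [r h]] := OG j; exists (K, r).
pose K := \sum_j (p j).1 + 1; pose s := \big[Num.min/1]_j (p j).2.
have S0 : 0 <= \sum_j (p j).1 by apply: sumr_ge0 => j _; case: (hp j).
have K0 : 0 < K by rewrite ltr_wpDl.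
have s0 : 0 < s by apply/bigmin_gtP; split => // j _; case: (hp j).
have [r r0 hr] := powR_lt_threshold s0 b0.
exists K, r; split => // z Wz ur j.
have u0 := W_coord_prod_gt0 d0 b0 Wz.
have zj0 := coord_neq0 j u0.
have zs : vnorm z < (p j).2.
  have /bigmin_gtP[_] := le_lt_trans (W_vnorm_le Wz) (hr _ (ltW u0) ur).
  by apply.
have muj0 : mu j != 0 by rewrite -modulus_gt0 mu1.
have -> : G z 0 j / (mu j * z 0 j) - a.[coord_prod z ^+ k] =
    (G z 0 j - mu j * z 0 j * a.[coord_prod z ^+ k]) / (mu j * z 0 j).
  by field; rewrite zj0 muj0.
rewrite modulusM modulusV modulusM mu1 mul1r ler_pdivrMr ?modulus_gt0//.
have [p0 _ /(_ z zs)/le_trans] := hp j; apply.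
rewrite -mulrA; apply: ler_pM => //; first exact: exprn_ge0.
  by rewrite /K (bigD1 j)//= -addrA lerDl addr_ge0// sumr_ge0// => i _; case: (hp i).
rewrite modulusX -exprM; set u := au z in u0 ur *.
have u1 : u <= 1 by rewrite ltW// (lt_le_trans ur)//; case/andP: r0.
have h1 : vnorm z ^+ l <= u `^ (beta * l%:R).
  rewrite powRrM powR_mulrn ?powR_ge0//.
  by rewrite lerXn2r ?nnegrE ?powR_ge0// W_vnorm_le.
have h2 := W_coord_ge j d0 b0 Wz; rewrite -/u in h2.
have h3 : 0 < u `^ (beta * (d%:R - 1)) by exact: powR_gt0.
rewrite -(ler_pM2r h3) -[leRHS]mulrA.
apply: (@le_trans _ _ (u ^+ (k * e) * u)); last first.
  by rewrite ler_wpM2l// exprn_ge0// ltW.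
apply: (@le_trans _ _ (u `^ (beta * l%:R) * u `^ (beta * (d%:R - 1)))).
  by rewrite ler_wpM2r// ltW.
have un0 : u != 0 by rewrite gt_eqF.
rewrite -powRD; last by rewrite un0 implybT.
rewrite -[X in _ <= _ * X](powRr1 (ltW u0)) -(powR_mulrn _ (ltW u0)).
rewrite -powRD; last by rewrite un0 implybT.
apply: ger_powR; first by rewrite u0.
by rewrite natrM; lra.
Qed.

End Wedge.

(** * Perturbation of products and powers *)

Section Products.
Variable R : realType.
Local Notation C := (Cplx R).

Lemma modulus_prod_dist (I : Type) (s : seq I) (f g : I -> C) (B D : R) : 1 <= B ->
  (forall i, modulus (f i) <= B) -> (forall i, modulus (g i) <= B) ->
  (forall i, modulus (f i - g i) <= D) ->
  modulus (\prod_(i <- s) f i - \prod_(i <- s) g i) <=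
    (size s)%:R * B ^+ (size s) * D.
Proof.
move=> B1 fB gB fgD; have B0 : 0 <= B by exact: le_trans B1.
have prodB (h : I -> C) t : (forall i, modulus (h i) <= B) ->
    modulus (\prod_(i <- t) h i) <= B ^+ size t.
  move=> hB; elim: t => [|i t ih]; first by rewrite big_nil modulus1.
  by rewrite big_cons modulusM exprS ler_pM.
elim: s => [|i s ih] /=; first by rewrite !big_nil subrr modulus0 !mul0r.
rewrite !big_cons.
have -> : f i * \prod_(j <- s) f j - g i * \prod_(j <- s) g j =
   (f i - g i) * \prod_(j <- s) f j +
   g i * (\prod_(j <- s) f j - \prod_(j <- s) g j) by ring.
have D0 : 0 <= D by exact: le_trans (fgD i).
rewrite (le_trans (modulusD _ _))// !modulusM -natr1 exprS.
have h1 : modulus (f i - g i) * modulus (\prod_(j <- s) f j) <= D * B ^+ size s.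
  by rewrite ler_pM// prodB.
have h2 : modulus (g i) * modulus (\prod_(j <- s) f j - \prod_(j <- s) g j) <=
   B * ((size s)%:R * B ^+ size s * D) by rewrite ler_pM.
have h3 : D * B ^+ size s <= B * B ^+ size s * D.
  by rewrite mulrC ler_wpM2r// ler_peMl ?exprn_ge0.
rewrite [in leRHS]mulrDl mul1r [leRHS]mulrDl.
have -> : (size s)%:R * (B * B ^+ size s) * D =
   B * ((size s)%:R * B ^+ size s * D) by ring.
by rewrite addrC lerD// (le_trans h1).
Qed.

Lemma horner_bound (q : {poly C}) : exists2 K : R, 0 <= K &
  forall t, modulus t <= 1 -> modulus q.[t] <= K.
Proof.
exists (\sum_(i < size q) modulus q`_i) => [|t t1]; first exact: sumr_ge0.
rewrite horner_coef (le_trans (modulus_sum _ _ _))// ler_sum// => i _.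
by rewrite modulusM modulusX ler_piMr// exprn_ile1.
Qed.

Lemma expr_1subX (c : C) n : exists r : {poly C}, (1 - c *: 'X) ^+ n =
  1 - (n%:R * c) *: 'X + ('C(n, 2)%:R * c ^+ 2) *: 'X^2 + 'X^3 * r.
Proof.
elim: n => [|n [r ih]].
  by exists 0; rewrite expr0 !mul0r !scale0r mulr0 subr0 !addr0.
exists (r * (1 - c *: 'X) - (('C(n, 2)%:R * c ^+ 2 * c))%:P).
pose e : {poly C} := c%:P.
have e1 m : (m%:R * c) *: 'X = m%:R * e * 'X :> {poly C}.
  by rewrite -mul_polyC rmorphM rmorph_nat.
have e2 m : (m%:R * c ^+ 2) *: 'X^2 = m%:R * e ^+ 2 * 'X^2 :> {poly C}.
  by rewrite -mul_polyC rmorphM rmorph_nat rmorphXn.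
have e3 : c *: 'X = e * 'X :> {poly C} by rewrite -mul_polyC.
have e4 : ('C(n, 2)%:R * c ^+ 2 * c)%:P = 'C(n, 2)%:R * e ^+ 2 * e.
  by rewrite !rmorphM rmorph_nat.
by rewrite exprSr ih binS bin1 natrD -natr1 e1 e2 e3 e4 -natrD e2 natrD natr1 e1
  -natr1; ring.
Qed.

End Products.

Lemma residue_uniq (h h' k : nat) (n : int) : (h < k)%N -> (h' < k)%N ->
  `|h%:Z - h'%:Z - k%:Z * n| < 1 -> h = h'.
Proof.
move=> hk hk' m0; have hh : h%:Z = h'%:Z + k%:Z * n by lia.
have n0 : n = 0 by nia.
by lia.
Qed.

(** * Sectors and the coordinate v = u^-k *)

Section Argument.
Variable R : realType.
Local Notation C := (Cplx R).
Implicit Types (w u M : C) (t tau theta : R).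

(* The argument, for w in the right half-plane. *)
Definition argr w : R := atan (Im w / Re w).

Lemma polar_argr w : 0 < Re w -> w = ofR (modulus w) * cis (argr w).
Proof.
move=> w0; set y := Im w / Re w.
have yE : Im w = y * Re w by rewrite divfK// gt_eqF.
have c0 : 0 < cos (atan y) by rewrite cos_gt0_pihalf// atan_gtNpi2 atan_ltpi2.
have sE : sin (atan y) = y * cos (atan y).
  have tE := atanK y; rewrite /tan in tE.
  by rewrite -[X in X * _]tE divfK// gt_eqF.
have m2 := sqr_modulus w.
have cE : modulus w * cos (atan y) = Re w.
  apply/eqP; rewrite -(@eqrXn2 _ 2)//; [|by rewrite mulr_ge0// ltW|exact: ltW].
  rewrite exprMn m2 yE; have := cos2Dsin2 (atan y); rewrite sE => h.
  apply/eqP; rewrite -[RHS]mulr1 -h; ring.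
apply: complex_ext; rewrite ?Re_ofRM ?Im_ofRM /= -/y; first by rewrite cE.
by rewrite sE mulrCA cE.
Qed.

Lemma argr_pihalf w : `|argr w| < pi / 2.
Proof. by rewrite ltr_norml atan_gtNpi2 atan_ltpi2. Qed.

Lemma norm_atan_le (y : R) : `|atan y| <= `|y|.
Proof.
rewrite -[atan y]subr0 -(@atan0 R) -[leRHS]mul1r.
apply: (@mean_value_bound R atan (fun y => (1 + y ^+ 2)^-1)) => x.
move=> _; have h : 1 <= 1 + x ^+ 2 by rewrite lerDl sqr_ge0.
by rewrite ger0_norm ?invf_le1 ?invr_ge0// (lt_le_trans _ h, le_trans _ h).
Qed.

Lemma argr_le w : 0 < Re w -> `|argr w| <= `|Im w| / Re w.
Proof.
by move=> w0; rewrite (le_trans (norm_atan_le _))// normrM normfV [`|Re w|]gtr0_norm.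
Qed.

Lemma argr_uniq w (rho : R) t : `|t| < pi / 2 -> 0 < rho -> w = ofR rho * cis t ->
  0 < Re w /\ argr w = t.
Proof.
rewrite ltr_norml => tpi rho0 ->; have c0 := cos_gt0_pihalf tpi.
rewrite /argr Re_ofRM Im_ofRM /=; split; first exact: mulr_gt0.
rewrite -mulf_div divff ?gt_eqF// mul1r.
by rewrite (_ : sin t / cos t = tan t)// tanK// in_itv/= -ltr_norml ltr_norml.
Qed.

Lemma argr_lt_tan w theta : 0 < Re w -> 0 < theta < pi / 2 ->
  (`|argr w| < theta) = (`|Im w| < tan theta * Re w).
Proof.
move=> w0 /andP[t0 tpi]; rewrite -ltr_pdivrMr//.
have -> : `|Im w| / Re w = `|Im w / Re w|.
  by rewrite normrM normfV [`|Re w|]gtr0_norm.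
have aE : theta = atan (tan theta).
  rewrite tanK// in_itv/= tpi andbT (lt_trans _ t0)// oppr_lt0 divr_gt0//.
  exact: pi_gt0.
rewrite {1}aE /argr; set y := Im w / Re w.
have atlt (a b : R) : (atan a < atan b) = (a < b).
  apply/idP/idP => [|/lt_atan//]; apply: contraLR; rewrite -!leNgt.
  exact: le_atan.
rewrite !ltr_norml -atanN !atlt //.
Qed.

Lemma tan_gt0 theta : 0 < theta < pi / 2 -> 0 < tan theta.
Proof.
move=> /andP[t0 tp]; rewrite /tan divr_gt0//.
  rewrite sin_gt0_pi// t0/= (lt_trans tp)// ltr_pdivrMr// ltr_pMr ?pi_gt0//.
  by rewrite ltr1n.
by rewrite cos_gt0_pihalf// tp andbT (lt_trans _ t0)// oppr_lt0 divr_gt0// pi_gt0.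
Qed.

Lemma polar_exists w : exists t, w = ofR (modulus w) * cis t.
Proof.
have [w0|w0|w0] := ltgtP (Re w) 0.
- have h : 0 < Re (- w) by rewrite ReN oppr_gt0.
  exists (argr (- w) + pi); rewrite cisD.
  have -> : cis pi = - 1 :> C.
    by apply: complex_ext => /=; rewrite ?cospi ?sinpi ?oppr0.
  by rewrite mulrN1 mulrN -modulusN -polar_argr// opprK.
- by exists (argr w); exact: polar_argr.
- have m2 : modulus w = `|Im w|.
    apply/eqP; rewrite -(@eqrXn2 _ 2)// sqr_modulus w0 expr0n add0r.
    by rewrite real_normK ?num_real.
  have [i0|i0] := ler0P (Im w).
    exists (- (pi / 2)); rewrite m2 ler0_norm//.
    apply: complex_ext; rewrite ?Re_ofRM ?Im_ofRM /= ?cosN ?sinN.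
      by rewrite cos_pihalf mulr0.
    by rewrite sin_pihalf mulrN1 opprK.
  exists (pi / 2); rewrite m2 gtr0_norm//.
  apply: complex_ext; rewrite ?Re_ofRM ?Im_ofRM /=.
    by rewrite cos_pihalf mulr0.
  by rewrite sin_pihalf mulr1.
Qed.

Variables (k : nat).
Hypothesis k0 : (0 < k)%N.
Let kR0 : 0 < k%:R :> R. Proof. by rewrite ltr0n. Qed.
Let kRn : k%:R != 0 :> R. Proof. by rewrite gt_eqF. Qed.
Let kpi : k%:R * (pi / (2 * k%:R)) = pi / 2 :> R. Proof. by field. Qed.

Definition fatou_v u : C := (u ^+ k)^-1.

Definition sector h theta u :=
  exists2 tau, `|tau| < theta & u = ofR (modulus u) * cis (2 * pi * h%:R / k%:R + tau).

Lemma modulus_fatou_v u : modulus (fatou_v u) = (modulus u ^+ k)^-1.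
Proof. by rewrite modulusV modulusX. Qed.

(** Inversion maps the disc with diameter from 0 to 1/r onto the half-plane Re v > r. *)
Lemma S_regionP h (r theta : R) u : 0 < r ->
  S_region k h r theta u <->
  [/\ u != 0, r < Re (fatou_v u) & sector h theta u].
Proof.
move=> r0.
have disc : u != 0 ->
    (modulus (u ^+ k - ofR (2 * r)^-1) < (2 * r)^-1) = (r < Re (fatou_v u)).
  move=> u0; have uk0 : 0 < modulus (u ^+ k) by rewrite modulus_gt0 expf_neq0.
  set x := u ^+ k in uk0 *; set a := (2 * r)^-1.
  have a0 : 0 < a by rewrite invr_gt0 mulr_gt0.
  have ar : r = (2 * a)^-1.
    by rewrite /a invfM invrK mulrA mulVf ?mul1r.
  rewrite -(@ltr_pXn2r _ 2)// ?nnegrE//; last exact: ltW.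
  rewrite sqr_modulus ReB ImB.
  have -> : (r < Re (fatou_v u)) = (r * (Re x ^+ 2 + Im x ^+ 2) < Re x).
    by rewrite /fatou_v Re_inv -sqr_modulus ltr_pdivlMr// exprn_gt0.
  rewrite (_ : Re (ofR a) = a)// (_ : Im (ofR a) = 0)// subr0.
  rewrite [in RHS]ar [_^-1 * _]mulrC ltr_pdivrMr ?mulr_gt0//.
  by apply/idP/idP; nra.
split=> [[h1 [t [ut tt]]]|[u0 h1 [tau ttau ut]]].
  have u0 : u != 0.
    apply: contraTneq h1 => ->; rewrite expr0n gtn_eqF//= sub0r modulusN.
    by rewrite modulus_ofR_ge0 ?ltxx// invr_ge0 mulr_ge0// ltW.
  split => //; first by rewrite -disc.
  by exists (t - 2 * pi * h%:R / k%:R) => //; rewrite subrKC.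
split; first by rewrite disc.
exists (2 * pi * h%:R / k%:R + tau); split => //.
by rewrite addrAC subrr add0r.
Qed.

Lemma cis_2pih h : cis (k%:R * (2 * pi * h%:R / k%:R)) = 1 :> C.
Proof. by rewrite mulrC divfK// mulrC cis_nat cis_2pi expr1n. Qed.

Lemma fatou_v_polar h tau u :
  u = ofR (modulus u) * cis (2 * pi * h%:R / k%:R + tau) ->
  fatou_v u = ofR (modulus (fatou_v u)) * cis (- (k%:R * tau)).
Proof.
move=> uE; rewrite modulus_fatou_v ofRV ofRX {1}/fatou_v {1}uE exprMn invfM.
rewrite -cis_nat mulrDr cisD cis_2pih mul1r; congr (_ * _).
have c0 : cis (k%:R * tau) != 0 :> C by rewrite -modulus_gt0 modulus_cis.
by apply: (mulIf c0); rewrite mulVf// -cisD addNr cis0.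
Qed.

Lemma sector_argr h theta u : u != 0 -> theta <= pi / (2 * k%:R) ->
  sector h theta u -> 0 < Re (fatou_v u) /\ `|argr (fatou_v u)| < k%:R * theta.
Proof.
move=> u0 tpi [tau ttau uE].
have h1 : `|- (k%:R * tau)| < k%:R * theta.
  by rewrite normrN normrM gtr0_norm// ltr_pM2l.
have h2 : k%:R * theta <= pi / 2.
  by rewrite -kpi ler_wpM2l// ltW.
have v0 : 0 < modulus (fatou_v u).
  by rewrite modulus_gt0 invr_neq0// expf_neq0.
by have [? ->] := argr_uniq (lt_le_trans h1 h2) v0 (fatou_v_polar uE).
Qed.

(* The branch of the argument is locally constant: a small multiplicative
   perturbation of u stays near the same k-th root direction. *)
Lemma sector_step h theta u M : u != 0 -> theta <= pi / (2 * k%:R) ->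
  sector h theta u -> modulus (M - 1) <= (4 * k%:R)^-1 ->
  0 < Re (fatou_v (u * M)) -> `|argr (fatou_v (u * M))| < k%:R * theta ->
  sector h theta (u * M).
Proof.
move=> u0 tpi [tau ttau uE] M1 v0 av.
have pi1 : 1 < pi :> R by rewrite (lt_le_trans _ (pi_ge2 R))// ltr1n.
have M14 : modulus (M - 1) <= 4^-1.
  by rewrite (le_trans M1)// lef_pV2 ?posrE// ?mulr_gt0// ler_pMr// ler1n.
have reM : 3 / 4 <= Re M.
  have := le_trans (Re_le_modulus (M - 1)) M14.
  by rewrite ReB (_ : Re (1 : C) = 1)// ler_norml => /andP[+ _]; lra.
have M0 : 0 < Re M by lra.
pose s := argr M.
have ks : `|k%:R * s| <= 2^-1.
  rewrite normrM gtr0_norm//.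
  have s1 : `|s| <= 2 * modulus (M - 1).
    rewrite (le_trans (argr_le M0))// ler_pdivrMr//.
    have := Im_le_modulus (M - 1); rewrite ImB (_ : Im (1 : C) = 0)// subr0.
    have := modulus_ge0 (M - 1); nra.
  rewrite (le_trans (ler_wpM2l (ltW kR0) s1))// mulrCA.
  rewrite (le_trans (ler_wpM2l _ (ler_wpM2l (ltW kR0) M1)))//.
  have -> : 2 * (k%:R / (4 * k%:R)) = 2^-1 :> R by field.
  by [].
have uME : u * M = ofR (modulus (u * M)) * cis (2 * pi * h%:R / k%:R + (tau + s)).
  rewrite {1}uE {1}(polar_argr M0) modulusM ofRM addrA [in RHS]cisD -/s.
  by ring.
have vE := fatou_v_polar uME.
have vE2 := polar_argr v0.
have v1 : ofR (modulus (fatou_v (u * M))) != 0 :> C.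
  rewrite -modulus_eq0 modulus_ofR_ge0// modulus_eq0.
  by apply: contraTneq v0 => ->; rewrite ltxx.
have cE : cis (argr (fatou_v (u * M)) + k%:R * (tau + s)) = 1 :> C.
  have /(mulfI v1) e := etrans (esym vE2) vE.
  by rewrite cisD e -cisD addNr cis0.
have ktau : `|k%:R * tau| < pi / 2.
  rewrite normrM gtr0_norm// (lt_le_trans (y := k%:R * theta)) ?ltr_pM2l//.
  by rewrite -kpi ler_wpM2l// ltW.
have := cis_eq1 _ cE => h0.
have {}h0 : argr (fatou_v (u * M)) + k%:R * (tau + s) = 0.
  apply: h0; rewrite (le_lt_trans (ler_normD _ _))// mulrDr.
  have := ler_normD (k%:R * tau) (k%:R * s); have := argr_pihalf (fatou_v (u * M)).
  by move: ktau ks pi1; lra.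
exists (tau + s) => //.
rewrite -(ltr_pM2l kR0) (le_lt_trans _ av)// -[X in X * _ <= _]gtr0_norm// -normrM.
by rewrite -normrN; move/eqP: h0; rewrite addr_eq0 => /eqP ->.
Qed.

Lemma sector_rotate h h' theta u (psi : R) : cis psi * cis (2 * pi * h%:R / k%:R) =
    cis (2 * pi * h'%:R / k%:R) :> C ->
  sector h theta u -> sector h' theta (cis psi * u).
Proof.
move=> e [tau tt uE]; exists tau => //.
by rewrite {1}uE modulusM modulus_cis mul1r !cisD -e; ring.
Qed.

(** The deviations from the two axes add up to less than pi / k, whereas distinct axes are at least
    2 pi / k apart modulo 2 pi. *)
Lemma sector_uniq h h' theta u : u != 0 -> theta <= pi / (2 * k%:R) ->
  (h < k)%N -> (h' < k)%N -> sector h theta u -> sector h' theta u -> h = h'.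
Proof.
move=> u0 tpi hk hk' [tau tt uE] [tau' tt' uE'].
have u1 : ofR (modulus u) != 0 :> C.
  by rewrite -modulus_eq0 modulus_ofR_ge0// modulus_eq0.
have /(mulfI u1)/cis_eq_cis[n en] := etrans (esym uE) uE'.
have pi0 := pi_gt0 R.
have e2 : h%:R - h'%:R - k%:R * n%:~R = k%:R * (tau' - tau) / (2 * pi) :> R.
  apply: (mulfI (lt0r_neq0 (mulr_gt0 (ltr0n R 2) pi0))).
  rewrite [RHS]mulrC divfK ?gt_eqF ?mulr_gt0//.
  have -> : tau' - tau = 2 * pi * h%:R / k%:R - 2 * pi * h'%:R / k%:R - 2 * pi * n%:~R.
    by rewrite -en; ring.
  by field.
have small : `|k%:R * (tau' - tau) / (2 * pi)| < 1.
  rewrite normrM normfV [`|2 * pi|]gtr0_norm ?mulr_gt0// ltr_pdivrMr ?mulr_gt0//.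
  rewrite normrM gtr0_norm// mul1r.
  have h1 : `|tau' - tau| < pi / k%:R.
    rewrite (le_lt_trans (ler_normB _ _))//.
    have -> : pi / k%:R = pi / (2 * k%:R) + pi / (2 * k%:R) :> R by field.
    by rewrite ltrD// (lt_le_trans _ tpi).
  by rewrite -ltr_pdivlMl// mulrC (lt_trans h1)// -mulrA ltr_pMl ?divr_gt0// ltr1n.
have : `|(h%:Z - h'%:Z - k%:Z * n)%:~R| < 1 :> R.
  by rewrite !intrD !mulrNz intrM -!pmulrn e2.
rewrite -intr_norm -[1]/(1%:~R) ltr_int => m0.
exact: residue_uniq hk hk' m0.
Qed.

(** The argument of v equals - k arg(u) up to n full turns; the index of the sector is - n reduced
    modulo k. *)
Lemma sector_exists theta u : u != 0 -> 0 < Re (fatou_v u) ->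
  `|argr (fatou_v u)| < k%:R * theta -> exists2 h, (h < k)%N & sector h theta u.
Proof.
move=> u0 v0 av; have [t uE] := polar_exists u.
have vE : fatou_v u = ofR (modulus (fatou_v u)) * cis (- (k%:R * t)).
  apply: (@fatou_v_polar 0); rewrite mulr0 mul0r add0r; exact: uE.
have v1 : ofR (modulus (fatou_v u)) != 0 :> C.
  rewrite -modulus_eq0 modulus_ofR_ge0// modulus_eq0.
  by apply: contraTneq v0 => ->; rewrite ltxx.
have /(mulfI v1)/cis_eq_cis[n en] := etrans (esym vE) (polar_argr v0).
pose h := (`|(- n %% k)%Z|)%N.
have kZ : k%:Z != 0 by rewrite eqz_nat -lt0n.
have hE : h%:Z = (- n %% k)%Z by rewrite gez0_abs// modz_ge0.
have hk : (h < k)%N by rewrite -ltz_nat hE ltz_pmod// ltz_nat.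
exists h => //.
exists (- argr (fatou_v u) / k%:R).
  by rewrite normrM normrN normfV [`|k%:R|]gtr0_norm// ltr_pdivrMr// mulrC.
rewrite {1}uE; congr (_ * _).
have nE : - n = (- n %/ k)%Z * k + h by rewrite hE -divz_eq.
have tE : t = 2 * pi * h%:R / k%:R - argr (fatou_v u) / k%:R +
    2 * pi * (- n %/ k)%Z%:~R.
  apply: (mulfI kRn).
  have e1 : - (k%:R * t) = argr (fatou_v u) + 2 * pi * n%:~R by rewrite -en; ring.
  have e2 : - n%:~R = (- n %/ k)%Z%:~R * k%:R + h%:R :> R.
    by rewrite -mulrNz {1}nE intrD intrM -!pmulrn.
  have -> : k%:R * t = - argr (fatou_v u) + 2 * pi * - n%:~R.
    by rewrite -[LHS]opprK e1; ring.
  by rewrite e2; field.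
rewrite {1}tE mulNr cisD.
suff -> : cis (2 * pi * (- n %/ k)%Z%:~R) = 1 :> C by rewrite mulr1.
exact: cis_int.
Qed.

End Argument.

(** * Expansion of one step of the dynamics *)

Section LocalStep.
Variables (R : realType) (d k l : nat).
Local Notation C := (Cplx R).
Local Notation Cd := 'rV[C]_d.
Local Notation N := (k * d)%N.
Variables (F : Cd -> Cd) (lam : 'I_d -> C).
Hypotheses (d0 : (0 < d)%N) (k0 : (0 < k)%N).
Hypotheses (lam1 : forall j, modulus (lam j) = 1) (plam : \prod_j lam j = 1).
Hypothesis OF : forall j, eqO l (fun z => F z 0 j)
  (fun z => lam j * z 0 j * (1 - coord_prod z ^+ k / N%:R)).
Implicit Types (z : Cd) (beta theta r : R).

Local Notation au z := (modulus (coord_prod z)).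
Local Notation xk z := (coord_prod z ^+ k).
Local Notation vz z := (fatou_v k (coord_prod z)).

Definition factor z j : C := F z 0 j / (lam j * z 0 j).
(** The coefficient of 1/v in the expansion v' = v + 1 + c/v + O(v^-2), before any further
    normalization. *)
Definition fatou_c : C := 1 - 'C(N, 2)%:R * N%:R^-1 ^+ 2.

Lemma N_neq0 : N%:R != 0 :> C.
Proof. by rewrite pnatr_eq0 -lt0n muln_gt0 k0. Qed.

Lemma fatou_vK z : (vz z)^-1 = xk z.
Proof. by rewrite invrK. Qed.

Lemma modulus_xk z : modulus (xk z) = (modulus (vz z))^-1.
Proof. by rewrite -modulusV fatou_vK. Qed.

Lemma local_factor beta (e : nat) : 0 < beta ->
  e%:R * k%:R + 1 <= beta * (l%:R + d%:R - 1) ->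
  exists K r : R, [/\ 0 < K, 0 < r <= 1 & forall z, W_region beta z -> au z < r ->
    forall j, modulus (factor z j - (1 - xk z / N%:R)) <= K * modulus (xk z) ^+ e].
Proof.
move=> b0 be.
have E (t : C) : (1 - N%:R^-1 *: 'X).[t] = 1 - t / N%:R.
  by rewrite hornerD hornerN hornerC hornerZ hornerX [_^-1 * _]mulrC.
have OF' j : eqO l (fun z => F z 0 j)
    (fun z => lam j * z 0 j * (1 - N%:R^-1 *: 'X).[xk z]).
  by apply: bigO_ext (OF j) => z; rewrite E.
have [K [r [K0 r0 h]]] := factor_bound d0 b0 lam1 OF' be.
by exists K, r; split => // z Wz ur j; have := h z Wz ur j; rewrite E.
Qed.

Definition total_factor z : C := \prod_j factor z j.

Lemma coord_prod_step z : 0 < au z -> coord_prod (F z) = coord_prod z * total_factor z.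
Proof.
move=> u0.
have -> : coord_prod z = \prod_j (lam j * z 0 j) by rewrite big_split /= plam mul1r.
rewrite -big_split /=; apply: eq_bigr => j _.
have l0 : lam j != 0 by rewrite -modulus_gt0 lam1 ltr01.
have z0 := coord_neq0 j u0.
by rewrite /factor mulrC divfK// mulf_neq0.
Qed.

(** Here x is 1/v and T is the factor by which u^k is multiplied, so 1/T governs v. The order e, 2
    or 3, is the precision to which T is known. *)
Lemma inverse_expansion (e : nat) (K1 : R) : (1 < e <= 3)%N -> 0 <= K1 ->
  exists K r : R, [/\ 0 <= K, 0 < r <= 1 & forall x T : C,
    modulus x < r -> modulus (T - (1 - x / N%:R) ^+ N) <= K1 * modulus x ^+ e ->
    modulus (T^-1 - (1 + x + fatou_c * x ^+ 2)) <= K * modulus x ^+ e].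
Proof.
move=> /andP[e1 e3] K10.
have [q qE] := @expr_1subX R (N%:R^-1 : C) N.
have [Q Q0 hQ] := horner_bound q.
have qx (x : C) : (1 - x / N%:R) ^+ N =
    1 - x + 'C(N, 2)%:R * N%:R^-1 ^+ 2 * x ^+ 2 + x ^+ 3 * q.[x].
  have := congr1 (fun p : {poly C} => p.[x]) qE.
  rewrite horner_exp !(hornerD, hornerN, hornerZ, hornerX, hornerXn, hornerM, hornerC).
  by rewrite [_^-1 * x]mulrC => ->; rewrite mulfV ?N_neq0// mul1r.
pose c2 : C := 'C(N, 2)%:R * N%:R^-1 ^+ 2.
have cc : fatou_c = 1 - c2 by [].
(* q(x) (1 + x + c x^2) = 1 + x^3 s(x) *)
pose s (x : C) : C := - fatou_c + c2 + c2 * fatou_c * x + q.[x] * (1 + x + fatou_c * x ^+ 2).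
have sE (x : C) : (1 - x / N%:R) ^+ N * (1 + x + fatou_c * x ^+ 2) = 1 + x ^+ 3 * s x.
  by rewrite qx -/c2 /s cc; ring.
pose mc := modulus fatou_c; pose m2 := modulus c2.
pose B := 2 + mc.
have mc0 : 0 <= mc by exact: modulus_ge0.
have m20 : 0 <= m2 by exact: modulus_ge0.
have Bx (x : C) : modulus x <= 1 -> modulus (1 + x + fatou_c * x ^+ 2) <= B.
  move=> x1; rewrite (le_trans (modulusD _ _))// (le_trans (lerD (modulusD _ _) (lexx _)))//.
  rewrite modulus1 modulusM modulusX /B lerD//; first by lra.
  by rewrite ler_piMr// exprn_ile1.
pose S := mc + m2 + m2 * mc + Q * B.
have S0 : 0 <= S by rewrite !addr_ge0 ?mulr_ge0// addr_ge0.
have sx (x : C) : modulus x <= 1 -> modulus (s x) <= S.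
  move=> x1; rewrite /s (le_trans (modulusD _ _))// lerD//; last first.
    by rewrite modulusM ler_pM ?hQ ?Bx.
  rewrite (le_trans (modulusD _ _))// lerD//.
    by rewrite (le_trans (modulusD _ _))// modulusN.
  by rewrite modulusM [modulus (c2 * _)]modulusM ler_piMr ?mulr_ge0.
pose D := 2 * (S + K1 * B).
have D0 : 0 <= D by rewrite mulr_ge0// addr_ge0// mulr_ge0// addr_ge0.
pose A := 2 + m2 + Q + K1.
have A0 : 0 < A by rewrite !ltr_wpDr.
exists D, (2 * A)^-1; split => //.
  rewrite invr_gt0 mulr_gt0//= invf_le1 ?mulr_gt0//.
  by rewrite /A; lra.
move=> x T; rewrite -[ltRHS]mul1r ltr_pdivlMr ?mulr_gt0// => xA hT.
have A2 : 2 <= A by rewrite /A; lra.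
have x0 := modulus_ge0 x.
have x1 : modulus x <= 1 by nra.
have xe : modulus x ^+ e <= modulus x.
  case: (e) e1 => // n _; rewrite exprS ler_piMr// exprn_ile1//.
have T2 : 2^-1 <= modulus T.
  have h1 : modulus (1 - T) <= A * modulus x.
    have -> : 1 - T = x - c2 * x ^+ 2 - x ^+ 3 * q.[x] - (T - (1 - x / N%:R) ^+ N).
      by rewrite qx -/c2; ring.
    rewrite (le_trans (modulusB _ _))// (le_trans (lerD (modulusB _ _) (lexx _)))//.
    rewrite (le_trans (lerD (lerD (modulusB _ _) (lexx _)) (lexx _)))//.
    rewrite [modulus (c2 * _)]modulusM [modulus (_ ^+ 3 * _)]modulusM !modulusX -/m2.
    have y2 : m2 * modulus x ^+ 2 <= m2 * modulus x.
      by rewrite ler_wpM2l// expr2 ler_piMr.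
    have y3 : modulus x ^+ 3 * modulus q.[x] <= Q * modulus x.
      rewrite mulrC ler_pM ?exprn_ge0 ?hQ//.
      by rewrite exprS ler_piMr// exprn_ile1.
    have y4 : K1 * modulus x ^+ e <= K1 * modulus x by rewrite ler_wpM2l.
    rewrite /A -/m2; lra.
  have := modulus_lower 1 (T - 1); rewrite modulus1 subrKC modulus_distC.
  by lra.
have T0 : T != 0 by rewrite -modulus_gt0 (lt_le_trans _ T2)// invr_gt0.
have -> : T^-1 - (1 + x + fatou_c * x ^+ 2) =
    T^-1 * (- (x ^+ 3 * s x) -
     (T - (1 - x / N%:R) ^+ N) * (1 + x + fatou_c * x ^+ 2)).
  have -> : - (x ^+ 3 * s x) - (T - (1 - x / N%:R) ^+ N) * (1 + x + fatou_c * x ^+ 2) =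
      1 - T * (1 + x + fatou_c * x ^+ 2).
    by rewrite [(_ - _) * (1 + x + _)]mulrBl sE; ring.
  by field; rewrite T0.
rewrite modulusM modulusV.
have Ti : (modulus T)^-1 <= 2.
  by rewrite -[leRHS]invrK lef_pV2 ?posrE ?invr_gt0// modulus_gt0.
have h3 : modulus (- (x ^+ 3 * s x) -
     (T - (1 - x / N%:R) ^+ N) * (1 + x + fatou_c * x ^+ 2)) <=
     (S + K1 * B) * modulus x ^+ e.
  rewrite (le_trans (modulusB _ _))// modulusN.
  rewrite [modulus (_ ^+ 3 * s x)]modulusM [modulus ((_ - _) * _)]modulusM.
  rewrite [modulus (_ ^+ 3)]modulusX [leRHS]mulrDl lerD//.
    rewrite mulrC ler_pM ?exprn_ge0 ?sx//.
    by rewrite -(subnKC e3) exprD ler_piMr ?exprn_ge0// exprn_ile1.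
  by rewrite [leRHS]mulrAC; apply: ler_pM; rewrite ?modulus_ge0 ?Bx.
rewrite (le_trans (ler_pM _ _ Ti h3)) ?invr_ge0// /D mulrA.
by [].
Qed.

Lemma fatou_v_step z : 0 < au z -> vz (F z) = vz z * (total_factor z ^+ k)^-1.
Proof. by move=> u0; rewrite /fatou_v coord_prod_step// exprMn invfM. Qed.

Lemma modulus_div_N (x : C) : modulus (x / N%:R) <= modulus x.
Proof.
rewrite modulusM modulusV modulus_nat ler_piMr// invf_le1 ?ltr0n ?muln_gt0 ?k0//.
by rewrite ler1n muln_gt0 k0.
Qed.

(** With e = 2, which admissible exponents allow, v' = v + 1 + O(1/v), enough for the absorbing
    regions. Comparing two orbits requires the term c/v explicitly, that is e = 3. *)
Lemma step_expansion beta (e : nat) : 0 < beta -> (1 < e <= 3)%N ->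
  e%:R * k%:R + 1 <= beta * (l%:R + d%:R - 1) ->
  exists K r : R, [/\ 0 < K, 0 < r <= 1 & forall z, W_region beta z -> au z < r ->
    [/\ 0 < au z, coord_prod (F z) != 0,
        forall j, modulus (factor z j - (1 - xk z / N%:R)) <= K * modulus (xk z) ^+ e,
        modulus (total_factor z - (1 - xk z / N%:R) ^+ d) <= K * modulus (xk z) ^+ e &
        modulus (vz (F z) - vz z - 1 - fatou_c * xk z) <= K * modulus (xk z) ^+ e.-1]].
Proof.
move=> b0 e13 be; have [K1 [r1 [K10 /andP[r10 r11] h1]]] := local_factor b0 be.
pose A := 2 + K1; have A1 : 1 <= A by rewrite /A; lra.
have A0 : 0 < A by lra.
pose K2 := d%:R * A ^+ d * K1.
pose B := Num.max (A ^+ d) (2 ^+ d).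
pose K3 := k%:R * K2 * B ^+ k.-1.
have K20 : 0 <= K2 by rewrite !mulr_ge0 ?exprn_ge0// ltW.
have B0 : 0 <= B by rewrite le_max !exprn_ge0// ltW.
have K30 : 0 <= K3 by rewrite !mulr_ge0 ?exprn_ge0// ltW.
have [K4 [r4 [K40 /andP[r40 r41] h4]]] := inverse_expansion e13 K30.
pose K := K1 + K2 + K4.
have K0 : 0 < K by rewrite /K; lra.
pose r5 := (2 * A)^-1.
have r50 : 0 < r5 by rewrite invr_gt0 mulr_gt0.
exists K, (Num.min (Num.min r1 r4) r5); split => //.
  by rewrite !lt_min r10 r40 r50 !ge_min r11.
move=> z Wz; rewrite !lt_min => /andP[/andP[ur1 ur4] ur5].
have u0 := W_coord_prod_gt0 d0 b0 Wz.
have u1 : au z < 1 by rewrite (lt_le_trans ur1).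
have x0 := modulus_ge0 (xk z).
have xu : modulus (xk z) <= au z.
  by case: (k) k0 => // n _; rewrite modulusX exprS ler_piMr ?exprn_ile1 ?modulus_ge0// ltW.
have x1 : modulus (xk z) <= 1 by lra.
have xe1 : modulus (xk z) ^+ e <= 1 by rewrite exprn_ile1.
have f1 := h1 z Wz ur1.
have w2 : modulus (1 - xk z / N%:R) <= 2.
  rewrite (le_trans (modulusB _ _))// modulus1 -[2]/(1 + 1) lerD2l.
  by rewrite (le_trans (modulus_div_N _)).
have fA j : modulus (factor z j) <= A.
  have -> : factor z j = (1 - xk z / N%:R) + (factor z j - (1 - xk z / N%:R)) by ring.
  rewrite (le_trans (modulusD _ _))// /A lerD// (le_trans (f1 j))//.
  by rewrite ler_piMr// ltW.
have t2 : modulus (total_factor z - (1 - xk z / N%:R) ^+ d) <= K2 * modulus (xk z) ^+ e.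
  have -> : (1 - xk z / N%:R) ^+ d = \prod_(j < d) (1 - xk z / N%:R).
    by rewrite prodr_const card_ord.
  have := @modulus_prod_dist R 'I_d (index_enum 'I_d) (factor z)
    (fun=> 1 - xk z / N%:R) A (K1 * modulus (xk z) ^+ e) A1 fA.
  have -> : size (index_enum 'I_d) = d.
    by rewrite -[RHS](size_enum_ord d) enumT [index_enum _]unlock.
  rewrite /K2 mulrA; apply => // i.
  by rewrite (le_trans w2)// /A lerDl ltW.
have M0 : total_factor z != 0.
  apply/prodf_neq0 => j _; rewrite -modulus_gt0.
  have h : modulus (1 - factor z j) <= A * modulus (xk z).
    have -> : 1 - factor z j = xk z / N%:R - (factor z j - (1 - xk z / N%:R)) by ring.
    rewrite (le_trans (modulusB _ _))// (le_trans (lerD (modulus_div_N _) (f1 j)))//.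
    have xe : modulus (xk z) ^+ e <= modulus (xk z).
      by case: (e) e13 => // n _; rewrite exprS ler_piMr// exprn_ile1.
    have := ler_wpM2l (ltW K10) xe; rewrite /A; lra.
  have h2 : A * modulus (xk z) <= 2^-1.
    rewrite (le_trans (ler_wpM2l (ltW A0) (le_trans xu (ltW ur5))))// /r5.
    by rewrite invfM mulrCA mulfV ?gt_eqF// mulr1.
  have := modulus_lower 1 (factor z j - 1); rewrite modulus1 subrKC modulus_distC.
  by lra.
have T3 : modulus (total_factor z ^+ k - (1 - xk z / N%:R) ^+ N) <= K3 * modulus (xk z) ^+ e.
  rewrite [N]mulnC exprM.
  have tB : modulus (total_factor z) <= B.
    rewrite le_max; apply/orP; left; rewrite modulus_prod.
    rewrite (@le_trans _ _ (\prod_(j < d) A))//; last by rewrite prodr_const card_ord.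
    by apply: ler_prod => j _; rewrite modulus_ge0 fA.
  have wB : modulus ((1 - xk z / N%:R) ^+ d) <= B.
    by rewrite le_max modulusX; apply/orP; right; rewrite lerXn2r ?nnegrE ?modulus_ge0.
  rewrite [(d * k)%N]mulnC.
  rewrite (le_trans (modulus_expr_dist k tB wB))// /K3.
  have -> : k%:R * K2 * B ^+ k.-1 * modulus (xk z) ^+ e =
    k%:R * (K2 * modulus (xk z) ^+ e) * B ^+ k.-1 by ring.
  by rewrite ler_wpM2r ?exprn_ge0// ler_wpM2l.
have i4 := h4 _ _ (le_lt_trans xu ur4) T3.
have K1K : K1 <= K by rewrite /K -addrA lerDl addr_ge0.
have K2K : K2 <= K by rewrite /K; lra.
have K4K : K4 <= K by rewrite /K; lra.
have xn0 : xk z != 0 by rewrite -modulus_gt0 modulusX exprn_gt0.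
have v0 : vz z != 0 by rewrite invr_neq0.
have e0 : (0 < e)%N by case/andP: e13 => /ltnW.
split => //.
- by rewrite coord_prod_step// mulf_neq0// -modulus_gt0.
- by move=> j; rewrite (le_trans (f1 j))// ler_wpM2r ?exprn_ge0.
- by rewrite (le_trans t2)// ler_wpM2r ?exprn_ge0.
rewrite fatou_v_step//.
have -> : vz z / total_factor z ^+ k - vz z - 1 - fatou_c * xk z =
   vz z * ((total_factor z ^+ k)^-1 - (1 + xk z + fatou_c * xk z ^+ 2)).
  rewrite -(fatou_vK z); by field; rewrite ?v0 ?expf_neq0.
rewrite modulusM (le_trans (ler_wpM2l (modulus_ge0 _) i4))//.
rewrite -[modulus (vz z)]invrK -modulus_xk.
rewrite -(prednK e0) exprS /= mulrCA mulKf ?gt_eqF ?modulus_gt0//.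
by rewrite ler_wpM2r ?exprn_ge0.
Qed.

End LocalStep.

Lemma cone_translate (R : realType) (re im re' im' T m : R) : 0 < T -> 0 < re -> `|im| < T * re ->
  m <= 2^-1 -> m * (1 + T) <= T -> `|re' - re - 1| <= m -> `|im' - im| <= m ->
  re + 2^-1 <= re' /\ `|im'| < T * re'.
Proof.
move=> T0 re0 h1 m1 m2; rewrite ler_norml => /andP[h2 _] h3.
have re1 : re + 2^-1 <= re' by lra.
split=> //; have := ler_normD (im' - im) im; rewrite subrK.
have : T * (re + 1 - m) <= T * re' by rewrite ler_pM2l//; lra.
by lra.
Qed.

Lemma small_relative_error (R : realType) (K T q x : R) : 0 < K -> 0 < T -> 0 < q -> 0 <= x ->
  x * (2 * K + K * (1 + T) / T + 4 * q * K) < 1 ->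
  [/\ K * x <= 2^-1, K * x * (1 + T) <= T & K * x <= (4 * q)^-1].
Proof.
move=> K0 T0 q0 x0; rewrite (mulrDr x) (mulrDr x).
have i1 : 0 <= x * (2 * K) by rewrite !mulr_ge0// ltW.
have i2 : 0 <= x * (K * (1 + T) / T).
  by rewrite mulr_ge0// divr_ge0 ?mulr_ge0 ?addr_ge0 ?(ltW K0) ?(ltW T0).
have i3 : 0 <= x * (4 * q * K) by rewrite !mulr_ge0 ?(ltW q0) ?(ltW K0).
move=> h; split; first by lra.
  have : x * (K * (1 + T) / T) <= 1 by lra.
  by rewrite !mulrA ler_pdivrMr// mul1r [x * K]mulrC.
by rewrite -[leRHS]mul1r ler_pdivlMr ?mulr_gt0//; lra.
Qed.

(** * Forward invariance of the regions B_h *)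

Section Invariance.
Variables (R : realType) (d k l : nat).
Local Notation C := (Cplx R).
Local Notation Cd := 'rV[C]_d.
Local Notation N := (k * d)%N.
Variables (F : Cd -> Cd) (lam : 'I_d -> C).
Hypotheses (d0 : (0 < d)%N) (k0 : (0 < k)%N).
Hypotheses (lam1 : forall j, modulus (lam j) = 1) (plam : \prod_j lam j = 1).
Hypothesis OF : forall j, eqO l (fun z => F z 0 j)
  (fun z => lam j * z 0 j * (1 - coord_prod z ^+ k / N%:R)).
Implicit Types (z : Cd) (beta theta r : R).

Local Notation au z := (modulus (coord_prod z)).
Local Notation xk z := (coord_prod z ^+ k).
Local Notation vz z := (fatou_v k (coord_prod z)).
Local Notation mx z := (modulus (coord_prod z ^+ k)).
Local Notation fac := (factor F lam).
Local Notation tfac := (total_factor F lam).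

Let kR0 : 0 < k%:R :> R. Proof. by rewrite ltr0n. Qed.
Let dR0 : 0 < d%:R :> R. Proof. by rewrite ltr0n. Qed.
Let NR0 : 0 < N%:R :> R. Proof. by rewrite ltr0n muln_gt0 k0. Qed.

(** From 1 + y <= expR y, used once for the power and once in the form ln t >= 1 - 1/t. *)
Lemma powR_ge_tangent (t b : R) : 0 < t -> 0 <= b -> 1 + b * (1 - t^-1) <= t `^ b.
Proof.
move=> t0 b0; rewrite /powR gt_eqF//.
rewrite (le_trans _ (expR_ge1Dx _))// lerD2l ler_wpM2l//.
have := expR_ge1Dx (ln t^-1); rewrite lnK ?posrE ?invr_gt0// lnV ?posrE//.
by lra.
Qed.

Lemma modulus_1sub_le (w : C) : modulus (1 - w) <= 1 - Re w + modulus w ^+ 2.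
Proof.
have h := sqr_modulus (1 - w); have h2 := sqr_modulus w.
move: h; rewrite ReB ImB (_ : Re (1 : C) = 1)// (_ : Im (1 : C) = 0)// => h.
by rewrite h2; have := modulus_ge0 (1 - w); nra.
Qed.

Lemma step_order2 beta : 0 < beta -> 2 * k%:R + 1 <= beta * (l%:R + d%:R - 1) ->
  exists K r : R, [/\ 0 < K, 0 < r <= 1 & forall z, W_region beta z -> au z < r ->
    [/\ 0 < au z /\ coord_prod (F z) != 0,
        forall j, modulus (fac z j - (1 - xk z / N%:R)) <= K * mx z ^+ 2,
        modulus (tfac z - (1 - xk z / k%:R)) <= K * mx z ^+ 2,
        modulus (tfac z - 1) <= K * mx z &
        modulus (vz (F z) - vz z - 1) <= K * mx z]].
Proof.
move=> b0 be; have [K [r [K0 r01 h]]] := step_expansion d0 k0 lam1 plam OF b0 (isT : 1 < 2 <= 3)%N be.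
have [q qE] := @expr_1subX R (N%:R^-1 : C) d.
have [Q Q0 hQ] := horner_bound q.
pose m2 := modulus ('C(d, 2)%:R * N%:R^-1 ^+ 2 : C).
pose mc := modulus (fatou_c R d k).
have m20 : 0 <= m2 by exact: modulus_ge0.
have mc0 : 0 <= mc by exact: modulus_ge0.
pose K' := K + m2 + Q + 1 + mc.
have K'0 : 0 < K' by rewrite /K'; lra.
exists K', r; split => // z Wz ur; have [u0 u'0 h1 h2 h3] := h z Wz ur.
have u1 : au z <= 1 by rewrite ltW// (lt_le_trans ur)//; case/andP: r01.
have x1 : mx z <= 1 by rewrite modulusX exprn_ile1 ?modulus_ge0.
have x0 : 0 <= mx z by exact: modulus_ge0.
have x2 : mx z ^+ 2 <= mx z by rewrite expr2 ler_piMr.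
have dx (x : C) : (1 - x / N%:R) ^+ d - (1 - x / k%:R) =
    'C(d, 2)%:R * N%:R^-1 ^+ 2 * x ^+ 2 + x ^+ 3 * q.[x].
  have := congr1 (fun p : {poly C} => p.[x]) qE.
  rewrite horner_exp !(hornerD, hornerN, hornerZ, hornerX, hornerXn, hornerM, hornerC).
  rewrite [_^-1 * x]mulrC => ->.
  have -> : d%:R / N%:R * x = x / k%:R.
    by rewrite natrM; field; rewrite !pnatr_eq0 -!lt0n k0 d0.
  by ring.
have h4 : modulus (tfac z - (1 - xk z / k%:R)) <= (K + m2 + Q) * mx z ^+ 2.
  have -> : tfac z - (1 - xk z / k%:R) = (tfac z - (1 - xk z / N%:R) ^+ d) +
     ((1 - xk z / N%:R) ^+ d - (1 - xk z / k%:R)) by ring.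
  rewrite (le_trans (modulusD _ _))// -addrA [leRHS]mulrDl lerD// dx.
  rewrite (le_trans (modulusD _ _))// [leRHS]mulrDl lerD//.
    by rewrite modulusM [modulus (xk z ^+ 2)]modulusX.
  rewrite modulusM mulrC [modulus (xk z ^+ 3)]modulusX.
  apply: ler_pM; rewrite ?modulus_ge0 ?exprn_ge0 ?hQ//.
  by rewrite exprS ler_piMl// exprn_ge0.
have h5 : modulus (xk z / k%:R) <= mx z.
  by rewrite modulusM modulusV modulus_nat ler_piMr// invf_le1// ler1n.
split => //.
- by move=> j; rewrite (le_trans (h1 j))// ler_wpM2r ?exprn_ge0// /K'; lra.
- by rewrite (le_trans h4)// ler_wpM2r ?exprn_ge0// /K'; lra.
- have -> : tfac z - 1 = (tfac z - (1 - xk z / k%:R)) - xk z / k%:R by ring.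
  rewrite (le_trans (modulusB _ _))// (le_trans (lerD h4 h5))//.
  have : (K + m2 + Q) * mx z ^+ 2 <= (K + m2 + Q) * mx z by rewrite ler_wpM2l// !addr_ge0// ltW.
  have : 0 <= mc * mx z by rewrite mulr_ge0.
  by rewrite /K'; lra.
have -> : vz (F z) - vz z - 1 = (vz (F z) - vz z - 1 - fatou_c R d k * xk z) +
  fatou_c R d k * xk z by ring.
rewrite (le_trans (modulusD _ _))// modulusM (le_trans (lerD h3 (lexx _)))//= expr1.
rewrite -mulrDl ler_wpM2r// /K' -/mc; lra.
Qed.

Lemma mx_lt (rho : R) z : 0 <= rho -> mx z < rho ^+ k -> au z < rho.
Proof. by move=> r0; rewrite modulusX ltr_pXn2r// nnegrE modulus_ge0. Qed.

Lemma Re_cone_le (v : C) (T : R) : 0 < Re v -> `|Im v| <= T * Re v ->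
  modulus v <= (1 + T) * Re v.
Proof.
move=> v0 vT; rewrite (le_trans (modulus_le_ReIm _))// gtr0_norm//.
by lra.
Qed.

Lemma Re_inv_cone (v : C) (T : R) : 0 < T -> 0 < Re v -> `|Im v| <= T * Re v ->
  (modulus v)^-1 / (1 + T) <= Re v^-1.
Proof.
move=> T0 v0 vT; rewrite Re_inv.
have m0 : 0 < modulus v by exact: lt_le_trans v0 (le_trans (ler_norm _) (Re_le_modulus _)).
rewrite -invfM ler_pdivlMr ?exprn_gt0// mulrC ler_pdivrMr ?mulr_gt0//; last by lra.
by rewrite mulrCA expr2 ler_pM2l// mulrC Re_cone_le.
Qed.

(** A coordinate is multiplied by a modulus 1 - Re x / (k d) + O(|x|^2), and |u|^beta by at least 1
    - beta Re x / k - O(|x|^2). Since beta < 1/d the former decreases faster, by g Re x to first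
    order; in the cone Re x >= |x| / (1 + T), so this gain beats the quadratic errors when x is
    small. *)
Lemma W_step beta (T : R) : 0 < beta < d%:R^-1 ->
  2 * k%:R + 1 <= beta * (l%:R + d%:R - 1) -> 0 < T ->
  exists2 r : R, 0 < r & forall z, W_region beta z -> mx z < r ->
    0 < Re (vz z) -> `|Im (vz z)| <= T * Re (vz z) -> W_region beta (F z).
Proof.
move=> /andP[b0 bd] be T0; have [K [rho [K0 /andP[rho0 rho1] h]]] := step_order2 b0 be.
have b1 : beta <= 1.
  by rewrite ltW// (lt_le_trans bd)// invf_le1// ler1n.
pose g := N%:R^-1 - beta / k%:R.
have g0 : 0 < g.
  rewrite /g subr_gt0 natrM invfM [ltRHS]mulrC ltr_pM2r ?invr_gt0//.
pose kap := (1 + T)^-1; have kap0 : 0 < kap by rewrite invr_gt0; lra.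
pose B := (1 + K) + K + 2 * (1 + K) ^+ 2.
have B0 : 0 < B by rewrite /B ltr_wpDr ?mulr_ge0 ?exprn_ge0//; lra.
pose r := Num.min (Num.min (rho ^+ k) (kap * g / B)) (2 * (1 + K))^-1.
have r0 : 0 < r.
  by rewrite !lt_min exprn_gt0//= divr_gt0 ?mulr_gt0//= invr_gt0; lra.
exists r => // z Wz; rewrite !lt_min => /andP[/andP[x1 x2] x3] v0 vT.
have ur : au z < rho by apply: mx_lt => //; exact: ltW.
have [[u0 u'0] hf hM hM1 _] := h z Wz ur.
have x0 : 0 <= mx z by exact: modulus_ge0.
have xv : (vz z)^-1 = xk z by exact: invrK.
pose a := Re (xk z).
have aX : kap * mx z <= a.
  have := Re_inv_cone T0 v0 vT; rewrite xv -modulusV xv mulrC.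
  by [].
have aX2 : a <= mx z by rewrite (le_trans (ler_norm _))// Re_le_modulus.
have {}x3 : (1 + K) * mx z <= 2^-1.
  move: x3; rewrite -[ltRHS]mul1r ltr_pdivlMr; last by lra.
  lra.
have {}x2 : mx z * B <= kap * g by rewrite -ler_pdivlMr// ltW.
have N1 : N%:R^-1 <= 1 :> R by rewrite invf_le1// ler1n muln_gt0 k0.
have k1 : k%:R^-1 <= 1 :> R by rewrite invf_le1// ler1n.
have reN (m : nat) (x : C) : Re (x / m%:R) = Re x / m%:R.
  have -> : (m%:R : C) = ofR m%:R by rewrite ofR_nat.
  by rewrite -ofRV mulrC Re_ofRM mulrC.
have F1 j : modulus (fac z j) <= 1 - a / N%:R + (1 + K) * mx z ^+ 2.
  have -> : fac z j = (1 - xk z / N%:R) + (fac z j - (1 - xk z / N%:R)) by ring.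
  rewrite (le_trans (modulusD _ _))// mulrDl mul1r addrA lerD//.
  rewrite (le_trans (modulus_1sub_le _))// reN lerD2l lerXn2r ?nnegrE ?modulus_ge0//.
  by rewrite modulusM modulusV modulus_nat ler_piMr.
pose del := a / k%:R + K * mx z ^+ 2.
have a0 : 0 <= a by rewrite (le_trans _ aX)// mulr_ge0// ltW.
have del0 : 0 <= del.
  by rewrite addr_ge0 ?mulr_ge0 ?exprn_ge0// ?invr_ge0 ltW.
have x1' : mx z <= 1.
  rewrite (le_trans (y := (1 + K) * mx z))//; first by rewrite ler_peMl// lerDl ltW.
  by rewrite (le_trans x3)// invf_le1// ler1n.
have xx : mx z ^+ 2 <= mx z by rewrite expr2 ler_piMr.
have del1 : del <= (1 + K) * mx z.
  rewrite mulrDl mul1r lerD//; first by rewrite (le_trans _ aX2)// ler_piMr.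
  by rewrite ler_wpM2l// ltW.
have M1 : 1 - del <= modulus (tfac z).
  have := Re_le_modulus (tfac z - (1 - xk z / k%:R)).
  rewrite ReB ReB reN (_ : Re (1 : C) = 1)// -/a => /le_trans/(_ hM).
  rewrite ler_norml => /andP[h1 _].
  rewrite (le_trans _ (le_trans (ler_norm _) (Re_le_modulus _)))//.
  by rewrite /del opprD addrA -lerBrDl.
have t0 : 0 < 1 - del by rewrite subr_gt0 (le_lt_trans (le_trans del1 x3))// invf_lt1// ltr1n.
have Mb : 1 - beta * del - 2 * del ^+ 2 <= modulus (tfac z) `^ beta.
  rewrite (@le_trans _ _ ((1 - del) `^ beta))//; last first.
    by rewrite ge0_ler_powR ?nnegrE ?modulus_ge0// ltW.
  rewrite (le_trans _ (powR_ge_tangent t0 (ltW b0)))//.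
  have -> : beta * (1 - (1 - del)^-1) = - (beta * (del / (1 - del))).
    by field; rewrite gt_eqF.
  have h1 : del / (1 - del) <= del + 2 * del ^+ 2.
    rewrite ler_pdivrMr// -subr_ge0.
    have -> : (del + 2 * del ^+ 2) * (1 - del) - del = del ^+ 2 * (1 - 2 * del) by ring.
    rewrite mulr_ge0 ?exprn_ge0// subr_ge0 -ler_pdivlMl// mulr1.
    exact: le_trans del1 x3.
  have h2 : 0 <= (1 - beta) * del ^+ 2 by rewrite mulr_ge0 ?exprn_ge0// subr_ge0.
  have h3 : beta * (del / (1 - del)) <= beta * (del + 2 * del ^+ 2) by rewrite ler_wpM2l// ltW.
  by move: h2 h3; generalize (beta * (del / (1 - del))); lra_goal.
have FM j : modulus (fac z j) <= modulus (tfac z) `^ beta.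
  rewrite (le_trans (F1 j))// (le_trans _ Mb)//.
  have e1 : del ^+ 2 <= (1 + K) ^+ 2 * mx z ^+ 2.
    by rewrite -exprMn lerXn2r ?nnegrE// mulr_ge0// addr_ge0// ltW.
  have e2 : beta * del <= beta * a / k%:R + K * mx z ^+ 2.
    have : beta * (K * mx z ^+ 2) <= K * mx z ^+ 2.
      by rewrite ler_piMl// mulr_ge0 ?exprn_ge0// ltW.
    by move=> e; rewrite /del mulrDr [beta * (a / _)]mulrA lerD2l.
  have e3 : B * mx z ^+ 2 <= a * g.
    rewrite expr2 mulrA [B * _]mulrC (le_trans (ler_wpM2r x0 x2))//.
    by rewrite mulrAC ler_wpM2r// ltW.
  have e4 : a * g = a / N%:R - beta * a / k%:R by rewrite /g; ring.
  by move: e1 e2 e3; rewrite e4 /B; generalize (modulus (coord_prod z ^+ k)) (del ^+ 2) (beta * del);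
    lra_goal.
move=> j; rewrite (coord_prod_step F lam1 plam)// modulusM powRM ?modulus_ge0//.
have zj0 : z 0 j != 0 by exact: coord_neq0.
have lj0 : lam j != 0 by rewrite -modulus_gt0 lam1 ltr01.
have -> : F z 0 j = lam j * z 0 j * fac z j.
  by rewrite /factor mulrC divfK// mulf_neq0.
rewrite modulusM modulusM lam1 mul1r.
rewrite (@le_lt_trans _ _ (modulus (z 0 j) * modulus (tfac z) `^ beta))//.
  by rewrite ler_wpM2l// modulus_ge0.
rewrite ltr_pM2r ?Wz// powR_gt0// (lt_le_trans t0)//.
Qed.

(** The step v' = v + 1 + O(1/v) pushes v further into the cone, and [sector_step] keeps the branch
    of the argument. The threshold r1 only has to make 1/v small, whence its uniformity in h and in
    r >= r1. *)
Lemma B_region_step theta beta : admissible_exponents d k l theta beta ->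
  exists2 r1 : R, 0 < r1 & forall h r z, r1 <= r -> B_region k h r theta beta z ->
    B_region k h r theta beta (F z) /\ Re (vz z) + 2^-1 <= Re (vz (F z)).
Proof.
move=> [/andP[t0 tpi] b01 be]; have b0 : 0 < beta by case/andP: b01.
pose T := tan (k%:R * theta).
have kt : 0 < k%:R * theta < pi / 2.
  rewrite mulr_gt0//= (_ : pi / 2 = k%:R * (pi / (2 * k%:R))) ?ltr_pM2l//.
  by field; rewrite pnatr_eq0 -lt0n.
have T0 : 0 < T by exact: tan_gt0.
have be' := ltW be.
have [K [rho [K0 /andP[rho0 rho1] hs]]] := step_order2 b0 be'.
have [r2 r20 hW] := W_step b01 be' T0.
pose B := 2 * K + K * (1 + T) / T + 4 * k%:R * K.
have B0 : 0 < B.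
  have T1 : 0 < 1 + T by lra.
  have B1 : 0 < K * (1 + T) / T by apply: divr_gt0 => //; exact: mulr_gt0.
  have B2 : 0 < k%:R * K by exact: mulr_gt0.
  by rewrite /B; lra.
pose eta := Num.min (Num.min r2 (rho ^+ k)) B^-1.
have eta0 : 0 < eta by rewrite !lt_min r20 exprn_gt0//= invr_gt0.
exists eta^-1; first by rewrite invr_gt0.
move=> h r z rr [Wz Sz].
have r0 : 0 < r by rewrite (lt_le_trans _ rr)// invr_gt0.
have [u0 rv sz] := (S_regionP k0 h theta (coord_prod z) r0).1 Sz.
have [v0 av] := sector_argr k0 u0 (ltW tpi) sz.
have Tv : `|Im (vz z)| < T * Re (vz z) by rewrite -argr_lt_tan.
have xeta : mx z < eta.
  rewrite -[mx z]invrK -modulusV -/(fatou_v k _) -[eta]invrK ltf_pV2 ?posrE ?invr_gt0//.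
    rewrite (le_lt_trans rr)// (lt_le_trans rv)//.
    exact: le_trans (ler_norm _) (Re_le_modulus _).
  by rewrite modulus_gt0 invr_neq0// expf_neq0.
have [x2 x3 xB] : [/\ mx z < r2, mx z < rho ^+ k & mx z < B^-1].
  by move: xeta; rewrite !lt_min => /andP[/andP[-> ->] ->].
have ur : au z < rho by apply: mx_lt => //; exact: ltW.
have [[au0 u'0] _ _ hM hv] := hs z Wz ur.
have x0 : 0 <= mx z by exact: modulus_ge0.
have XB : mx z * B < 1 by rewrite -ltr_pdivlMr// mul1r.
have [j1 j2 j3] := small_relative_error K0 T0 kR0 x0 XB.
have re1 := le_trans (Re_le_modulus _) hv; have im1 := le_trans (Im_le_modulus _) hv.
rewrite !ReB (_ : Re (1 : C) = 1)// in re1.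
rewrite !ImB (_ : Im (1 : C) = 0)// subr0 in im1.
have [re2 Tv'] := cone_translate T0 v0 Tv j1 j2 re1 im1.
have v'0 : 0 < Re (vz (F z)) by rewrite (lt_le_trans _ re2)// addr_gt0.
split=> //; split; first exact: (hW z Wz x2 v0 (ltW Tv)).
apply/(S_regionP k0 h theta _ r0); split => //.
  by rewrite (lt_le_trans rv)// (le_trans _ re2)// lerDl.
rewrite (coord_prod_step F lam1 plam)//.
apply: (sector_step k0 u0 (ltW tpi) sz).
- exact: le_trans hM j3.
- by rewrite -(coord_prod_step F lam1 plam).
- rewrite -(coord_prod_step F lam1 plam)// argr_lt_tan//.
Qed.

Lemma B_region_iter theta beta : admissible_exponents d k l theta beta ->
  exists2 r1 : R, 0 < r1 & forall h r z, r1 <= r -> B_region k h r theta beta z ->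
    forall n, B_region k h r theta beta (iter n F z) /\
      n%:R / 2 <= Re (vz (iter n F z)).
Proof.
move=> /B_region_step[r1 r10 hr]; exists r1 => // h r z rr Bz n.
have r0 : 0 < r by exact: lt_le_trans rr.
elim: n => [|n [Bn vn]].
  split => //; rewrite mul0r.
  have [_ /(S_regionP k0 h theta _ r0)[_ rv _]] := Bz.
  by rewrite ltW// (lt_trans r0).
have [Bn' vn'] := hr h r _ rr Bn.
by split => //=; rewrite (le_trans _ vn')// -natr1 mulrDl mul1r lerD2r.
Qed.

Lemma W_uniform_small beta (e : R) : 0 < beta -> 0 < e ->
  exists2 N0 : R, 0 < N0 & forall z, W_region beta z -> N0 < modulus (vz z) ->
    vnorm z < e.
Proof.
move=> b0 e0; have [r /andP[r0 _] hr] := powR_lt_threshold e0 b0.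
exists (r ^- k); first by rewrite invr_gt0 exprn_gt0.
move=> z Wz vr; have u0 := W_coord_prod_gt0 d0 b0 Wz.
rewrite (le_lt_trans (W_vnorm_le Wz))// hr// ?modulus_ge0//.
apply: mx_lt; first exact: ltW.
rewrite -[mx z]invrK -modulusV -/(fatou_v k _) invf_plt ?posrE ?exprn_gt0//.
by rewrite modulus_gt0 invr_neq0// expf_neq0// -modulus_gt0.
Qed.

End Invariance.

(** A bound on the infinite product of the factors 1 + B / n^2: the quantity a n * expR (B / (n -
    1)) does not increase, because 1/n^2 + 1/n <= 1/(n - 1). *)
Lemma growth_bounded (R : realType) (a : nat -> R) (B : R) (n0 : nat) :
  0 <= B -> (2 <= n0)%N -> (forall n, (n0 <= n)%N -> 0 <= a n) ->
  (forall n, (n0 <= n)%N -> a n.+1 <= a n * (1 + B / n%:R ^+ 2)) ->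
  forall n, (n0 <= n)%N -> a n <= a n0 * expR B.
Proof.
move=> B0 n02 a0 aS n n0n.
pose t m : R := (n0 + m)%:R.
have t2 m : 2 <= t m by rewrite ler_nat (leq_trans n02)// leq_addr.
have key m : a (n0 + m)%N * expR (B / (t m - 1)) <= a n0 * expR (B / (t 0 - 1)).
  elim: m => [|m ih]; first by rewrite addn0.
  rewrite (le_trans _ ih)// addnS.
  have -> : t m.+1 - 1 = t m by rewrite /t addnS -natr1 addrK.
  have h0 := a0 _ (leq_addr m n0); have h1 := aS _ (leq_addr m n0).
  rewrite (le_trans (ler_wpM2r (expR_ge0 _) h1))// -mulrA ler_wpM2l//.
  rewrite (le_trans (ler_wpM2r (expR_ge0 _) (expR_ge1Dx _)))// -expRD ler_expR.
  rewrite -/(t m) -mulrDr ler_wpM2l//.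
  have := t2 m; set x := t m => x2.
  rewrite -subr_ge0.
  have -> : (x - 1)^-1 - (x ^- 2 + x^-1) = (x ^+ 2 * (x - 1))^-1.
    by field; apply/andP; split; lra.
  by rewrite invr_ge0 mulr_ge0 ?exprn_ge0//; lra.
have := key (n - n0)%N; rewrite subnKC// => h.
have m1 : 0 <= (t (n - n0)%N - 1) by have := t2 (n - n0)%N; lra.
have e1 : 1 <= expR (B / (t (n - n0)%N - 1)) 
  by rewrite (le_trans _ (expR_ge1Dx _))// lerDl divr_ge0.
rewrite (@le_trans _ _ (a n * expR (B / (t (n - n0)%N - 1))))//.
  by rewrite ler_peMr// a0.
rewrite (le_trans h)// ler_wpM2l ?a0// ler_expR ler_piMr// invf_le1.
  by have := t2 0; lra.
by have := t2 0; lra.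
Qed.

(** * Asymptotics of orbits in W(beta) *)

Section Orbit.
Variables (R : realType) (d k l : nat).
Local Notation C := (Cplx R).
Local Notation Cd := 'rV[C]_d.
Local Notation N := (k * d)%N.
Variables (F : Cd -> Cd) (lam : 'I_d -> C).
Hypotheses (d0 : (0 < d)%N) (k0 : (0 < k)%N).
Hypotheses (lam1 : forall j, modulus (lam j) = 1) (plam : \prod_j lam j = 1).
Hypothesis OF : forall j, eqO l (fun z => F z 0 j)
  (fun z => lam j * z 0 j * (1 - coord_prod z ^+ k / N%:R)).

Local Notation au z := (modulus (coord_prod z)).
Local Notation xk z := (coord_prod z ^+ k).
Local Notation vz z := (fatou_v k (coord_prod z)).
Local Notation mx z := (modulus (coord_prod z ^+ k)).
Local Notation fac := (factor F lam).
Local Notation tfac := (total_factor F lam).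

Lemma modulus_vz (z : Cd) : modulus (vz z) = (mx z)^-1.
Proof. exact: modulusV. Qed.

(** The d-th power of the factor of z_j and the factor of u have the same expansion up to O(x^2). As
    x is of size 1/n along an orbit, these errors are summable. *)
Lemma ratio_step beta : 0 < beta -> 2 * k%:R + 1 <= beta * (l%:R + d%:R - 1) ->
  exists K r : R, [/\ 0 <= K, 0 < r & forall z, W_region beta z -> au z < r ->
    forall j, modulus (F z 0 j) ^+ d / au (F z) <=
      modulus (z 0 j) ^+ d / au z * (1 + K * mx z ^+ 2)].
Proof.
move=> b0 be.
have [K [r [K0 /andP[r0 r1] h]]] := step_expansion d0 k0 lam1 plam OF b0 (isT : 1 < 2 <= 3)%N be.
pose A := 2 + K; have A0 : 0 <= A by rewrite /A; lra.
have [K1 [r' [K10 /andP[r'0 _] h1]]] := step_order2 d0 k0 lam1 plam OF b0 be.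
pose K2 := d%:R * K * A ^+ d.-1 + K.
have K20 : 0 <= K2 by rewrite addr_ge0// ?mulr_ge0 ?exprn_ge0// ltW.
pose s := (2 * K1)^-1; have s0 : 0 < s by rewrite invr_gt0 mulr_gt0.
exists (2 * K2), (Num.min (Num.min r r') s); split; first by rewrite mulr_ge0.
  by rewrite !lt_min r0 r'0 s0.
move=> z Wz; rewrite !lt_min => /andP[/andP[ur ur'] us] j.
have [u0 u'0 hf hM _] := h z Wz ur; have [_ _ _ hM1 _] := h1 z Wz ur'.
have u1 : au z <= 1 by rewrite ltW// (lt_le_trans ur).
have x1 : mx z <= 1 by rewrite modulusX exprn_ile1 ?modulus_ge0.
have x0 : 0 <= mx z by exact: modulus_ge0.
have xu : mx z <= au z.
  by case: (k) k0 => // n _; rewrite modulusX exprS ler_piMr ?exprn_ile1 ?modulus_ge0.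
have M2 : 2^-1 <= modulus (tfac z).
  have h2 : K1 * mx z <= 2^-1.
    rewrite (le_trans (ler_wpM2l (ltW K10) (le_trans xu (ltW us))))// /s.
    by rewrite invfM mulrCA mulfV ?gt_eqF// mulr1.
  have := modulus_lower 1 (tfac z - 1); rewrite modulus1 subrKC.
  by move=> h3; have := le_trans hM1 h2; lra.
have w2 : modulus (1 - xk z / N%:R) <= 2.
  rewrite (le_trans (modulusB _ _))// modulus1 -[2]/(1 + 1) lerD2l.
  by rewrite (le_trans (modulus_div_N _ _ _)).
have wA : modulus (1 - xk z / N%:R) <= A by rewrite (le_trans w2)// /A lerDl ltW.
have fA : modulus (fac z j) <= A.
  have -> : fac z j = (1 - xk z / N%:R) + (fac z j - (1 - xk z / N%:R)) by ring.
  rewrite (le_trans (modulusD _ _))// /A lerD// (le_trans (hf j))//.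
  by rewrite ler_piMr ?exprn_ile1// ltW.
have fM : modulus (fac z j ^+ d) <= modulus (tfac z) + K2 * mx z ^+ 2.
  have -> : fac z j ^+ d = tfac z + ((fac z j ^+ d - (1 - xk z / N%:R) ^+ d) -
    (tfac z - (1 - xk z / N%:R) ^+ d)) by ring.
  rewrite (le_trans (modulusD _ _))// lerD2l (le_trans (modulusB _ _))//.
  rewrite /K2 mulrDl lerD// (le_trans (modulus_expr_dist d fA wA))//.
  have -> : d%:R * K * A ^+ d.-1 * mx z ^+ 2 = d%:R * (K * mx z ^+ 2) * A ^+ d.-1 by ring.
  by rewrite ler_wpM2r ?exprn_ge0// ler_wpM2l.
have Mp : 0 < modulus (tfac z) by rewrite (lt_le_trans _ M2)// invr_gt0.
rewrite (coord_prod_step F lam1 plam)// modulusM.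
have zj0 : z 0 j != 0 by exact: coord_neq0.
have lj0 : lam j != 0 by rewrite -modulus_gt0 lam1 ltr01.
have -> : F z 0 j = lam j * z 0 j * fac z j.
  by rewrite /factor mulrC divfK// mulf_neq0.
rewrite modulusM modulusM lam1 mul1r exprMn.
have zd : 0 <= modulus (z 0 j) ^+ d / au z by rewrite divr_ge0 ?exprn_ge0 ?modulus_ge0.
have -> : modulus (z 0 j) ^+ d * modulus (fac z j) ^+ d / (au z * modulus (tfac z)) =
  modulus (z 0 j) ^+ d / au z * (modulus (fac z j) ^+ d / modulus (tfac z)).
  by field; rewrite !gt_eqF.
rewrite ler_wpM2l// ler_pdivrMr// -modulusX (le_trans fM)// [leRHS]mulrDl mul1r lerD2l.
have : 0 <= K2 * mx z ^+ 2 by rewrite mulr_ge0 ?exprn_ge0.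
have -> : 2 * K2 * mx z ^+ 2 * modulus (tfac z) = K2 * mx z ^+ 2 * (2 * modulus (tfac z)) by ring.
by move=> h2; rewrite ler_peMr//; lra.
Qed.

Variables (z : nat -> Cd) (beta : R).
Hypothesis zS : forall n, z n.+1 = F (z n).
Hypothesis Wz : forall n, W_region beta (z n).
Hypotheses (b0 : 0 < beta) (be : 2 * k%:R + 1 <= beta * (l%:R + d%:R - 1)).
Hypothesis z_cvg : forall e : R, 0 < e -> exists n0, forall n, (n0 <= n)%N -> mx (z n) < e.

Lemma orbit_au_gt0 n : 0 < au (z n).
Proof. exact: W_coord_prod_gt0 (Wz n). Qed.

Lemma orbit_mx_gt0 n : 0 < mx (z n).
Proof. by rewrite modulusX exprn_gt0// orbit_au_gt0. Qed.

Lemma orbit_au_small (e : R) : 0 < e -> exists n0, forall n, (n0 <= n)%N -> au (z n) < e.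
Proof.
move=> e0; have [n0 h] := z_cvg (exprn_gt0 k e0).
by exists n0 => n /h; apply: mx_lt => //; exact: ltW.
Qed.

(** From some index on each increment of v is within e/2 of 1; the other e/2 absorbs the initial
    segment. *)
Lemma orbit_fatou_v (e : R) : 0 < e -> exists n0, forall n, (n0 <= n)%N ->
  modulus (vz (z n) - n%:R) <= e * n%:R.
Proof.
move=> e0; have [K [r [K0 /andP[r0 _] h]]] := step_order2 d0 k0 lam1 plam OF b0 be.
have e2 : 0 < e / 2 by rewrite divr_gt0.
have [n1 hn1] := orbit_au_small r0.
have [n2 hn2] := z_cvg (divr_gt0 e2 K0).
pose n3 := maxn n1 n2.
have step m : modulus (vz (z (n3 + m)%N) - vz (z n3) - m%:R) <= e / 2 * m%:R.
  elim: m => [|m ih]; first by rewrite addn0 subrr subr0 modulus0 mulr0.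
  have n1m : (n1 <= n3 + m)%N by apply: leq_trans (leq_addr _ _); exact: leq_maxl.
  have n2m : (n2 <= n3 + m)%N by apply: leq_trans (leq_addr _ _); exact: leq_maxr.
  have [_ _ _ _ hv] := h _ (Wz _) (hn1 _ n1m).
  have hx := hn2 _ n2m; rewrite ltr_pdivlMr// mulrC in hx.
  have -> : vz (z (n3 + m.+1)%N) - vz (z n3) - m.+1%:R =
    (vz (F (z (n3 + m)%N)) - vz (z (n3 + m)%N) - 1) + (vz (z (n3 + m)%N) - vz (z n3) - m%:R).
    by rewrite addnS zS -natr1; ring.
  have eS : e / 2 * m.+1%:R = e / 2 + e / 2 * m%:R by rewrite -natr1; ring.
  rewrite (le_trans (modulusD _ _))// eS lerD//.
  exact: le_trans hv (ltW hx).
pose A := modulus (vz (z n3)) + n3%:R.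
have A0 : 0 <= A by rewrite addr_ge0 ?modulus_ge0.
exists (n3 + (Num.trunc (A / (e / 2))).+1)%N => n nn.
have n3n : (n3 <= n)%N by rewrite (leq_trans _ nn)// leq_addr.
have hA : A <= e / 2 * n%:R.
  rewrite mulrC -ler_pdivrMr// (le_trans (ltW (truncnS_gt _)))//.
  by rewrite ler_nat (leq_trans _ nn)// leq_addl.
have := step (n - n3)%N; rewrite subnKC// => hs.
have -> : vz (z n) - n%:R = (vz (z n) - vz (z n3) - (n - n3)%:R) + (vz (z n3) - n3%:R).
  by rewrite natrB//; ring.
rewrite (le_trans (modulusD _ _))// [e]splitr mulrDl lerD//.
  rewrite (le_trans hs)// ler_wpM2l ?(ltW e2)// ler_nat leq_subr//.
by rewrite (le_trans (modulusB _ _))// modulus_nat.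
Qed.

Lemma orbit_fatou_v_cone (e : R) : 0 < e <= 1 -> exists n0, forall n, (n0 <= n)%N ->
  [/\ (0 < n)%N, n%:R / 2 <= Re (vz (z n)),
      `|Im (vz (z n))| <= e * Re (vz (z n)) & mx (z n) <= 2 / n%:R].
Proof.
move=> /andP[e0 e1]; have [n0 h] := orbit_fatou_v (divr_gt0 e0 (ltr0n R 2)).
exists (maxn n0 1) => n; rewrite geq_max => /andP[/h hn n1].
have n0R : 0 < n%:R :> R by rewrite ltr0n.
have re := le_trans (Re_le_modulus _) hn; have im := le_trans (Im_le_modulus _) hn.
rewrite ReB ImB in re im.
have nRe : Re (n%:R : C) = n%:R by rewrite -ofR_nat.
have nIm : Im (n%:R : C) = 0 by rewrite -ofR_nat.
rewrite nRe in re; rewrite nIm subr0 in im.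
have re2 : n%:R / 2 <= Re (vz (z n)).
  by move: re; rewrite ler_norml => /andP[re _]; nra.
split => //; first by rewrite (le_trans im)//; nra.
rewrite -[mx _]invrK -modulus_vz -[leRHS]invrK lef_pV2 ?posrE.
- by rewrite invf_div (le_trans re2)// (le_trans (ler_norm _))// Re_le_modulus.
- by rewrite modulus_vz invr_gt0 orbit_mx_gt0.
by rewrite invf_div divr_gt0.
Qed.

(** The upper bound on |z_j|^d / |u| is [ratio_step] iterated. The lower bound follows from it: u is
    the product of the coordinates and the other d - 1 of them are not too large. *)
Lemma orbit_ratio : exists2 D : R, 0 < D & exists n0, forall n, (n0 <= n)%N ->
  forall j, modulus (z n 0 j) ^+ d <= D * au (z n) /\ au (z n) <= D * modulus (z n 0 j) ^+ d.
Proof.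
have [K [r [K0 r0 h]]] := ratio_step b0 be.
have [n1 hn1] := orbit_au_small r0.
have [n2 hn2] := orbit_fatou_v_cone (e := 1) (introT andP (conj ltr01 (lexx _))).
pose n3 := maxn (maxn n1 n2) 2.
have n31 : (n1 <= n3)%N by rewrite /n3 !leq_max leqnn.
have n32 : (n2 <= n3)%N by rewrite /n3 !leq_max leqnn orbT.
pose a j n := modulus (z n 0 j) ^+ d / au (z n).
have a0 j n : 0 <= a j n by rewrite divr_ge0 ?exprn_ge0 ?modulus_ge0.
have aS j n : (n3 <= n)%N -> a j n.+1 <= a j n * (1 + 4 * K / n%:R ^+ 2).
  move=> n3n; have ur := hn1 _ (leq_trans n31 n3n).
  have [nn0 _ _ xn] := hn2 _ (leq_trans n32 n3n).
  have n0R : 0 < n%:R :> R by rewrite ltr0n.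
  rewrite /a zS (le_trans (h _ (Wz n) ur j))// ler_wpM2l ?a0// lerD2l.
  have -> : 4 * K / n%:R ^+ 2 = K * (2 / n%:R) ^+ 2 by field; rewrite gt_eqF.
  by rewrite ler_wpM2l// lerXn2r ?nnegrE ?modulus_ge0// divr_ge0 ?ltW.
have ab j n : (n3 <= n)%N -> a j n <= a j n3 * expR (4 * K).
  apply: growth_bounded => //; first exact: mulr_ge0.
    by rewrite /n3 leq_maxr.
  by move=> m /aS.
pose D0 := 1 + \sum_j a j n3 * expR (4 * K).
have D01 : 1 <= D0 by rewrite lerDl sumr_ge0// => j _; rewrite mulr_ge0 ?expR_ge0.
have up n j : (n3 <= n)%N -> modulus (z n 0 j) ^+ d <= D0 * au (z n).
  move=> n3n; have := ab j n n3n; rewrite ler_pdivrMr ?orbit_au_gt0// => /le_trans; apply.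
  rewrite ler_wpM2r ?modulus_ge0// /D0 (bigD1 j)//= addrCA lerDl addr_ge0//.
  by apply: sumr_ge0 => i _; rewrite mulr_ge0 ?expR_ge0.
exists (D0 ^+ d); first by rewrite exprn_gt0// (lt_le_trans _ D01).
have D0d : D0 <= D0 ^+ d by case: (d) d0 => // m _; rewrite exprS ler_peMr ?exprn_ege1//; lra.
exists n3 => n n3n j; split.
  by rewrite (le_trans (up _ j n3n))// ler_wpM2r ?modulus_ge0.
have u0 := orbit_au_gt0 n.
have e1 : au (z n) ^+ d <= modulus (z n 0 j) ^+ d * (D0 * au (z n)) ^+ d.-1.
  rewrite {1}/coord_prod (bigD1 j)//= modulusM exprMn ler_wpM2l ?exprn_ge0 ?modulus_ge0//.
  rewrite modulus_prod -prodrXl.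
  have -> : (D0 * au (z n)) ^+ d.-1 = \prod_(i < d | i != j) (D0 * au (z n)).
    by rewrite prodr_const cardC1 card_ord.
  by apply: ler_prod => i _; rewrite exprn_ge0 ?modulus_ge0//= up.
rewrite -(@ler_pM2r _ (au (z n) ^+ d.-1)) ?exprn_gt0// -exprS prednK//.
rewrite (le_trans e1)// exprMn [D0 ^+ d * _]mulrC -!mulrA ler_wpM2l ?exprn_ge0 ?modulus_ge0//.
rewrite ler_wpM2r ?exprn_ge0 ?modulus_ge0//.
by rewrite -[in leRHS](prednK d0) exprS ler_peMl// exprn_ge0//; lra.
Qed.

(** As |z_j| is comparable to |u|^(1/d), the orbit enters W(beta') for every beta' < 1/d, whatever
    the beta it started with. *)
Lemma orbit_eventually_W (beta' : R) : 0 < beta' < d%:R^-1 ->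
  exists n0, forall n, (n0 <= n)%N -> W_region beta' (z n).
Proof.
move=> /andP[b'0 b'd]; have [D D0 [n0 h]] := orbit_ratio.
have s0 : 0 < 1 - beta' * d%:R.
  by rewrite subr_gt0 -ltr_pdivlMr ?ltr0n// mul1r.
have [r /andP[r0 _] hr] := powR_lt_threshold (divr_gt0 ltr01 D0) s0.
have [n1 hn1] := orbit_au_small r0.
exists (maxn n0 n1) => n; rewrite geq_max => /andP[/h hn /hn1 ur] j.
have u0 := orbit_au_gt0 n.
rewrite -(@ltr_pXn2r _ d)// ?nnegrE ?modulus_ge0 ?powR_ge0//.
rewrite -[ltRHS]powR_mulrn ?powR_ge0// -powRrM (le_lt_trans (hn j).1)//.
have hr' := hr _ (ltW u0) ur; rewrite ltr_pdivlMr// in hr'.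
have un0 : au (z n) != 0 by rewrite gt_eqF.
have uE : au (z n) = au (z n) `^ (1 - beta' * d%:R) * au (z n) `^ (beta' * d%:R).
  rewrite -powRD; last by rewrite un0 implybT.
  by rewrite subrK powRr1// ltW.
rewrite [X in D * X < _]uE.
by rewrite mulrA [D * _]mulrC gtr_pMl ?powR_gt0.
Qed.

(** Since v_n / n tends to 1, the argument of v_n tends to 0 and its real part to infinity, so any
    angle and radius are reached. The radius is first enlarged to r2, for which the region is known
    to be forward invariant; this fixes h. *)
Lemma orbit_eventually_B theta' beta' (r : R) : admissible_exponents d k l theta' beta' ->
  0 < r -> exists2 h, (h < k)%N &
    exists n0, forall n, (n0 <= n)%N -> B_region k h r theta' beta' (z n).
Proof.
move=> adm r0; have [r1 r10 hr] := B_region_iter d0 k0 lam1 plam OF adm.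
have [/andP[t0 tpi] b'0 _] := adm.
have [n1 hn1] := orbit_eventually_W b'0.
have kR0 : 0 < k%:R :> R by rewrite ltr0n.
have kt : 0 < k%:R * theta' < pi / 2.
  rewrite mulr_gt0//= (_ : pi / 2 = k%:R * (pi / (2 * k%:R))) ?ltr_pM2l//.
  by field; rewrite pnatr_eq0 -lt0n.
have T0 := tan_gt0 kt; set T := tan _ in T0.
pose e := Num.min 1 (T / 2).
have e01 : 0 < e <= 1 by rewrite lt_min ltr01 divr_gt0//= ge_min lexx.
have [n2 hn2] := orbit_fatou_v_cone e01.
pose r2 := Num.max r r1.
have r20 : 0 < r2 by rewrite lt_max r0.
pose n3 := maxn (maxn n1 n2) (Num.trunc (2 * r2)).+1.
have [n31 n32] : (n1 <= n3)%N /\ (n2 <= n3)%N by rewrite /n3 !leq_max !leqnn !orbT.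
have [_ re im _] := hn2 _ n32.
have rr : r2 < Re (vz (z n3)).
  rewrite (lt_le_trans _ re)// ltr_pdivlMr// mulrC (lt_le_trans (truncnS_gt _))//.
  by rewrite ler_nat /n3 leq_max leqnn orbT.
have v0 : 0 < Re (vz (z n3)) by exact: lt_trans rr.
have u0 : coord_prod (z n3) != 0 by rewrite -modulus_gt0 orbit_au_gt0.
have av : `|argr (vz (z n3))| < k%:R * theta'.
  rewrite argr_lt_tan// (le_lt_trans im)// ltr_pM2r// -/T.
  have : e <= T / 2 by rewrite ge_min lexx orbT.
  lra.
have [h hk sh] := sector_exists k0 u0 v0 av.
have Bn3 : B_region k h r2 theta' beta' (z n3).
  split; first exact: hn1.
  exact/(S_regionP k0 h theta' _ r20).
exists h => //; exists n3 => n n3n.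
have zit m : z (n3 + m)%N = iter m F (z n3).
  by elim: m => [|m ih]; rewrite ?addn0// addnS zS ih.
have r12 : r1 <= r2 by rewrite le_max lexx orbT.
have [[Wn Sn] _] := hr h r2 _ r12 Bn3 (n - n3)%N.
rewrite -zit subnKC// in Wn Sn.
split => //; apply/(S_regionP k0 h theta' _ r0).
have [? rn ?] := (S_regionP k0 h theta' _ r20).1 Sn; split => //.
by rewrite (le_lt_trans _ rn)// le_max lexx.
Qed.

End Orbit.

Lemma quarter_lt (R : realType) (r n re re' : R) :
  4 * r < n -> n / 2 <= re -> 2^-1 * re <= re' -> r < re'.
Proof. by lra. Qed.

Lemma modulus_ge_half (R : realType) (M : Cplx R) :
  modulus (M - 1) <= 2^-1 -> 2^-1 <= modulus M.
Proof.
by have := modulus_lower 1 (M - 1); rewrite modulus1 subrKC; lra.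
Qed.

Lemma cone_perturb (R : realType) (T re im re' im' m : R) : 0 < T -> 0 < re ->
  `|im| <= T / 4 * re -> m <= 2^-1 -> m <= T / 8 ->
  `|re' - re| <= m * re -> `|im' - im| <= m * re ->
  2^-1 * re <= re' /\ `|im'| < T * re'.
Proof.
move=> T0 re0 h1 m1 m2 h2 h3.
have a1 : m * re <= 2^-1 * re by rewrite ler_pM2r.
have a2 : m * re <= T / 8 * re by rewrite ler_pM2r.
have a3 : 2^-1 * re <= re' by move: h2; rewrite ler_norml => /andP[? _]; lra.
split=> //; have := ler_normD (im' - im) im; rewrite subrK.
have : T * (2^-1 * re) <= T * re' by rewrite ler_pM2l.
have : 0 < T * re by exact: mulr_gt0.
by lra.
Qed.

Lemma leq_sum6 (a b c d e f : nat) : let s := (a + b + c + d + e + f)%N in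
  [/\ (a <= s)%N, (b <= s)%N & (c <= s)%N] /\ [/\ (d <= s)%N, (e <= s)%N & (f <= s)%N].
Proof. by move=> s; rewrite /s; split; split; lia. Qed.

(** * Elementary properties of the basins *)

Section Basins.
Variables (R : realType) (d k l : nat).
Local Notation C := (Cplx R).
Local Notation Cd := 'rV[C]_d.
Local Notation N := (k * d)%N.
Variables (F : Cd -> Cd) (lam : 'I_d -> C).
Hypotheses (d0 : (0 < d)%N) (k0 : (0 < k)%N).
Hypotheses (lam1 : forall j, modulus (lam j) = 1) (plam : \prod_j lam j = 1).
Hypothesis OF : forall j, eqO l (fun z => F z 0 j)
  (fun z => lam j * z 0 j * (1 - coord_prod z ^+ k / N%:R)).

Local Notation au z := (modulus (coord_prod z)).
Local Notation mx z := (modulus (coord_prod z ^+ k)).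

Variables (theta beta r : R).
Hypothesis adm : admissible_exponents d k l theta beta.
Hypothesis admr : admissible_radius F k r theta beta.
Local Notation Omega h := (basin F k h r theta beta).
Local Notation Bh h := (B_region k h r theta beta).

Let r0 : 0 < r. Proof. by case: admr. Qed.
Let thpi : theta <= pi / (2 * k%:R). Proof. by case: adm => /andP[_ /ltW]. Qed.

Lemma mx_le_vnorm (z : Cd) : vnorm z <= 1 -> mx z <= vnorm z.
Proof.
move=> z1; have u1 : au z <= vnorm z.
  rewrite (le_trans (modulus_coord_prod_le z))//.
  by case: (d) d0 z z1 => // n _ z z1; rewrite exprS ler_piMr ?exprn_ile1 ?vnorm_ge0.
rewrite (le_trans _ u1)//.
by case: (k) k0 => // n _; rewrite modulusX exprS ler_piMr ?exprn_ile1 ?modulus_ge0// (le_trans u1).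
Qed.

Lemma mx_cvg0 (z : nat -> Cd) :
  (forall e : R, 0 < e -> exists n0, forall n, (n0 <= n)%N -> vnorm (z n) < e) ->
  forall e : R, 0 < e -> exists n0, forall n, (n0 <= n)%N -> mx (z n) < e.
Proof.
move=> hz e e0; have e1 : 0 < Num.min e 1 by rewrite lt_min e0 ltr01.
have [n0 h] := hz _ e1; exists n0 => n /h; rewrite lt_min => /andP[ze z1].
by rewrite (le_lt_trans (mx_le_vnorm (ltW z1))).
Qed.

Lemma basin_in_B h z : (h < k)%N -> Omega h z ->
  exists n0, forall n, (n0 <= n)%N -> Bh h (iter n F z).
Proof.
move=> hk [n0 _ Bn]; exists n0 => n /subnK <-; elim: (n - n0)%N => [|m ih] //.
by rewrite addSn /=; apply: (admr.2 h hk).1; exists (iter (m + n0) F z).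
Qed.

Lemma basin_attracted h z : (h < k)%N -> Omega h z ->
  forall e : R, 0 < e -> exists n0, forall n, (n0 <= n)%N -> vnorm (iter n F z) < e.
Proof.
move=> hk [m _ Bm] e e0.
have [_ /uniform_vnormP/(_ e e0)[n0 hn]] := admr.2 h hk.
exists (n0 + m)%N => n nn; have mn : (m <= n)%N by rewrite (leq_trans (leq_addl _ _) nn).
have := hn (n - m)%N; rewrite leq_subRL// addnC => /(_ nn _ Bm).
by rewrite subr0 -iterD subnK.
Qed.

Lemma basin_disjoint h h' z : (h < k)%N -> (h' < k)%N -> Omega h z -> Omega h' z -> h = h'.
Proof.
move=> hk hk' /(basin_in_B hk)[n hn] /(basin_in_B hk')[n' hn'].
have [_ /(S_regionP k0 _ _ _ r0)[u0 _ s1]] := hn _ (leq_maxl n n').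
have [_ /(S_regionP k0 _ _ _ r0)[_ _ s2]] := hn' _ (leq_maxr n n').
exact: (sector_uniq k0 u0 thpi hk hk' s1 s2).
Qed.

Lemma basin_stepE h z : (h < k)%N -> Omega h (F z) <-> Omega h z.
Proof.
move=> hk; split => [[n _ Bn]|/(basin_in_B hk)[n hn]].
  by exists n.+1 => //=; rewrite /= -iterS iterSr.
by exists n => //=; rewrite -iterSr; exact: hn.
Qed.

Lemma basin_iterE h n z : (h < k)%N -> Omega h (iter n F z) <-> Omega h z.
Proof.
by move=> hk; elim: n z => [//|n ih] z; rewrite iterSr ih; exact: basin_stepE.
Qed.

(** Recognizes points of the basins by membership in a W(beta1) whose exponent may differ from the
    beta of the basins. *)
Lemma eventually_W_basin beta1 z : 0 < beta1 -> 2 * k%:R + 1 <= beta1 * (l%:R + d%:R - 1) ->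
  (exists n0, forall n, (n0 <= n)%N -> W_region beta1 (iter n F z)) ->
  (forall e : R, 0 < e -> exists n0, forall n, (n0 <= n)%N -> vnorm (iter n F z) < e) ->
  exists2 h, (h < k)%N & Omega h z.
Proof.
move=> b1 be1 [n0 Wn] zc.
pose y n := iter (n + n0) F z.
have yS n : y n.+1 = F (y n) by rewrite /y addSn.
have Wy n : W_region beta1 (y n) by apply: Wn; rewrite leq_addl.
have yc e : 0 < e -> exists n0, forall n, (n0 <= n)%N -> mx (y n) < e.
  move=> e0; have [n1 h1] := mx_cvg0 zc e0; exists n1 => n n1n.
  by apply: h1; rewrite (leq_trans n1n) ?leq_addr.
have [h hk [m hm]] := @orbit_eventually_B R d k l F lam d0 k0 lam1 plam OF y beta1
    yS Wy b1 be1 yc theta beta r adm r0.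
by exists h => //; exists (m + n0)%N => //; exact: hm.
Qed.

Lemma B_region_point h : exists z : Cd, Bh h z.
Proof.
have [t0 bd] : 0 < theta /\ beta < d%:R^-1 by case: adm => /andP[-> _] /andP[].
(* All coordinates are taken equal. The argument psi puts u on the axis of the h-th sector, and s =
   1 / (r + 2) gives v = (r + 2)^(d k) > r. *)
pose s := (r + 2)^-1.
have s0 : 0 < s by rewrite /s invr_gt0 addr_gt0.
have s1 : s < 1 by rewrite /s invf_lt1 ?addr_gt0//; have := r0; lra.
pose psi : R := 2 * pi * h%:R / N%:R.
exists (const_mx (ofR s * cis psi)).
have uE : coord_prod (const_mx (ofR s * cis psi) : Cd) = ofR (s ^+ d) * cis (2 * pi * h%:R / k%:R).
  rewrite /coord_prod; under eq_bigr => j _ do rewrite mxE.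
  rewrite prodr_const card_ord exprMn -ofRX -cis_nat; congr (_ * cis _).
  by rewrite /psi natrM; field; rewrite !pnatr_eq0 -!lt0n ?d0 ?k0.
have sd0 : 0 < s ^+ d by exact: exprn_gt0.
have aE : au (const_mx (ofR s * cis psi) : Cd) = s ^+ d.
  by rewrite uE modulusM modulus_cis mulr1 modulus_ofR_ge0// ltW.
split => [j|].
  rewrite aE mxE modulusM modulus_cis mulr1 modulus_ofR_ge0 ?(ltW s0)//.
  rewrite -powR_mulrn ?(ltW s0)// -powRrM.
  have sn0 : s != 0 by rewrite gt_eqF.
  have sE : s = s `^ (d%:R * beta) * s `^ (1 - d%:R * beta).
    rewrite -powRD; last by rewrite sn0 implybT.
    by rewrite addrC subrK powRr1// ltW.
  rewrite [ltLHS]sE gtr_pMr ?powR_gt0//.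
  have p1 : 1 `^ (1 - d%:R * beta) = 1 :> R by rewrite powR1.
  rewrite -[ltRHS]p1 gt0_ltr_powR ?nnegrE ?ler01 ?(ltW s0)//.
  by rewrite subr_gt0 mulrC -ltr_pdivlMr ?ltr0n// mul1r.
apply/(S_regionP k0 _ _ _ r0); split.
- by rewrite -modulus_gt0 aE.
- have -> : fatou_v k (coord_prod (const_mx (ofR s * cis psi) : Cd)) = ofR (s ^- (d * k)).
    rewrite /fatou_v uE exprMn -cis_nat cis_2pih// mulr1 -ofRX -ofRV exprM.
    by [].
  rewrite /= -exprVn /s invrK.
  have : (d * k)%N != 0%N by rewrite -lt0n muln_gt0 d0.
  case: (d * k)%N => // m _.
  have r0' := r0; have r1 : 1 <= r + 2 by lra.
  rewrite exprS (@lt_le_trans _ _ (r + 2))//; first lra.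
  by rewrite ler_peMr ?exprn_ege1//; lra.
exists 0; first by rewrite normr0.
by rewrite addr0 aE uE.
Qed.

Lemma basin_nonempty h : exists z, Omega h z.
Proof. by have [z Bz] := B_region_point h; exists z; exists 0%N. Qed.

End Basins.

(** * G permutes the basins *)

Section RootAction.
Variables (R : realType) (d k l p : nat).
Local Notation C := (Cplx R).
Local Notation Cd := 'rV[C]_d.
Local Notation N := (k * d)%N.
Variables (G : Cd -> Cd) (mu lam : 'I_d -> C) (a : {poly C}).
Hypotheses (d0 : (0 < d)%N) (k0 : (0 < k)%N) (p0 : (0 < p)%N) (pk : (p %| k)%N).
Hypotheses (mu1 : forall j, modulus (mu j) = 1) (pmu : \prod_j mu j = cis (2 * pi / p%:R)).
Hypotheses (lam1 : forall j, modulus (lam j) = 1) (plam : \prod_j lam j = 1).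
Hypothesis a0 : a`_0 = 1.
Hypothesis OG : forall j, eqO l (fun z => G z 0 j)
  (fun z => mu j * z 0 j * a.[coord_prod z ^+ k]).
Hypothesis OF : forall j, eqO l (fun z => iter p G z 0 j)
  (fun z => lam j * z 0 j * (1 - coord_prod z ^+ k / N%:R)).

Local Notation F := (iter p G).
Local Notation au z := (modulus (coord_prod z)).
Local Notation xk z := (coord_prod z ^+ k).
Local Notation vz z := (fatou_v k (coord_prod z)).
Local Notation mx z := (modulus (coord_prod z ^+ k)).

Let kR0 : 0 < k%:R :> R. Proof. by rewrite ltr0n. Qed.

(** Apart from the rotation by 2 pi / p, G multiplies u by a factor M = 1 + O(x), because the
    polynomial a is 1 at 0. *)
Lemma root_step beta : 0 < beta -> 2 * k%:R + 1 <= beta * (l%:R + d%:R - 1) ->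
  exists K s : R, [/\ 0 < K, 0 < s <= 1 & forall z, W_region beta z -> au z < s ->
    exists M : C, [/\ coord_prod (G z) = cis (2 * pi / p%:R) * coord_prod z * M,
      forall j, modulus (G z 0 j) <= 2 * modulus (z 0 j),
      M != 0, modulus (M - 1) <= K * mx z & modulus (M ^- k - 1) <= K * mx z]].
Proof.
move=> b0 be; have [K [s [K0 /andP[s0 s1] h]]] := factor_bound d0 b0 mu1 OG be.
have [b bE] : exists b : {poly C}, a = 1 + 'X * b.
  exists (drop_poly 1 a); rewrite -[LHS](poly_take_drop 1) expr1 mulrC; congr (_ + _).
  apply/polyP => i; rewrite coef_take_poly coef1; case: i => [|i] //=.
have [Q Q0 hQ] := horner_bound b.
pose K1 := Q + K; have K10 : 0 < K1 by rewrite ltr_wpDl.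
have [K2 K2E] : {K2 | K2 = d%:R * 2 ^+ d * K1} by eexists.
have K20 : 0 < K2 by rewrite K2E !mulr_gt0 ?exprn_gt0// ltr0n.
have [K3 K3E] : {K3 | K3 = 2 * (k%:R * K2 * 2 ^+ k.-1)} by eexists.
have K30 : 0 < K3 by rewrite K3E !mulr_gt0 ?exprn_gt0// ltr0n.
pose s' := (2 * (K1 + K2 + K3))^-1.
have s'0 : 0 < s' by rewrite invr_gt0 mulr_gt0// addr_gt0// addr_gt0.
exists (K2 + K3), (Num.min s s'); split; first exact: addr_gt0.
  by rewrite lt_min s0 s'0 ge_min s1.
move=> z Wz; rewrite lt_min => /andP[us us'].
have u0 := W_coord_prod_gt0 d0 b0 Wz.
have u1 : au z <= 1 by rewrite ltW// (lt_le_trans us).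
have x0 : 0 <= mx z by exact: modulus_ge0.
have x1 : mx z <= 1 by rewrite modulusX exprn_ile1 ?modulus_ge0.
have xu : mx z <= au z.
  by case: (k) k0 => // n _; rewrite modulusX exprS ler_piMr ?exprn_ile1 ?modulus_ge0.
have small : (K1 + K2 + K3) * mx z <= 2^-1.
  have S0 : 0 < K1 + K2 + K3 by lra.
  rewrite (le_trans (ler_wpM2l (ltW S0) (le_trans xu (ltW us'))))// /s'.
  by rewrite invfM mulrCA mulfV ?gt_eqF// mulr1.
have i1 : 0 <= K1 * mx z by rewrite mulr_ge0// ltW.
have i2 : 0 <= K2 * mx z by rewrite mulr_ge0// ltW.
have i3 : 0 <= K3 * mx z by rewrite mulr_ge0// ltW.
have [j1 j2 j3] : [/\ K1 * mx z <= 2^-1, K2 * mx z <= 2^-1 & K3 * mx z <= 2^-1].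
  by move: i1 i2 i3 small; rewrite !mulrDl => *; split; lra.
pose g j : C := G z 0 j / (mu j * z 0 j).
have g1 j : modulus (g j - 1) <= K1 * mx z.
  have -> : g j - 1 = xk z * b.[xk z] + (g j - a.[xk z]).
    by rewrite [in a.[_]]bE hornerD hornerM hornerX hornerC; ring.
  rewrite (le_trans (modulusD _ _))// /K1 mulrDl lerD//.
    by rewrite modulusM mulrC ler_wpM2r// hQ.
  rewrite (le_trans (h z Wz us j))// expr2 ler_wpM2l ?(ltW K0)// ler_piMr//.
have g2 j : modulus (g j) <= 2.
  rewrite -[g j](subrK 1) (le_trans (modulusD _ _))// modulus1.
  by move: (g1 j) j1; lra_goal.
have M1 : modulus (\prod_j g j - 1) <= K2 * mx z.
  have e1 : modulus (1 : C) <= 2 by rewrite modulus1 ler1n.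
  have := @modulus_prod_dist R 'I_d (index_enum 'I_d) g (fun=> 1) 2 (K1 * mx z)
    (ler1n _ 2) g2 (fun=> e1) g1.
  have -> : size (index_enum 'I_d) = d by rewrite -[RHS](size_enum_ord d) enumT [index_enum _]unlock.
  have KE : K2 * mx z = d%:R * 2 ^+ d * (K1 * mx z) by rewrite K2E !mulrA.
  by rewrite big1_eq KE.
exists (\prod_j g j); set M := \prod_j g j in M1 *.
have z0 j : mu j * z 0 j != 0.
  by rewrite mulf_neq0 ?coord_neq0// -modulus_gt0 mu1.
have Mn0 : M != 0.
  by rewrite -modulus_gt0; have := modulus_ge_half (le_trans M1 j2); lra_goal.
have Mb : modulus M <= 2.
  rewrite -[M](subrK 1) (le_trans (modulusD _ _))// modulus1.
  by move: M1 j2; lra_goal.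
have Mk : modulus (M ^+ k - 1) <= K3 / 2 * mx z.
  have := modulus_expr_dist k Mb (_ : modulus 1 <= 2); rewrite expr1n modulus1 => /(_ (ler1n _ 2)).
  move/le_trans; apply.
  have -> : K3 / 2 * mx z = k%:R * (K2 * mx z) * 2 ^+ k.-1 by rewrite K3E; field.
  by rewrite ler_wpM2r ?exprn_ge0// ler_wpM2l.
have Mk2 : 2^-1 <= modulus (M ^+ k).
  by apply: modulus_ge_half; move: Mk j3 i3; lra_goal.
split => //.
- rewrite -pmu -mulrA [coord_prod z * M]mulrC mulrCA /M /coord_prod -!big_split /=.
  by apply: eq_bigr => j _; rewrite /g divfK.
- move=> j; have -> : G z 0 j = g j * (mu j * z 0 j) by rewrite divfK.
  by rewrite modulusM modulusM mu1 mul1r ler_wpM2r ?modulus_ge0.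
- by apply: (le_trans M1); rewrite ler_wpM2r// lerDl ltW.
have -> : M ^- k - 1 = (1 - M ^+ k) / M ^+ k by field; rewrite expf_neq0.
rewrite modulusM modulusV ler_pdivrMr ?(lt_le_trans _ Mk2) ?invr_gt0// modulus_distC.
apply: (le_trans Mk); rewrite mulrAC.
apply: (le_trans (ler_wpM2l i3 Mk2)); rewrite ler_wpM2r ?modulus_ge0// ler_wpM2r//.
by rewrite lerDr ltW.
Qed.

Variables (theta beta r : R).
Hypothesis adm : admissible_exponents d k l theta beta.
Hypothesis admr : admissible_radius F k r theta beta.
Local Notation Omega h := (basin F k h r theta beta).

Lemma cis_root_step h : cis (2 * pi / p%:R) * cis (2 * pi * h%:R / k%:R) =
  cis (2 * pi * ((h + k %/ p) %% k)%N%:R / k%:R) :> C.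
Proof.
set m := (h + k %/ p)%N.
have kp : (k %/ p)%:R = k%:R / p%:R :> R.
  by rewrite -[X in _ = X%:R / _](divnK pk) natrM mulfK// pnatr_eq0 -lt0n.
have pn0 : p%:R != 0 :> R by rewrite pnatr_eq0 -lt0n.
have kn0 : k%:R != 0 :> R by rewrite gt_eqF.
rewrite -cisD.
have -> : 2 * pi / p%:R + 2 * pi * h%:R / k%:R =
    (m %/ k)%:R * (2 * pi) + 2 * pi * (m %% k)%N%:R / k%:R :> R.
  have mE : m%:R = (m %/ k)%:R * k%:R + (m %% k)%N%:R :> R.
    by rewrite -natrM -natrD -divn_eq.
  have -> : (m %% k)%N%:R = h%:R + k%:R / p%:R - (m %/ k)%:R * k%:R :> R.
    by rewrite -kp -natrD -/m mE addrAC subrr add0r.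
  by field; rewrite ?pn0 ?kn0.
by rewrite cisD cis_nat cis_2pi expr1n mul1r.
Qed.

(** G loses constant factors and need not preserve W(beta). Far along the orbit, however, the point
    is in W(beta') with beta' halfway between beta and 1/d, and |u|^(beta' - beta) absorbs the
    constants. At such a time the image by G lies directly in the region of the rotated sector. *)
Lemma root_basin h z : (h < k)%N -> Omega h z -> Omega ((h + k %/ p) %% k)%N (G z).
Proof.
move=> hk Oz; set h' := ((h + k %/ p) %% k)%N.
have [/andP[t0 tpi] /andP[b0 bd] be] := adm; have be' := ltW be.
have r0 : 0 < r by case: admr.
have [n0 Bn] := basin_in_B admr hk Oz.
pose y n := iter (n + n0) F z.
have yS n : y n.+1 = F (y n) by rewrite /y addSn.
have By n : B_region k h r theta beta (y n) by apply: Bn; rewrite leq_addl.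
have Wy n : W_region beta (y n) by case: (By n).
have yc e : 0 < e -> exists n0, forall n, (n0 <= n)%N -> mx (y n) < e.
  move=> e0; have [n1 h1] := mx_cvg0 d0 k0 (basin_attracted admr hk Oz) e0.
  by exists n1 => n n1n; apply: h1; rewrite (leq_trans n1n) ?leq_addr.
have kt : 0 < k%:R * theta < pi / 2.
  rewrite mulr_gt0//= (_ : pi / 2 = k%:R * (pi / (2 * k%:R))) ?ltr_pM2l//.
  by field; rewrite pnatr_eq0 -lt0n.
have T0 := tan_gt0 kt; set T := tan _ in T0.
have b'd : 0 < (beta + d%:R^-1) / 2 < d%:R^-1 by apply/andP; split; lra.
have b'b : 0 < (beta + d%:R^-1) / 2 - beta by lra.
set beta' := _ / 2 in b'd b'b.
have e01 : 0 < Num.min 1 (T / 4) <= 1 by rewrite lt_min ltr01 divr_gt0//= ge_min lexx.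
have [n1 hn1] := orbit_fatou_v_cone d0 k0 lam1 plam OF yS Wy b0 be' yc e01.
have [n2 hn2] := orbit_eventually_W d0 k0 lam1 plam OF yS Wy b0 be' yc b'd.
have [K [s [K0 /andP[s0 _] hG]]] := root_step b0 be'.
(* One factor 2 comes from |G(z)_j| <= 2 |z_j|, the other from |M|^beta >= 1/2. *)
have q40 : 0 < 4^-1 :> R by [].
have [s1 /andP[s10 _] hs1] := powR_lt_threshold q40 b'b.
pose eta := Num.min (Num.min (4 * k%:R)^-1 2^-1) (Num.min 2^-1 (T / 8) / (1 + T / 4)).
have T8 : 0 < T / 8 by rewrite divr_gt0.
have T41 : 0 < 1 + T / 4 by rewrite addr_gt0// divr_gt0.
have mm : 0 < Num.min 2^-1 (T / 8) by rewrite lt_min T8 andbT invr_gt0.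
have eta0 : 0 < eta.
  have k4 : 0 < (4 * k%:R)^-1 :> R by rewrite invr_gt0 mulr_gt0.
  have e1 : 0 < Num.min (4 * k%:R)^-1 2^-1 :> R by rewrite lt_min k4 invr_gt0 ltr0n.
  by rewrite /eta lt_min e1 (divr_gt0 mm T41).
have [n3 hn3] := orbit_au_small k0 yc s0.
have [n4 hn4] := orbit_au_small k0 yc s10.
have [n5 hn5] := yc _ (divr_gt0 eta0 K0).
pose n := (n1 + n2 + n3 + n4 + n5 + (Num.trunc (4 * r)).+1)%N.
have [[q1 q2 q3] [q4 q5 q6]] := leq_sum6 n1 n2 n3 n4 n5 (Num.trunc (4 * r)).+1.
have [nn0 re im _] := hn1 n q1.
have W'n := hn2 n q2.
have us := hn3 n q3.
have us1 := hn4 n q4.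
have xeta := hn5 n q5.
have rn : 4 * r < n%:R.
  by rewrite (lt_le_trans (truncnS_gt _))// ler_nat.
have [M [uG Gj Mn0 M1 Mk]] := hG _ (Wy n) us.
have u0 := W_coord_prod_gt0 d0 b0 (Wy n).
have xe : K * mx (y n) <= eta.
  by rewrite mulrC -ler_pdivlMr// ltW.
have [eta1 eta2 eta3] : [/\ eta <= (4 * k%:R)^-1, eta <= 2^-1 &
    eta * (1 + T / 4) <= Num.min 2^-1 (T / 8)].
  rewrite -ler_pdivlMr//; set q := _ / (1 + T / 4).
  by rewrite /eta -/q !ge_min !lexx !orbT.
have vE : vz (G (y n)) = vz (y n) * M ^- k.
  rewrite /fatou_v uG !exprMn !invfM -cis_nat.
  have -> : k%:R * (2 * pi / p%:R) = (k %/ p)%:R * (2 * pi) :> R.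
    rewrite -[in LHS](divnK pk) natrM; field.
    by rewrite pnatr_eq0 -lt0n.
  by rewrite cis_nat cis_2pi expr1n invr1 mul1r.
have v0 : 0 < Re (vz (y n)) by rewrite (lt_le_trans _ re)// divr_gt0// ltr0n.
have imT : `|Im (vz (y n))| <= T / 4 * Re (vz (y n)).
  by rewrite (le_trans im)// ler_pM2r// ge_min lexx orbT.
have vm := Re_cone_le v0 imT.
have vd : modulus (vz (G (y n)) - vz (y n)) <= Num.min 2^-1 (T / 8) * Re (vz (y n)).
  have -> : vz (G (y n)) - vz (y n) = (M ^- k - 1) * vz (y n) by rewrite vE; ring.
  rewrite modulusM (@le_trans _ _ (eta * ((1 + T / 4) * Re (vz (y n)))))//.
    by apply: ler_pM; rewrite ?modulus_ge0// (le_trans Mk).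
  by rewrite mulrA ler_pM2r.
have rd := le_trans (Re_le_modulus _) vd; have id := le_trans (Im_le_modulus _) vd.
rewrite ReB in rd; rewrite ImB in id.
have [m1 m2] : Num.min 2^-1 (T / 8) <= 2^-1 /\ Num.min 2^-1 (T / 8) <= T / 8.
  by rewrite !ge_min !lexx !orbT.
have [re' Timv'] := cone_perturb T0 v0 imT m1 m2 rd id.
have v'0 : 0 < Re (vz (G (y n))) by rewrite (lt_le_trans _ re')// mulr_gt0// invr_gt0.
have av' : `|argr (vz (G (y n)))| < k%:R * theta by rewrite argr_lt_tan.
have [un0 _ sy] := (S_regionP k0 h theta _ r0).1 (By n).2.
have Gn : iter (n + n0) F (G z) = G (y n).
  by rewrite /y -!iterM -iterS iterSr.
exists (n + n0)%N => //=; rewrite Gn; split.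
  move=> j; have Wj := W'n j.
  have uG' : modulus (coord_prod (G (y n))) = au (y n) * modulus M.
    by rewrite uG !modulusM modulus_cis mul1r.
  have M2 : 2^-1 <= modulus M.
    exact: modulus_ge_half (le_trans M1 (le_trans xe eta2)).
  rewrite uG' powRM ?modulus_ge0//.
  have b1 : beta <= 1.
    by rewrite ltW// (lt_le_trans bd)// invf_le1 ?ltr0n// ler1n.
  have Mb : 2^-1 <= modulus M `^ beta.
    rewrite (@le_trans _ _ (2^-1 `^ beta))//; last first.
      by rewrite ge0_ler_powR ?nnegrE ?modulus_ge0 ?invr_ge0// ltW.
    rewrite -[leLHS](powRr1 (_ : 0 <= 2^-1)) ?invr_ge0//.
    by rewrite ger_powR// invr_gt0 ltr0n invf_le1// ler1n.
  have pb0 : 0 < au (y n) `^ beta by rewrite powR_gt0.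
  have e1 : au (y n) `^ beta' = au (y n) `^ beta * au (y n) `^ (beta' - beta).
    rewrite -powRD; first by rewrite subrKC.
    by rewrite (gt_eqF u0) implybT.
  have e2 := hs1 _ (ltW u0) us1.
  rewrite (le_lt_trans (Gj j))// (@lt_le_trans _ _ (au (y n) `^ beta / 2))//; last first.
    by rewrite ler_pM2l.
  rewrite -ltr_pdivlMl// (lt_le_trans Wj)// e1.
  have -> : 2^-1 * (au (y n) `^ beta / 2) = au (y n) `^ beta / 4 by field.
  by rewrite ler_pM2l// ltW.
apply/(S_regionP k0 _ _ _ r0); split.
- by rewrite uG !mulf_neq0// -modulus_gt0 modulus_cis.
- exact: quarter_lt rn re re'.
rewrite uG; have Psi := sector_rotate (cis_root_step h) sy.
apply: (sector_step k0 _ (ltW tpi) Psi).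
- by rewrite mulf_neq0// -modulus_gt0 modulus_cis.
- exact: le_trans M1 (le_trans xe eta1).
- by rewrite -uG.
- by rewrite -uG.
Qed.

Lemma root_iter_basin h q z : (h < k)%N -> Omega h z ->
  Omega ((h + q * (k %/ p)) %% k)%N (iter q G z).
Proof.
move=> hk Oz; elim: q => [|q ih]; first by rewrite mul0n addn0 modn_small.
have := root_basin (ltn_pmod _ k0) ih.
by rewrite modnDml -addnA -mulSnr.
Qed.

Lemma root_basin_image h : (forall z, exists y, G y = z) -> (h < k)%N ->
  G @` Omega h = Omega ((h + k %/ p) %% k)%N.
Proof.
move=> sG hk; apply/seteqP; split => [_ [z Oz <-]|y Oy]; first exact: root_basin.
have [z zy] := sG y; exists z => //.
(* Surjectivity: applying G another p - 1 times to y = G z gives F z, and p shifts of the index by k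
   / p return to h. *)
apply/(basin_stepE admr z hk); rewrite -(prednK p0) iterSr zy.
have := root_iter_basin p.-1 (ltn_pmod _ k0) Oy.
rewrite modnDml -addnA -mulSn prednK// [(p * _)%N]mulnC divnK//.
by rewrite modnDr modn_small.
Qed.

Lemma root_iter_basin_image h q : (forall z, exists y, G y = z) -> (h < k)%N ->
  iter q G @` Omega h = Omega ((h + q * (k %/ p)) %% k)%N.
Proof.
move=> sG hk; elim: q => [|q ih].
  rewrite mul0n addn0 modn_small//=; apply/seteqP; split => [_ [z Oz <-]//|z Oz].
  by exists z.
rewrite (_ : iter q.+1 G = G \o iter q G)// -image_comp ih root_basin_image ?ltn_pmod//.
by rewrite modnDml -addnA -mulSnr.
Qed.

End RootAction.

(** * Fatou components *)

Section Compactness.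
Variable R : realType.
Local Notation C := (Cplx R).

Lemma continuous_ofR : continuous (@ofR R : R -> C).
Proof.
move=> x; apply/(@cvgrPdist_lt C C^o) => e /ofR_gt0P[e' e'0 ->].
exists e' => //= y xy.
by rewrite -ofRB normC_modulus ofR_lt modulus_ofR.
Qed.

Lemma compact_square (c : C) (r : R) :
  compact [set w : C | `|Re (w - c)| <= r /\ `|Im (w - c)| <= r].
Proof.
pose f (p : R * R) : C := ofR p.1 + Complex 0 1 * ofR p.2.
have cf : continuous f.
  move=> p; apply: (@cvgD C C^o).
    by apply: continuous_comp; [exact: cvg_fst|exact: continuous_ofR].
  apply: (@cvgM C); first exact: cvg_cst.
  by apply: continuous_comp; [exact: cvg_snd|exact: continuous_ofR].
have -> : [set w : C | `|Re (w - c)| <= r /\ `|Im (w - c)| <= r] =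
    f @` (`[Re c - r, Re c + r] `*` `[Im c - r, Im c + r]).
  apply/seteqP; split => [w [h1 h2]|_ [[x y] [/= h1 h2] <-]].
    exists (Re w, Im w); last first.
      by apply: complex_ext; rewrite /f /= ?mul0r ?mul1r ?mulr0 ?subrr ?addr0 ?add0r ?subr0.
    rewrite !ReB !ImB !ler_norml in h1 h2.
    by rewrite /= !in_itv /=; move: h1 h2 => /andP[? ?] /andP[? ?]; split; apply/andP; split; lra.
  rewrite !in_itv /= in h1 h2; rewrite !ReB !ImB /f /= !mul0r ?mul1r ?mulr0 ?subr0 ?addr0 ?add0r.
  by rewrite !ler_norml; move: h1 h2 => /andP[? ?] /andP[? ?]; split; apply/andP; split; lra.
apply: continuous_compact; first exact: continuous_subspaceT.
by apply: compact_setX; exact: segment_compact.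
Qed.

Lemma closed_vball n (c : 'rV[C]_n) (r : R) : closed (vball c r).
Proof.
rewrite -openC; apply/open_vnormP => z /negP; rewrite -ltNge => rz.
exists (vnorm (z - c) - r); first by rewrite subr_gt0.
move=> w wz; apply/negP; rewrite -ltNge.
by have := vnorm_triangle w z c; rewrite [vnorm (z - w)]vnorm_distC; lra.
Qed.

Lemma compact_vball n (c : 'rV[C]_n) (r : R) : compact (vball c r).
Proof.
pose A (i : 'I_n) : set C := [set w | `|Re (w - c 0 i)| <= r /\ `|Im (w - c 0 i)| <= r].
have cA i : compact (A i) by exact: compact_square.
apply: (subclosed_compact _ (rV_compact cA)); first exact: closed_vball.
move=> v vr i /=; have h : modulus (v ord0 i - c 0 i) <= r.
  by have := modulus_le_vnorm (v - c) i; rewrite !mxE => /le_trans; apply.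
by split; [exact: le_trans (Re_le_modulus _) h|exact: le_trans (Im_le_modulus _) h].
Qed.

End Compactness.

(** * Openness of the regions B_h *)

Section OpenRegions.
Variables (R : realType) (d k : nat).
Local Notation C := (Cplx R).
Local Notation Cd := 'rV[C]_d.
Hypotheses (d0 : (0 < d)%N) (k0 : (0 < k)%N).
Local Notation au z := (modulus (coord_prod z)).

Let kR0 : 0 < k%:R :> R. Proof. by rewrite ltr0n. Qed.

Lemma inverse_power_bound : exists2 K : R, 0 < K & forall M : C, modulus (M - 1) <= K^-1 ->
  M != 0 /\ modulus (M ^- k - 1) <= K * modulus (M - 1).
Proof.
pose K : R := 2 * (k%:R * 2 ^+ k.-1).
have K2 : 2 <= K.
  by rewrite /K ler_peMr// mulr_ege1 ?ler1n// exprn_ege1// ler1n.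
have K0 : 0 < K by lra.
exists K => // M MK.
have Mh : modulus (M - 1) <= 2^-1 by rewrite (le_trans MK)// lef_pV2 ?posrE.
have M2 := modulus_ge_half Mh.
have M0 : M != 0 by rewrite -modulus_gt0 (lt_le_trans _ M2)// invr_gt0.
split => //.
have Mb : modulus M <= 2.
  rewrite -[M](subrK 1) (le_trans (modulusD _ _))// modulus1.
  by rewrite (le_trans (lerD Mh (lexx _)))//; lra.
have e1 : modulus (1 : C) <= 2 by rewrite modulus1 ler1n.
have Mk : modulus (M ^+ k - 1) <= K / 2 * modulus (M - 1).
  have := modulus_expr_dist k Mb e1; rewrite expr1n => /le_trans; apply.
  have -> : K / 2 * modulus (M - 1) = k%:R * modulus (M - 1) * 2 ^+ k.-1 by rewrite /K; field.
  by [].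
have Mk2 : 2^-1 <= modulus (M ^+ k).
  apply: modulus_ge_half; rewrite (le_trans Mk)// mulrAC ler_pdivrMr// mulVf//.
  by rewrite mulrC -ler_pdivlMr// mul1r.
have -> : M ^- k - 1 = (1 - M ^+ k) / M ^+ k by field; rewrite expf_neq0.
rewrite modulusM modulusV ler_pdivrMr ?(lt_le_trans _ Mk2) ?invr_gt0// modulus_distC.
have : K * modulus (M - 1) / 2 <= K * modulus (M - 1) * modulus (M ^+ k).
  by rewrite ler_wpM2l// mulr_ge0 ?modulus_ge0// ltW.
by apply: le_trans; rewrite (le_trans Mk)// mulrAC.
Qed.

(** Multiplying u by M displaces v by at most K eta |v|. The constants are explicit because this
    serves both for openness and for the charts, where u moves along with the reference orbit. *)
Lemma S_region_perturb : exists2 K : R, 0 < K & forall h (r theta eta : R) u M,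
  0 < theta < pi / (2 * k%:R) -> 0 < r -> u != 0 -> sector k h theta u ->
  modulus (M - 1) <= eta -> eta <= K^-1 ->
  r < Re (fatou_v k u) - K * eta * modulus (fatou_v k u) ->
  `|Im (fatou_v k u)| + K * eta * modulus (fatou_v k u) <
    tan (k%:R * theta) * (Re (fatou_v k u) - K * eta * modulus (fatou_v k u)) ->
  S_region k h r theta (u * M).
Proof.
have [K1 K10 hK1] := inverse_power_bound.
pose K := K1 + 4 * k%:R; have K0 : 0 < K by rewrite addr_gt0// mulr_gt0.
exists K => // h r theta eta u M /andP[t0 tpi] r0 u0 su M1 etaK h1 h2.
set v := fatou_v k u in h1 h2.
have eta0 : 0 <= eta by rewrite (le_trans _ M1) ?modulus_ge0.
have [M0 Mk] : M != 0 /\ modulus (M ^- k - 1) <= K1 * modulus (M - 1).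
  by apply: hK1; rewrite (le_trans M1)// (le_trans etaK)// lef_pV2 ?posrE ?lerDl ?mulr_ge0.
have vE : fatou_v k (u * M) = v * M ^- k by rewrite /fatou_v exprMn invfM.
have vd : modulus (fatou_v k (u * M) - v) <= K * eta * modulus v.
  have -> : fatou_v k (u * M) - v = (M ^- k - 1) * v by rewrite vE; ring.
  rewrite modulusM ler_wpM2r ?modulus_ge0// (le_trans Mk)// ler_pM ?modulus_ge0//.
    exact: ltW.
  by rewrite /K lerDl mulr_ge0.
have rd := le_trans (Re_le_modulus _) vd; have id := le_trans (Im_le_modulus _) vd.
rewrite ReB in rd; rewrite ImB in id.
have rd1 : Re v - K * eta * modulus v <= Re (fatou_v k (u * M)).
  by move: rd; rewrite ler_norml => /andP[+ _]; rewrite lerBrDr addrC.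
have id1 : `|Im (fatou_v k (u * M))| <= `|Im v| + K * eta * modulus v.
  have := ler_normD (Im (fatou_v k (u * M)) - Im v) (Im v); rewrite subrK => /le_trans; apply.
  by rewrite addrC lerD2l.
have kt : 0 < k%:R * theta < pi / 2.
  rewrite mulr_gt0//= (_ : pi / 2 = k%:R * (pi / (2 * k%:R))) ?ltr_pM2l//.
  by field; rewrite pnatr_eq0 -lt0n.
have T0 := tan_gt0 kt.
have rv : r < Re (fatou_v k (u * M)) by exact: lt_le_trans rd1.
have v0 := lt_trans r0 rv.
apply/(S_regionP k0 _ _ _ r0); split => //; first by rewrite mulf_neq0.
apply: (sector_step k0 u0 (ltW tpi) su) => //.
  rewrite (le_trans M1)// (le_trans etaK)// lef_pV2 ?posrE ?mulr_gt0//.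
  by rewrite /K lerDr ltW.
rewrite argr_lt_tan// (le_lt_trans id1)// (lt_le_trans h2)//.
by rewrite ler_wpM2l// ltW.
Qed.

Lemma S_region_open h (r theta : R) u : 0 < theta < pi / (2 * k%:R) -> 0 < r ->
  S_region k h r theta u -> exists2 e : R, 0 < e & forall w, modulus (w - u) < e ->
  S_region k h r theta w.
Proof.
move=> tt r0 Su; have [K K0 hK] := S_region_perturb.
have [u0 rv su] := (S_regionP k0 _ _ _ r0).1 Su.
have [/andP[t0 tpi]] := (tt).
have [v0 av] := sector_argr k0 u0 (ltW tpi) su.
have kt : 0 < k%:R * theta < pi / 2.
  rewrite mulr_gt0//= (_ : pi / 2 = k%:R * (pi / (2 * k%:R))) ?ltr_pM2l//.
  by field; rewrite pnatr_eq0 -lt0n.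
have T0 := tan_gt0 kt.
have Tv : `|Im (fatou_v k u)| < tan (k%:R * theta) * Re (fatou_v k u) by rewrite -argr_lt_tan.
set v := fatou_v k u in rv v0 av Tv; set T := tan _ in T0 Tv.
have mu0 : 0 < modulus u by rewrite modulus_gt0.
have mv0 : 0 < modulus v by rewrite modulus_gt0 invr_neq0// expf_neq0.
pose g := Num.min (Re v - r) ((T * Re v - `|Im v|) / (1 + T)).
have T1 : 0 < 1 + T by lra.
have g0 : 0 < g by rewrite lt_min subr_gt0 rv divr_gt0// subr_gt0.
pose eta := Num.min K^-1 (g / 2 / (K * modulus v)).
have Kv : 0 < K * modulus v by exact: mulr_gt0.
have eta0 : 0 < eta.
  by rewrite lt_min invr_gt0 K0; apply: divr_gt0 => //; exact: divr_gt0.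
exists (eta * modulus u); first exact: mulr_gt0.
move=> w wu; have -> : w = u * (w / u) by rewrite mulrC divfK.
have [etaK etag] : eta <= K^-1 /\ K * eta * modulus v < g.
  split; first by rewrite ge_min lexx.
  have : eta <= g / 2 / (K * modulus v) by rewrite ge_min lexx orbT.
  by rewrite ler_pdivlMr// mulrA [eta * K]mulrC => /le_lt_trans; apply; lra.
have [g1 g2] : g <= Re v - r /\ g * (1 + T) <= T * Re v - `|Im v|.
  by split; [rewrite ge_min lexx|rewrite -ler_pdivlMr// ge_min lexx orbT].
apply: (hK _ _ _ eta) => //; rewrite -/v.
- have -> : w / u - 1 = (w - u) / u by field.
  by rewrite modulusM modulusV ler_pdivrMr// ltW.
- by move: etag g1; set y := K * eta * _; clear; move=> *; lra.
rewrite -/T; have : K * eta * modulus v * (1 + T) < g * (1 + T) by rewrite ltr_pM2r.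
by move: g2; set y := K * eta * _; nra.
Qed.

Lemma W_region_vnorm (beta : R) (z : Cd) : W_region beta z <-> vnorm z < au z `^ beta.
Proof.
split => [Wz|h j]; last exact: le_lt_trans (modulus_le_vnorm z j) h.
by apply: vnorm_lt => //; exact: le_lt_trans (modulus_ge0 _) (Wz (Ordinal d0)).
Qed.

Lemma coord_prod_continuous (z : Cd) (e : R) : 0 < e -> exists2 r : R, 0 < r &
  forall w, vnorm (w - z) < r -> modulus (coord_prod w - coord_prod z) < e.
Proof.
move=> e0; pose f (w : Cd) : 'rV[C]_1 := \row__ coord_prod w.
have af : analytic f z.
  apply: entire_analytic => j; rewrite /f; under eq_fun do rewrite mxE.
  by apply: entire_prod => i; exact: entire_coord.
have [r r0 h] := (continuous_vnormP f z).1 (analytic_continuous af) e e0.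
exists r => // w /h; apply: le_lt_trans.
by have := modulus_le_vnorm (f w - f z) 0; rewrite !mxE.
Qed.

Lemma B_region_open h (r theta beta : R) : 0 < theta < pi / (2 * k%:R) -> 0 < beta -> 0 < r ->
  open (B_region k h r theta beta : set Cd).
Proof.
move=> tt b0 r0; apply/open_vnormP => z [/W_region_vnorm Wz Sz].
have [e e0 he] := S_region_open tt r0 Sz.
have vz0 := vnorm_ge0 z.
(* b lies strictly between |z| and |u|^beta, and s^beta = b: near z the norm stays below b while |u|
   stays above s. *)
pose b := (vnorm z + au z `^ beta) / 2.
have [b1 b2] : vnorm z < b /\ b < au z `^ beta by split; rewrite /b; lra.
have bp : 0 < b by exact: le_lt_trans b1.
pose s := b `^ beta^-1.
have sb : s `^ beta = b by rewrite /s -powRrM mulVf ?gt_eqF// powRr1// ltW.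
have us : s < au z.
  rewrite ltNge; apply/negP => h1; have : au z `^ beta <= s `^ beta.
    by rewrite ge0_ler_powR ?nnegrE ?modulus_ge0 ?powR_ge0// ltW.
  by rewrite sb leNgt b2.
have e1 : 0 < Num.min e (au z - s) by rewrite lt_min e0 subr_gt0.
have [q q0 hq] := coord_prod_continuous z e1.
exists (Num.min q (b - vnorm z)); first by rewrite lt_min q0 subr_gt0.
move=> w; rewrite lt_min => /andP[/hq wq wb].
rewrite lt_min in wq; case/andP: wq => we ws.
split; last exact: he.
apply/W_region_vnorm.
have hb : vnorm w < b by have := vnorm_distD w z; lra.
have hs : s < au w.
  have := modulusB (coord_prod z - coord_prod w) (- coord_prod w); rewrite opprK subrK modulusN.
  by rewrite modulus_distC in ws; lra.
rewrite (lt_trans hb)// -sb gt0_ltr_powR ?nnegrE ?powR_ge0 ?modulus_ge0//.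
Qed.

End OpenRegions.

Lemma vanish_bigO (R : realType) d (f : 'rV[Cplx R]_d -> Cplx R) l :
  (0 < l)%N -> bigO l f -> f 0 = 0.
Proof.
move=> l0 [K [r [_ r0 h]]]; apply/eqP; rewrite -modulus_eq0.
have := h 0; rewrite vnorm0 expr0n gtn_eqF//= mulr0 => /(_ r0) f0.
by rewrite eq_le f0 modulus_ge0.
Qed.

Lemma entire_map_continuous (R : realType) d (f : 'rV[Cplx R]_d -> 'rV[Cplx R]_d) :
  entire_map f -> continuous f.
Proof. by move=> ef z; apply: analytic_continuous; exact: entire_analytic. Qed.

(** In a sequence of iterates of G the exponents come in no particular order; either case of this
    dichotomy yields a convergent subsequence. *)
Lemma constant_or_tends_to_infinity (m : nat -> nat) :
  (exists v, exists s : nat -> nat, {homo s : i j / (i < j)%N} /\ forall i, m (s i) = v) \/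
  (forall v, exists n0, forall n, (n0 <= n)%N -> (v <= m n)%N).
Proof.
have [[v hv]|nv] := pselect (exists v, forall i, exists j, (i < j)%N /\ m j = v).
  have /choice[g hg] := hv.
  left; exists v, (fun i => iter i.+1 g 0); split.
    apply: homo_ltn => [y x z|i]; first exact: ltn_trans.
    by rewrite [in X in (_ < X)%N]iterS; case: (hg (iter i.+1 g 0)).
  by move=> i; rewrite iterS; case: (hg (iter i g 0)).
right; elim=> [|v [n0 hn0]]; first by exists 0%N.
have /existsNP[i hi] : ~ (forall i, exists j, (i < j)%N /\ m j = v).
  by move=> h; apply: nv; exists v.
exists (maxn n0 i.+1) => n; rewrite geq_max => /andP[/hn0 vn iln].
rewrite ltn_neqAle vn andbT; apply/eqP => mn.
by apply: hi; exists n; split.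
Qed.

(** * The basins lie in the Fatou set *)

Section FatouSubset.
Variables (R : realType) (d k p : nat).
Local Notation C := (Cplx R).
Local Notation Cd := 'rV[C]_d.
Variable G : Cd -> Cd.
Hypotheses (d0 : (0 < d)%N) (k0 : (0 < k)%N) (p0 : (0 < p)%N).
Hypotheses (eG : entire_map G) (G0 : G 0 = 0).
Variables (theta beta r : R).
Hypotheses (tt : 0 < theta < pi / (2 * k%:R)) (b0 : 0 < beta).
Local Notation F := (iter p G).
Hypothesis admr : admissible_radius F k r theta beta.
Local Notation Omega h := (basin F k h r theta beta).
Local Notation Bh h := (B_region k h r theta beta).

Lemma B_preimage_open h n : open (iter n F @^-1` Bh h).
Proof.
have r0 : 0 < r by case: admr.
apply/open_vnormP => z Bz.
have /open_vnormP/(_ _ Bz)[e e0 he] := B_region_open (h := h) d0 k0 tt b0 r0.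
have eF : entire_map (iter n F) by exact: entire_map_iter (entire_map_iter _ eG).
have /continuous_vnormP/(_ e e0)[s s0 hs] := @entire_map_continuous R d _ eF z.
by exists s => // w ws; apply: he; exact: hs.
Qed.

Lemma basin_open h : open (Omega h).
Proof. by apply: bigcup_open => n _; exact: B_preimage_open. Qed.

(** From iterates of F = G^p to those of G: the remaining fewer than p steps are finitely many
    continuous maps fixing the origin. *)
Lemma B_preimage_uniform h n : (h < k)%N -> forall e : R, 0 < e -> exists N, forall m, (N <= m)%N ->
  forall z, Bh h (iter n F z) -> vnorm (iter m G z) < e.
Proof.
move=> hk e e0.
have Gq0 q : iter q G 0 = 0 by elim: q => //= q ->.
have /choice[del hdel] : forall q, exists del : R, 0 < del /\
    forall w, vnorm w < del -> vnorm (iter q G w) < e.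
  move=> q; have := @entire_map_continuous R d _ (entire_map_iter q eG) 0.
  move/continuous_vnormP => /(_ e e0)[del del0 h']; exists del; split => // w wd.
  by have := h' w; rewrite Gq0 !subr0; apply.
pose del0 := \big[Num.min/1]_(q < p) del q.
have d00 : 0 < del0 by apply/bigmin_gtP; split => // q _; case: (hdel q).
have [_ /uniform_vnormP/(_ _ d00)[N hN]] := admr.2 h hk.
exists (p * (N + n))%N => m Nm z Bz.
rewrite (divn_eq m p) addnC iterD mulnC.
have -> : iter (p * (m %/ p)) G z = iter (m %/ p) F z.
  by rewrite mulnC; elim: (m %/ p)%N => //= q <-; rewrite -iterD mulSn.
apply: (hdel _).2.
have Nn : (N + n <= m %/ p)%N by rewrite leq_divRL// mulnC.
have := hN (m %/ p - n)%N; rewrite leq_subRL ?(leq_trans (leq_addl _ _) Nn)// addnC => /(_ Nn _ Bz).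
rewrite subr0 -iterD subnK ?(leq_trans (leq_addl _ _) Nn)// => /lt_le_trans; apply.
by apply/bigmin_leP; right; exists (Ordinal (ltn_pmod m p0)).
Qed.

Lemma basin_sub_fatou h : (h < k)%N -> Omega h `<=` fatou_set G.
Proof.
move=> hk z [n _ Bz]; exists (iter n F @^-1` Bh h); split => //.
  exact: B_preimage_open.
move=> f hf; have /choice[m hm] : forall i, exists m, f i = iter m G.
  by move=> i; have [m _ <-] := hf i; exists m.
have [[v [s [sh ms]]]|m_oo] := constant_or_tends_to_infinity m.
  exists s; split => //; left; exists (iter v G) => K _ _; apply/uniform_vnormP => e e0.
  by exists 0%N => i _ w _ /=; rewrite hm ms subrr vnorm0.
exists id; split => //; left; exists (fun=> 0) => K _ KU; apply/uniform_vnormP => e e0.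
have [N hN] := B_preimage_uniform n hk e0; have [n0 hn0] := m_oo N.
by exists n0 => i /hn0 Ni w /KU Bw /=; rewrite hm subr0; exact: hN.
Qed.

End FatouSubset.

Lemma powR_inv_base (R : realType) (a b : R) : 0 < a -> a^-1 `^ b = (a `^ b)^-1.
Proof.
move=> a0; have ab : a `^ b != 0 by rewrite gt_eqF// powR_gt0.
apply: (mulIf ab); rewrite mulVf// -powRM ?invr_ge0 ?(ltW a0)//.
by rewrite mulVf ?gt_eqF// powR1.
Qed.

(** * The three circles inequality *)

Section ThreeCircles.
Variables (R : realType) (n : nat).
Local Notation C := (Cplx R).

(* Hadamard's three circles inequality, up to a constant: interpolate the
   Cauchy estimates on the two outer radii. *)
Lemma three_circles (f : 'rV[C]_n -> C) (c : 'rV[C]_n) (s S rho al M1 M3 : R) :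
  0 < s -> s <= S -> 0 < al -> al < 1 -> 0 <= rho -> rho < s `^ al * S `^ (1 - al) ->
  0 < M1 -> M1 <= M3 -> approx (vball c S) f ->
  (forall z, vball c s z -> modulus (f z) <= M1) ->
  (forall z, vball c S z -> modulus (f z) <= M3) ->
  forall z, vball c rho z -> modulus (f z) <=
    2 / (1 - rho / (s `^ al * S `^ (1 - al))) * (M1 `^ al * M3 `^ (1 - al)) + M1.
Proof.
move=> s0 sS al0 al1 rho0 rhoD M10 M13 af f1 f3 z zc.
have S0 : 0 < S by exact: lt_le_trans sS.
have M30 : 0 < M3 by exact: lt_le_trans M13.
set D := s `^ al * S `^ (1 - al) in rhoD *.
have D0 : 0 < D by rewrite mulr_gt0 ?powR_gt0.
have DS : D <= S.
  have -> : S = S `^ al * S `^ (1 - al).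
    rewrite -powRD; last by rewrite (gt_eqF S0) implybT.
    by rewrite addrC subrK powRr1// ltW.
  by rewrite /D ler_pM2r ?powR_gt0// ge0_ler_powR ?nnegrE// ltW.
(* Approximating within M1 at most doubles both bounds; the same error is the summand M1 of the
   conclusion. *)
have [P pP fP] := af _ M10.
have P1 w : vball c s w -> modulus (P w) <= 2 * M1.
  move=> wc; have wS : vball c S w by exact: le_trans wc sS.
  have -> : P w = f w - (f w - P w) by ring.
  by rewrite (le_trans (modulusB _ _))// (le_trans (lerD (f1 _ wc) (fP _ wS)))//; lra.
have P3 w : vball c S w -> modulus (P w) <= 2 * M3.
  move=> wS; have -> : P w = f w - (f w - P w) by ring.
  by rewrite (le_trans (modulusB _ _))// (le_trans (lerD (f3 _ wS) (fP _ wS)))//; lra.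
have zS : vball c S z by rewrite /vball /= (le_trans zc)// (le_trans (ltW rhoD)).
have -> : f z = P z + (f z - P z) by ring.
rewrite (le_trans (modulusD _ _))// lerD ?fP//.
pose h := z - c; pose t := vnorm h.
have t0 : 0 <= t by exact: vnorm_ge0.
pose x := t / D.
have x0 : 0 <= x by rewrite divr_ge0// ltW.
have xrho : x <= rho / D by rewrite ler_pM2r ?invr_gt0.
have x1 : x < 1 by rewrite (le_lt_trans xrho)// ltr_pdivrMr// mul1r.
have [q qE] := polyfun_line pP c h.
pose K := 2 * (M1 `^ al * M3 `^ (1 - al)).
have al1' : 0 <= 1 - al by lra.
have KE : (2 * M1) `^ al * (2 * M3) `^ (1 - al) = K.
  rewrite !powRM ?ltW// mulrACA -powRD; last by rewrite pnatr_eq0 implybT.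
  by rewrite addrC subrK powRr1.
have Pz : P z = q.[1] by rewrite -qE scale1r /h subrKC.
have K0 : 0 <= K by rewrite !mulr_ge0 ?powR_ge0.
have qx i : modulus q`_i <= K * x ^+ i.
  have [h0|h0] := eqVneq h 0.
    have qc u : q.[u] = P c by rewrite -qE h0 scaler0 addr0.
    (* A polynomial that is constant as a function is constant: the difference has as many roots as
       its size. *)
    have q1 : q = (P c)%:P.
      apply/eqP; rewrite -subr_eq0; apply/eqP/(@roots_geq_poly_eq0 _ _ [seq i%:R | i <- iota 0 (size (q - (P c)%:P))]).
      - by apply/allP => u _; rewrite /root hornerD hornerN hornerC qc subrr.
      - by rewrite map_inj_uniq ?iota_uniq//; move=> a b /eqP; rewrite eqr_nat => /eqP.
      - by rewrite size_map size_iota.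
    rewrite q1 coefC; case: i => [|i] /=; last by rewrite modulus0 mulr_ge0// exprn_ge0.
    rewrite expr0 mulr1.
    have e1 := P1 c; rewrite /vball /= subrr vnorm0 in e1.
    have e3 := P3 c; rewrite /vball /= subrr vnorm0 in e3.
    rewrite -KE; have [->|Pc0] := eqVneq (modulus (P c)) 0; first by rewrite mulr_ge0 ?powR_ge0.
    have -> : modulus (P c) = modulus (P c) `^ al * modulus (P c) `^ (1 - al).
      rewrite -powRD; last by rewrite Pc0 implybT.
      by rewrite addrC subrK powRr1// modulus_ge0.
    by apply: ler_pM; rewrite ?powR_ge0// ge0_ler_powR ?nnegrE ?modulus_ge0 ?mulr_ge0 ?e1 ?e3// ltW.
  have tp : 0 < t by rewrite lt_def t0 andbT vnorm_eq0.
  have q1 := polyfun_coef s0 qE P1 tp i.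
  have q3 := polyfun_coef S0 qE P3 tp i.
  have [->|qi0] := eqVneq (modulus q`_i) 0; first by rewrite mulr_ge0// exprn_ge0.
  have -> : modulus q`_i = modulus q`_i `^ al * modulus q`_i `^ (1 - al).
    rewrite -powRD; last by rewrite qi0 implybT.
    by rewrite addrC subrK powRr1// modulus_ge0.
  have si0 : 0 <= s^-1 by rewrite invr_ge0 ltW.
  have Si0 : 0 <= S^-1 by rewrite invr_ge0 ltW.
  have ts0 : 0 <= t / s by rewrite divr_ge0// ltW.
  have tS0 : 0 <= t / S by rewrite divr_ge0// ltW.
  have -> : K * x ^+ i = (2 * M1 * (t / s) ^+ i) `^ al * (2 * M3 * (t / S) ^+ i) `^ (1 - al).
    rewrite powRM ?exprn_ge0 ?mulr_ge0 ?(ltW M10)//.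
    rewrite [(2 * M3 * _) `^ _]powRM ?exprn_ge0 ?mulr_ge0 ?(ltW M30)//.
    rewrite mulrACA KE; congr (_ * _).
    rewrite -!powR_mulrn// -!powRrM ![i%:R * _]mulrC !powRrM -powRM ?powR_ge0//; congr (_ `^ _).
    rewrite !powRM ?invr_ge0 ?(ltW s0) ?(ltW S0)// mulrACA -powRD; last by rewrite (gt_eqF tp) implybT.
    have -> : al + (1 - al) = 1 by ring.
    by rewrite powRr1// !powR_inv_base// -invfM.
  apply: ler_pM; rewrite ?powR_ge0// ge0_ler_powR ?nnegrE ?modulus_ge0// ?mulr_ge0 ?exprn_ge0//; exact: ltW.
have := @poly_tail_le R q K x 0 x0 x1 qx; rewrite big_ord0 subr0 expr0 -Pz => /le_trans; apply.
have -> : 2 / (1 - rho / D) * (M1 `^ al * M3 `^ (1 - al)) = K / (1 - rho / D).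
  by rewrite /K; ring.
rewrite mul1r ler_wpM2l// lef_pV2 ?posrE ?subr_gt0//; first by lra.
by rewrite ltr_pdivrMr// mul1r.
Qed.

End ThreeCircles.

(** * Slow motion near the zero set of the coordinate product *)

Section Escape.
Variables (R : realType) (d k l : nat).
Local Notation C := (Cplx R).
Local Notation Cd := 'rV[C]_d.
Local Notation N := (k * d)%N.
Variables (F : Cd -> Cd) (lam : 'I_d -> C).
Hypotheses (d0 : (0 < d)%N) (k0 : (0 < k)%N) (l0 : (0 < l)%N).
Hypotheses (lam1 : forall j, modulus (lam j) = 1) (plam : \prod_j lam j = 1).
Hypothesis OF : forall j, eqO l (fun z => F z 0 j)
  (fun z => lam j * z 0 j * (1 - coord_prod z ^+ k / N%:R)).
Local Notation au z := (modulus (coord_prod z)).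
Local Notation mx z := (modulus (coord_prod z ^+ k)).

(** Outside W(beta) relative errors are useless, so a step is estimated absolutely, e being the
    scale of |w| and tau that of |u|. *)
Lemma escape_step : exists A B r : R, [/\ 0 < A, 0 < B, 0 < r <= 1 &
  forall (w : Cd) (e tau : R), 0 < e -> 2 * e < r -> 0 <= tau -> 2 * tau <= 1 ->
    vnorm w <= 2 * e -> au w <= 2 * tau ->
    [/\ vnorm (F w) <= vnorm w + A * (e * tau ^+ k + e ^+ l),
        vnorm w <= vnorm (F w) + A * (e * tau ^+ k + e ^+ l) &
        au (F w) <= au w + B * (tau ^+ k.+1 + e ^+ (l + d.-1))]].
Proof.
have /choice[q hq] : forall j, exists q : R * R, [/\ 0 <= q.1, 0 < q.2 &
    forall z, vnorm z < q.2 -> modulus (F z 0 j - lam j * z 0 j *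
      (1 - coord_prod z ^+ k / N%:R)) <= q.1 * vnorm z ^+ l].
  by move=> j; have [K [r h]] := OF j; exists (K, r).
pose K := \sum_j (q j).1 + 1; pose s := \big[Num.min/1]_j (q j).2.
have S0 : 0 <= \sum_j (q j).1 by apply: sumr_ge0 => j _; case: (hq j).
have K0 : 0 < K by rewrite ltr_wpDl.
have s0 : 0 < s by apply/bigmin_gtP; split => // j _; case: (hq j).
have s1 : s <= 1 by apply: bigmin_le_id.
have hK z j : vnorm z < s -> modulus (F z 0 j - lam j * z 0 j *
      (1 - coord_prod z ^+ k / N%:R)) <= K * vnorm z ^+ l.
  move=> /bigmin_gtP[_ /(_ j isT) zs]; have [q0 _ /(_ z zs)/le_trans] := hq j; apply.
  rewrite ler_wpM2r ?exprn_ge0 ?vnorm_ge0// /K (bigD1 j)//= -addrA lerDl addr_ge0// sumr_ge0//.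
  by move=> i _; case: (hq i).
pose KL := K * 2 ^+ l; have KL0 : 0 < KL by rewrite mulr_gt0 ?exprn_gt0.
pose A := 2 * 2 ^+ k + KL.
have A0 : 0 < A by rewrite addr_gt0// mulr_gt0 ?exprn_gt0.
pose b := 4 + KL.
have b1 : 1 <= b by rewrite /b; lra.
pose B := d%:R * 2 ^+ d.-1 * 2 ^+ k.+1 + d%:R * b ^+ d * KL.
have B0 : 0 < B by rewrite addr_gt0 ?mulr_gt0 ?exprn_gt0 ?ltr0n//; lra.
exists A, B, s; split; rewrite ?s0//.
move=> w e tau e0 es tau0 tau1 we wt.
have w0 := vnorm_ge0 w.
have ws : vnorm w < s by exact: le_lt_trans es.
have xt : mx w <= 2 ^+ k * tau ^+ k.
  by rewrite -exprMn modulusX lerXn2r ?nnegrE ?modulus_ge0// mulr_ge0.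
have x0 : 0 <= mx w by exact: modulus_ge0.
have x1 : mx w <= 1 by rewrite modulusX exprn_ile1 ?modulus_ge0// (le_trans wt).
have wl : K * vnorm w ^+ l <= KL * e ^+ l.
  by rewrite /KL -mulrA -exprMn ler_wpM2l ?(ltW K0)// lerXn2r ?nnegrE// mulr_ge0// ltW.
have xN : modulus (coord_prod w ^+ k / N%:R) <= mx w by exact: modulus_div_N.
have xN2 : modulus (1 - coord_prod w ^+ k / N%:R) <= 2.
  by rewrite (le_trans (modulusB _ _))// modulus1; move: xN x1; lra_goal.
have dist j : modulus (F w 0 j - lam j * w 0 j) <= A * (e * tau ^+ k + e ^+ l).
  have -> : F w 0 j - lam j * w 0 j = (F w 0 j - lam j * w 0 j * (1 - coord_prod w ^+ k / N%:R)) -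
    lam j * w 0 j * (coord_prod w ^+ k / N%:R) by ring.
  rewrite (le_trans (modulusB _ _))// (le_trans (lerD (hK w j ws) (lexx _)))//.
  rewrite (le_trans (lerD wl (lexx _)))// !modulusM lam1 mul1r -modulusM.
  have h1 : modulus (w 0 j) * modulus (coord_prod w ^+ k / N%:R) <= 2 * e * (2 ^+ k * tau ^+ k).
    apply: ler_pM; rewrite ?modulus_ge0//; last exact: le_trans xN xt.
    exact: le_trans (modulus_le_vnorm _ _) we.
  have h2 : 0 <= KL * (e * tau ^+ k) by rewrite !mulr_ge0 ?exprn_ge0// ltW.
  have h3 : 0 <= 2 * 2 ^+ k * e ^+ l by rewrite !mulr_ge0 ?exprn_ge0// ltW.
  rewrite (le_trans (lerD (lexx _) h1))// /A.
  have -> : (2 * 2 ^+ k + KL) * (e * tau ^+ k + e ^+ l) =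
    KL * e ^+ l + 2 * e * (2 ^+ k * tau ^+ k) + KL * (e * tau ^+ k) + 2 * 2 ^+ k * e ^+ l by ring.
  by rewrite -addrA lerDl addr_ge0.
have lw j : modulus (lam j * w 0 j) = modulus (w 0 j) by rewrite modulusM lam1 mul1r.
have E0 : 0 <= A * (e * tau ^+ k + e ^+ l).
  by apply: mulr_ge0; [exact: ltW|apply: addr_ge0; rewrite ?mulr_ge0 ?exprn_ge0// ltW].
split.
- apply: vnorm_le => [|j]; first exact: addr_ge0.
  rewrite -[F w 0 j](subrK (lam j * w 0 j)) (le_trans (modulusD _ _))// addrC lerD//.
  by rewrite lw modulus_le_vnorm.
- apply: vnorm_le => [|j]; first by rewrite addr_ge0 ?vnorm_ge0.
  rewrite -lw -[lam j * w 0 j](subrK (F w 0 j)) (le_trans (modulusD _ _))// addrC lerD//.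
    exact: modulus_le_vnorm.
  by rewrite modulus_distC.
(* Divided by e, the coordinates are bounded and their errors are O(e^(l - 1)); multiplying the
   estimate for the product back by e^d gives e^(l + d - 1). *)
pose g j : C := F w 0 j / ofR e; pose f j : C := lam j * w 0 j * (1 - coord_prod w ^+ k / N%:R) / ofR e.
have me : modulus (ofR e) = e by rewrite modulus_ofR_ge0// ltW.
have en0 : ofR e != 0 :> C by rewrite -modulus_gt0 me.
have e1 : e <= 1 by move: es s1 e0; lra_goal.
have el : e ^+ l <= e by case: (l) l0 => // n _; rewrite exprS ler_piMr ?exprn_ile1// ltW.
have f4 j : modulus (f j) <= 4.
  rewrite modulusM modulusV me ler_pdivrMr// modulusM lw (@le_trans _ _ (2 * e * 2))//; last first.
    by rewrite mulrAC -natrM.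
  apply: ler_pM; rewrite ?modulus_ge0//.
  exact: le_trans (modulus_le_vnorm _ _) we.
have gf j : modulus (g j - f j) <= KL * (e ^+ l / e).
  rewrite /g /f -mulrBl modulusM modulusV me mulrA ler_pM2r ?invr_gt0//.
  exact: le_trans (hK w j ws) wl.
have ele : e ^+ l / e <= 1 by rewrite ler_pdivrMr// mul1r.
have fb j : modulus (f j) <= b by apply: (le_trans (f4 j)); rewrite lerDl ltW.
have gb j : modulus (g j) <= b.
  rewrite -[g j](subrK (f j)) (le_trans (modulusD _ _))// /b addrC lerD//.
  by rewrite (le_trans (gf j))// ler_piMr// ltW.
have hd := @modulus_prod_dist R 'I_d (index_enum 'I_d) g f b _ b1 gb fb gf.
have szd : size (index_enum 'I_d) = d by rewrite -[RHS](size_enum_ord d) enumT [index_enum _]unlock.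
rewrite szd in hd.
have pg : \prod_j g j = coord_prod (F w) / ofR e ^+ d.
  by rewrite big_split /= prodr_const card_ord exprVn.
have pf : \prod_j f j = coord_prod w * (1 - coord_prod w ^+ k / N%:R) ^+ d / ofR e ^+ d.
  by rewrite !big_split /= !prodr_const card_ord exprVn plam mul1r.
rewrite pg pf -mulrBl modulusM modulusV modulusX me ler_pdivrMr ?exprn_gt0// in hd.
have d1 : modulus ((1 - coord_prod w ^+ k / N%:R) ^+ d - 1) <= d%:R * 2 ^+ d.-1 * mx w.
  have e2 : modulus (1 : C) <= 2 by rewrite modulus1 ler1n.
  have := modulus_expr_dist d xN2 e2; rewrite expr1n => /le_trans; apply.
  rewrite mulrAC ler_wpM2l ?mulr_ge0 ?exprn_ge0//.
  have -> : 1 - coord_prod w ^+ k / N%:R - 1 = - (coord_prod w ^+ k / N%:R) by ring.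
  by rewrite modulusN.
have -> : coord_prod (F w) = (coord_prod (F w) - coord_prod w * (1 - coord_prod w ^+ k / N%:R) ^+ d) +
  (coord_prod w + coord_prod w * ((1 - coord_prod w ^+ k / N%:R) ^+ d - 1)) by ring.
rewrite (le_trans (modulusD _ _))// (le_trans (lerD hd (modulusD _ _)))//.
rewrite addrCA lerD2l modulusM.
have h1 : au w * modulus ((1 - coord_prod w ^+ k / N%:R) ^+ d - 1) <=
    d%:R * 2 ^+ d.-1 * 2 ^+ k.+1 * tau ^+ k.+1.
  rewrite (@le_trans _ _ (2 * tau * (d%:R * 2 ^+ d.-1 * (2 ^+ k * tau ^+ k))))//.
    apply: ler_pM; rewrite ?modulus_ge0// (le_trans d1)// ler_wpM2l// mulr_ge0 ?exprn_ge0//.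
  by rewrite !exprS le_eqVlt; apply/orP; left; apply/eqP; ring.
have h2 : d%:R * b ^+ d * (KL * (e ^+ l / e)) * e ^+ d = d%:R * b ^+ d * KL * e ^+ (l + d.-1).
  rewrite exprD -[in e ^+ d](prednK d0) exprS; field.
  by rewrite gt_eqF.
rewrite h2 (le_trans (lerD (lexx _) h1))// /B.
have h3 : 0 <= d%:R * 2 ^+ d.-1 * 2 ^+ k.+1 * e ^+ (l + d.-1) by rewrite !mulr_ge0 ?exprn_ge0// ltW.
have h4 : 0 <= d%:R * b ^+ d * KL * tau ^+ k.+1.
  have b0 := le_trans ler01 b1.
  by rewrite mulr_ge0 ?exprn_ge0// mulr_ge0 ?(ltW KL0)// mulr_ge0 ?exprn_ge0.
move: h3 h4; set a1 := d%:R * 2 ^+ d.-1 * 2 ^+ k.+1; set a2 := d%:R * b ^+ d * KL.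
set t1 := tau ^+ _; set t2 := e ^+ _.
have -> : (a1 + a2) * (t1 + t2) = a1 * t1 + a1 * t2 + a2 * t1 + a2 * t2 by ring.
clear; move=> *; lra.
Qed.

End Escape.

Lemma escape_constants (R : realType) (A B x : R) : 0 < A -> 0 < B -> 0 <= x ->
  x <= (4 * A + 2 * B)^-1 -> 2 * A * x <= 2^-1 /\ 2 * B * x <= 1.
Proof.
move=> A0 B0 x0; rewrite -[leRHS]mul1r ler_pdivlMr; last by lra.
move=> h; have h1 : 0 <= A * x by rewrite mulr_ge0// ltW.
have h2 : 0 <= B * x by rewrite mulr_ge0// ltW.
by split; lra.
Qed.

(** * Escape time and decay rate *)

Section EscapeTime.
Variables (R : realType) (d k l : nat).
Local Notation C := (Cplx R).
Local Notation Cd := 'rV[C]_d.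
Local Notation N := (k * d)%N.
Variables (F : Cd -> Cd) (lam : 'I_d -> C).
Hypotheses (d0 : (0 < d)%N) (k0 : (0 < k)%N) (l0 : (0 < l)%N).
Hypotheses (lam1 : forall j, modulus (lam j) = 1) (plam : \prod_j lam j = 1).
Hypothesis OF : forall j, eqO l (fun z => F z 0 j)
  (fun z => lam j * z 0 j * (1 - coord_prod z ^+ k / N%:R)).
Local Notation au z := (modulus (coord_prod z)).

Variable beta : R.
Hypotheses (b0 : 0 < beta) (bd : beta < d%:R^-1).
Hypothesis be : 2 * k%:R + 1 <= beta * (l%:R + d%:R - 1).

(* An orbit starting close to the zero set of the coordinate product needs a
   long time to approach the origin. *)
Lemma escape_time : exists e0 c0 : R, [/\ 0 < e0, 0 < c0 & forall z : Cd,
  0 < vnorm z -> vnorm z < e0 -> au z <= vnorm z `^ beta^-1 ->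
  forall i, i%:R * vnorm z `^ (k%:R / beta) <= c0 -> vnorm z / 2 <= vnorm (iter i F z)].
Proof.
have [A [B [r [A0 B0 /andP[r0 r1] hs]]]] := escape_step d0 k0 l0 lam1 plam OF.
have bi0 : 0 < beta^-1 by rewrite invr_gt0.
have q0 : 0 < 2^-1 :> R by [].
have [e1 /andP[e10 e11] he1] := powR_lt_threshold q0 bi0.
pose c0 := (4 * A + 2 * B)^-1; have c00 : 0 < c0 by rewrite invr_gt0 addr_gt0 ?mulr_gt0.
exists (Num.min e1 (r / 2)), c0; split => //; first by rewrite lt_min e10 divr_gt0.
move=> z; set e := vnorm z => ep; rewrite lt_min => /andP[ee1 er] uz.
have e1' : e <= 1 by lra.
(* The bound on |u| that holds outside W(beta). *)
pose tau := e `^ beta^-1.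
have t2 : 2 * tau <= 1 by have := he1 _ (ltW ep) ee1; rewrite -/tau; lra.
have t0 : 0 <= tau by exact: powR_ge0.
have tkE : e `^ (k%:R / beta) = tau ^+ k.
  by rewrite /tau -powR_mulrn ?powR_ge0// -powRrM mulrC.
have en0 : e != 0 by rewrite gt_eqF.
have ege (x y : R) : x <= y -> e `^ y <= e `^ x.
  by move=> xy; apply: ger_powR => //; rewrite ep.
have bd1 : beta * d%:R < 1 by rewrite -ltr_pdivlMr ?ltr0n// mul1r.
(* The remainders of [escape_step] are dominated by its terms in tau. This uses beta (l + d - 1) >=
   2k + 1, here together with beta d < 1. *)
have el : e ^+ l <= e * tau ^+ k.
  rewrite -(prednK l0) exprS ler_wpM2l ?(ltW ep)// -tkE -powR_mulrn ?(ltW ep)//.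
  apply: ege; rewrite ler_pdivrMr// mulrC -subn1 natrB//.
  have : 0 <= k%:R :> R by [].
  by move: be; rewrite !(mulrDr, mulrBr); lra.
have el2 : e ^+ (l + d.-1) <= tau ^+ k.+1.
  rewrite /tau -[leRHS]powR_mulrn ?powR_ge0// -powRrM -powR_mulrn ?(ltW ep)//.
  apply: ege; rewrite mulrC ler_pdivrMr// mulrC natrD -subn1 natrB// -natr1.
  have : 0 <= k%:R :> R by [].
  by move: be; rewrite !(mulrDr, mulrBr); lra.
have tk0 : 0 <= tau ^+ k by exact: exprn_ge0.
have tkk : tau ^+ k.+1 = tau * tau ^+ k by rewrite exprS.
(* Bootstrap: while i tau^k <= c0 the accumulated drift keeps |w| and |u| within twice their initial
   scales, so the one-step estimate applies again. *)
have key i : i%:R * tau ^+ k <= c0 ->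
    [/\ vnorm (iter i F z) <= e + 2 * A * e * (i%:R * tau ^+ k),
        e <= vnorm (iter i F z) + 2 * A * e * (i%:R * tau ^+ k) &
        au (iter i F z) <= tau + 2 * B * tau * (i%:R * tau ^+ k)].
  elim: i => [|i ih] hi.
    by rewrite !mul0r !mulr0 !addr0 /= lexx.
  have hi' : i%:R * tau ^+ k <= c0.
    by rewrite (le_trans _ hi)// ler_wpM2r// ler_nat.
  have [h1 h2 h3] := ih hi'.
  have it0 : 0 <= i%:R * tau ^+ k by rewrite mulr_ge0.
  have [j1 j2] := escape_constants A0 B0 it0 hi'.
  have v2 : vnorm (iter i F z) <= 2 * e.
    apply: (le_trans h1); move: (ler_wpM2l (ltW ep) j1) (ep).
    by generalize (tau ^+ k); lra_goal.
  have u2 : au (iter i F z) <= 2 * tau.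
    apply: (le_trans h3); move: (ler_wpM2l t0 j2).
    by generalize (tau ^+ k); lra_goal.
  have er2 : 2 * e < r by rewrite -ltr_pdivlMl// mulrC.
  have [s1 s2 s3] := hs _ e tau ep er2 t0 t2 v2 u2.
  have AA : A * (e * tau ^+ k + e ^+ l) <= 2 * A * e * tau ^+ k.
    by move: (ler_wpM2l (ltW A0) el); generalize (tau ^+ k) (e ^+ l); lra_goal.
  have BB : B * (tau ^+ k.+1 + e ^+ (l + d.-1)) <= 2 * B * tau * tau ^+ k.
    by move: (ler_wpM2l (ltW B0) el2); rewrite tkk; generalize (tau ^+ k) (e ^+ (l + d.-1)); lra_goal.
  have iS : i.+1%:R * tau ^+ k = i%:R * tau ^+ k + tau ^+ k by rewrite -natr1 mulrDl mul1r.
  rewrite iS /=; split.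
  - by move: h1 s1 AA; lra_goal.
  - by move: h2 s2 AA; lra_goal.
  by move: h3 s3 BB; lra_goal.
move=> i; rewrite tkE => hi; have [_ h2 _] := key i hi.
have it0 : 0 <= i%:R * tau ^+ k by rewrite mulr_ge0.
have [j1 _] := escape_constants A0 B0 it0 hi.
by move: (ler_wpM2l (ltW ep) j1) h2; generalize (tau ^+ k) (vnorm (iter i F z)); lra_goal.
Qed.

(** If w is not in W(beta), its orbit has norm at least |w| / 2 for about |w|^(- k / beta) steps.
    Decay at the rate i^(- a) then forces |w| <= D |w|^(k a / beta), which is impossible for small w
    because k a > beta. *)
Lemma decay_in_W (a A : R) (i0 : nat) : 0 < a -> beta < k%:R * a -> 0 < A ->
  exists2 e1 : R, 0 < e1 & forall w : Cd,
    (forall i, (i0 < i)%N -> vnorm (iter i F w) <= A * (i%:R `^ a)^-1) ->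
    0 < vnorm w -> vnorm w < e1 -> W_region beta w.
Proof.
move=> a0 ba A0; have [e0 [c0 [e00 c00 hesc]]] := escape_time.
have kap : 0 < k%:R * a / beta - 1 by rewrite subr_gt0 ltr_pdivlMr// mul1r.
have kb : 0 < k%:R / beta by rewrite divr_gt0// ltr0n.
pose D := 2 * A * ((c0 / 2) `^ a)^-1.
have D0 : 0 < D by rewrite !mulr_gt0// invr_gt0 powR_gt0// divr_gt0.
have D1 : 0 < D^-1 by rewrite invr_gt0.
have [e2 /andP[e20 _] he2] := powR_lt_threshold D1 kap.
have i2 : 0 < c0 / (2 * i0%:R + 2) by rewrite divr_gt0// ltr_wpDl// mulr_ge0.
have [e3 /andP[e30 _] he3] := powR_lt_threshold i2 kb.
exists (Num.min (Num.min e0 e2) e3); first by rewrite !lt_min e00 e20.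
move=> w hw; set e := vnorm w => ep; rewrite !lt_min => /andP[/andP[ee0 ee2] ee3].
apply/(W_region_vnorm d0); rewrite ltNge; apply/negP => ue.
have bi0 : 0 <= beta^-1 by rewrite invr_ge0 ltW.
have uz : au w <= e `^ beta^-1.
  have -> : au w = (au w `^ beta) `^ beta^-1.
    by rewrite -powRrM mulfV ?gt_eqF// powRr1 ?modulus_ge0.
  by rewrite ge0_ler_powR ?nnegrE ?powR_ge0 ?(ltW ep).
pose T := e `^ (k%:R / beta).
have T0 : 0 < T by exact: powR_gt0.
pose Q := c0 / T.
have Q0 : 0 < Q by exact: divr_gt0.
have Qi : 2 * i0%:R + 2 <= Q.
  have := he3 _ (ltW ep) ee3; rewrite -/T ltr_pdivlMr; last by rewrite ltr_wpDl// mulr_ge0.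
  by rewrite /Q ler_pdivlMr// mulrC => /ltW.
pose i := Num.trunc Q.
have iQ : i%:R <= Q by rewrite truncn_le// ltW.
have iQ2 : Q / 2 <= i%:R.
  move: (truncnS_gt Q) Qi (ler0n R i0); rewrite -/i -natr1; lra_goal.
have ii0 : (i0 < i)%N by rewrite -(ltr_nat R); move: Qi iQ2; lra_goal.
have h1 := hesc w ep ee0 uz i; rewrite -/T -/e in h1.
have {}h1 : e / 2 <= vnorm (iter i F w) by apply: h1; rewrite -ler_pdivlMr.
have h2 := le_trans h1 (hw i ii0).
have Q20 : 0 < Q / 2 by rewrite divr_gt0.
have h3 : (i%:R `^ a)^-1 <= ((Q / 2) `^ a)^-1.
  rewrite lef_pV2 ?posrE ?powR_gt0//; last by rewrite (lt_le_trans Q20).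
  by rewrite ge0_ler_powR ?nnegrE// ltW.
have h4 : ((Q / 2) `^ a)^-1 = ((c0 / 2) `^ a)^-1 * (e * e `^ (k%:R * a / beta - 1)).
  have -> : Q / 2 = c0 / 2 * T^-1 by rewrite /Q; ring.
  rewrite powRM ?invr_ge0 ?(ltW T0) ?divr_ge0 ?(ltW c00)// invfM powR_inv_base// invrK.
  congr (_ * _); rewrite /T -powRrM.
  have e1 : e = e `^ 1 by rewrite powRr1// ltW.
  rewrite [X in _ = X * _]e1 -powRD; last by rewrite (gt_eqF ep) implybT.
  by congr (_ `^ _); ring.
have h5 : e / 2 <= D / 2 * (e * e `^ (k%:R * a / beta - 1)).
  rewrite (le_trans h2)// (le_trans (ler_wpM2l (ltW A0) h3))// h4 /D.
  set y := (_ `^ a)^-1; set x := e * _.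
  by have -> : 2 * A * y / 2 * x = A * (y * x) by field.
have h6 := he2 _ (ltW ep) ee2.
have h7 : e < e.
  rewrite -(@ltr_pM2r _ (2^-1))// (le_lt_trans h5)//.
  have -> : D / 2 * (e * e `^ (k%:R * a / beta - 1)) = D * e `^ (k%:R * a / beta - 1) * (e / 2) by ring.
  rewrite -[ltRHS]mul1r ltr_pM2r ?divr_gt0//.
  by rewrite mulrC -ltr_pdivlMr// mul1r.
by rewrite ltxx in h7.
Qed.

End EscapeTime.

(** * Bounds on compact sets and on balls of normality *)

Section UniformDecay.
Variables (R : realType) (d k p : nat).
Local Notation C := (Cplx R).
Local Notation Cd := 'rV[C]_d.
Variable G : Cd -> Cd.
Hypotheses (d0 : (0 < d)%N) (k0 : (0 < k)%N) (p0 : (0 < p)%N).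
Hypotheses (eG : entire_map G).
Variables (theta beta r : R).
Hypotheses (tt : 0 < theta < pi / (2 * k%:R)) (b0 : 0 < beta).
Local Notation F := (iter p G).
Hypothesis admr : admissible_radius F k r theta beta.
Local Notation Omega h := (basin F k h r theta beta).
Local Notation Bh h := (B_region k h r theta beta).
Local Notation au z := (modulus (coord_prod z)).
Local Notation vz z := (fatou_v k (coord_prod z)).
Hypothesis grow : forall h z n, Bh h z -> n%:R / 2 <= Re (vz (iter n F z)).

Definition total_basin : set Cd := [set z | exists2 h, (h < k)%N & Omega h z].

Lemma total_basin_open : open total_basin.
Proof.
have -> : total_basin = \bigcup_(h in [set h | (h < k)%N]) Omega h.
  by apply/seteqP; split => z [h hk Oz]; exists h.
by apply: bigcup_open => h _; exact: (basin_open d0 k0 eG tt b0 admr).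
Qed.

(** A finite cover gives one time m at which all of K is in the regions B_h. From then on Re v grows
    by 1/2 per step, so Re v_n >= n/4 for large n, and |z| <= |u|^beta = |v|^(- beta / k). *)
Lemma compact_basin_decay (K : set Cd) : compact K -> K `<=` total_basin ->
  exists2 A : R, 0 < A & exists n1, forall z n, K z -> (n1 <= n)%N ->
    vnorm (iter n F z) <= A * (n%:R `^ (beta / k%:R))^-1.
Proof.
move=> cK KO.
pose U m : set Cd := \bigcup_(h in [set h | (h < k)%N]) (iter m F @^-1` Bh h).
have [D _ KD] : finite_subset_cover setT U K.
  move: cK; rewrite compact_cover; apply.
    by move=> m _; apply: bigcup_open => h _; exact: (B_preimage_open d0 k0 eG tt b0 admr).
  by move=> z /KO[h hk [m _ Bz]]; exists m => //; exists h.
pose m := (\max_(i <- finmap.enum_fset D) i)%N.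
have Km z : K z -> exists2 h, (h < k)%N & Bh h (iter m F z).
  move=> /KD[i /= iD [h hk Bi]]; exists h => //.
  have im : (i <= m)%N by by exact: (@leq_bigmax_seq _ (finmap.enum_fset D) predT (fun i => i) i iD isT).
  rewrite -(subnK im); elim: (m - i)%N => [//|n ih].
  by rewrite addSn /=; apply: (admr.2 h hk).1; exists (iter (n + i) F z).
pose s := beta / k%:R; have s0 : 0 < s by rewrite divr_gt0// ltr0n.
exists (4 `^ s); first by rewrite powR_gt0.
exists (2 * m).+1 => z n Kz nm.
have [h hk Bm] := Km z Kz.
have mn : (m <= n)%N by lia.
have n0 : 0 < n%:R :> R by rewrite ltr0n; lia.
have Bn : Bh h (iter n F z).
  rewrite -(subnK mn); elim: (n - m)%N => [//|i ih].
  by rewrite addSn /=; apply: (admr.2 h hk).1; exists (iter (i + m) F z).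
have vn : n%:R / 4 <= Re (vz (iter n F z)).
  have := grow (n - m)%N Bm; rewrite -iterD subnK// natrB// => h1; apply: le_trans h1.
  have : 2 * m%:R <= n%:R :> R by rewrite -natrM ler_nat; lia.
  lra.
have u0 : 0 < au (iter n F z) by case: Bn => Wn _; exact: W_coord_prod_gt0 Wn.
rewrite (le_trans (W_vnorm_le Bn.1))//.
have -> : au (iter n F z) `^ beta = modulus (coord_prod (iter n F z) ^+ k) `^ s.
  rewrite modulusX -powR_mulrn ?modulus_ge0// -powRrM; congr (_ `^ _).
  by rewrite /s mulrC divfK// pnatr_eq0 -lt0n.
rewrite -powR_inv_base// -powRM ?invr_ge0//.
rewrite ge0_ler_powR ?nnegrE ?modulus_ge0 ?mulr_ge0 ?invr_ge0 ?(ltW s0) ?(ltW b0)//.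
rewrite -[leLHS]invrK -modulusV -/(fatou_v k _) -[leRHS]invrK lef_pV2 ?posrE.
- rewrite invf_div (le_trans vn)// (le_trans (ler_norm _))// Re_le_modulus//.
- by rewrite modulus_gt0 invr_neq0// expf_neq0// -modulus_gt0.
by rewrite invf_div divr_gt0.
Qed.

(* Compact divergence is excluded by the orbit of a point of the basin. *)
Lemma fatou_orbits_bounded (U : set Cd) (q c : Cd) (S : R) : normal_on U (range (fun n => iter n G)) ->
  vball q S `<=` U -> U c -> total_basin c ->
  exists M : R, forall n z, vball q S z -> vnorm (iter n F z) <= M.
Proof.
move=> nU qU Uc [h hk Oc].
have [B hB] : exists B : R, forall n, vnorm (iter n F c) <= B.
  have [n0 hn0] := basin_attracted admr hk Oc ltr01.
  exists (1 + \sum_(i < n0) vnorm (iter i F c)) => n.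
  have [n0n|nn0] := leqP n0 n.
    by rewrite (le_trans (ltW (hn0 _ n0n)))// lerDl sumr_ge0// => i _; exact: vnorm_ge0.
  rewrite (bigD1 (Ordinal nn0))//= addrCA lerDl addr_ge0// sumr_ge0// => i _; exact: vnorm_ge0.
apply: contrapT => nb.
have /choice[m hm] : forall i : nat, exists m : nat * Cd,
    vball q S m.2 /\ i%:R < vnorm (iter m.1 F m.2).
  move=> i; apply: contrapT => h1; apply: nb; exists i%:R => n z zq.
  by rewrite leNgt; apply/negP => h2; apply: h1; exists (n, z).
have iterF n : iter n F = iter (n * p) G.
  by apply/funext => z; elim: n z => //= n ih z; rewrite ih -iterD.
pose f i := iter (m i).1 F.
have [|s [sh [[g cg]|dv]]] := nU f; first by move=> i; exists ((m i).1 * p)%N => //; rewrite /f iterF.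
  have /uniform_vnormP/(_ _ ltr01)[n0 hn0] := cg _ (@compact_vball R d q S) qU.
  have eF : entire_map (f (s n0)) by exact: entire_map_iter (entire_map_iter _ eG).
  have /choice[K hK] : forall j, exists K : R, 0 <= K /\
      forall z, vball q S z -> modulus (f (s n0) z 0 j) <= K.
    move=> j; have [K K0 h'] := approx_bound (vbounded_ball q S) (entire_approx (eF j) (vbounded_ball q S)).
    by exists K.
  pose KK := \sum_j K j.
  have KK0 : 0 <= KK by apply: sumr_ge0 => j _; case: (hK j).
  have bK z : vball q S z -> vnorm (f (s n0) z) <= KK.
    move=> zq; apply: vnorm_le => // j; have [_ /(_ z zq)/le_trans] := hK j; apply.
    by rewrite /KK (bigD1 j)//= lerDl sumr_ge0// => i _; case: (hK i).
  pose i := maxn n0 (Num.trunc (KK + 2)).+1.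
  have si : (i <= s i)%N.
    elim: i => // j ih; exact: leq_ltn_trans ih (sh _ _ (ltnSn j)).
  have [zq zbig] := hm (s i).
  have h1 := hn0 i (leq_maxl _ _) _ zq; have h2 := hn0 n0 (leqnn _) _ zq.
  have h3 := bK _ zq; rewrite /= in h1 h2.
  have h4 : KK + 2 < vnorm (f (s i) (m (s i)).2).
    rewrite (lt_trans _ zbig)// (lt_le_trans (truncnS_gt _))// ler_nat.
    by rewrite (leq_trans _ si)// leq_maxr.
  have := vnorm_distD (f (s i) (m (s i)).2) (f (s n0) (m (s i)).2).
  have := vnorm_triangle (g (m (s i)).2) (f (s i) (m (s i)).2) (f (s n0) (m (s i)).2).
  rewrite [vnorm (g _ - _)]vnorm_distC; lra.
have [n0 _ hn0] := dv [set c] (vball 0 B) (@compact_set1 _ c) (fun z (e : z = c) => eq_ind_r U Uc e)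
  (@compact_vball R d 0 B).
have := hn0 n0 (leqnn _); rewrite -subset0 => /(_ (f (s n0) c)); apply; split; first by exists c.
by rewrite /vball /= subr0 hB.
Qed.

End UniformDecay.

Lemma midpoint_lt (R : realType) (x y z : R) : x < y -> y <= z -> x < (x + y) / 2 < z.
Proof. by move=> *; apply/andP; split; lra. Qed.

(** * The basins are Fatou components *)

Section FatouComponents.
Variables (R : realType) (d k l p : nat).
Local Notation C := (Cplx R).
Local Notation Cd := 'rV[C]_d.
Local Notation N := (k * d)%N.
Variables (G : Cd -> Cd) (lam : 'I_d -> C).
Local Notation F := (iter p G).
Hypotheses (d1 : (1 < d)%N) (k0 : (0 < k)%N) (p0 : (0 < p)%N) (l0 : (0 < l)%N).
Hypotheses (lam1 : forall j, modulus (lam j) = 1) (plam : \prod_j lam j = 1).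
Hypothesis OF : forall j, eqO l (fun z => F z 0 j)
  (fun z => lam j * z 0 j * (1 - coord_prod z ^+ k / N%:R)).
Hypotheses (eG : entire_map G) (iG : injective G) (G0 : G 0 = 0).
Variables (theta beta r : R).
Hypothesis adm : admissible_exponents d k l theta beta.
Hypothesis admr : admissible_radius F k r theta beta.
Local Notation Omega h := (basin F k h r theta beta).
Local Notation Bh h := (B_region k h r theta beta).
Local Notation vz z := (fatou_v k (coord_prod z)).
Local Notation Omegas := (total_basin k p G theta beta r).
Hypothesis grow : forall h z n, Bh h z -> n%:R / 2 <= Re (vz (iter n F z)).

Let d0 : (0 < d)%N. Proof. exact: ltnW. Qed.
Let b0 : 0 < beta. Proof. by case: adm => _ /andP[]. Qed.
Let tt : 0 < theta < pi / (2 * k%:R). Proof. by case: adm. Qed.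

Definition decay_rate (a : R) (A : R) (i0 : nat) (z : Cd) : Prop :=
  forall i, (i0 < i)%N -> vnorm (iter i F z) <= A * (i%:R `^ a)^-1.

Lemma F_iter_neq0 n z : z != 0 -> iter n F z != 0.
Proof.
have G1 q w : w != 0 -> iter q G w != 0.
  by elim: q => //= q ih /ih; apply: contra => /eqP; rewrite -{1}G0 => /iG ->.
by elim: n => //= n ih /ih; exact: G1.
Qed.

(** Decay on a whole ball, and not only at z, serves to exclude z = 0: points (t, 0, ..., 0) near
    the origin would lie in W(beta') by [decay_in_W], although their coordinate product vanishes. *)
Lemma decay_total_basin beta' (a A e : R) i0 (z : Cd) : 0 < beta' -> beta' < d%:R^-1 ->
  2 * k%:R + 1 <= beta' * (l%:R + d%:R - 1) -> 0 < a -> beta' < k%:R * a -> 0 < A -> 0 < e ->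
  (forall w, vnorm (w - z) < e -> decay_rate a A i0 w) -> Omegas z.
Proof.
move=> b'0 b'd be' a0 ba A0 e0 hz.
have [e1 e10 he1] := decay_in_W d0 k0 l0 lam1 plam OF b'0 b'd be' i0 a0 ba A0.
have z0 : z != 0.
  apply/eqP => z0; pose t := Num.min (e1 / 2) (e / 2).
  have t0 : 0 < t by rewrite lt_min !divr_gt0.
  have [te1 te] : t < e1 /\ t < e.
    have [] : t <= e1 / 2 /\ t <= e / 2 by rewrite !ge_min !lexx !orbT.
    by move=> *; split; lra.
  pose w : Cd := \row_j (if j == Ordinal d0 then ofR t else 0).
  have wt : vnorm w = t.
    apply/le_anti/andP; split.
      apply: vnorm_le => [|j]; first exact: ltW.
      by rewrite mxE; case: eqP => _; rewrite ?modulus0 ?modulus_ofR_ge0 ?(ltW t0).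
    by have := modulus_le_vnorm w (Ordinal d0); rewrite mxE eqxx modulus_ofR_ge0 ?(ltW t0).
  have /he1 : decay_rate a A i0 w by apply: hz; rewrite z0 subr0 wt.
  rewrite wt => /(_ t0 te1) Ww.
  have := W_coord_prod_gt0 d0 b'0 Ww.
  rewrite /coord_prod (bigD1 (Ordinal d1))//= mxE (_ : _ == _ = false)// mul0r modulus0.
  by rewrite ltxx.
have dz : decay_rate a A i0 z by apply: hz; rewrite subrr vnorm0.
have small (e2 : R) : 0 < e2 -> exists n0, forall n, (n0 <= n)%N -> vnorm (iter n F z) < e2.
  move=> e20; pose Q := (A / e2) `^ a^-1.
  exists (i0 + (Num.trunc Q).+1)%N => n nn.
  have i0n : (i0 < n)%N by rewrite (leq_trans _ nn)// addnS ltnS leq_addr.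
  have Qn : Q < n%:R by rewrite (lt_le_trans (truncnS_gt _))// ler_nat (leq_trans _ nn)// leq_addl.
  rewrite (le_lt_trans (dz n i0n))//.
  have n0 : 0 < n%:R `^ a by rewrite powR_gt0// (le_lt_trans (powR_ge0 _ _) Qn).
  rewrite ltr_pdivrMr// -ltr_pdivrMl// mulrC.
  have -> : A / e2 = Q `^ a.
    by rewrite /Q -powRrM mulVf ?gt_eqF// powRr1// divr_ge0 ?ltW.
  by rewrite gt0_ltr_powR ?nnegrE ?powR_ge0.
have [n0 hn0] := small _ e10.
have Wz : exists n1, forall n, (n1 <= n)%N -> W_region beta' (iter n F z).
  exists (n0 + i0).+1 => n nn; apply: he1.
  - move=> i ii; have i0' : 0 < i%:R :> R by rewrite ltr0n (leq_ltn_trans _ ii).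
    rewrite -iterD (le_trans (dz (i + n)%N _))//.
      by rewrite (leq_trans (leq_ltn_trans (leq_addl n0 i0) nn)) ?leq_addl.
    rewrite ler_wpM2l ?(ltW A0)// lef_pV2 ?posrE ?powR_gt0 ?ltr0n ?addn_gt0 ?(leq_ltn_trans _ ii)//.
    by rewrite ge0_ler_powR ?nnegrE ?(ltW a0)// ler_nat leq_addr.
  - by rewrite lt_def vnorm_ge0 andbT vnorm_eq0; exact: F_iter_neq0.
  - by apply: hn0; exact: ltnW (leq_ltn_trans (leq_addr i0 n0) nn).
have [h hk Oh] := eventually_W_basin d0 k0 lam1 plam OF adm admr b'0 be' Wz small.
by exists h.
Qed.

(** c is a basin point close to q, and rr is the supremum of the radii of balls about c contained in
    the union of the basins. The interpolated decay produces a larger such ball, a contradiction. *)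
Lemma total_basin_closed_in_fatou q : fatou_set G q -> closure Omegas q -> Omegas q.
Proof.
move=> [U [Uo Uq nU]] clq; apply: contrapT => nq.
have [/andP[t0 tpi] /andP[_ bd] be] := adm.
have [rho0 rho00 hU] := (open_vnormP U).1 Uo q Uq.
pose S0 := rho0 / 2; have S00 : 0 < S0 by rewrite divr_gt0.
have qU : vball q S0 `<=` U.
  by move=> z zq; apply: hU; rewrite (le_lt_trans zq)// /S0; lra.
have [c [Oc cq]] : exists c, Omegas c /\ vnorm (c - q) < S0 / 4.
  have [c [Oc cq]] := clq [set w | vnorm (w - q) < S0 / 4]
    ((nbhs_vnormP q _).2 (ex_intro2 _ _ (S0 / 4) (divr_gt0 S00 (ltr0n _ 4)) (fun w h => h))).
  by exists c.
have Uc : U c by apply: qU; rewrite /vball /=; lra.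
have [M hM] := fatou_orbits_bounded eG admr nU qU Uc Oc.
pose Ss : set R := [set s | 0 <= s /\ vball c s `<=` Omegas].
have ubS s : Ss s -> s <= vnorm (q - c).
  by move=> [_ h]; rewrite leNgt; apply/negP => /ltW/h.
have S0c : Ss 0.
  by split => // z; rewrite /vball /= => zc; rewrite (_ : z = c)//; apply/eqP;
    rewrite -subr_eq0 -vnorm_eq0 eq_le zc vnorm_ge0.
have hsS : has_sup Ss by split; [exists 0|exists (vnorm (q - c)) => s /ubS].
pose rr := sup Ss.
have Oo : open Omegas := total_basin_open d0 k0 eG tt b0 admr.
have rr0 : 0 < rr.
  have [e e0 he] := (open_vnormP _).1 Oo c Oc.
  rewrite (@lt_le_trans _ _ (e / 2)) ?divr_gt0//; apply: sup_upper_bound => //.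
  split; first by rewrite divr_ge0 ?ltW.
  by move=> z zc; apply: he; rewrite (le_lt_trans zc)//; lra.
have rrc : rr <= vnorm (q - c) by apply: sup_le_ub; [exists 0|move=> s /ubS].
pose Rb := S0 / 2.
have rrb : 2 * rr <= Rb by rewrite vnorm_distC in cq; rewrite /Rb; lra.
have Rb0 : 0 < Rb by rewrite divr_gt0.
have bMq z : vball c Rb z -> vball q S0 z.
  rewrite /vball /= => zc; have := vnorm_triangle c z q; rewrite /Rb in zc; lra.
have ld0 : 0 < l%:R + d%:R - 1 :> R.
  by rewrite -addrA ltr_wpDr ?ltr0n// subr_ge0 ler1n.
(* The least exponent for which the estimates on W(b') hold. Admissibility is strict, so b' < beta,
   which leaves room for a worse rate of decay. *)
pose b' : R := (2 * k%:R + 1) / (l%:R + d%:R - 1).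
have b'0 : 0 < b' by rewrite divr_gt0// ltr_wpDl// mulr_ge0.
have b'b : b' < beta by rewrite ltr_pdivrMr.
have b'd : b' < d%:R^-1 by exact: lt_trans bd.
have be' : 2 * k%:R + 1 <= b' * (l%:R + d%:R - 1) by rewrite divfK// gt_eqF.
(* With this weight the rate beta / k drops to (b' + beta) / (2 k), still above the b' / k required
   by [decay_total_basin]. *)
pose al := (b' + beta) / 2 / beta.
have al0 : 0 < al by rewrite divr_gt0// divr_gt0// addr_gt0.
have al1 : al < 1 by rewrite ltr_pdivrMr// mul1r; case/andP: (midpoint_lt b'b (lexx beta)).
have alb : al * beta = (b' + beta) / 2 by rewrite divfK// gt_eqF.
have kR0 : 0 < k%:R :> R by rewrite ltr0n.
pose a := al * (beta / k%:R).
have a0 : 0 < a by rewrite mulr_gt0// divr_gt0.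
have ka : k%:R * a = (b' + beta) / 2.
  by rewrite /a -alb; field; rewrite gt_eqF.
have ba : b' < k%:R * a by rewrite ka; case/andP: (midpoint_lt b'b (lexx beta)).
(* As Rb >= 2 rr and g^2 = 2^(1 - al), an inner radius rr / g still gives an interpolated radius D
   >= rr g, beyond rr. *)
pose g := 2 `^ ((1 - al) / 2) : R.
have g1 : 1 < g.
  have p1 : 1 `^ ((1 - al) / 2) = 1 :> R by rewrite powR1.
  by rewrite -[ltLHS]p1 gt0_ltr_powR ?nnegrE ?ler0n ?ler01 ?ltr1n// divr_gt0// subr_gt0.
have g0 : 0 < g := lt_trans ltr01 g1.
have gg : g * g = 2 `^ (1 - al).
  rewrite /g -powRD; last by rewrite pnatr_eq0 implybT.
  by rewrite -splitr.
pose s : R := rr / g.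
have s0 : 0 < s by rewrite divr_gt0.
have srr : s < rr by rewrite ltr_pdivrMr// ltr_pMr.
pose D := s `^ al * Rb `^ (1 - al).
have Dg : rr * g <= D.
  have h1 : rr `^ al / g <= s `^ al.
    rewrite /s powRM ?invr_ge0 ?(ltW rr0) ?(ltW g0)// powR_inv_base//.
    rewrite ler_wpM2l ?powR_ge0// lef_pV2 ?posrE ?powR_gt0//.
    by rewrite -[leRHS](powRr1 (ltW g0)) ler_powR// ltW.
  have h2 : (g * g) * rr `^ (1 - al) <= Rb `^ (1 - al).
    rewrite gg -powRM ?(ltW rr0)// ge0_ler_powR ?nnegrE ?(ltW Rb0) ?mulr_ge0 ?(ltW rr0)//.
    by rewrite subr_ge0 ltW.
  have rn0 : rr != 0 by rewrite gt_eqF.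
  have rrE : rr = rr `^ al * rr `^ (1 - al).
    rewrite -powRD; last by rewrite rn0 implybT.
    by rewrite addrC subrK powRr1// ltW.
  have -> : rr * g = rr `^ al / g * (g * g * rr `^ (1 - al)).
    by rewrite {1}rrE; field; rewrite gt_eqF.
  by apply: ler_pM; rewrite ?mulr_ge0 ?powR_ge0 ?invr_ge0 ?(ltW g0).
pose rho : R := rr * (1 + g) / 2.
have rrg : rr < rr * g by rewrite ltr_pMr.
have rhoE : rho = (rr + rr * g) / 2 by rewrite /rho mulrDr mulr1.
have [rho1 rho2] : rr < rho /\ rho < D by have /andP[] := midpoint_lt rrg Dg; rewrite -rhoE.
have sRb : s <= Rb by rewrite (le_trans (ltW srr))// (le_trans _ rrb)// ler_peMl ?ler1n// ltW.
have sO : vball c s `<=` Omegas.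
  have [s' [_ s'O] ss'] := sup_gt (x := s) hsS.1 srr.
  by move=> z zc; apply: s'O; rewrite /vball /= (le_trans zc)// ltW.
have [A A0 [n1 hA]] := compact_basin_decay d0 k0 p0 eG tt b0 admr grow (@compact_vball R d c s) sO.
pose M3 : R := `|M| + A.
have M3A : A <= M3 by rewrite lerDr.
pose C0 := 2 / (1 - rho / D).
have C00 : 0 < C0.
  by rewrite divr_gt0// subr_gt0 ltr_pdivrMr ?mul1r// (lt_trans rr0)// (lt_trans rho1).
pose A' := C0 * (A `^ al * M3 `^ (1 - al)) + A.
have M30 : 0 < M3 by exact: lt_le_trans M3A.
have A'0 : 0 < A'.
  by apply: addr_gt0 => //; apply: mulr_gt0 => //; apply: mulr_gt0; exact: powR_gt0.
have decay z : vball c rho z -> decay_rate a A' n1 z.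
  move=> zc n n1n.
  have n0 : 0 < n%:R :> R by rewrite ltr0n (leq_ltn_trans _ n1n).
  have n1R : 1 <= n%:R :> R by rewrite ler1n (leq_ltn_trans _ n1n).
  pose M1 := A * (n%:R `^ (beta / k%:R))^-1.
  have M10 : 0 < M1 by rewrite mulr_gt0// invr_gt0 powR_gt0.
  have bk0 : 0 <= beta / k%:R by rewrite divr_ge0// ltW.
  have nb1 : 1 <= n%:R `^ (beta / k%:R).
    by have := ler_powR n1R bk0; rewrite powRr0.
  have M1A : M1 <= A by rewrite ler_piMr ?(ltW A0)// invf_le1// (lt_le_trans _ nb1).
  apply: vnorm_le => [|j]; first by rewrite mulr_ge0 ?invr_ge0 ?powR_ge0 ?(ltW A'0).
  have eFj : approx (vball c Rb) (fun z => iter n F z 0 j).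
    apply: entire_approx (vbounded_ball c Rb).
    exact: (entire_map_iter _ (entire_map_iter _ eG)).
  have b1 w : vball c s w -> modulus (iter n F w 0 j) <= M1.
    by move=> wc; rewrite (le_trans (modulus_le_vnorm _ _))// hA// ltnW.
  have b3 w : vball c Rb w -> modulus (iter n F w 0 j) <= M3.
    move=> /bMq wq; rewrite (le_trans (modulus_le_vnorm _ _))// (le_trans (hM n w wq))//.
    by rewrite (le_trans (ler_norm M))// /M3 lerDl ltW.
  have rho_ge0 : 0 <= rho := ltW (lt_trans rr0 rho1).
  have tc : modulus (iter n F z 0 j) <= C0 * (M1 `^ al * M3 `^ (1 - al)) + M1.
    exact: (three_circles s0 sRb al0 al1 rho_ge0 rho2 M10 (le_trans M1A M3A) eFj b1 b3 zc).
  have m1 : M1 `^ al = A `^ al * (n%:R `^ a)^-1.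
    rewrite /M1 powRM ?invr_ge0 ?powR_ge0 ?(ltW A0)// powR_inv_base ?powR_gt0// -powRrM.
    by rewrite /a [al * _]mulrC.
  have m2 : M1 <= A * (n%:R `^ a)^-1.
    rewrite /M1 ler_wpM2l ?(ltW A0)// lef_pV2 ?posrE ?powR_gt0//.
    by rewrite ler_powR// /a ler_piMl// ltW.
  apply: (le_trans tc); rewrite m1; move: m2; set y := (_ `^ a)^-1 => m2.
  have -> : A' * y = C0 * (A `^ al * y * M3 `^ (1 - al)) + A * y by rewrite /A'; ring.
  by rewrite lerD2l.
pose rho' := (rr + rho) / 2.
have rho'E : rr < rho' < rho := midpoint_lt rho1 (lexx rho).
have : rho' <= rr.
  apply: sup_upper_bound => //; split.
    by rewrite ltW// (lt_trans rr0)//; case/andP: rho'E.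
  move=> z zc; have e0 : 0 < rho - rho' by rewrite subr_gt0; case/andP: rho'E.
  apply: (decay_total_basin b'0 b'd be' a0 ba A'0 e0) => w wz.
  by apply: decay; rewrite /vball /= in zc *; have := vnorm_triangle z w c; lra.
by rewrite leNgt; case/andP: rho'E => ->.
Qed.

(** The basin is open, and closed relative to the Fatou set: a limit point lies in some basin, and
    by openness and disjointness this can only be the same one. Hence it fills the component
    containing it. *)
Lemma basin_fatou_component h : (h < k)%N -> connected (Omega h) ->
  fatou_component G (Omega h).
Proof.
move=> hk cO; have [z Oz] := basin_nonempty d0 k0 adm admr h.
have sub := basin_sub_fatou d0 k0 p0 eG G0 tt b0 admr hk.
exists z; first exact: sub.
apply/seteqP; split; first exact: connected_component_max.
set V := connected_component _ z.
have cV : connected V by exact: component_connected.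
have Vf : V `<=` fatou_set G by exact: connected_component_sub.
have -> : V = V `&` Omega h; last by move=> w [].
apply/esym; apply: cV.
- by exists z; split => //; apply: connected_component_refl; exact: sub.
- by exists (Omega h) => //; exact: (basin_open d0 k0 eG tt b0 admr).
exists (closure (Omega h)); first exact: closed_closure.
apply/seteqP; split => [w [Vw Ow]|w [Vw clw]]; first by split => //; exact: subset_closure.
split => //.
have [h' hk' Ow'] : Omegas w.
  apply: total_basin_closed_in_fatou; first exact: Vf.
  by apply: (@closure_subset _ (Omega h)) => // y Oy; exists h.
have oh' : open (Omega h') by exact: (basin_open d0 k0 eG tt b0 admr).
have [y [Oy Oy']] := clw _ (open_nbhs_nbhs (conj oh' Ow')).
by rewrite (basin_disjoint k0 adm admr hk hk' Oy Oy').
Qed.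

End FatouComponents.

(** * Fatou coordinates *)

Lemma cauchy_vnorm (R : realType) n (Y : nat -> 'rV[Cplx R]_n) (b : nat -> R) :
  (forall e : R, 0 < e -> exists N, b N < e) ->
  (forall m i, vnorm (Y (m + i)%N - Y m) <= b m) ->
  exists L, forall m, vnorm (L - Y m) <= b m.
Proof.
move=> b_small Yb.
have /choice[L hL] : forall j, exists l, forall e : R, 0 < e -> exists N, forall m, (N <= m)%N ->
    modulus (Y m 0 j - l) < e.
  move=> j; apply: cauchy_modulus => e e0; have [N bN] := b_small _ (divr_gt0 e0 (ltr0n _ 2)).
  exists N => m m' Nm Nm'.
  have h i : (N <= i)%N -> modulus (Y i 0 j - Y N 0 j) < e / 2.
    move=> Ni; rewrite (le_lt_trans _ bN)// (le_trans _ (Yb N (i - N)%N))// subnKC//.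
    by have := modulus_le_vnorm (Y i - Y N) j; rewrite !mxE.
  rewrite (le_lt_trans (modulus_triangle (Y N 0 j) _ _))// [e]splitr ltrD ?h//.
  by rewrite modulus_distC h.
exists (\row_j L j) => m.
have b0 : 0 <= b m by exact: le_trans (vnorm_ge0 _) (Yb m 0%N).
apply: vnorm_le => // j; rewrite !mxE; apply/ler_addgt0Pr => e e0.
have [N hN] := hL j e e0.
have h1 := hN (m + N)%N (leq_addl _ _).
have h2 : modulus (Y (m + N)%N 0 j - Y m 0 j) <= b m.
  by rewrite (le_trans _ (Yb m N))//; have := modulus_le_vnorm (Y (m + N)%N - Y m) j; rewrite !mxE.
rewrite (le_trans (modulus_triangle (Y (m + N)%N 0 j) _ _))// addrC lerD//.
by rewrite modulus_distC ltW.
Qed.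

(** * Inversion of perturbations of the identity *)

Section Picard.
Variables (R : realType) (n : nat) (phi : 'rV[Cplx R]_n -> 'rV[Cplx R]_n).
Variables (y0 : 'rV[Cplx R]_n) (rho M : R).
Hypothesis rho0 : 0 < rho.
Hypothesis aphi : forall j, approx (vball y0 rho) (fun y => phi y 0 j).
Hypothesis phiM : forall y, vball y0 rho y -> vnorm (phi y) <= M.
Hypothesis Mrho : 16 * M <= rho.

Lemma vball_sub (c c' : 'rV[Cplx R]_n) (r r' : R) : vnorm (c - c') + r <= r' ->
  vball c r `<=` vball c' r'.
Proof.
move=> cr z; rewrite /vball /= => zc.
by have := vnorm_triangle c z c'; lra.
Qed.

Lemma picard_lipschitz a b : vball y0 (rho / 8) a -> vball y0 (rho / 8) b ->
  vnorm (phi a - phi b) <= vnorm (a - b) / 2.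
Proof.
rewrite /vball /= => ha hb; have r0 := rho0; have Mr := Mrho.
apply: vnorm_le => [|j]; first by rewrite divr_ge0 ?vnorm_ge0.
have bb : vball b (rho / 2) `<=` vball y0 rho by apply: vball_sub; lra.
have r2 : 0 < rho / 2 by lra.
have hM w : vball b (rho / 2) w -> modulus (phi w 0 j) <= M.
  by move=> /bb/phiM; apply: le_trans; exact: modulus_le_vnorm.
have ab : vnorm (a - b) <= rho / 2 / 2.
  by have := vnorm_triangle y0 a b; rewrite [vnorm (y0 - b)]vnorm_distC; lra.
have := approx_lipschitz r2 (approx_sub bb (aphi j)) hM ab; rewrite subrKC !mxE => /le_trans.
apply; have -> : 2 * M / (rho / 2) = 4 * M / rho by field; rewrite gt_eqF.
rewrite mulrC ler_wpM2l ?vnorm_ge0// ler_pdivrMr//; lra.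
Qed.

Lemma picard_unique a b : vball y0 (rho / 8) a -> vball y0 (rho / 8) b ->
  a + phi a = b + phi b -> a = b.
Proof.
move=> ha hb e; have := picard_lipschitz ha hb.
have -> : phi a - phi b = - (a - b).
  have -> : phi a = b + phi b - a by rewrite -e addrAC subrr add0r.
  by rewrite addrAC addrK opprB.
rewrite vnormN => h; apply/eqP; rewrite -subr_eq0 -vnorm_eq0 eq_le vnorm_ge0 andbT.
by have := vnorm_ge0 (a - b); lra.
Qed.

(** For y in the ball of radius rho / 16 the iterates of w |-> y - phi w stay in the ball of radius
    rho / 8, as M <= rho / 16; there Cauchy's estimate makes phi a contraction. The iterates are
    limits of polynomials and converge uniformly, so the solution is holomorphic in y. *)
Lemma picard_inverse : exists g : 'rV[Cplx R]_n -> 'rV[Cplx R]_n,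
  [/\ forall j, approx (vball y0 (rho / 16)) (fun y => g y 0 j),
      forall y, vball y0 (rho / 16) y -> vball y0 (rho / 8) (g y) &
      forall y, vball y0 (rho / 16) y -> g y + phi (g y) = y].
Proof.
have r0 := rho0; have Mr := Mrho.
have M0 : 0 <= M.
  by apply: le_trans (phiM (y := y0) _); rewrite ?vnorm_ge0// /vball /= subrr vnorm0 ltW.
pose s m y := iter m (fun w => y - phi w) y.
have sin m y : vball y0 (rho / 16) y -> vball y0 (rho / 8) (s m y).
  rewrite /vball /= => yr; elim: m => [|m ih] /=; first by rewrite (le_trans yr)//; lra.
  have h := phiM (y := s m y); rewrite /vball /= in h.
  rewrite addrAC (le_trans (vnormD _ _))// vnormN.
  by have := h (le_trans ih _); have : rho / 8 <= rho by [lra|]; move=> a1 a2; have := a2 a1; lra.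
have sM m y : vball y0 (rho / 16) y -> vnorm (phi (s m y)) <= M.
  by move=> yr; apply: phiM; have := sin m y yr; rewrite /vball /=; lra.
have sS m y : vball y0 (rho / 16) y -> vnorm (s m.+1 y - s m y) <= M * 2^-1 ^+ m.
  move=> yr; elim: m => [|m ih].
    by rewrite /= addrAC subrr add0r vnormN expr0 mulr1 (sM 0%N y).
  have -> : s m.+2 y - s m.+1 y = - (phi (s m.+1 y) - phi (s m y)).
    by apply/rowP => j; rewrite /= !mxE; ring.
  rewrite vnormN.
  rewrite (le_trans (picard_lipschitz (sin m.+1 y yr) (sin m y yr)))//.
  by rewrite exprSr mulrA ler_pM2r.
have s0 : forall m i y, vball y0 (rho / 16) y ->
    vnorm (s (m + i)%N y - s m y) <= M * 2 * 2^-1 ^+ m * (1 - 2^-1 ^+ i).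
  move=> m i y yr; elim: i => [|i ih].
    by rewrite addn0 subrr vnorm0 expr0 subrr mulr0.
  rewrite addnS (le_trans (vnorm_triangle (s (m + i)%N y) _ _))//.
  rewrite (le_trans (lerD (sS _ _ yr) ih))// exprD exprS.
  by set p := _ ^+ m; set q := _ ^+ i; rewrite le_eqVlt; apply/orP; left; apply/eqP; field.
pose b m : R := M * 2 * 2^-1 ^+ m.
have sb y m i : vball y0 (rho / 16) y -> vnorm (s (m + i)%N y - s m y) <= b m.
  move=> yr; apply: (le_trans (s0 m i y yr)); apply: ler_piMr.
    by rewrite !mulr_ge0 ?exprn_ge0.
  by rewrite lerBlDr lerDl exprn_ge0.
have b_small e : 0 < e -> exists N, b N < e.
  move=> e0; pose N := (Num.trunc (M * 2 / e)).+1; exists N.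
  have NE : M * 2 / e < N%:R by exact: truncnS_gt.
  have p2 : N%:R <= 2 ^+ N :> R.
    by rewrite -natrX ler_nat ltnW// ltn_expl.
  by rewrite /b exprVn ltr_pdivrMr ?exprn_gt0// [e * _]mulrC -ltr_pdivrMr// (lt_le_trans NE).
have /choice[g hg] : forall y, exists L, vball y0 (rho / 16) y -> forall m, vnorm (L - s m y) <= b m.
  move=> y; have [yr|nyr] := pselect (vball y0 (rho / 16) y); last by exists 0.
  by have [L hL] := cauchy_vnorm b_small (fun m i => sb y m i yr); exists L.
have gin y : vball y0 (rho / 16) y -> vball y0 (rho / 8) (g y).
  move=> yr; rewrite /vball /=; apply/ler_addgt0Pr => e e0.
  have [N bN] := b_small e e0; have := hg y yr N; have := sin N y yr.
  rewrite /vball /= => h1 h2; have := vnorm_triangle (s N y) (g y) y0; lra.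
exists g; split => //.
  move=> j; apply: approx_lim => e e0; have [N bN] := b_small e e0.
  exists (fun y => s N y 0 j); last first.
    move=> y yr; rewrite (le_trans _ (ltW bN))// (le_trans _ (hg y yr N))//.
    by have := modulus_le_vnorm (g y - s N y) j; rewrite !mxE.
  elim: N {bN} j => [|N ih] j /=; first exact: approx_coord.
  apply: (@approx_ext _ _ _ (fun y => y 0 j - phi (s N y) 0 j)); first by move=> y _; rewrite !mxE.
  apply: approxB; [exact: vbounded_ball|exact: approx_coord|].
  apply: (@approx_comp _ _ _ _ (vball y0 rho) (fun y => phi y 0 j) (s N) (rho / 2)) => //.
  - exact: vbounded_ball.
  - by lra.
  move=> y w yr wy; have := sin N y yr; rewrite /vball /= => h1.
  by have := vnorm_triangle (s N y) w y0; lra.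
move=> y yr; apply/eqP; rewrite -subr_eq0 -vnorm_eq0 eq_le vnorm_ge0 andbT.
apply/ler_addgt0Pr => e e0; rewrite add0r.
have e4 : 0 < e / 4 by lra.
have [N bN] := b_small _ e4.
have hN := hg y yr N; have hN1 := hg y yr N.+1.
have bN1 : b N.+1 <= b N.
  by rewrite /b ler_wpM2l ?mulr_ge0// exprS ler_piMl ?exprn_ge0//; lra.
have -> : g y + phi (g y) - y = (g y - s N.+1 y) + (phi (g y) - phi (s N y)).
  by apply/rowP => j; rewrite /= !mxE; ring.
rewrite (le_trans (vnormD _ _))//.
have := picard_lipschitz (gin y yr) (sin N y yr); lra.
Qed.

End Picard.

Lemma two_point_arith (R : realType) (K m q c x y t a1 a2 a3 : R) :
  0 <= K -> 0 <= m -> 0 <= q -> 0 <= c -> 0 <= x -> 0 <= y -> 0 <= t ->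
  a1 <= x * q -> a2 <= y * q -> a3 <= m * t ->
  K * x + K * y + (a3 + (a1 + a2)) <= (K + m + q + 1 + c) * (x + y + t).
Proof.
move=> K0 m0 q0 c0 x0 y0 t0 h1 h2 h3.
have f1 : 0 <= (m + 1 + c) * (x + y) by rewrite mulr_ge0 ?addr_ge0.
have f2 : 0 <= (K + q + 1 + c) * t by rewrite mulr_ge0 ?addr_ge0.
by lra.
Qed.

(** * Charts centred at a point of the wedge *)

Section Chart.
Variables (R : realType) (d k l : nat).
Local Notation C := (Cplx R).
Local Notation Cd := 'rV[C]_d.
Local Notation N := (k * d)%N.
Variables (F : Cd -> Cd) (lam : 'I_d -> C).
Hypotheses (d0 : (0 < d)%N) (k0 : (0 < k)%N).
Hypotheses (lam1 : forall j, modulus (lam j) = 1) (plam : \prod_j lam j = 1).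
Hypothesis OF : forall j, eqO l (fun z => F z 0 j)
  (fun z => lam j * z 0 j * (1 - coord_prod z ^+ k / N%:R)).
Local Notation au z := (modulus (coord_prod z)).
Local Notation xk z := (coord_prod z ^+ k).
Local Notation vz z := (fatou_v k (coord_prod z)).
Local Notation mx z := (modulus (coord_prod z ^+ k)).
Local Notation o := (Ordinal d0).
Implicit Types a w y : Cd.

Let kn0 : k%:R != 0 :> C. Proof. by rewrite pnatr_eq0 -lt0n. Qed.

(* Coordinates centred at a: coordinate 0 approximates v - v(a), where
   v = 1/(z_1 ... z_d)^k, and the others are the ratios z_j / a_j. *)
Definition chart a y : Cd := \row_j (if j == o
  then a 0 o * (\prod_(i | i != o) y 0 i)^-1 * (1 - y 0 o * xk a / k%:R)
  else a 0 j * y 0 j).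

Definition chart_inv a w : Cd := \row_j (if j == o
  then k%:R * vz a * (1 - coord_prod w / coord_prod a) else w 0 j / a 0 j).

(** These sets exhaust C x (C - {0})^(d-1); the estimates in the charts are uniform on each of
    them. *)
Definition annulus (r : R) y := modulus (y 0 o) <= r /\
  forall j, j != o -> r^-1 <= modulus (y 0 j) <= r.

Lemma annulus_neq0 r y j : 0 < r -> annulus r y -> j != o -> y 0 j != 0.
Proof.
move=> r0 [_ h] /h/andP[h1 _]; rewrite -modulus_gt0 (lt_le_trans _ h1)// invr_gt0//.
Qed.

Lemma annulus_le r r' y : 0 < r -> r <= r' -> annulus r y -> annulus r' y.
Proof.
move=> r0 rr [h1 h2]; split; first exact: le_trans rr.
move=> j /h2/andP[h3 h4]; rewrite (le_trans h4)// andbT (le_trans _ h3)//.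
by rewrite lef_pV2 ?posrE// (lt_le_trans r0).
Qed.

Lemma annulus_near r y y' : 1 <= r -> annulus r y -> vnorm (y' - y) <= (2 * r)^-1 ->
  annulus (2 * r) y'.
Proof.
move=> r1 [h1 h2] yy.
have r0 : 0 < r by lra.
have yj j : modulus (y' 0 j - y 0 j) <= (2 * r)^-1.
  by have := modulus_le_vnorm (y' - y) j; rewrite !mxE => /le_trans; apply.
have r2 : (2 * r)^-1 <= r.
  by rewrite -[leRHS]mul1r -ler_pdivrMr// -invfM invf_le1; [nra|nra].
have rr : r^-1 = (2 * r)^-1 + (2 * r)^-1 by field; rewrite gt_eqF.
split.
  have := modulusD (y' 0 o - y 0 o) (y 0 o); rewrite subrK.
  by have := yj o; lra.
move=> j /h2/andP[h3 h4].
have := modulusD (y' 0 j - y 0 j) (y 0 j); rewrite subrK.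
have := modulusD (y 0 j - y' 0 j) (y' 0 j); rewrite subrK modulus_distC.
by have := yj j; move=> e1 e2 e3; apply/andP; split; lra.
Qed.

Lemma prod_neq0 (P : pred 'I_d) (f : 'I_d -> C) : (forall j, P j -> f j != 0) ->
  \prod_(j | P j) f j != 0.
Proof. by move=> h; apply/prodf_neq0. Qed.

(** The purpose of the formula for coordinate 0 of [chart]: the coordinate product depends on y
    through y_0 alone, and affinely. *)
Lemma coord_prod_chart a y : (forall j, j != o -> y 0 j != 0) ->
  coord_prod (chart a y) = coord_prod a * (1 - y 0 o * xk a / k%:R).
Proof.
move=> y0.
have aE : coord_prod a = a 0 o * \prod_(j < d | j != o) a 0 j by rewrite /coord_prod (bigD1 o).
have yE : \prod_(j < d | j != o) chart a y 0 j =
    \prod_(j < d | j != o) a 0 j * \prod_(j < d | j != o) y 0 j.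
  by rewrite -big_split; apply: eq_bigr => j /negbTE jo; rewrite mxE jo.
rewrite [LHS]/coord_prod (bigD1 o)//= mxE eqxx yE.
move: (xk a) (prod_neq0 y0) => X; rewrite aE.
by set P := \prod_(j < d | j != o) y 0 j => P0; field; rewrite P0 kn0.
Qed.

Lemma chartK a y : 0 < au a -> (forall j, j != o -> y 0 j != 0) ->
  chart_inv a (chart a y) = y.
Proof.
move=> ua y0; apply/rowP => j; rewrite mxE; case: eqP => [->|/eqP jo].
  rewrite coord_prod_chart//; have u0 : coord_prod a != 0 by rewrite -modulus_gt0.
  rewrite [coord_prod a * _]mulrC mulfK// /fatou_v; field.
  by rewrite kn0 expf_neq0.
by rewrite mxE (negbTE jo) mulrC mulKf// coord_neq0.
Qed.

Lemma chart_invK a w : 0 < au a -> (forall j, w 0 j != 0) -> chart a (chart_inv a w) = w.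
Proof.
move=> ua w0; apply/rowP => j; rewrite mxE; case: eqP => [->|/eqP jo]; last first.
  by rewrite mxE (negbTE jo) mulrC divfK// coord_neq0.
have -> : \prod_(i < d | i != o) chart_inv a w 0 i =
    \prod_(i < d | i != o) w 0 i / \prod_(i < d | i != o) a 0 i.
  by rewrite -prodf_div; apply: eq_bigr => i /negbTE io; rewrite mxE io.
have u0 : coord_prod a != 0 by rewrite -modulus_gt0.
have -> : 1 - chart_inv a w 0 o * xk a / k%:R = coord_prod w / coord_prod a.
  by rewrite mxE eqxx /fatou_v; field; rewrite ?kn0 ?u0 ?expf_neq0.
have A0 := prod_neq0 (P := fun i => i != o) (fun i _ => coord_neq0 i ua).
have W0 := prod_neq0 (P := fun i => i != o) (fun i _ => w0 i).
have a0 := coord_neq0 o ua.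
have aE : coord_prod a = a 0 o * \prod_(j < d | j != o) a 0 j by rewrite /coord_prod (bigD1 o).
have wE : coord_prod w = w 0 o * \prod_(j < d | j != o) w 0 j by rewrite /coord_prod (bigD1 o).
by rewrite aE wE; field; rewrite W0 A0 a0.
Qed.

Lemma shifted_power_bound : exists2 K : R, 0 <= K & forall del : C, modulus del <= 1 ->
  modulus ((1 - del) ^+ k - 1 + k%:R * del) <= K * modulus del ^+ 2.
Proof.
have [q qE] := @expr_1subX R (1 : C) k.
have [Q Q0 hQ] := horner_bound q.
exists (modulus ('C(k, 2)%:R : C) + Q); first by rewrite addr_ge0 ?modulus_ge0.
move=> del del1.
have := congr1 (fun p : {poly C} => p.[del]) qE.
rewrite horner_exp !(hornerD, hornerN, hornerZ, hornerX, hornerXn, hornerM, hornerC).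
rewrite mul1r expr1n !mulr1 => ->.
have -> : 1 - k%:R * del + 'C(k, 2)%:R * del ^+ 2 + del ^+ 3 * q.[del] - 1 + k%:R * del =
  'C(k, 2)%:R * del ^+ 2 + del ^+ 3 * q.[del] by ring.
rewrite (le_trans (modulusD _ _))// [leRHS]mulrDl.
rewrite [modulus ('C(k, 2)%:R * _)]modulusM [modulus (del ^+ 2)]modulusX lerD2l.
rewrite [modulus (del ^+ 3 * _)]modulusM [modulus (del ^+ 3)]modulusX mulrC.
apply: ler_pM; rewrite ?modulus_ge0 ?exprn_ge0 ?hQ ?modulus_ge0//.
by rewrite exprS ler_piMl ?exprn_ge0 ?modulus_ge0.
Qed.

(** The last estimate compares two points. Bounding each factor separately would leave an error
    O(x^2); taking differences, the quadratic terms contribute only |x(z) - x(w)| times O(x), which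
    is O(x^3) for points of the same chart. *)
Lemma total_factor_expansion beta : 0 < beta ->
  3 * k%:R + 1 <= beta * (l%:R + d%:R - 1) ->
  exists K s : R, [/\ 0 < K, 0 < s <= 1, 
   forall z, W_region beta z -> au z < s ->
    [/\ 0 < au z, coord_prod (F z) != 0,
        forall j, modulus (factor F lam z j - (1 - xk z / N%:R)) <= K * mx z ^+ 3,
        modulus (total_factor F lam z - (1 - xk z / k%:R)) <= K * mx z ^+ 2 &
        modulus (vz (F z) - vz z - 1) <= K * mx z] &
   forall z w, W_region beta z -> W_region beta w -> au z < s -> au w < s ->
     modulus (total_factor F lam z - total_factor F lam w - (xk w - xk z) / k%:R) <=
     K * (mx z ^+ 3 + mx w ^+ 3 + modulus (xk z - xk w) * (mx z + mx w))].
Proof.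
move=> b0 be; have [K [s [K0 s01 h]]] :=
  step_expansion d0 k0 lam1 plam OF b0 (isT : 1 < 3 <= 3)%N be.
have [q qE] := @expr_1subX R (N%:R^-1 : C) d.
have [Q Q0 hQ] := horner_bound q.
pose c2 : C := 'C(d, 2)%:R * N%:R^-1 ^+ 2; pose m2 := modulus c2.
pose mc := modulus (fatou_c R d k).
have m20 : 0 <= m2 by exact: modulus_ge0.
have mc0 : 0 <= mc by exact: modulus_ge0.
have pE (x : C) : (1 - x / N%:R) ^+ d = 1 - x / k%:R + c2 * x ^+ 2 + x ^+ 3 * q.[x].
  have := congr1 (fun p : {poly C} => p.[x]) qE.
  rewrite horner_exp !(hornerD, hornerN, hornerZ, hornerX, hornerXn, hornerM, hornerC).
  rewrite [_^-1 * x]mulrC => ->.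
  have -> : d%:R / N%:R * x = x / k%:R.
    by rewrite natrM; field; rewrite !pnatr_eq0 -!lt0n k0 d0.
  by [].
pose K' := K + m2 + Q + 1 + mc.
have K'0 : 0 < K' by rewrite /K'; lra.
have x01 (z : Cd) : au z < s -> 0 <= mx z <= 1.
  move=> us; rewrite modulus_ge0 modulusX exprn_ile1 ?modulus_ge0//.
  by rewrite ltW// (lt_le_trans us)//; case/andP: s01.
exists K', s; split => // [z Wz us|z w Wz Ww us uw].
  have [u0 u'0 h1 h2 h3] := h z Wz us; have /andP[x0 x1] := x01 z us.
  have x32 : mx z ^+ 3 <= mx z ^+ 2 by rewrite exprS ler_piMl ?exprn_ge0.
  have x21 : mx z ^+ 2 <= mx z by rewrite expr2 ler_piMr.
  split => //.
  - by move=> j; rewrite (le_trans (h1 j))// ler_wpM2r ?exprn_ge0// /K'; lra.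
  - have -> : total_factor F lam z - (1 - xk z / k%:R) =
       (total_factor F lam z - (1 - xk z / N%:R) ^+ d) + (c2 * xk z ^+ 2 + xk z ^+ 3 * q.[xk z]).
      by rewrite pE; ring.
    rewrite (le_trans (modulusD _ _))// (le_trans (lerD h2 (modulusD _ _)))//.
    rewrite [modulus (c2 * _)]modulusM [modulus (xk z ^+ 2)]modulusX -/m2.
    rewrite [modulus (xk z ^+ 3 * _)]modulusM [modulus (xk z ^+ 3)]modulusX.
    have e1 : mx z ^+ 3 * modulus q.[xk z] <= mx z ^+ 2 * Q.
      by apply: ler_pM; rewrite ?modulus_ge0 ?exprn_ge0 ?hQ.
    have e2 := ler_wpM2l (ltW K0) x32.
    have e3 : 0 <= (1 + mc) * mx z ^+ 2 by rewrite mulr_ge0 ?exprn_ge0//; lra.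
    by rewrite /K'; lra.
  have -> : vz (F z) - vz z - 1 = (vz (F z) - vz z - 1 - fatou_c R d k * xk z) +
    fatou_c R d k * xk z by ring.
  rewrite (le_trans (modulusD _ _))// modulusM (le_trans (lerD h3 (lexx _)))//=.
  have e1 := ler_wpM2l (ltW K0) x21.
  have e3 : 0 <= (m2 + Q + 1) * mx z by rewrite mulr_ge0//; lra.
  by rewrite -/mc /K'; lra.
have [_ _ _ h1 _] := h z Wz us; have [_ _ _ h2 _] := h w Ww uw.
have /andP[x0 x1] := x01 z us; have /andP[y0 y1] := x01 w uw.
have -> : total_factor F lam z - total_factor F lam w - (xk w - xk z) / k%:R =
  (total_factor F lam z - (1 - xk z / N%:R) ^+ d) -
  (total_factor F lam w - (1 - xk w / N%:R) ^+ d) +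
  (c2 * ((xk z - xk w) * (xk z + xk w)) + (xk z ^+ 3 * q.[xk z] - xk w ^+ 3 * q.[xk w])).
  by rewrite !pE; ring.
rewrite (le_trans (modulusD _ _))//.
rewrite (le_trans (lerD (modulusB _ _) (modulusD _ _)))//.
rewrite (le_trans (lerD (lerD h1 h2) (lerD (lexx _) (modulusB _ _))))//.
rewrite [modulus (c2 * _)]modulusM [modulus ((xk z - xk w) * _)]modulusM -/m2.
rewrite [modulus (xk z ^+ 3 * _)]modulusM [modulus (xk z ^+ 3)]modulusX.
rewrite [modulus (xk w ^+ 3 * _)]modulusM [modulus (xk w ^+ 3)]modulusX.
have e1 : mx z ^+ 3 * modulus q.[xk z] <= mx z ^+ 3 * Q.
  by rewrite ler_wpM2l ?exprn_ge0 ?hQ.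
have e2 : mx w ^+ 3 * modulus q.[xk w] <= mx w ^+ 3 * Q.
  by rewrite ler_wpM2l ?exprn_ge0 ?hQ.
have e3 : modulus (xk z - xk w) * modulus (xk z + xk w) <=
    modulus (xk z - xk w) * (mx z + mx w).
  by rewrite ler_wpM2l ?modulus_ge0 ?modulusD.
have e4 := ler_wpM2l m20 e3.
exact: (two_point_arith (ltW K0) m20 Q0 mc0 (exprn_ge0 3 x0) (exprn_ge0 3 y0)
  (mulr_ge0 (modulus_ge0 _) (addr_ge0 x0 y0)) e1 e2 e4).
Qed.

End Chart.

(** * The map read in successive charts *)

Section Transition.
Variables (R : realType) (d k l : nat).
Local Notation C := (Cplx R).
Local Notation Cd := 'rV[C]_d.
Local Notation N := (k * d)%N.
Variables (F : Cd -> Cd) (lam : 'I_d -> C).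
Hypotheses (d0 : (0 < d)%N) (k0 : (0 < k)%N).
Hypotheses (lam1 : forall j, modulus (lam j) = 1) (plam : \prod_j lam j = 1).
Hypothesis OF : forall j, eqO l (fun z => F z 0 j)
  (fun z => lam j * z 0 j * (1 - coord_prod z ^+ k / N%:R)).
Local Notation au z := (modulus (coord_prod z)).
Local Notation xk z := (coord_prod z ^+ k).
Local Notation vz z := (fatou_v k (coord_prod z)).
Local Notation mx z := (modulus (coord_prod z ^+ k)).
Local Notation o := (Ordinal d0).
Local Notation chart := (chart k d0).
Local Notation chart_inv := (chart_inv k d0).
Local Notation annulus := (annulus d0).
Implicit Types a w y : Cd.

Let kn0 : k%:R != 0 :> C. Proof. by rewrite pnatr_eq0 -lt0n. Qed.

Lemma modulus_div_nat n (x : C) : (0 < n)%N -> modulus (x / n%:R) <= modulus x.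
Proof.
move=> n0; rewrite modulusM modulusV modulus_nat ler_piMr ?modulus_ge0//.
by rewrite invf_le1 ?ler1n ?ltr0n.
Qed.

Lemma mx_le_au a : au a <= 1 -> mx a <= au a.
Proof. by move=> a1; rewrite modulusX; case: (k) k0 => // n _; rewrite exprS ler_piMr ?exprn_ile1 ?modulus_ge0. Qed.

Lemma chart_perturb (r : R) : 1 <= r -> exists2 c : R, 1 <= c & forall a y,
  0 < au a -> annulus r y -> r * mx a <= 2^-1 -> let w := chart a y in
  let del := y 0 o * xk a / k%:R in
  [/\ coord_prod w = coord_prod a * (1 - del), modulus del <= r * mx a,
      au w <= 2 * au a, mx w <= c * mx a &
      modulus (xk w - xk a) <= c * mx a ^+ 2 /\
      modulus (xk w - xk a + k%:R * (xk a * del)) <= c * mx a ^+ 3].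
Proof.
move=> r1; have r0 : 0 < r by lra.
have [K K0 hK] := @shifted_power_bound R k.
exists (1 + 2 ^+ k + (K + k%:R) * r + K * r ^+ 2).
  by rewrite -!addrA lerDl !addr_ge0 ?mulr_ge0 ?exprn_ge0 ?addr_ge0 ?ler0n// ltW.
move=> a y ua yr ra w del.
have uE : coord_prod w = coord_prod a * (1 - del).
  by apply: coord_prod_chart => // j; exact: (annulus_neq0 r0 yr).
have dl : modulus del <= r * mx a.
  rewrite (le_trans (modulus_div_nat _ k0))// modulusM ler_wpM2r ?modulus_ge0//.
  exact: yr.1.
have d1 : modulus del <= 1 by lra.
have dm0 := modulus_ge0 del; have x0 := modulus_ge0 (xk a).
have d2 : modulus (1 - del) <= 2 by rewrite (le_trans (modulusB _ _))// modulus1; lra.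
have xE : xk w = xk a * (1 - del) ^+ k by rewrite uE exprMn.
have A1 : 0 <= (K + k%:R) * r by rewrite mulr_ge0 ?addr_ge0 ?ler0n// ltW.
have A2 : 0 <= K * r ^+ 2 by rewrite mulr_ge0 ?exprn_ge0// ltW.
have A3 : 0 <= 2 ^+ k :> R by exact: exprn_ge0.
have B2 : modulus (xk w - xk a + k%:R * (xk a * del)) <= mx a * (K * modulus del ^+ 2).
  have -> : xk w - xk a + k%:R * (xk a * del) = xk a * ((1 - del) ^+ k - 1 + k%:R * del).
    by rewrite xE; ring.
  by rewrite modulusM ler_wpM2l// hK.
have D2 : modulus del ^+ 2 <= r ^+ 2 * mx a ^+ 2 by rewrite -exprMn lerXn2r ?nnegrE ?mulr_ge0// ltW.
split => //.
- by rewrite uE modulusM mulrC ler_wpM2r ?modulus_ge0.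
- rewrite xE modulusM mulrC; apply: (ler_wpM2r x0).
  rewrite (le_trans (y := 2 ^+ k))//; first by rewrite modulusX lerXn2r ?nnegrE ?modulus_ge0.
  by lra.
split.
  have -> : xk w - xk a = (xk w - xk a + k%:R * (xk a * del)) - k%:R * (xk a * del) by ring.
  rewrite (le_trans (modulusB _ _))// (le_trans (lerD B2 (lexx _)))//.
  rewrite [modulus (_ * (_ * _))]modulusM modulus_nat [modulus (xk a * _)]modulusM.
  have e1 : K * modulus del ^+ 2 <= K * (r * mx a).
    by rewrite ler_wpM2l// expr2 (le_trans _ dl)// ler_piMr.
  have e2 := ler_wpM2l x0 e1.
  have e3 : k%:R * (mx a * modulus del) <= k%:R * (mx a * (r * mx a)).
    by rewrite ler_wpM2l ?ler0n// ler_wpM2l.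
  have e4 : 0 <= (1 + 2 ^+ k + K * r ^+ 2) * mx a ^+ 2.
    by rewrite mulr_ge0 ?exprn_ge0// addr_ge0// addr_ge0.
  by move: e2 e3 e4; move: (mx a) (modulus del) => X D; lra.
rewrite (le_trans B2)//.
have e2 := ler_wpM2l x0 (ler_wpM2l K0 D2).
have e4 : 0 <= (1 + 2 ^+ k + (K + k%:R) * r) * mx a ^+ 3.
  by rewrite mulr_ge0 ?exprn_ge0// addr_ge0// addr_ge0.
by move: e2 e4; move: (mx a) (modulus del) => X D; lra.
Qed.

(* Coordinate 0 of the transition, with v, v' = v + 1 + e4 the Fatou coordinates of a and F(a),
   and m, m' the factors by which F multiplies the products of the coordinates of a, chart a y. *)
Lemma transition_identity (x m m' del v' : C) : x != 0 -> m != 0 ->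
  k%:R * v' * (1 - (1 - del) * m' / m) - k%:R * x^-1 * del =
  k%:R / m * (del * ((m - 1) + (v' - x^-1 - 1) * m + del - (1 - del) * x * (v' - x^-1)) +
     (1 - del) * v' * (m - m' + del * x)).
Proof. by move=> x0 m0; field; rewrite x0 m0. Qed.

(** In [transition_identity] the first group is a product of two terms O(x). In the second, v' is of
    size 1/x, which is why m - m' + del x has to be known to order x^3. *)
Lemma transition_bound (x m m' del v' : C) (r K c : R) : 0 < modulus x <= 1 -> 
  modulus del <= r * modulus x -> modulus del <= 1 -> 0 <= K -> K * modulus x <= 1 ->
  modulus (m - 1) <= (K + 1) * modulus x -> modulus (m - 1) <= 2^-1 ->
  modulus (v' - x^-1 - 1) <= K * modulus x -> 
  modulus (m - m' + del * x) <= c * modulus x ^+ 3 ->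
  modulus (k%:R * v' * (1 - (1 - del) * m' / m) - k%:R * x^-1 * del) <=
  2 * k%:R * (r * (3 * K + r + 5) + 6 * c) * modulus x ^+ 2.
Proof.
move=> /andP[x0 x1] dr d1 K0 Kx m1 m2 v1 mm.
have x00 : x != 0 by rewrite -modulus_gt0.
have m00 : m != 0.
  by rewrite -modulus_gt0 (lt_le_trans _ (modulus_ge_half m2))// invr_gt0.
have mi : modulus (k%:R / m) <= 2 * k%:R.
  rewrite modulusM modulusV modulus_nat mulrC ler_wpM2r ?ler0n//.
  by rewrite invf_ple ?posrE ?modulus_gt0// modulus_ge_half.
have mu : modulus m <= 2.
  by have := modulusD (m - 1) 1; rewrite subrK modulus1; lra.
have dd : modulus (1 - del) <= 2 by rewrite (le_trans (modulusB _ _))// modulus1; lra.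
have e1 : modulus (v' - x^-1) <= 2.
  by have := modulusD (v' - x^-1 - 1) 1; rewrite subrK modulus1; lra.
have e2 : modulus v' <= 3 / modulus x.
  have := modulusD (v' - x^-1) x^-1; rewrite subrK modulusV.
  have : 1 <= (modulus x)^-1 by rewrite invf_ge1.
  by lra.
rewrite transition_identity// modulusM -!mulrA.
rewrite [leRHS]mulrA; apply: ler_pM; rewrite ?modulus_ge0//.
have f1 : modulus ((1 - del) * (v' * (m - m' + del * x))) <= 6 * c * modulus x ^+ 2.
  rewrite modulusM modulusM.
  have -> : 6 * c * modulus x ^+ 2 = 2 * (3 / modulus x * (c * modulus x ^+ 3)).
    by field; rewrite gt_eqF.
  by rewrite ler_pM ?mulr_ge0 ?modulus_ge0// ler_pM ?modulus_ge0.
have f2 : modulus (m - 1 + (v' - x^-1 - 1) * m + del - (1 - del) * (x * (v' - x^-1))) <=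
    (3 * K + r + 5) * modulus x.
  have g1 : modulus ((v' - x^-1 - 1) * m) <= K * modulus x * 2.
    by rewrite modulusM ler_pM ?modulus_ge0.
  have g2 : modulus ((1 - del) * (x * (v' - x^-1))) <= 2 * (modulus x * 2).
    by rewrite !modulusM ler_pM ?mulr_ge0 ?modulus_ge0// ler_wpM2l ?modulus_ge0.
  rewrite (le_trans (modulusB _ _))// (le_trans (lerD (modulusD _ _) (lexx _)))//.
  rewrite (le_trans (lerD (lerD (modulusD _ _) (lexx _)) (lexx _)))//.
  by lra.
have f3 : modulus (del * (m - 1 + (v' - x^-1 - 1) * m + del - (1 - del) * (x * (v' - x^-1)))) <=
    r * modulus x * ((3 * K + r + 5) * modulus x).
  by rewrite modulusM ler_pM ?modulus_ge0.
rewrite (le_trans (modulusD _ _))// (le_trans (lerD f3 f1))//.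
by move: (modulus x) => X; rewrite le_eqVlt; apply/orP; left; apply/eqP; ring.
Qed.

(** Coordinate 0 is [transition_bound]. In the other coordinates y_j is multiplied by the quotient
    of the factors of F at the two points, which differ by O(x^2). *)
Lemma chart_transition beta (r : R) : 0 < beta ->
  3 * k%:R + 1 <= beta * (l%:R + d%:R - 1) -> 1 <= r ->
  exists B s : R, [/\ 0 <= B, 0 < s & forall a y, W_region beta a ->
    W_region beta (chart a y) -> au a < s -> annulus r y ->
    coord_prod (F (chart a y)) != 0 /\
    vnorm (chart_inv (F a) (F (chart a y)) - y) <= B * mx a ^+ 2].
Proof.
move=> b0 be r1; have r0 : 0 < r by lra.
have [K [s [K0 /andP[s0 s1] h h2]]] := total_factor_expansion d0 k0 lam1 plam OF b0 be.
have [c c1 hc] := chart_perturb r1; have c0 : 0 <= c by lra.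
pose B0 : R := K * (1 + c ^+ 3 + c * (1 + c)) + c.
pose B1 : R := r * (2 * (K * (1 + c ^+ 3) + c)).
pose B2 : R := 2 * k%:R * (r * (3 * K + r + 5) + 6 * B0).
have B00 : 0 <= B0.
  rewrite /B0 addr_ge0// mulr_ge0 ?(ltW K0)//.
  by rewrite !addr_ge0 ?exprn_ge0 ?mulr_ge0 ?addr_ge0.
have B10 : 0 <= B1.
  by rewrite /B1 !mulr_ge0 ?(ltW r0)// addr_ge0// mulr_ge0 ?(ltW K0)// addr_ge0 ?exprn_ge0.
have B20 : 0 <= B2.
  rewrite /B2 mulr_ge0 ?mulr_ge0 ?ler0n// addr_ge0 ?mulr_ge0 ?(ltW r0)//.
  by rewrite !addr_ge0 ?mulr_ge0 ?(ltW r0) ?(ltW K0).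
pose s' := Num.min (s / 2) (2 * (1 + K + r))^-1.
exists (B1 + B2), s'; split; first exact: addr_ge0.
  by rewrite lt_min divr_gt0//= invr_gt0; lra.
move=> a y Wa Ww; rewrite lt_min => /andP[us us2] yr.
have us' : au a < s by lra.
have ua1 : au a <= 1 by lra.
have [ua uFa fa Ma va] := h a Wa us'.
have xu := mx_le_au ua1.
have x0 : 0 < mx a by rewrite modulusX exprn_gt0.
have xs : (1 + K + r) * mx a <= 2^-1.
  have := le_lt_trans xu us2; rewrite invfM ltr_pdivlMr; last by lra.
  by lra.
have rx : r * mx a <= 2^-1 by move: xs (mulr_gt0 K0 x0) (x0); lra_goal.
have Kx : (1 + K) * mx a <= 2^-1 by move: xs (mulr_gt0 r0 x0); lra_goal.
have x1 : mx a <= 1 by move: Kx (mulr_gt0 K0 x0); lra_goal.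
have [uE dl uw xw [xd1 xd2]] := hc a y ua yr rx.
set w := chart a y in Ww uE uw xw xd1 xd2 *.
set del := y 0 o * xk a / k%:R in uE dl xd2.
have uws : au w < s by move: uw us; lra_goal.
have [uw0 uFw fw Mw _] := h w Ww uws.
have x32 : mx a ^+ 3 <= mx a ^+ 2 by rewrite exprS ler_piMl ?exprn_ge0 ?modulus_ge0.
have x21 : mx a ^+ 2 <= mx a by rewrite expr2 ler_piMr ?modulus_ge0.
have xw3 : mx w ^+ 3 <= c ^+ 3 * mx a ^+ 3.
  by rewrite -exprMn lerXn2r ?nnegrE ?mulr_ge0 ?modulus_ge0.
have X20 : 0 <= mx a ^+ 2 by rewrite exprn_ge0// modulus_ge0.
have a0 j : a 0 j != 0 by exact: coord_neq0.
have l0 j : lam j != 0 by rewrite -modulus_gt0 lam1.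
have FE (z : Cd) j : z 0 j != 0 -> F z 0 j = lam j * z 0 j * factor F lam z j.
  by move=> z0; rewrite /factor mulrC divfK// mulf_neq0.
have fd j : modulus (factor F lam w j - factor F lam a j) <=
    (K * (1 + c ^+ 3) + c) * mx a ^+ 2.
  have -> : factor F lam w j - factor F lam a j =
    (factor F lam w j - (1 - xk w / N%:R)) - (factor F lam a j - (1 - xk a / N%:R)) -
    (xk w - xk a) / N%:R by rewrite mulrBl; ring.
  apply: (le_trans (modulusB _ _)); apply: (le_trans (lerD (modulusB _ _) (lexx _))).
  have e1 := fa j; have e2 := fw j.
  have e3 : modulus ((xk w - xk a) / N%:R) <= modulus (xk w - xk a).
    by rewrite modulus_div_nat// muln_gt0 k0 d0.
  have e4 := ler_wpM2l (ltW K0) xw3.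
  have e5 : K * (1 + c ^+ 3) * mx a ^+ 3 <= K * (1 + c ^+ 3) * mx a ^+ 2.
    by rewrite ler_wpM2l// mulr_ge0 ?(ltW K0)// addr_ge0 ?exprn_ge0.
  by move: e1 e2 e3 e4 e5 xd1; lra_goal.
have half (f : C) : modulus (f - (1 - xk a / k%:R)) <= K * mx a ^+ 2 ->
    modulus (f - 1) <= (K + 1) * mx a.
  move=> fh; have -> : f - 1 = f - (1 - xk a / k%:R) - xk a / k%:R by ring.
  apply: (le_trans (modulusB _ _)); have := modulus_div_nat (xk a) k0.
  by move: fh (ler_wpM2l (ltW K0) x21); lra_goal.
split=> //; apply: vnorm_le => [|j]; first by rewrite mulr_ge0 ?addr_ge0.
rewrite !mxE; case: eqP => [->|/eqP jo]; last first.
  have hf : modulus (factor F lam a j - 1) <= 2^-1.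
    have -> : factor F lam a j - 1 = factor F lam a j - (1 - xk a / N%:R) - xk a / N%:R by ring.
    rewrite (le_trans (modulusB _ _))//.
    have := modulus_div_nat (xk a) (n := N); rewrite muln_gt0 k0 d0 => /(_ isT).
    by move: (fa j) (ler_wpM2l (ltW K0) x21) (ler_wpM2l (ltW K0) x32) Kx; lra_goal.
  have hf0 := modulus_ge_half hf.
  have f0 : factor F lam a j != 0 by rewrite -modulus_gt0; move: hf0; lra_goal.
  rewrite !FE//; last exact: coord_neq0.
  have -> : w 0 j = a 0 j * y 0 j by rewrite mxE (negbTE jo).
  have -> : lam j * (a 0 j * y 0 j) * factor F lam w j / (lam j * a 0 j * factor F lam a j) - y 0 j
    = y 0 j * ((factor F lam a j)^-1 * (factor F lam w j - factor F lam a j)).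
    by field; rewrite f0 a0 l0.
  rewrite modulusM modulusM modulusV.
  have g1 : modulus (y 0 j) <= r by have /andP[] := yr.2 j jo.
  have g2 : (modulus (factor F lam a j))^-1 <= 2.
    by rewrite invf_ple ?posrE//; move: hf0; lra_goal.
  apply: (le_trans (y := B1 * mx a ^+ 2)); last by rewrite ler_wpM2r// lerDl.
  rewrite /B1 -!mulrA ler_pM ?modulus_ge0 ?mulr_ge0 ?invr_ge0 ?modulus_ge0//.
  by rewrite ler_pM ?invr_ge0 ?modulus_ge0.
rewrite (coord_prod_step F lam1 plam ua) (coord_prod_step F lam1 plam uw0) uE.
set m := total_factor F lam a; set m' := total_factor F lam w.
have m1 := half _ Ma.
have m2 : modulus (m - 1) <= 2^-1 by move: m1 Kx; lra_goal.
have m0 : m != 0 by rewrite -modulus_gt0; move: (modulus_ge_half m2); lra_goal.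
have u0 : coord_prod a != 0 by rewrite -modulus_gt0.
have x00 : xk a != 0 by rewrite expf_neq0.
have -> : 1 - coord_prod a * (1 - del) * m' / (coord_prod a * m) = 1 - (1 - del) * m' / m.
  by field; rewrite u0 m0.
have -> : y 0 o = k%:R * (xk a)^-1 * del by rewrite /del; field; rewrite x00 kn0.
rewrite -(coord_prod_step F lam1 plam ua).
have vE : vz a = (xk a)^-1 by [].
apply: (le_trans (y := B2 * mx a ^+ 2)); last by rewrite ler_wpM2r// lerDr.
apply: transition_bound => //.
- by rewrite x0 x1.
- by move: rx dl; lra_goal.
- exact: ltW.
- by move: Kx x0; lra_goal.
have := h2 a w Wa Ww us' uws; rewrite -/m -/m' [modulus (xk a - xk w)]modulus_distC => g1.
have -> : m - m' + del * xk a = (m - m' - (xk w - xk a) / k%:R) +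
  (xk w - xk a + k%:R * (xk a * del)) / k%:R by field.
rewrite (le_trans (modulusD _ _))//.
have g2 := modulus_div_nat (xk w - xk a + k%:R * (xk a * del)) k0.
have g3 : modulus (xk w - xk a) * (mx a + mx w) <= c * mx a ^+ 2 * ((1 + c) * mx a).
  by rewrite ler_pM ?addr_ge0 ?modulus_ge0//; move: xw; lra_goal.
have g4 : K * (mx a ^+ 3 + mx w ^+ 3 + modulus (xk w - xk a) * (mx a + mx w)) <=
  K * (mx a ^+ 3 + c ^+ 3 * mx a ^+ 3 + c * mx a ^+ 2 * ((1 + c) * mx a)).
  by rewrite ler_wpM2l ?(ltW K0)// !lerD.
have -> : B0 * mx a ^+ 3 = K * (mx a ^+ 3 + c ^+ 3 * mx a ^+ 3 + c * mx a ^+ 2 * ((1 + c) * mx a))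
  + c * mx a ^+ 3 by rewrite /B0; ring.
apply: (lerD (le_trans g1 g4)).
exact: le_trans g2 xd2.
Qed.

End Transition.

(** * Orbits followed in the charts of a reference orbit *)

Section ReferenceOrbit.
Variables (R : realType) (d k l : nat).
Local Notation C := (Cplx R).
Local Notation Cd := 'rV[C]_d.
Local Notation N := (k * d)%N.
Variables (F : Cd -> Cd) (lam : 'I_d -> C).
Hypotheses (d0 : (0 < d)%N) (k0 : (0 < k)%N).
Hypotheses (lam1 : forall j, modulus (lam j) = 1) (plam : \prod_j lam j = 1).
Hypothesis OF : forall j, eqO l (fun z => F z 0 j)
  (fun z => lam j * z 0 j * (1 - coord_prod z ^+ k / N%:R)).
Variables (theta beta r : R) (h : nat) (ref : nat -> Cd).
Hypotheses (tt : 0 < theta < pi / (2 * k%:R)) (bd : 0 < beta < d%:R^-1).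
Hypothesis be3 : 3 * k%:R + 1 <= beta * (l%:R + d%:R - 1).
Hypothesis r0 : 0 < r.
Local Notation Bh := (B_region k h r theta beta).
Local Notation au z := (modulus (coord_prod z)).
Local Notation xk z := (coord_prod z ^+ k).
Local Notation vz z := (fatou_v k (coord_prod z)).
Local Notation mx z := (modulus (coord_prod z ^+ k)).
Local Notation o := (Ordinal d0).
Local Notation chart := (chart k d0).
Local Notation chart_inv := (chart_inv k d0).
Local Notation annulus := (annulus d0).
Hypothesis refS : forall n, ref n.+1 = F (ref n).
Hypothesis refB : forall n, Bh (ref n).
Hypothesis ref_cvg : forall e : R, 0 < e -> exists n0, forall n, (n0 <= n)%N -> mx (ref n) < e.

Let kR0 : 0 < k%:R :> R. Proof. by rewrite ltr0n. Qed.
Let b0 : 0 < beta. Proof. by case/andP: bd. Qed.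
Let refW n : W_region beta (ref n). Proof. by case: (refB n). Qed.
Let be2 : 2 * k%:R + 1 <= beta * (l%:R + d%:R - 1).
Proof. by apply: le_trans be3; rewrite lerD2r ler_wpM2r// ler_nat. Qed.
Let ref_au n : 0 < au (ref n). Proof. exact: W_coord_prod_gt0 (refW n). Qed.

Lemma chart_coord_bound (s : R) a y j : 1 <= s -> annulus s y ->
  modulus (1 - y 0 o * xk a / k%:R) <= 2 ->
  modulus (chart a y 0 j) <= 2 * s ^+ d * modulus (a 0 j).
Proof.
move=> s1 ys d2; have s0 : 0 < s by lra.
have sd : 1 <= s ^+ d by rewrite exprn_ege1.
rewrite mxE; case: eqP => [->|/eqP jo]; last first.
  rewrite modulusM mulrC ler_wpM2r ?modulus_ge0//.
  have /andP[_ h1] := ys.2 j jo; rewrite (le_trans h1)//.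
  have : s <= s ^+ d by case: (d) d0 => // n _; rewrite exprS ler_peMr ?exprn_ege1// ltW.
  by lra.
rewrite !modulusM modulusV modulus_prod -mulrA mulrC.
apply: ler_pM; rewrite ?mulr_ge0 ?modulus_ge0 ?invr_ge0 ?prodr_ge0//.
  rewrite mulrC; apply: ler_pM; rewrite ?modulus_ge0 ?invr_ge0 ?prodr_ge0//.
rewrite -[s ^+ d]invrK lef_pV2 ?posrE; last 2 first.
- by rewrite prodr_gt0// => i io; rewrite modulus_gt0 (annulus_neq0 s0 ys io).
- by rewrite invr_gt0 exprn_gt0.
have si : s^-1 <= 1 by rewrite invf_le1.
rewrite (le_trans (y := \prod_(i < d | i != o) s^-1))//.
  rewrite prodr_const cardC1 card_ord -exprVn.
  by case: (d) d0 => // n _; rewrite exprS ler_piMl ?exprn_ge0 ?invr_ge0 ?(ltW s0).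
by apply: ler_prod => i io; rewrite invr_ge0 (ltW s0)/=; case/andP: (ys.2 i io).
Qed.

(** Moving in the chart displaces v by at most K s, whereas v_n is close to n in a narrow cone, so
    the sector condition persists. The factor 2 s^d lost by the coordinates is absorbed by starting
    from W(beta2) with beta2 > beta. *)
Lemma chart_in_B (s : R) : 1 <= s -> exists n0, forall n, (n0 <= n)%N ->
  forall y, annulus s y -> Bh (chart (ref n) y).
Proof.
move=> s1; have s0 : 0 < s by lra.
have [K K0 hK] := S_region_perturb R k0.
have kt : 0 < k%:R * theta < pi / 2.
  case/andP: tt => t0 t1; rewrite mulr_gt0//=.
  by move: t1; rewrite invfM mulrA ltr_pdivlMr// mulrC.
have T0 := tan_gt0 kt; set T := tan (k%:R * theta) in T0.
pose e := Num.min 1 (T / 2).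
have e01 : 0 < e <= 1 by rewrite lt_min ltr01 divr_gt0//= ge_min lexx.
have eT : e <= T / 2 by rewrite ge_min lexx orbT.
have [n1 hn1] := orbit_fatou_v_cone d0 k0 lam1 plam OF refS refW b0 be2 ref_cvg e01.
pose beta2 := (beta + d%:R^-1) / 2.
have [bb2 b2d] : beta < beta2 /\ beta2 < d%:R^-1 by case/andP: bd; rewrite /beta2; lra.
have [n2 hn2] := orbit_eventually_W d0 k0 lam1 plam OF refS refW b0 be2 ref_cvg
  (introT andP (conj (lt_trans b0 bb2) b2d)).
have sd : 1 <= s ^+ d by rewrite exprn_ege1.
have e2 : 0 < (4 * s ^+ d)^-1 by rewrite invr_gt0; lra.
have db : 0 < beta2 - beta by rewrite subr_gt0.
have [q /andP[q0 _] hq] := powR_lt_threshold e2 db.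
have [n3 hn3] := orbit_au_small k0 ref_cvg q0.
have [n4 hn4] : exists n0, forall n, (n0 <= n)%N -> s * mx (ref n) < Num.min 2^-1 K^-1.
  have m0 : 0 < Num.min 2^-1 K^-1 / s by rewrite divr_gt0// lt_min !invr_gt0 K0 ltr0n.
  by have [n0 hn0] := ref_cvg m0; exists n0 => n /hn0; rewrite ltr_pdivlMr// mulrC.
have [Q QE] : {Q | Q = K * s * (1 + T) / T} by eexists.
pose E : R := 2 * (r + K * s) + 4 * Q.
have hn5 : E < (Num.truncn E).+1%:R by exact: truncnS_gt.
set n5 := (Num.truncn E).+1 in hn5.
exists (maxn (maxn n1 n2) (maxn n3 (maxn n4 n5))) => n; rewrite !geq_max.
move=> /andP[/andP[/hn1[n00 v1 v2 _] /hn2 W2] /and3P[/hn3 u3 /hn4 x4 n5n]] y ys.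
have [x2 xK] : s * mx (ref n) <= 2^-1 /\ s * mx (ref n) <= K^-1.
  by move: x4; rewrite lt_min => /andP[/ltW x2 /ltW xK].
set a := ref n in v1 v2 W2 u3 x4 x2 xK *; have ua : 0 < au a by exact: ref_au.
have x0 : 0 < mx a by rewrite modulusX exprn_gt0.
set del := y 0 o * xk a / k%:R.
have uE : coord_prod (chart a y) = coord_prod a * (1 - del).
  by apply: coord_prod_chart => // j; exact: (annulus_neq0 s0 ys).
have dl : modulus del <= s * mx a.
  by rewrite (le_trans (modulus_div_nat _ k0))// modulusM ler_wpM2r ?modulus_ge0// ys.1.
have dl2 : modulus del <= 2^-1 by exact: le_trans dl x2.
have d2 : modulus (1 - del) <= 2.
  by rewrite (le_trans (modulusB _ _))// modulus1; move: dl2; lra_goal.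
have dN : modulus (1 - del - 1) = modulus del by rewrite addrAC subrr add0r modulusN.
have d3 : 2^-1 <= modulus (1 - del) by apply: modulus_ge_half; rewrite dN.
split.
  move=> j; rewrite (le_lt_trans (chart_coord_bound j s1 ys d2))//.
  rewrite uE modulusM powRM ?modulus_ge0//.
  have g1 : 2^-1 <= modulus (1 - del) `^ beta.
    rewrite (le_trans (y := 2^-1 `^ beta))//; last first.
      by rewrite ge0_ler_powR ?nnegrE ?modulus_ge0 ?(ltW b0).
    rewrite -[leLHS](powRr1 (_ : 0 <= 2^-1)) ?invr_ge0//.
    have b1 : beta <= 1.
      by case/andP: bd => _ /ltW b2; rewrite (le_trans b2)// invf_le1 ?ltr0n// ler1n.
    by rewrite ger_powR// invr_gt0 ltr0n invf_le1// ler1n.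
  have g2 : au a `^ beta2 = au a `^ beta * au a `^ (beta2 - beta).
    rewrite -powRD; first by rewrite subrKC.
    by rewrite (gt_eqF ua) implybT.
  have g3 := hq _ (ltW ua) u3.
  have g4 : 0 < au a `^ beta by exact: powR_gt0.
  rewrite (lt_le_trans (y := 2 * s ^+ d * (au a `^ beta * au a `^ (beta2 - beta))))//.
    by rewrite -g2 ltr_pM2l ?W2// mulr_gt0// exprn_gt0.
  rewrite mulrCA ler_pM2l// (le_trans _ g1)//.
  rewrite (le_trans (y := 2 * s ^+ d * (4 * s ^+ d)^-1))//.
    by rewrite ler_pM2l ?ltW// mulr_gt0// exprn_gt0.
  by rewrite invfM mulrACA divff ?gt_eqF ?exprn_gt0// mulr1; lra.
have [_ /(S_regionP k0 _ _ _ r0)[u00 _ sec]] := refB n.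
have nE : E < n%:R by rewrite (lt_le_trans hn5)// ler_nat.
have Ks : K * (s * mx a) * modulus (vz a) = K * s.
  by rewrite modulus_vz; field; rewrite gt_eqF.
have T1 : 0 <= Q by rewrite QE divr_ge0 ?(ltW T0)// !mulr_ge0 ?(ltW K0) ?(ltW s0) ?addr_ge0 ?(ltW T0).
have Ks0 : 0 < K * s by rewrite mulr_gt0.
rewrite uE; apply: (hK h r theta (s * mx a)) => //.
- by rewrite dN.
- by rewrite Ks; move: nE v1 r0 T1; rewrite /E; lra_goal.
rewrite Ks -/T.
have h1 : e * Re (vz a) <= T / 2 * Re (vz a).
  rewrite ler_wpM2r//; move: v1; apply: le_trans; by rewrite divr_ge0.
have h2 : 2 * Q < Re (vz a).
  by move: nE v1 r0 Ks0; rewrite /E; lra_goal.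
have h3 : T * (2 * Q) < T * Re (vz a) by rewrite ltr_pM2l.
have h4 : T * (2 * Q) = 2 * (K * s * (1 + T)).
  by rewrite QE; field; rewrite gt_eqF.
by move: h1 h3 v2; rewrite h4; lra_goal.
Qed.

(** A transition at time t moves the point by at most B (2/t)^2 <= D (1/t - 1/(t + 1)), where D = 8
    B. The total drift from time n on is at most D/n <= 1/(2 s), so the orbit never leaves the
    annulus of parameter 2 s, on which the estimate holds. *)
Lemma chart_orbit (s : R) : 1 <= s -> exists2 D : R, 0 <= D & exists2 n0, (0 < n0)%N &
  forall n, (n0 <= n)%N -> forall y, annulus s y ->
  let w m := iter m F (chart (ref n) y) in let Y m := chart_inv (ref (n + m)) (w m) in
  forall m, [/\ Bh (w m), annulus (2 * s) (Y m) &
    forall i, vnorm (Y (m + i)%N - Y m) <= D / (n + m)%:R].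
Proof.
move=> s1; have s0 : 0 < s by lra.
have s21 : 1 <= 2 * s by lra.
have [B [q [B0 q0 hB]]] := chart_transition d0 k0 lam1 plam OF b0 be3 s21.
have [n1 hn1] := chart_in_B s21.
have [n2 hn2] := orbit_au_small k0 ref_cvg q0.
have [n3 hn3] := orbit_fatou_v_cone d0 k0 lam1 plam OF refS refW b0 be2 ref_cvg
  (introT andP (conj ltr01 (lexx 1))).
pose D := 8 * B; have D0 : 0 <= D by rewrite /D mulr_ge0.
exists D => //.
pose n4 := (Num.truncn (D * (2 * s))).+1.
exists (maxn (maxn n1 n2) (maxn n3 n4)); first by rewrite !leq_max /n4 ltn0Sn !orbT.
move=> n; rewrite !geq_max => /andP[/andP[n1n n2n] /andP[n3n n4n]] y ys w Y.
have n0 : (0 < n)%N by exact: leq_trans n4n.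
have nm0 m : 0 < (n + m)%:R :> R by rewrite ltr0n addn_gt0 n0.
have YS m : annulus (2 * s) (Y m) -> w m = chart (ref (n + m)) (Y m) ->
    [/\ Bh (w m), w m.+1 = chart (ref (n + m.+1)) (Y m.+1) &
      vnorm (Y m.+1 - Y m) <= D * ((n + m)%:R^-1 - (n + m.+1)%:R^-1)].
  move=> Ym wm.
  have nnm : (n <= n + m)%N by exact: leq_addr.
  have Bm : Bh (w m) by rewrite wm; apply: hn1 => //; exact: leq_trans nnm.
  have Wm : W_region beta (chart (ref (n + m)) (Y m)) by rewrite -wm; case: Bm.
  have [uw h1] := hB _ _ (refW (n + m)) Wm (hn2 _ (leq_trans n2n nnm)) Ym.
  have [_ _ _ xn] := hn3 _ (leq_trans n3n nnm).
  rewrite -wm -refS -addnS in uw h1.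
  split => //.
    by rewrite /Y chart_invK// => j; apply: coord_neq0; rewrite modulus_gt0.
  rewrite (le_trans h1)//.
  have e1 : mx (ref (n + m)) ^+ 2 <= (2 / (n + m)%:R) ^+ 2.
    by rewrite lerXn2r ?nnegrE ?modulus_ge0// divr_ge0// ltW.
  rewrite (le_trans (ler_wpM2l B0 e1))// /D [8 * B]mulrC -mulrA ler_wpM2l//.
  have n1m : 1 <= (n + m)%:R :> R by rewrite ler1n addn_gt0 n0.
  rewrite addnS -[(n + m).+1%:R]natr1; move: (nm0 m) n1m; move: (n + m)%:R => t t0 t1.
  have -> : 8 * (t^-1 - (t + 1)^-1) = 8 / (t * (t + 1)) by field; rewrite !gt_eqF//; lra.
  rewrite expr_div_n ler_pdivlMr ?mulr_gt0//; last by lra.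
  rewrite mulrAC ler_pdivrMr ?exprn_gt0//.
  by have : 0 <= t * (t - 1); [rewrite mulr_ge0//; lra|lra].
have Ds : D / n%:R <= (2 * s)^-1.
  rewrite ler_pdivrMr ?ltr0n// mulrC ler_pdivlMr ?mulr_gt0//.
  by rewrite ltW// (lt_le_trans (truncnS_gt _))// ler_nat.
have P m : [/\ annulus (2 * s) (Y m), w m = chart (ref (n + m)) (Y m) &
    vnorm (Y m - y) <= D * (n%:R^-1 - (n + m)%:R^-1)].
  elim: m => [|m [Ym wm ym]].
    have Y0 : Y 0%N = y.
      rewrite /Y/= addn0 chartK// => j jo; exact: annulus_neq0 ys jo.
    rewrite Y0 addn0 !subrr mulr0; split => //; last by rewrite vnorm0.
    by apply: annulus_le ys => //; lra.
  have [_ wm' ym'] := YS m Ym wm.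
  have ym2 : vnorm (Y m.+1 - y) <= D * (n%:R^-1 - (n + m.+1)%:R^-1).
    rewrite -(subrKA (Y m)) (le_trans (vnormD _ _))//.
    have -> : D * (n%:R^-1 - (n + m.+1)%:R^-1) = D * ((n + m)%:R^-1 - (n + m.+1)%:R^-1) +
      D * (n%:R^-1 - (n + m)%:R^-1) by ring.
    exact: lerD.
  split => //; apply: (annulus_near s1 ys); rewrite (le_trans ym2)// (le_trans _ Ds)//.
  by rewrite ler_wpM2l// gerBl invr_ge0 ltW.
move=> m; have [Ym wm _] := P m; have [Bm _ _] := YS m Ym wm; split => // i.
have hY i' : vnorm (Y (m + i')%N - Y m) <= D * ((n + m)%:R^-1 - (n + m + i')%:R^-1).
  elim: i' => [|i' ih]; first by rewrite !addn0 !subrr mulr0 vnorm0.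
  have [Ym' wm' _] := P (m + i')%N; have [_ _ ym'] := YS _ Ym' wm'.
  rewrite addnS -(subrKA (Y (m + i')%N)) (le_trans (vnormD _ _))//.
  have -> : D * ((n + m)%:R^-1 - (n + m + i'.+1)%:R^-1) =
    D * ((n + (m + i'))%:R^-1 - (n + (m + i').+1)%:R^-1) +
    D * ((n + m)%:R^-1 - (n + m + i')%:R^-1) by rewrite !addnS !addnA; ring.
  exact: lerD.
by rewrite (le_trans (hY i))// ler_wpM2l// gerBl invr_ge0 -addnA ltW.
Qed.

End ReferenceOrbit.

(** * Shadowing: every orbit of a basin stays near the reference orbit *)

Section ShadowingPower.
Variables (R : realType) (k : nat).
Local Notation C := (Cplx R).

(* In the cone |arg q| <= pi / (2k), all powers q^i with i < k have nonnegative real part, so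
   (q^k - 1) / (q - 1) = 1 + q + ... + q^(k-1) has modulus at least 1. *)
Lemma modulus_sub1_le_expr (t : R) (q : C) : (0 < k)%N -> q = ofR (modulus q) * cis t ->
  `|t| <= pi / (2 * k%:R) -> modulus (q - 1) <= modulus (q ^+ k - 1).
Proof.
move=> k0 qE tk; rewrite subrX1 modulusM ler_peMr ?modulus_ge0//.
have rX i : (i < k)%N -> 0 <= Re (q ^+ i).
  move=> ik; rewrite qE exprMn -ofRX -cis_nat Re_ofRM mulr_ge0 ?exprn_ge0 ?modulus_ge0//=.
  apply: cos_ge0_pihalf; rewrite -ler_norml normrM normr_nat.
  have i1 : i%:R <= k%:R :> R by rewrite ler_nat ltnW.
  rewrite (le_trans (ler_pM _ _ i1 tk))//.
  have kn : k%:R != 0 :> R by rewrite pnatr_eq0 -lt0n.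
  by rewrite le_eqVlt; apply/orP; left; apply/eqP; field.
rewrite (le_trans _ (Re_le_modulus _))// (le_trans _ (ler_norm _))//.
case: (k) k0 rX => // n _ rX; rewrite big_ord_recl expr0 ReD lerDl.
elim/big_rec: _ => [//|i x _ x0]; rewrite ReD addr_ge0//.
by apply: rX; rewrite lift0 ltnS.
Qed.

End ShadowingPower.

Lemma trans_ratio_bound (R : realType) (a b ua ub D1 D2 : R) : 0 <= D1 -> a <= D1 * ua ->
  ub <= D2 * b -> ua <= 3 * ub -> a <= 3 * (D1 * D2) * b.
Proof.
move=> D10 e1 e2 e3; rewrite (le_trans e1)//.
by have := ler_wpM2l D10 e3; have := ler_wpM2l D10 e2; lra.
Qed.

Lemma modulus_near_nat (R : realType) (v : Cplx R) (n : nat) :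
  modulus (v - n%:R) <= 2^-1 * n%:R -> n%:R / 2 <= modulus v <= 3 * n%:R / 2.
Proof.
move=> vn; have := modulusD (v - n%:R) n%:R; rewrite subrK modulus_nat.
have := modulusD (n%:R - v) v; rewrite subrK modulus_nat modulus_distC.
by move=> a1 a2; apply/andP; split; lra.
Qed.

Lemma three_halves (R : realType) (x y n : R) : x <= 3 * n / 2 -> n / 2 <= y -> x <= 3 * y.
Proof. by lra. Qed.

Section ReferenceOrbit.
Variables (R : realType) (d k l : nat).
Local Notation C := (Cplx R).
Local Notation Cd := 'rV[C]_d.
Local Notation N := (k * d)%N.
Variables (F : Cd -> Cd) (lam : 'I_d -> C).
Hypotheses (d0 : (0 < d)%N) (k0 : (0 < k)%N).
Hypotheses (lam1 : forall j, modulus (lam j) = 1) (plam : \prod_j lam j = 1).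
Hypothesis OF : forall j, eqO l (fun z => F z 0 j)
  (fun z => lam j * z 0 j * (1 - coord_prod z ^+ k / N%:R)).
Variables (theta beta r : R) (h : nat) (ref : nat -> Cd).
Hypotheses (tt : 0 < theta < pi / (2 * k%:R)) (bd : 0 < beta < d%:R^-1).
Hypothesis be3 : 3 * k%:R + 1 <= beta * (l%:R + d%:R - 1).
Hypothesis r0 : 0 < r.
Local Notation Bh := (B_region k h r theta beta).
Local Notation au z := (modulus (coord_prod z)).
Local Notation xk z := (coord_prod z ^+ k).
Local Notation vz z := (fatou_v k (coord_prod z)).
Local Notation mx z := (modulus (coord_prod z ^+ k)).
Local Notation chart := (chart k d0).
Local Notation chart_inv := (chart_inv k d0).
Local Notation annulus := (annulus d0).
Hypothesis refS : forall n, ref n.+1 = F (ref n).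
Hypothesis refB : forall n, Bh (ref n).
Hypothesis ref_cvg : forall e : R, 0 < e -> exists n0, forall n, (n0 <= n)%N -> mx (ref n) < e.

Let b0 : 0 < beta. Proof. by case/andP: bd. Qed.
Let refW n : W_region beta (ref n). Proof. by case: (refB n). Qed.
Let be2 : 2 * k%:R + 1 <= beta * (l%:R + d%:R - 1).
Proof. by apply: le_trans be3; rewrite lerD2r ler_wpM2r// ler_nat. Qed.
Let ref_au n : 0 < au (ref n). Proof. exact: W_coord_prod_gt0 (refW n). Qed.

Variable z : nat -> Cd.
Hypotheses (zS : forall n, z n.+1 = F (z n)) (zB : forall n, Bh (z n)).
Hypothesis z_cvg : forall e : R, 0 < e -> exists n0, forall n, (n0 <= n)%N -> mx (z n) < e.
Let zW n : W_region beta (z n). Proof. by case: (zB n). Qed.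

(** The terms c/v of two orbits differ by c times the difference of the v's divided by their
    product, of relative size 1/n^2; the remainders are O(1/n^2) as well. All these errors are
    summable. *)
Lemma fatou_v_distance : exists2 A : R, 0 <= A & exists n0, forall n, (n0 <= n)%N ->
  modulus (vz (z n) - vz (ref n)) <= A.
Proof.
have [K [s [K0 /andP[s0 s1] hs]]] := step_expansion d0 k0 lam1 plam OF b0 (isT : 1 < 3 <= 3)%N be3.
have [n1 hn1] := orbit_au_small k0 ref_cvg s0.
have [n2 hn2] := orbit_au_small k0 z_cvg s0.
have e01 : 0 < (1 : R) <= 1 by rewrite ltr01 lexx.
have [n3 hn3] := orbit_fatou_v_cone d0 k0 lam1 plam OF refS refW b0 be2 ref_cvg e01.
have [n4 hn4] := orbit_fatou_v_cone d0 k0 lam1 plam OF zS zW b0 be2 z_cvg e01.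
pose n0 := maxn (maxn n1 n2) (maxn (maxn n3 n4) 2).
pose D n := modulus (vz (z n) - vz (ref n)).
pose mc := modulus (fatou_c R d k).
have mc0 : 0 <= mc by exact: modulus_ge0.
have mz n : (n0 <= n)%N -> [/\ (0 < n)%N, au (z n) < s, au (ref n) < s, mx (z n) <= 2 / n%:R &
    mx (ref n) <= 2 / n%:R].
  rewrite !geq_max => /andP[/andP[a1 a2] /andP[/andP[a3 a4] a5]].
  have [n00 _ _ x1] := hn3 _ a3; have [_ _ _ x2] := hn4 _ a4.
  by split => //; [exact: hn2|exact: hn1].
have DS n : (n0 <= n)%N -> D n.+1 <= D n * (1 + 4 * mc / n%:R ^+ 2) + 8 * K / n%:R ^+ 2.
  move=> /mz[nn0 uz ur xz xr].
  have [uz0 _ _ _ hz] := hs _ (zW n) uz; have [ur0 _ _ _ hr] := hs _ (refW n) ur.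
  have nR : 0 < n%:R :> R by rewrite ltr0n.
  have xz0 : xk (z n) != 0 by rewrite expf_neq0// -modulus_gt0.
  have xr0 : xk (ref n) != 0 by rewrite expf_neq0// -modulus_gt0.
  have -> : D n.+1 = modulus ((vz (z n) - vz (ref n)) * (1 - fatou_c R d k * (xk (z n) * xk (ref n))) +
     (vz (F (z n)) - vz (z n) - 1 - fatou_c R d k * xk (z n)) -
     (vz (F (ref n)) - vz (ref n) - 1 - fatou_c R d k * xk (ref n))).
    rewrite /D zS refS; congr modulus.
    by rewrite [vz (z n)]/fatou_v [vz (ref n)]/fatou_v; field; rewrite xz0 xr0.
  rewrite (le_trans (modulusB _ _))// (le_trans (lerD (modulusD _ _) (lexx _)))//.
  rewrite (le_trans (lerD (lerD (lexx _) hz) hr))//= -addrA.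
  have q0 : 0 <= 2 / n%:R :> R by rewrite divr_ge0// ltW.
  have sq (x : R) : 0 <= x -> x <= 2 / n%:R -> K * x ^+ 2 <= 4 * K / n%:R ^+ 2.
    move=> x0 xn; have -> : 4 * K / n%:R ^+ 2 = K * (2 / n%:R) ^+ 2.
      by field; rewrite gt_eqF.
    by rewrite (ler_wpM2l (ltW K0))// lerXn2r ?nnegrE.
  apply: lerD; last first.
    have -> : 8 * K / n%:R ^+ 2 = 4 * K / n%:R ^+ 2 + 4 * K / n%:R ^+ 2.
      by field; rewrite gt_eqF.
    by apply: lerD; apply: sq; rewrite ?modulus_ge0.
  rewrite modulusM ler_wpM2l ?modulus_ge0// (le_trans (modulusB _ _))// modulus1 lerD2l.
  rewrite [modulus (fatou_c R d k * _)]modulusM [modulus (xk (z n) * _)]modulusM -/mc.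
  have -> : 4 * mc / n%:R ^+ 2 = mc * ((2 / n%:R) * (2 / n%:R)).
    by field; rewrite gt_eqF.
  by rewrite ler_wpM2l// ler_pM ?modulus_ge0.
pose B := 4 * mc + 8 * K; have B0 : 0 <= B by rewrite /B addr_ge0 ?mulr_ge0// ltW.
have n02 : (2 <= n0)%N by rewrite /n0 !leq_max leqnn !orbT.
have D0 n : 0 <= D n by exact: modulus_ge0.
(* Passing to 1 + D n turns the additive error 8 K / n^2 into a multiplicative one. *)
have := @growth_bounded R (fun n => 1 + D n) B n0 B0 n02 (fun n _ => addr_ge0 ler01 (D0 n)) _.
move=> gb; exists ((1 + D n0) * expR B); first by rewrite mulr_ge0 ?expR_ge0// addr_ge0.
exists n0 => n nn; have : 1 + D n <= (1 + D n0) * expR B.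
  apply: gb => // m /DS Dm; rewrite (le_trans (lerD (lexx 1) Dm))//.
  have i0 : 0 <= (m%:R ^+ 2)^-1 :> R by rewrite invr_ge0 exprn_ge0.
  have f1 : 0 <= mc * (m%:R ^+ 2)^-1 by rewrite mulr_ge0.
  have f2 : 0 <= D m * (K * (m%:R ^+ 2)^-1) by rewrite !mulr_ge0// ltW.
  have -> : (1 + D m) * (1 + B / m%:R ^+ 2) = 1 + (D m * (1 + 4 * mc / m%:R ^+ 2) +
    8 * K / m%:R ^+ 2) + (4 * (mc / m%:R ^+ 2) + 8 * (D m * (K / m%:R ^+ 2))) by rewrite /B; ring.
  by rewrite lerDl addr_ge0// mulr_ge0.
by apply: le_trans; rewrite lerDr.
Qed.

(** The ratios of coordinates are bounded because all coordinates are comparable to |u|^(1/d). For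
    coordinate 0 let q be the quotient of the two products: q^k - 1 is O(1/n) as the v's stay at
    bounded distance, and the condition on theta keeps arg q within pi / (2k), so that q - 1 is no
    larger. *)
Lemma shadowing : 2 * theta <= pi / (2 * k%:R) -> exists2 s : R, 1 <= s & exists n0,
  forall n, (n0 <= n)%N -> annulus s (chart_inv (ref n) (z n)).
Proof.
move=> th2; have [A A0 [n0 hA]] := fatou_v_distance.
have [D1 D10 [n1 hD1]] := orbit_ratio d0 k0 lam1 plam OF refS refW b0 be2 ref_cvg.
have [D2 D20 [n2 hD2]] := orbit_ratio d0 k0 lam1 plam OF zS zW b0 be2 z_cvg.
have e01 : 0 < (2^-1 : R) <= 1 by rewrite invr_gt0 ltr0n/=; lra.
have [n3 hn3] := orbit_fatou_v d0 k0 lam1 plam OF refS refW b0 be2 ref_cvg (proj1 (andP e01)).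
have [n4 hn4] := orbit_fatou_v d0 k0 lam1 plam OF zS zW b0 be2 z_cvg (proj1 (andP e01)).
pose M := 1 + 3 * (D1 * D2); have DD : 0 < D1 * D2 by rewrite mulr_gt0.
pose s := M + 3 * k%:R * A.
have s1 : 1 <= s by rewrite /s /M -addrA lerDl addr_ge0// mulr_ge0 ?mulr_ge0// ltW.
exists s => //; exists (maxn (maxn n0 n1) (maxn (maxn n2 n3) (maxn n4 1))) => n.
rewrite !geq_max => /andP[/andP[/hA hv /hD1 h1] /andP[/andP[/hD2 h2 /hn3 h3] /andP[/hn4 h4 n00]]].
have nR : 0 < n%:R :> R by rewrite ltr0n.
have zu : 0 < au (z n) by exact: W_coord_prod_gt0 (zW n).
have ru := ref_au n.
have /andP[vr1 vr2] := modulus_near_nat h3; have /andP[vz1 vz2] := modulus_near_nat h4.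
have ratio (a b : Cd) : 0 < au a -> 0 < au b -> modulus (vz b) <= 3 * modulus (vz a) ->
    au a <= 3 * au b.
  move=> a0 b00; rewrite !modulus_fatou_v => ab.
  have e1 : au a ^+ k <= 3 * au b ^+ k.
    move: ab; rewrite ler_pdivlMr ?exprn_gt0// mulrC ler_pdivrMr ?exprn_gt0//.
  rewrite -(@ler_pXn2r _ k) ?nnegrE ?mulr_ge0 ?(ltW a0) ?(ltW b00)// (le_trans e1)// exprMn.
  rewrite ler_wpM2r ?exprn_ge0 ?(ltW b00)//.
  by case: (k) k0 => // m _; rewrite exprS ler_peMr// exprn_ege1// ler1n.
have uz : au (z n) <= 3 * au (ref n) by apply: ratio => //; exact: three_halves vr2 vz1.
have ur : au (ref n) <= 3 * au (z n) by apply: ratio => //; exact: three_halves vz2 vr1.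
have M1 : 1 <= M by rewrite /M lerDl mulr_ge0// ltW.
have M0 : 0 < M := lt_le_trans ltr01 M1.
have Ms : M <= s by rewrite /s lerDl mulr_ge0 ?mulr_ge0.
have ratioj (a b : R) : 0 <= a -> 0 < b -> a ^+ d <= 3 * (D1 * D2) * b ^+ d -> a / b <= M.
  move=> a0 b00 ab; rewrite ler_pdivrMr// -(@ler_pXn2r _ d) ?nnegrE ?mulr_ge0 ?(ltW b00) ?(ltW M0)//.
  rewrite (le_trans ab)// exprMn ler_wpM2r ?exprn_ge0 ?(ltW b00)//.
  rewrite (le_trans (y := M))//; first by rewrite /M lerDr.
  by case: (d) d0 => // m _; rewrite exprS ler_peMr ?exprn_ege1// ltW.
have zj j : 0 < modulus (z n 0 j) by rewrite modulus_gt0 coord_neq0.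
have rj j : 0 < modulus (ref n 0 j) by rewrite modulus_gt0 coord_neq0.
split; last first.
  move=> j jo; rewrite mxE (negbTE jo) modulusM modulusV; apply/andP; split.
    rewrite -[leRHS]invrK lef_pV2 ?posrE ?invr_gt0 ?divr_gt0// ?(lt_le_trans ltr01 s1)//.
    rewrite invf_div (le_trans _ Ms)// ratioj ?(ltW (rj j))//.
    exact: trans_ratio_bound (ltW D10) (h1 j).1 (h2 j).2 ur.
  rewrite (le_trans _ Ms)// ratioj ?(ltW (zj j))//.
  by rewrite [D1 * D2]mulrC; exact: trans_ratio_bound (ltW D20) (h2 j).1 (h1 j).2 uz.
rewrite mxE eqxx.
have [_ /(S_regionP k0 _ _ _ r0)[uz0 _ [t1 tt1 zE]]] := zB n.
have [_ /(S_regionP k0 _ _ _ r0)[ur0 _ [t2 tt2 rE]]] := refB n.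
set q := coord_prod (z n) / coord_prod (ref n).
have qE : q = ofR (modulus q) * cis (t1 - t2).
  rewrite /q {1}zE {1}rE modulusM modulusV ofRM ofRV.
  have o1 : ofR (au (ref n)) != 0 :> C by rewrite -modulus_gt0 modulus_ofR_ge0 ?ltW.
  rewrite !cisD cisN.
  have c1 t : cis t != 0 :> C by rewrite -modulus_gt0 modulus_cis.
  by field; rewrite o1 !c1.
have q1 : modulus (q - 1) <= modulus (q ^+ k - 1).
  apply: (modulus_sub1_le_expr k0 qE); rewrite (le_trans (ler_normB _ _))//.
  by rewrite (le_trans _ th2)// mulr_natl mulr2n lerD// ltW.
have vz0 : 0 < modulus (vz (z n)) by rewrite (lt_le_trans _ vz1)// divr_gt0.
have qk : q ^+ k - 1 = (vz (ref n) - vz (z n)) / vz (z n).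
  rewrite /q expr_div_n /fatou_v; field; rewrite !expf_neq0//.
rewrite modulusM modulusM modulus_nat modulus_distC.
have e1 : modulus (q - 1) <= A * (2 / n%:R).
  rewrite (le_trans q1)// qk modulusM modulusV modulus_distC ler_pM ?modulus_ge0 ?invr_ge0 ?modulus_ge0//.
  by rewrite invf_ple ?posrE ?divr_gt0// invf_div.
rewrite (le_trans (y := k%:R * (3 * n%:R / 2) * (A * (2 / n%:R))))//.
  by rewrite ler_pM ?mulr_ge0 ?modulus_ge0// ler_wpM2l.
have -> : k%:R * (3 * n%:R / 2) * (A * (2 / n%:R)) = 3 * k%:R * A by field; rewrite gt_eqF.
by rewrite /s lerDr (le_trans ler01 M1).
Qed.

End ReferenceOrbit.

(** * The model domain is connected and open *)

Section ConnectedModel.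
Variables (R : realType) (d : nat).
Local Notation C := (Cplx R).
Local Notation Cd := 'rV[C]_d.

Lemma cexp_surjective (w : C) : w != 0 -> exists L, cexp L = w.
Proof.
move=> w0; have [t wE] := polar_exists w.
exists (Complex (ln (modulus w)) t); rewrite [RHS]wE /cexp /= lnK//.
by rewrite posrE modulus_gt0.
Qed.

Lemma continuous_ray (X : Cd) : continuous (fun s : R => ofR s *: X).
Proof.
move=> s0; apply/cvg_vnormP => e e0.
have X0 : 0 < vnorm X + 1 by rewrite ltr_wpDl ?vnorm_ge0.
have h : 0 < e / (vnorm X + 1) by rewrite divr_gt0.
exists (e / (vnorm X + 1)) => //= s sh; rewrite -scalerBl -ofRB.
apply: (le_lt_trans (y := `|s - s0| * vnorm X)).
  apply: vnorm_le => [|j]; first by rewrite mulr_ge0 ?vnorm_ge0.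
  by rewrite mxE modulusM modulus_ofR ler_wpM2l// modulus_le_vnorm.
rewrite /ball_/= distrC in sh; rewrite (le_lt_trans (y := `|s - s0| * (vnorm X + 1)))//.
  by rewrite ler_wpM2l// lerDl.
by rewrite -ltr_pdivlMr.
Qed.

Lemma connected_space : connected [set: Cd].
Proof.
have -> : [set: Cd] = \bigcup_(X in [set: Cd]) ((fun s : R => ofR s *: X) @` `[0, 1]).
  apply/seteqP; split => // X _; exists X => //; exists 1; last by rewrite scale1r.
  by rewrite /= in_itv /= ler01 lexx.
apply: bigcup_connected => [|X _].
  exists 0 => X _; exists 0; first by rewrite /= in_itv /= ler01 lexx.
  by rewrite ofR0 scale0r.
apply: connected_continuous_connected; first exact: segment_connected.
by apply: continuous_subspaceT; exact: continuous_ray.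
Qed.

(** It is the image of the whole space under the exponential in all coordinates but the first. *)
Lemma C_times_Cstars_connected : connected (C_times_Cstars R d).
Proof.
pose E (X : Cd) : Cd := \row_j (if (0 < j)%N then cexp (X 0 j) else X 0 j).
have -> : C_times_Cstars R d = E @` setT.
  apply/seteqP; split => [z hz|_ [X _ <-] j j0]; last by rewrite mxE j0 cexp_neq0.
  have /choice[L hL] (j : 'I_d) : exists L, (0 < j)%N -> cexp L = z 0 j.
    have [/hz/cexp_surjective[L LE]|j0] := boolP (0 < j)%N; first by exists L.
    by exists 0.
  exists (\row_j (if (0 < j)%N then L j else z 0 j)) => //; apply/rowP => j.
  by rewrite !mxE; have [/hL|] := boolP (0 < j)%N.
apply: connected_continuous_connected; first exact: connected_space.
apply: continuous_subspaceT; apply: entire_map_continuous => j B.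
have [j0|j0] := boolP (0 < j)%N.
  apply: (@approx_ext _ _ _ (fun z => cexp (z 0 j))); first by move=> z _; rewrite mxE j0.
  exact: (entire_cexp (entire_coord j)).
apply: (@approx_ext _ _ _ (fun z => z 0 j)); first by move=> z _; rewrite mxE (negbTE j0).
exact: (entire_coord j).
Qed.

Lemma open_C_times_Cstars : open (C_times_Cstars R d).
Proof.
apply/open_vnormP => z hz.
pose m := \prod_(j < d | (0 < j)%N) modulus (z 0 j).
have /choice[r hr] (j : 'I_d) : exists r : R, 0 < r /\ ((0 < j)%N -> r <= modulus (z 0 j)).
  have [j0|j0] := boolP (0 < j)%N; last by exists 1.
  by exists (modulus (z 0 j)); rewrite modulus_gt0 hz.
exists (\big[Num.min/1]_j r j).
  by elim/big_ind: _ => // [x y x0 y0|j _]; [rewrite lt_min x0|case: (hr j)].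
move=> w wz j j0; apply/eqP => w0.
have h1 : \big[Num.min/1]_j r j <= r j by rewrite (bigD1 j)//= ge_min lexx.
have := modulus_le_vnorm (w - z) j; rewrite !mxE w0 sub0r modulusN.
move=> h2; have := le_trans ((hr j).2 j0) h2; move: wz h1; lra.
Qed.

End ConnectedModel.

(** * Holomorphy of the charts *)

Section ChartRegularity.
Variables (R : realType) (d k : nat).
Local Notation C := (Cplx R).
Local Notation Cd := 'rV[C]_d.
Hypotheses (d0 : (0 < d)%N).
Local Notation o := (Ordinal d0).
Implicit Types a w y : Cd.

Lemma chart_inv_entire a : entire_map (chart_inv k d0 a).
Proof.
move=> j B; have vb := vbounded_ball (0 : Cd) B; case: (eqVneq j o) => [jo|jo].
  apply: (@approx_ext _ _ _ (fun w =>
    k%:R * fatou_v k (coord_prod a) * (1 - coord_prod w * (coord_prod a)^-1))).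
    by move=> z _; rewrite mxE jo eqxx.
  apply: approxM => //; first exact: approx_cst.
  apply: approxB => //; first exact: approx_cst.
  apply: approxM => //; last exact: approx_cst.
  by apply: approx_prod => // i _; exact: approx_coord.
apply: (@approx_ext _ _ _ (fun w => w 0 j * (a 0 j)^-1)).
  by move=> z _; rewrite mxE (negbTE jo).
by apply: approxM => //; [exact: approx_coord|exact: approx_cst].
Qed.

Lemma approx_inv_coord (y0 : Cd) (rho : R) j : y0 0 j != 0 -> 0 <= rho ->
  rho <= modulus (y0 0 j) / 2 -> approx (vball y0 rho) (fun y => (y 0 j)^-1).
Proof.
move=> yj rho0 hr; have vb := vbounded_ball y0 rho.
pose g (y : Cd) : C := (y0 0 j)^-1 * (y 0 j - y0 0 j).
apply: (@approx_ext _ _ _ (fun y => (y0 0 j)^-1 * (1 + g y)^-1)).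
  move=> y _; rewrite -invfM /g mulrDr mulr1 mulrA divff// mul1r.
  by rewrite addrC subrK.
apply: approxM => //; first exact: approx_cst.
have h34 : 0 <= 3 / 4 :> R by rewrite divr_ge0.
apply: (@approx_comp1 _ _ _ (fun t => (1 + t)^-1) g (3 / 4) 2^-1).
- by apply: approx1_inv => //; lra.
- apply: approxM => //; first exact: approx_cst.
  by apply: approxB => //; [exact: approx_coord|exact: approx_cst].
- by lra.
move=> y yr; rewrite modulusM modulusV mulrC ler_pdivrMr ?modulus_gt0//.
have := modulus_le_vnorm (y - y0) j; rewrite !mxE => /le_trans; apply.
by rewrite (le_trans yr)// mulrC.
Qed.

Lemma chart_approx a (y0 : Cd) (rho : R) j : 0 <= rho ->
  (forall i, i != o -> y0 0 i != 0 /\ rho <= modulus (y0 0 i) / 2) ->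
  approx (vball y0 rho) (fun y => chart k d0 a y 0 j).
Proof.
move=> rho0 hy; have vb := vbounded_ball y0 rho; case: (eqVneq j o) => [jo|jo].
  apply: (@approx_ext _ _ _ (fun y => a 0 o * (\prod_(i < d | i != o) (y 0 i)^-1) *
    (1 - y 0 o * (coord_prod a ^+ k / k%:R)))).
    move=> y _; rewrite mxE jo eqxx mulrA; congr (_ * _ * _).
    by rewrite prodfV.
  apply: approxM => //.
    apply: approxM => //; first exact: approx_cst.
    by apply: approx_prod => // i io; apply: approx_inv_coord => //; case: (hy i io).
  apply: approxB => //; first exact: approx_cst.
  by apply: approxM => //; [exact: approx_coord|exact: approx_cst].
apply: (@approx_ext _ _ _ (fun y => a 0 j * y 0 j)).
  by move=> y _; rewrite mxE (negbTE jo).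
by apply: approxM => //; [exact: approx_cst|exact: approx_coord].
Qed.

Lemma C_times_Cstars_annulus (X : Cd) : C_times_Cstars R d X ->
  exists2 s : R, 1 <= s & annulus d0 s X.
Proof.
move=> hX; have Xj j : j != o -> 0 < modulus (X 0 j).
  move=> jo; rewrite modulus_gt0 hX// lt0n; apply: contra jo => /eqP j0.
  by apply/eqP/val_inj.
have m0 j : 0 <= (modulus (X 0 j))^-1 by rewrite invr_ge0 modulus_ge0.
pose S := \sum_j (modulus (X 0 j))^-1.
have S0 : 0 <= S by rewrite sumr_ge0.
exists (1 + vnorm X + S); first by rewrite -addrA lerDl addr_ge0 ?vnorm_ge0.
have le_s j : modulus (X 0 j) <= 1 + vnorm X + S.
  by have := modulus_le_vnorm X j; move: S0; lra_goal.
split => // j jo; rewrite le_s andbT.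
have jS : (modulus (X 0 j))^-1 <= 1 + vnorm X + S.
  have : (modulus (X 0 j))^-1 <= S by rewrite /S (bigD1 j)//= lerDl sumr_ge0.
  by have := vnorm_ge0 X; lra_goal.
rewrite -[leRHS]invrK lef_pV2 ?posrE ?invr_gt0 ?Xj//.
by rewrite (lt_le_trans _ jS)// invr_gt0 Xj.
Qed.

Lemma annulus_C_times_Cstars (s : R) (X : Cd) : 0 < s -> annulus d0 s X -> C_times_Cstars R d X.
Proof.
move=> s0 hX j j0; apply: (annulus_neq0 s0 hX).
by apply: contraTneq j0 => ->; rewrite ltnn.
Qed.

Lemma annulus_closed (s : R) (Y : nat -> Cd) L :
  (forall e : R, 0 < e -> exists N, forall n, (N <= n)%N -> vnorm (Y n - L) < e) ->
  (exists N, forall n, (N <= n)%N -> annulus d0 s (Y n)) -> annulus d0 s L.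
Proof.
move=> YL [N0 hN].
have h j (e : R) : 0 < e -> exists2 n, annulus d0 s (Y n) & modulus (Y n 0 j - L 0 j) < e.
  move=> /YL[N1 hN1]; exists (maxn N0 N1); first by apply: hN; rewrite leq_maxl.
  rewrite (le_lt_trans _ (hN1 _ (leq_maxr N0 N1)))//.
  by have := modulus_le_vnorm (Y (maxn N0 N1) - L) j; rewrite !mxE.
have tri (a b : C) : modulus a <= modulus b + modulus (b - a).
  by have := modulusD (a - b) b; rewrite subrK modulus_distC; lra.
split => [|j jo].
  apply/ler_addgt0Pr => e /(h o)[n [a _] b].
  by have := tri (L 0 o) (Y n 0 o); move: a b; lra_goal.
apply/andP; split; apply/ler_addgt0Pr => e /(h j)[n [_ /(_ j jo)/andP[a1 a2]] b].
  by have := tri (Y n 0 j) (L 0 j); rewrite modulus_distC; move: a1 b; lra_goal.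
by have := tri (L 0 j) (Y n 0 j); move: a2 b; lra_goal.
Qed.

End ChartRegularity.

Lemma cancel_iter (T : Type) (f g : T -> T) n : cancel f g -> cancel (iter n f) (iter n g).
Proof. by move=> fK; elim: n => // n ih x; rewrite iterSr /= fK. Qed.

(** * The limit coordinate and its inverse *)

Section ReferenceOrbit.
Variables (R : realType) (d k l : nat).
Local Notation C := (Cplx R).
Local Notation Cd := 'rV[C]_d.
Local Notation N := (k * d)%N.
Variables (F : Cd -> Cd) (lam : 'I_d -> C).
Hypotheses (d0 : (0 < d)%N) (k0 : (0 < k)%N).
Hypotheses (lam1 : forall j, modulus (lam j) = 1) (plam : \prod_j lam j = 1).
Hypothesis OF : forall j, eqO l (fun z => F z 0 j)
  (fun z => lam j * z 0 j * (1 - coord_prod z ^+ k / N%:R)).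
Variables (theta beta r : R) (h : nat) (ref : nat -> Cd).
Hypotheses (tt : 0 < theta < pi / (2 * k%:R)) (bd : 0 < beta < d%:R^-1).
Hypothesis be3 : 3 * k%:R + 1 <= beta * (l%:R + d%:R - 1).
Hypothesis r0 : 0 < r.
Local Notation Bh := (B_region k h r theta beta).
Local Notation au z := (modulus (coord_prod z)).
Local Notation mx z := (modulus (coord_prod z ^+ k)).
Local Notation o := (Ordinal d0).
Local Notation chart := (chart k d0).
Local Notation chart_inv := (chart_inv k d0).
Local Notation annulus := (annulus d0).
Hypothesis refS : forall n, ref n.+1 = F (ref n).
Hypothesis refB : forall n, Bh (ref n).
Hypothesis ref_cvg : forall e : R, 0 < e -> exists n0, forall n, (n0 <= n)%N -> mx (ref n) < e.

Variable Finv : Cd -> Cd.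
Hypotheses (eF : entire_map F) (eFinv : entire_map Finv) (FK : cancel F Finv) (FinvK : cancel Finv F).
Hypothesis hk : (h < k)%N.
Hypothesis admr : admissible_radius F k r theta beta.
Hypothesis th2 : 2 * theta <= pi / (2 * k%:R).
Local Notation Omega := (basin F k h r theta beta).
Local Notation track z n := (chart_inv (ref n) (iter n F z)).

Let b0 : 0 < beta. Proof. by case/andP: bd. Qed.
Let refW n : W_region beta (ref n). Proof. by case: (refB n). Qed.
Let ref_au n : 0 < au (ref n). Proof. exact: W_coord_prod_gt0 (refW n). Qed.

Lemma B_coord_neq0 (w : Cd) j : Bh w -> w 0 j != 0.
Proof. by case=> Ww _; apply: coord_neq0; exact: W_coord_prod_gt0 Ww. Qed.

Lemma basin_track z : Omega z -> exists2 s : R, 1 <= s & exists n0, forall n, (n0 <= n)%N ->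
  [/\ Bh (iter n F z), annulus s (track z n) & iter n F z = chart (ref n) (track z n)].
Proof.
move=> Oz; have [n0 hB] := basin_in_B admr hk Oz.
pose z' n := iter (n + n0) F z; pose ref' n := ref (n + n0).
have z'S n : z' n.+1 = F (z' n) by [].
have ref'S n : ref' n.+1 = F (ref' n) by rewrite /ref' addSn refS.
have z'B n : Bh (z' n) by apply: hB; rewrite leq_addl.
have ref'B n : Bh (ref' n) by exact: refB.
have z'_cvg e : 0 < e -> exists n0, forall n, (n0 <= n)%N -> mx (z' n) < e.
  move=> e0; have [N hN] := mx_cvg0 d0 k0 (basin_attracted admr hk Oz) e0.
  by exists N => n Nn; apply: hN; rewrite (leq_trans Nn)// leq_addr.
have ref'_cvg e : 0 < e -> exists n0, forall n, (n0 <= n)%N -> mx (ref' n) < e.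
  move=> /ref_cvg[N hN].
  by exists N => n Nn; apply: hN; rewrite (leq_trans Nn)// leq_addr.
have [s s1 [n1 hs]] := shadowing d0 k0 lam1 plam OF bd be3 r0 ref'S ref'B ref'_cvg
  z'S z'B z'_cvg th2.
exists s => //; exists (n1 + n0)%N => n nn.
have n0n : (n0 <= n)%N by rewrite (leq_trans _ nn)// leq_addl.
have Bz := hB n n0n; split => //.
  have := hs (n - n0)%N; rewrite /z' /ref' subnK//; apply.
  by rewrite leq_subRL// addnC.
by rewrite chart_invK// => j; exact: B_coord_neq0 Bz.
Qed.

Lemma track_cvg z : Omega z -> exists L, forall e : R, 0 < e ->
  exists N, forall n, (N <= n)%N -> vnorm (track z n - L) < e.
Proof.
move=> Oz; have [s s1 [n1 h1]] := basin_track Oz.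
have [D D0 [n2 n20 h2]] := chart_orbit d0 k0 lam1 plam OF tt bd be3 r0 refS refB ref_cvg s1.
pose n0 := maxn n1 n2; have [Bz az zE] := h1 n0 (leq_maxl _ _).
pose Y m := track z (n0 + m).
have YE m : Y m = chart_inv (ref (n0 + m)) (iter m F (chart (ref n0) (track z n0))).
  by rewrite -zE -iterD [(m + n0)%N]addnC.
have small (e : R) : 0 < e -> exists N, D / (n0 + N)%:R < e.
  move=> e0; exists (Num.truncn (D / e)).+1.
  rewrite ltr_pdivrMr ?ltr0n ?addn_gt0 ?orbT// mulrC -ltr_pdivrMr//.
  by rewrite (lt_le_trans (truncnS_gt _))// ler_nat leq_addl.
have YC m i : vnorm (Y (m + i)%N - Y m) <= D / (n0 + m)%:R.
  have [_ _ /(_ i)] := h2 n0 (leq_maxr _ _) _ az m.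
  by rewrite -!YE.
have [L hL] := cauchy_vnorm small YC; exists L => e /small[N hN].
exists (n0 + N)%N => n nn; have n0n : (n0 <= n)%N by rewrite (leq_trans _ nn)// leq_addr.
have -> : track z n = Y (n - n0)%N by rewrite /Y subnKC.
rewrite vnorm_distC (le_lt_trans (hL _))// (le_lt_trans _ hN)//.
rewrite subnKC// ler_wpM2l// lef_pV2 ?posrE ?ltr0n ?ler_nat//.
  by rewrite (leq_trans _ n0n)// /n0 leq_max n20 orbT.
by rewrite addn_gt0 /n0 leq_max n20 orbT.
Qed.

Lemma limit_coordinate : exists f : Cd -> Cd, forall z, Omega z -> forall e : R, 0 < e ->
  exists N, forall n, (N <= n)%N -> vnorm (track z n - f z) < e.
Proof.
have /choice[f hf] (z : Cd) : exists L, Omega z -> forall e : R, 0 < e ->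
    exists N, forall n, (N <= n)%N -> vnorm (track z n - L) < e.
  have [/track_cvg[L hL]|nO] := pselect (Omega z); first by exists L.
  by exists 0 => /nO.
by exists f.
Qed.

Variable f : Cd -> Cd.
Hypothesis hf : forall z, Omega z -> forall e : R, 0 < e ->
  exists N, forall n, (N <= n)%N -> vnorm (track z n - f z) < e.

(** An approximate inverse of the limit coordinate: y is placed in the chart at [ref n] and pulled
    back by n steps. *)
Definition parametrization n y := iter n Finv (chart (ref n) y).

Lemma limit_coordinate_image z : Omega z -> C_times_Cstars R d (f z).
Proof.
move=> Oz; have [s s1 [n1 h1]] := basin_track Oz; have s0 : 0 < s by lra.
apply: (annulus_C_times_Cstars s0 (d0 := d0)).
apply: (annulus_closed (hf Oz)); exists n1 => n /h1[]; by [].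
Qed.

Lemma chart_analytic a y : C_times_Cstars R d y -> analytic (chart a) y.
Proof.
move=> /(C_times_Cstars_annulus d0)[s s1 ys]; have s0 : 0 < s by lra.
have i0 : 0 < (2 * s)^-1 by rewrite invr_gt0; lra.
exists (2 * s)^-1 => // j; apply: chart_approx => [|i io]; first exact: ltW.
split; first exact: (annulus_neq0 s0 ys).
have /andP[yi _] := ys.2 i io.
by rewrite invfM mulrC ler_pM2r ?invr_gt0.
Qed.

(* Deep in the orbit, the coordinate f read in the chart at ref n is a small perturbation of the
   identity. *)
Lemma near_identity (s : R) : 1 <= s -> exists2 D : R, 0 <= D & exists2 n0, (0 < n0)%N &
  forall n, (n0 <= n)%N ->
  (forall y, annulus s y -> Omega (parametrization n y) /\
    vnorm (f (parametrization n y) - y) <= D / n%:R) /\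
  (forall y0 rho j, 0 <= rho -> vball y0 rho `<=` annulus s ->
    (forall i, i != o -> rho <= modulus (y0 0 i) / 2) ->
    approx (vball y0 rho) (fun y => (f (parametrization n y) - y) 0 j)).
Proof.
move=> s1; have s0 : 0 < s by lra.
have [D D0 [n0 n00 h2]] := chart_orbit d0 k0 lam1 plam OF tt bd be3 r0 refS refB ref_cvg s1.
exists D => //; exists n0 => // n nn.
pose Y y m := chart_inv (ref (n + m)) (iter m F (chart (ref n) y)).
have YE y m : Y y m = track (parametrization n y) (n + m).
  by rewrite /Y addnC iterD (cancel_iter _ FinvK).
have OP y : annulus s y -> Omega (parametrization n y).
  by move=> /(h2 n nn)/(_ 0%N)[By _ _]; exists n => //=; rewrite (cancel_iter _ FinvK).
have fY y m : annulus s y -> vnorm (f (parametrization n y) - Y y m) <= D / (n + m)%:R.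
  move=> ys; apply/ler_addgt0Pr => e e0.
  have [N hN] := hf (OP y ys) e0.
  have [_ _ /(_ N) h3] := h2 n nn y ys m.
  have h4 := hN (n + (m + N))%N; rewrite -YE in h4.
  rewrite (le_trans (vnorm_triangle (Y y (m + N)%N) _ _))// addrC lerD//.
  by rewrite vnorm_distC ltW// h4// addnA leq_addl.
split => [y ys|y0 rho j rho0 ball y0j].
  split; first exact: OP.
  have := fY y 0%N ys; rewrite addn0 {1}/Y addn0 /= chartK//.
  by move=> i io; exact: (annulus_neq0 s0 ys).
have yb : vball y0 rho y0 by rewrite /vball /= subrr vnorm0.
have vb := vbounded_ball y0 rho.
apply: (@approx_ext _ _ _ (fun y => f (parametrization n y) 0 j - y 0 j)).
  by move=> y _; rewrite !mxE.
apply: approxB => //; last exact: approx_coord.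
apply: approx_lim => e e0; pose m := (Num.truncn (D / e)).+1.
exists (fun y => Y y m 0 j).
  have ef : entire_map (chart_inv (ref (n + m)) \o iter m F).
    by apply: entire_map_comp; [exact: chart_inv_entire|exact: entire_map_iter].
  apply: (@approx_ext _ _ _ ((fun w => (chart_inv (ref (n + m)) \o iter m F) w 0 j) \o chart (ref n))).
    by [].
  have ac i : approx (vball y0 rho) (fun y => chart (ref n) y 0 i).
    apply: chart_approx => // i' io; split; last exact: y0j.
    exact: (annulus_neq0 s0 (ball _ yb)).
  have [K K0 hK] : exists2 K : R, 0 <= K & forall y, vball y0 rho y -> vnorm (chart (ref n) y) <= K.
    have /choice[K hK] i : exists K : R, 0 <= K /\
        forall y, vball y0 rho y -> modulus (chart (ref n) y 0 i) <= K.
      by have [K K0 hK] := approx_bound vb (ac i); exists K.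
    exists (\sum_i K i) => [|y yr]; first by apply: sumr_ge0 => i _; case: (hK i).
    apply: vnorm_le => [|i]; first by apply: sumr_ge0 => i _; case: (hK i).
    rewrite (le_trans ((hK i).2 _ yr))// (bigD1 i)//= lerDl sumr_ge0// => i' _.
    by case: (hK i').
  apply: (@approx_comp _ _ _ _ (vball 0 (K + 1)) _ _ 1) => //; [exact: vbounded_ball|exact: (ef j)|].
  move=> y w yr wy; rewrite /vball /= subr0.
  by rewrite (le_trans (vnorm_distD w (chart (ref n) y)))// lerD// hK.
move=> y yr; rewrite (le_trans (y := D / (n + m)%:R))//.
  have := modulus_le_vnorm (f (parametrization n y) - Y y m) j; rewrite !mxE => /le_trans; apply.
  exact: fY (ball _ yr).
rewrite ler_pdivrMr ?ltr0n ?addn_gt0 ?orbT// mulrC -ler_pdivrMr//.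
by rewrite ltW// (lt_le_trans (truncnS_gt _))// ler_nat leq_addl.
Qed.

Lemma parametrization_track z n : iter n F z = chart (ref n) (track z n) ->
  parametrization n (track z n) = z.
Proof. by move=> zE; rewrite /parametrization -zE (cancel_iter _ FK). Qed.

(** The radius rho depends on X only, while the perturbation is at most D/n; so 16 M <= rho holds
    for all large n. *)
Lemma picard_setup X : C_times_Cstars R d X -> exists2 rho : R, 0 < rho & exists n0,
  forall n, (n0 <= n)%N -> exists2 M : R, 16 * M <= rho &
  (forall j, approx (vball X rho) (fun y => (f (parametrization n y) - y) 0 j)) /\
  (forall y, vball X rho y -> [/\ C_times_Cstars R d y, Omega (parametrization n y) &
     vnorm (f (parametrization n y) - y) <= M]).
Proof.
move=> TX; have [s s1 Xs] := C_times_Cstars_annulus d0 TX; have s0 : 0 < s by lra.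
have s21 : 1 <= 2 * s by lra.
have [D D0 [n0 n00 hn]] := near_identity s21.
pose rho := (2 * s)^-1; have rho0 : 0 < rho by rewrite invr_gt0; lra.
have ball : vball X rho `<=` annulus (2 * s) by move=> y /= yr; exact: (annulus_near s1 Xs).
exists rho => //; exists (maxn n0 (Num.truncn (16 * D / rho)).+1) => n; rewrite geq_max.
move=> /andP[n0n nD]; have [h1 h2] := hn n n0n.
have nR : 0 < n%:R :> R by rewrite ltr0n (leq_trans n00).
exists (D / n%:R).
  rewrite mulrA ler_pdivrMr// [rho * _]mulrC -ler_pdivrMr//.
  by rewrite ltW// (lt_le_trans (truncnS_gt _))// ler_nat.
split => [j|y yr]; last first.
  have [Oy hy] := h1 y (ball y yr); split => //.
  by apply: (annulus_C_times_Cstars (s := 2 * s) (d0 := d0)); [lra|exact: ball].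
apply: h2 => // [|i io]; first exact: ltW.
have /andP[Xi _] := Xs.2 i io.
by rewrite /rho invfM mulrC ler_pM2r ?invr_gt0.
Qed.

(** For large n the tracks of z and z' both lie in the small ball about the common value f z and
    solve the same equation y + phi y = f z, whose solution there is unique. *)
Lemma limit_coordinate_inj z z' : Omega z -> Omega z' -> f z = f z' -> z = z'.
Proof.
move=> Oz Oz' fzz'.
have [rho rho0 [n0 hn]] := picard_setup (limit_coordinate_image Oz).
have r8 : 0 < rho / 8 by rewrite divr_gt0.
have near w : Omega w -> exists N, forall n, (N <= n)%N ->
    vball (f w) (rho / 8) (track w n) /\ parametrization n (track w n) = w.
  move=> Ow; have [s _ [n1 h1]] := basin_track Ow.
  have [n2 h2] := hf Ow r8; exists (maxn n1 n2) => n; rewrite geq_max => /andP[/h1[_ _ wE] /h2 wn].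
  by split; [exact: ltW|exact: parametrization_track].
have [n1 h1] := near z Oz; have [n2 h2] := near z' Oz'.
pose n := maxn n0 (maxn n1 n2); have a1 : (n0 <= n)%N by exact: leq_maxl.
have a2 : (n1 <= n)%N by rewrite /n !leq_max leqnn orbT.
have b1 : (n2 <= n)%N by rewrite /n !leq_max leqnn !orbT.
have [M Mrho [hphi hM]] := hn n a1.
have [t1 p1] := h1 n a2; have [t2 p2] := h2 n b1.
have := @picard_unique R d (fun y => f (parametrization n y) - y) (f z) rho M rho0 hphi
  (fun y yr => let: And3 _ _ h := hM y yr in h) Mrho (track z n) (track z' n) t1.
rewrite {1}fzz' => /(_ t2); rewrite !subrKC p1 p2 => /(_ fzz') e.
by rewrite -p1 -p2 e.
Qed.

(** The Picard solution, read through [parametrization n], is a local holomorphic right inverse of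
    f. *)
Lemma limit_coordinate_section X : C_times_Cstars R d X -> exists g : Cd -> Cd,
  analytic g X /\ exists2 e : R, 0 < e & forall y, vball X e y -> Omega (g y) /\ f (g y) = y.
Proof.
move=> TX; have [rho rho0 [n hn]] := picard_setup TX.
have [M Mrho [hphi hM]] := hn n (leqnn n).
have [g [ag gr gE]] := picard_inverse rho0 hphi (fun y yr => let: And3 _ _ h := hM y yr in h) Mrho.
have r16 : 0 < rho / 16 by rewrite divr_gt0.
have gb y : vball X (rho / 16) y -> vball X rho (g y).
  by move=> /gr; rewrite /vball /= => /le_trans; apply; lra.
exists (fun y => parametrization n (g y)); split; last first.
  exists (rho / 16) => // y yr; split; first by case: (hM _ (gb y yr)).
  by have := gE y yr; rewrite subrKC.
have Xb : vball X (rho / 16) X by rewrite /vball /= subrr vnorm0 ltW.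
have ga : analytic g X by exists (rho / 16).
apply: (@analytic_comp _ _ _ _ (parametrization n) g) => //.
apply: (@analytic_comp _ _ _ _ (iter n Finv) (chart (ref n))).
  by apply: chart_analytic => //; case: (hM _ (gb X Xb)).
exact/entire_analytic/entire_map_iter.
Qed.

(** Near z, f is the track at time n followed by f \o parametrization n, and the latter differs from
    the identity by a limit of polynomials. *)
Lemma limit_coordinate_analytic z : Omega z -> analytic f z.
Proof.
move=> Oz; have [s s1 [n1 h1]] := basin_track Oz; have s0 : 0 < s by lra.
have s21 : 1 <= 2 * s by lra.
have [D D0 [n0 n00 hn]] := near_identity s21.
pose n := maxn n0 n1; have [_ h2] := hn n (leq_maxl _ _).
have [Bz az zE] := h1 n (leq_maxr _ _).
(* [B_preimage_open] is applied to F itself, with p = 1. *)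
have [e e0 he] : exists2 e : R, 0 < e & forall w, vnorm (w - z) < e -> Bh (iter n F w).
  have /open_vnormP/(_ z Bz) := @B_preimage_open R d k 1 F d0 k0 eF theta beta r tt b0 admr h n.
  by case=> e e0 he; exists e => // w /he.
have e2 : 0 < e / 2 by rewrite divr_gt0.
apply: (@analytic_ext _ _ _ ((f \o parametrization n) \o (chart_inv (ref n) \o iter n F)) _ _ _ e2).
  move=> w wz; rewrite /= parametrization_track// chart_invK// => j.
  by apply/B_coord_neq0/he; apply: le_lt_trans wz _; lra.
apply: analytic_comp.
  apply: entire_analytic; apply: entire_map_comp; first exact: chart_inv_entire.
  exact: entire_map_iter.
have i0 : 0 < (2 * s)^-1 by rewrite invr_gt0; lra.
exists (2 * s)^-1 => // j.
apply: (@approx_ext _ _ _ (fun y => (f (parametrization n y) - y) 0 j + y 0 j)).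
  by move=> y _; rewrite !mxE subrK.
apply: approxD; last exact: approx_coord.
apply: h2; first exact: ltW.
  by move=> y yr; exact: (annulus_near s1 az).
move=> i io; have /andP[Xi _] := az.2 i io.
by rewrite invfM mulrC ler_pM2r ?invr_gt0.
Qed.

(** The inverse is chosen pointwise; by injectivity of f it agrees with the local holomorphic
    sections, hence is holomorphic. *)
Lemma limit_coordinate_inverse : exists g : Cd -> Cd,
  [/\ forall X, C_times_Cstars R d X -> analytic g X,
      forall X, C_times_Cstars R d X -> Omega (g X) /\ f (g X) = X &
      forall z, Omega z -> g (f z) = z].
Proof.
have /choice[g hg] (X : Cd) : exists z, C_times_Cstars R d X -> Omega z /\ f z = X.
  have [TX|nT] := pselect (C_times_Cstars R d X); last by exists 0 => /nT.
  have [g [_ [e e0 he]]] := limit_coordinate_section TX; exists (g X) => _.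
  by apply: he; rewrite /vball /= subrr vnorm0 ltW.
exists g; split => // [X TX|z Oz]; last first.
  have [Og fg] := hg _ (limit_coordinate_image Oz).
  exact: limit_coordinate_inj.
have [g' [ag' [e e0 he]]] := limit_coordinate_section TX.
have /open_vnormP/(_ X TX)[e' e'0 he'] := @open_C_times_Cstars R d.
have m0 : 0 < Num.min e (e' / 2) by rewrite lt_min e0 divr_gt0.
apply: (analytic_ext m0 _ ag') => w; rewrite /vball /= le_min => /andP[w1 w2].
have [Ow fw] := he w w1.
have w3 : vnorm (w - X) < e' by rewrite (le_lt_trans w2)// ltr_pdivrMr// ltr_pMr// ltr1n.
have [Ow' fw'] := hg w (he' w w3).
by apply: limit_coordinate_inj => //; rewrite fw fw'.
Qed.

End ReferenceOrbit.

(** * The main theorem *)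

Section Basin.
Variables (R : realType) (d k l : nat).
Local Notation C := (Cplx R).
Local Notation Cd := 'rV[C]_d.
Local Notation N := (k * d)%N.
Variables (F Finv : Cd -> Cd) (lam : 'I_d -> C).
Hypotheses (d0 : (0 < d)%N) (k0 : (0 < k)%N).
Hypotheses (lam1 : forall j, modulus (lam j) = 1) (plam : \prod_j lam j = 1).
Hypothesis OF : forall j, eqO l (fun z => F z 0 j)
  (fun z => lam j * z 0 j * (1 - coord_prod z ^+ k / N%:R)).
Hypotheses (eF : entire_map F) (eFinv : entire_map Finv) (FK : cancel F Finv) (FinvK : cancel Finv F).
Variables (theta beta r : R).
Hypothesis adm : admissible_exponents d k l theta beta.

(** Besides the existence of an admissible radius, this provides the linear growth of Re v, from
    which the rate of decay on compact sets is derived. *)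
Lemma admissible_radius_growth : exists2 s : R, admissible_radius F k s theta beta &
  forall h z n, B_region k h s theta beta z ->
    n%:R / 2 <= Re (fatou_v k (coord_prod (iter n F z))).
Proof.
have [r1 r10 hr] := B_region_iter d0 k0 lam1 plam OF adm.
have b0 : 0 < beta by case: adm => _ /andP[].
exists r1; last by move=> h z n /(hr h r1 z (lexx _))/(_ n)[].
split => // h hk; split.
  by move=> _ [z Bz <-]; have [] := hr h r1 z (lexx _) Bz 1.
apply/uniform_vnormP => e e0.
have [M M0 hM] := W_uniform_small d0 k0 b0 e0.
exists (Num.trunc (2 * M)).+1 => n nM z Bz; rewrite subr0.
have [[Wn _] vn] := hr h r1 z (lexx _) Bz n.
apply: hM => //; rewrite (lt_le_trans _ (le_trans (ler_norm _) (Re_le_modulus _)))//.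
rewrite (lt_le_trans _ vn)// ltr_pdivlMr// mulrC (lt_le_trans (truncnS_gt _))//.
by rewrite ler_nat.
Qed.

Hypothesis admr : admissible_radius F k r theta beta.
Hypothesis be3 : 3 * k%:R + 1 <= beta * (l%:R + d%:R - 1).
Hypothesis th2 : 2 * theta <= pi / (2 * k%:R).
Variable h : nat.
Hypothesis hk : (h < k)%N.
Local Notation Omega := (basin F k h r theta beta).

Lemma basin_model : exists f g : Cd -> Cd,
  [/\ forall z, Omega z -> analytic f z,
      forall X, C_times_Cstars R d X -> analytic g X,
      forall z, Omega z -> C_times_Cstars R d (f z) /\ g (f z) = z &
      forall X, C_times_Cstars R d X -> Omega (g X) /\ f (g X) = X].
Proof.
have [zs Bzs] := B_region_point d0 k0 adm admr h.
pose ref n := iter n F zs.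
have refS n : ref n.+1 = F (ref n) by [].
have refB n : B_region k h r theta beta (ref n).
  by elim: n => [//|n ih]; apply: (admr.2 h hk).1; exists (ref n).
have Ozs : Omega zs by exists 0%N.
have ref_cvg := mx_cvg0 d0 k0 (basin_attracted admr hk Ozs).
have [tt bd _] := adm; have r0 : 0 < r by case: admr.
have [f hf] := limit_coordinate d0 k0 lam1 plam OF tt bd be3 r0 refS refB ref_cvg hk admr th2.
have [g [ag Og gf]] := limit_coordinate_inverse k0 lam1 plam OF tt bd be3 r0 refS refB ref_cvg
  eF eFinv FK FinvK hk admr th2 hf.
exists f, g; split => // z Oz.
  exact: (limit_coordinate_analytic k0 lam1 plam OF tt bd be3 r0 refS refB ref_cvg
    eF FK FinvK hk admr th2 hf Oz).
split; last exact: gf.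
exact: (limit_coordinate_image k0 lam1 plam OF bd be3 r0 refS refB ref_cvg hk admr th2 hf Oz).
Qed.

Lemma basin_biholomorphic : biholomorphic Omega (C_times_Cstars R d).
Proof.
have [tt /andP[b0 _] _] := adm.
have [f [g [af ag gf fg]]] := basin_model; split.
- exact: (@basin_open R d k 1 F d0 k0 eF theta beta r tt b0 admr h).
- exact: open_C_times_Cstars.
exists f, g; split => // z Tz; apply: analytic_differentiable; [exact: af|exact: ag].
Qed.

(** The basin is the image of the connected model under the inverse of the limit coordinate. *)
Lemma basin_connected : connected Omega.
Proof.
have [f [g [af ag gf fg]]] := basin_model.
have -> : Omega = g @` C_times_Cstars R d.
  apply/seteqP; split => [z Oz|_ [X TX <-]]; last by case: (fg X TX).
  by have [Tf gz] := gf z Oz; exists (f z).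
apply: connected_continuous_connected; first exact: C_times_Cstars_connected.
rewrite continuous_open_subspace; last exact: open_C_times_Cstars.
by move=> X /set_mem TX; apply: analytic_continuous; exact: ag.
Qed.

End Basin.

(** Otherwise (n + 1) e_j would be a resonant exponent; a second index, available since d >= 2,
    forces q = 0 and hence n = 0. *)
Lemma one_resonant_root_of_unity (R : realType) (d : nat) (lam : 'I_d -> Cplx R) j n :
  (1 < d)%N -> one_resonant lam -> (0 < n)%N -> lam j ^+ n <> 1.
Proof.
move=> d1 res n0 ln.
have [i ij] : exists i : 'I_d, i != j.
  have [j0|j0] := eqVneq j (Ordinal (ltnW d1)).
    by exists (Ordinal d1); rewrite j0.
  by exists (Ordinal (ltnW d1)); rewrite eq_sym.
have [hres _] := res (fun i => (i == j) * n.+1)%N j.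
case: hres => [|q hq].
  by rewrite (bigD1 j)//= eqxx mul1n exprS ln mulr1 big1 ?mulr1// => i0 /negbTE ->.
have := hq i; rewrite (negbTE ij) mul0n addn0 => q0.
by have := hq j; rewrite eqxx mul1n -q0 add0n => -[] n0'; rewrite n0' in n0.
Qed.

Lemma has_normal_form_eqO (R : realType) (d k l : nat) (F : 'rV[Cplx R]_d -> 'rV[Cplx R]_d)
    (lam : 'I_d -> Cplx R) :
  (forall j, eqO l (fun z => F z 0 j)
    (fun z => lam j * z 0 j * (1 - coord_prod z ^+ k / (k * d)%:R))) ->
  has_normal_form F k l lam.
Proof.
move=> OF; apply/eqaddO_vnormP.
have /choice[Kr hKr] : forall j, exists Kr : R * R, [/\ 0 <= Kr.1, 0 < Kr.2 &
    forall z, vnorm z < Kr.2 ->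
      modulus (F z 0 j - lam j * z 0 j * (1 - coord_prod z ^+ k / (k * d)%:R)) <= Kr.1 * vnorm z ^+ l].
  by move=> j; have [K [r [K0 r0 h]]] := OF j; exists (K, r).
exists (1 + \sum_j (Kr j).1), (\big[Num.min/1]_j (Kr j).2); split.
- by rewrite ltr_pwDl// sumr_ge0// => j _; case: (hKr j).
- by elim/big_ind: _ => // [x y x0 y0|j _]; [rewrite lt_min x0|case: (hKr j)].
move=> z zr.
have K0 : 0 <= 1 + \sum_j (Kr j).1.
  by rewrite addr_ge0// sumr_ge0// => j _; case: (hKr j).
apply: vnorm_le => [|j]; first by rewrite mulr_ge0 ?exprn_ge0 ?vnorm_ge0.
have [Kj rj hj] := hKr j; rewrite !mxE mulrC.
rewrite (le_trans (hj z _))//.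
  by rewrite (lt_le_trans zr)// (bigD1 j)//= ge_min lexx.
rewrite ler_wpM2r ?exprn_ge0 ?vnorm_ge0// (bigD1 j)//= addrCA lerDl addr_ge0//.
by rewrite sumr_ge0// => i _; case: (hKr i).
Qed.

(** * Periodic cycles of Fatou components *)

Section MainTheorem.
Variables (R : realType) (d k l p : nat).
Local Notation C := (Cplx R).
Local Notation Cd := 'rV[C]_d.
Local Notation N := (k * d)%N.
Variables (G H : Cd -> Cd) (mu lam : 'I_d -> C) (a : {poly C}).
Hypotheses (d1 : (1 < d)%N) (k0 : (0 < k)%N) (p0 : (0 < p)%N) (pk : (p %| k)%N) (l0 : (0 < l)%N).
Hypotheses (mu1 : forall j, modulus (mu j) = 1) (pmu : \prod_j mu j = cis (2 * pi / p%:R)).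
Hypotheses (lam1 : forall j, modulus (lam j) = 1) (plam : \prod_j lam j = 1).
Hypothesis a0 : a`_0 = 1.
Hypothesis OG : forall j, eqO l (fun z => G z 0 j)
  (fun z => mu j * z 0 j * a.[coord_prod z ^+ k]).
Hypothesis OF : forall j, eqO l (fun z => iter p G z 0 j)
  (fun z => lam j * z 0 j * (1 - coord_prod z ^+ k / N%:R)).
Hypotheses (eG : entire_map G) (eH : entire_map H) (GK : cancel G H) (HK : cancel H G) (G0 : G 0 = 0).
Variables (theta beta r : R).
Hypothesis adm : admissible_exponents d k l theta beta.
Hypothesis admr : admissible_radius (iter p G) k r theta beta.
Hypothesis grow : forall h z n, B_region k h r theta beta z ->
  n%:R / 2 <= Re (fatou_v k (coord_prod (iter n (iter p G) z))).
Hypothesis be3 : 3 * k%:R + 1 <= beta * (l%:R + d%:R - 1).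
Hypothesis th2 : 2 * theta <= pi / (2 * k%:R).
Local Notation Omega h := (basin (iter p G) k h r theta beta).

Let d0 : (0 < d)%N. Proof. exact: ltnW. Qed.
Let surG z : exists y, G y = z. Proof. by exists (H z). Qed.

Lemma basin_properties h : (h < k)%N ->
  [/\ fatou_component G (Omega h), periodic_set G p (Omega h), attracting G 0 (Omega h),
      non_recurrent 0 (Omega h) & biholomorphic (Omega h) (C_times_Cstars R d)].
Proof.
move=> hk; have eF := entire_map_iter p eG; have eFi := entire_map_iter p eH.
have FK := cancel_iter p GK; have FiK := cancel_iter p HK.
have im q := root_iter_basin_image d0 k0 p0 pk mu1 pmu lam1 plam a0 OG OF adm admr q surG hk.
have [z0 Oz0] := basin_nonempty d0 k0 adm admr h.
have b0 : 0 < beta by case: adm => _ /andP[].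
have att z : Omega h z -> forall e : R, 0 < e -> exists N, forall m, (N <= m)%N ->
    vnorm (iter m G z) < e.
  move=> [n _ Bz] e e0; have [N hN] := B_preimage_uniform p0 eG G0 admr n hk e0.
  by exists N => m /hN; apply.
split.
- apply: (basin_fatou_component d1 k0 p0 l0 lam1 plam OF eG (can_inj GK) G0 adm admr grow hk).
  exact: (basin_connected d0 k0 lam1 plam OF eF eFi FK FiK adm admr be3 th2 hk).
- split; first by rewrite im mulnC divnK// modnDr modn_small.
  (* For 0 < q < p the shift q k / p lies strictly between 0 and k, and distinct basins are
     disjoint. *)
  move=> q /andP[q1 qp] e; have kp : (0 < k %/ p)%N by rewrite divn_gt0// dvdn_leq.
  have := im q; rewrite e => e'.
  have Oz1 : Omega ((h + q * (k %/ p)) %% k)%N z0 by rewrite -e'.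
  have hh := basin_disjoint k0 adm admr hk (ltn_pmod _ k0) Oz0 Oz1.
  have : h + q * (k %/ p) = h + 0 %[mod k] by rewrite addn0 -hh modn_small.
  move/eqP; rewrite eqn_modDl mod0n modn_small ?muln_eq0.
    by rewrite -leqn0 leqNgt q1/= -leqn0 leqNgt kp.
  by rewrite -[X in (_ < X)%N](divnK pk) mulnC ltn_pmul2l.
- by move=> z Oz; apply/cvgn_vnormP => e e0; have [N hN] := att z Oz e e0;
    exists N => n /hN; rewrite subr0.
- split.
    move=> U /nbhs_vnormP[e e0 hU].
    have [n hn] := basin_attracted admr hk Oz0 e0.
    exists (iter n (iter p G) z0); split; first exact/(basin_iterE admr n z0 hk).
    by apply: hU; rewrite subr0 hn.
  (* The origin is fixed and its coordinate product is zero, so it never enters W(beta) and belongs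
     to no basin. *)
  move=> /interior_subset[n _ [Wz _]].
  have := W_coord_prod_gt0 d0 b0 Wz.
  have -> : iter n (iter p G) 0 = 0.
    have G0n q : iter q G 0 = 0 by elim: q => //= q ->.
    by elim: n {Wz} => //= n ->.
  by rewrite /coord_prod (bigD1 (Ordinal d0))//= mxE mul0r modulus0 ltxx.
exact: (basin_biholomorphic d0 k0 lam1 plam OF eF eFi FK FiK adm admr be3 th2 hk).
Qed.

(** With i < k / p and q < p the index does not wrap around modulo k, so it determines i as its
    residue modulo k / p. *)
Lemma basin_cycle (i q : nat) : (i < k %/ p)%N -> (q < p)%N ->
  (i + q * (k %/ p) < k)%N /\ iter q G @` Omega i = Omega (i + q * (k %/ p))%N.
Proof.
move=> ik qp; have ik' : (i < k)%N by rewrite (leq_trans ik)// leq_div.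
have h1 : (i + q * (k %/ p) < k)%N.
  have kE : (p * (k %/ p))%N = k by rewrite mulnC divnK.
  have e1 : (i + q * (k %/ p) < q.+1 * (k %/ p))%N by rewrite mulSn ltn_add2r.
  by rewrite (leq_trans e1)// -[X in (_ <= X)%N]kE leq_mul2r qp orbT.
split => //.
rewrite (root_iter_basin_image d0 k0 p0 pk mu1 pmu lam1 plam a0 OG OF adm admr q surG ik').
by rewrite modn_small.
Qed.

End MainTheorem.

Theorem theorem4 (R : realType) (d k p : nat)
    (hd : (2 <= d)%N) (hk : (1 <= k)%N) (hp : (1 <= p)%N) (hpk : (p %| k)%N) :
  exists (G : Cspace R d -> Cspace R d) (l : nat) (lambda : 'I_d -> Cplx R),
    [/\ automorphism G,
        (* the form of G^p near the origin *)
        [/\ (2 * k * d + 1 < l)%N,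
            forall j, `|lambda j| = 1,
            forall j (n : nat), (0 < n)%N -> lambda j ^+ n <> 1,
            one_resonant lambda &
            has_normal_form (iter p G) k l lambda],
        (* the action of G on the basins of G^p; the parameters of the basins
           can be chosen, and the result holds for every choice *)
        forall theta0 beta0 : R, admissible_exponents d k l theta0 beta0 ->
          (exists r0 : R, admissible_radius (iter p G) k r0 theta0 beta0) /\
          (forall r0 : R, admissible_radius (iter p G) k r0 theta0 beta0 ->
            forall h : nat, (h < k)%N ->
              G @` basin (iter p G) k h r0 theta0 beta0 =
              basin (iter p G) k ((h + k %/ p) %% k)%N r0 theta0 beta0) &
        (* k/p disjoint p-periodic cycles V i, G (V i), ..., G^(p-1) (V i) *)
        exists V : 'I_(k %/ p)%N -> set (Cspace R d),
          (forall (i : 'I_(k %/ p)%N) (q : nat), (q < p)%N ->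
            let Viq := iter q G @` V i in
            [/\ fatou_component G Viq,
                periodic_set G p Viq,
                attracting G 0 Viq,
                non_recurrent 0 Viq &
                biholomorphic Viq (C_times_Cstars R d)]) /\
          (forall (i j : 'I_(k %/ p)%N) (q r : nat),
            i != j -> (q < p)%N -> (r < p)%N ->
            (iter q G @` V i) `&` (iter r G @` V j) = set0)].
Proof.
(* With beta = 3 / (4 d) this gives beta (l + d - 1) = 3k + 9/4 - 3 / (4 d) > 3k + 1, the precision
   required by the charts, and also l > 2 k d + 1. *)
pose l := (4 * k * d + 2 * d)%N.
have d0 : (0 < d)%N by exact: ltnW.
have l1 : (1 < l)%N by rewrite /l (leq_trans _ (leq_addl _ _))// (leq_trans hd)// leq_pmull.
have [G [a [mu [t [jG a0 [mu1 _ pmu t0 res] OG OF]]]]] :=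
  exists_root_automorphism R hd hk hp hpk l1.
pose lam (j : 'I_d) : Cplx R := cis (t j).
have lam1 j : modulus (lam j) = 1 by exact: modulus_cis.
have plam : \prod_j lam j = 1 by rewrite -cis_sum t0 cis0.
have [[H [eG eH GK HK]] _ O1] := jG.
have G0 : G 0 = 0 by apply/rowP => j; rewrite mxE; exact: vanish_bigO (O1 j).
have surG z : exists y, G y = z by exists (H z).
have kR : 0 < k%:R :> R by rewrite ltr0n.
have dR : 0 < d%:R :> R by rewrite ltr0n.
have pi0 := pi_gt0 R.
(* The angle is small enough for shadowing, where two arguments are subtracted and 2 theta <= pi /
   (2 k) is needed; beta may be any fixed fraction of 1/d large enough compared with l. *)
pose theta : R := pi / (8 * k%:R); pose beta : R := 3 / (4 * d%:R).
have be : 3 * k%:R + 1 < beta * (l%:R + d%:R - 1).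
  have d2 : 2 <= d%:R :> R by rewrite ler_nat.
  rewrite /beta mulrAC ltr_pdivlMr ?mulr_gt0// /l natrD !natrM.
  have := mulr_gt0 kR dR; nra.
have adm : admissible_exponents d k l theta beta.
  split.
  - by rewrite /theta divr_gt0 ?mulr_gt0//= ltr_pM2l// ltf_pV2 ?posrE ?mulr_gt0// ltr_pM2r// ltr_nat.
  - rewrite /beta divr_gt0 ?mulr_gt0//= invfM mulrA gtr_pMl ?invr_gt0//.
    by rewrite ltr_pdivrMr// mul1r ltr_nat.
  by rewrite (le_lt_trans _ be)// lerD2r ler_wpM2r// ?ler_nat// ltW.
have th2 : 2 * theta <= pi / (2 * k%:R).
  rewrite /theta mulrA ler_pdivrMr ?mulr_gt0// mulrAC ler_pdivlMr ?mulr_gt0//.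
  by have := mulr_gt0 pi0 kR; nra.
(* These parameters serve to construct the Fatou components; the action on the basins is proved
   below for all admissible ones. *)
have [r admr grow] := admissible_radius_growth d0 hk lam1 plam OF adm.
have props := basin_properties hd hk hp hpk (ltnW l1) mu1 pmu lam1 plam a0 OG OF eG eH GK HK G0
  adm admr grow (ltW be) th2.
have cyc := basin_cycle hd hk hp hpk mu1 pmu lam1 plam a0 OG OF HK adm admr.
exists G, l, lam; split.
- by apply: entire_auto_automorphism; exists H.
- split.
  + by rewrite /l -addnS leq_add ?leq_pmulr// !leq_mul2r !orbT.
  + by move=> j; rewrite normC_modulus lam1.
  + by move=> j n n0; exact: one_resonant_root_of_unity.
  + exact: res.
  + exact: has_normal_form_eqO.
- move=> theta0 beta0 adm0; split.
    by have [r0 h0 _] := admissible_radius_growth d0 hk lam1 plam OF adm0; exists r0.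
  move=> r0 admr0 h hk'.
  exact: (root_basin_image d0 hk hp hpk mu1 pmu lam1 plam a0 OG OF adm0 admr0 surG hk').
(* The basins of index i < k / p represent the orbits of the shift by k / p modulo k. *)
exists (fun i => basin (iter p G) k i r theta beta); split => [i q qp Viq|i j q q' ij qp qp'].
  by have [hiq E] := cyc i q (ltn_ord i) qp; rewrite /Viq E; exact: props.
have [h1 ->] := cyc i q (ltn_ord i) qp; have [h2 ->] := cyc j q' (ltn_ord j) qp'.
apply/seteqP; split => // z [Oz Oz'].
have := basin_disjoint hk adm admr h1 h2 Oz Oz'.
(* Equal basins have equal indices, and reducing these modulo k / p recovers i and j. *)
move=> /(congr1 (modn^~ (k %/ p)%N)); rewrite [(i + _)%N]addnC [(j + _)%N]addnC !modnMDl !modn_small// => /val_inj e.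
by rewrite e eqxx in ij.
Qed.
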